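(* Let $R,\varepsilon>0$, let $f\in\mathbb{R}[x_1,x_2]$ have exactly $3$ monomial terms and degree $D$, and let $\delta>0$ be any constant. Then, using just $O\!\left(\log(D)\log\left(D\log\frac{R}{\varepsilon}\right)\right)$ arithmetic operations and $O\left(\log^{2+\delta}D\right)$ bit operations, one can $\varepsilon$-approximate all isolated inflection points, vertical tangents, and singular points of the curve $\{(x_1,x_2)\in[0,R]^2 : f(x_1,x_2)=0\}$.
   Context: $\varepsilon$-approximating a finite set of points in $\mathbb{R}^2$ means $\varepsilon$-approximating each coordinate separately: finding points whose coordinates are each within distance less than $\varepsilon$ of the corresponding coordinates of the true points, with each true point so approximated. The model of computation is the BSS machine over $\mathbb{R}$ (real arithmetic and comparisons allowed, together with bit operations); arithmetic operations are counted as field operations in the field generated over $\mathbb{Q}$ by the coefficients of $f$. All $O$-constants are absolute and effectively computable (the constant in the bit-operation bound may depend on $\delta$). *)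

(* Defs.v *)
From Stdlib Require Import Reals List Arith.
Open Scope R_scope.

(* Trinomials in R[x1,x2]:  f = sum_{i<3} c i * x1^(ea i) * x2^(eb i)  *)

Definition is_trinomial (c : nat -> R) (ea eb : nat -> nat) : Prop :=
  (forall i, (i < 3)%nat -> c i <> 0) /\
  (forall i j, (i < 3)%nat -> (j < 3)%nat -> i <> j ->
     (ea i, eb i) <> (ea j, eb j)).

Definition tdeg (ea eb : nat -> nat) : nat :=
  Nat.max (ea 0%nat + eb 0%nat)
    (Nat.max (ea 1%nat + eb 1%nat) (ea 2%nat + eb 2%nat)).

Fixpoint ffact (n k : nat) : nat :=
  match k with O => 1%nat | S k' => (ffact n k' * (n - k'))%nat end.

Definition tri_d (c : nat -> R) (ea eb : nat -> nat) (i j : nat) (x y : R) : R :=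
  sum_f_R0 (fun t => c t * INR (ffact (ea t) i) * INR (ffact (eb t) j)
                     * x ^ (ea t - i) * y ^ (eb t - j)) 2.

Definition in_box (Rb : R) (p : R * R) : Prop :=
  0 <= fst p <= Rb /\ 0 <= snd p <= Rb.

Definition on_curve c ea eb Rb (p : R * R) : Prop :=
  in_box Rb p /\ tri_d c ea eb 0 0 (fst p) (snd p) = 0.

Definition singular_pt c ea eb Rb (p : R * R) : Prop :=
  on_curve c ea eb Rb p /\ tri_d c ea eb 1 0 (fst p) (snd p) = 0
  /\ tri_d c ea eb 0 1 (fst p) (snd p) = 0.

Definition vtangent_pt c ea eb Rb (p : R * R) : Prop :=
  on_curve c ea eb Rb p /\ tri_d c ea eb 0 1 (fst p) (snd p) = 0
  /\ tri_d c ea eb 1 0 (fst p) (snd p) <> 0.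

(* inflection points: smooth point where the curvature form
   f11 f2^2 - 2 f12 f1 f2 + f22 f1^2 vanishes *)
Definition inflection_pt c ea eb Rb (p : R * R) : Prop :=
  let x := fst p in let y := snd p in
  let f1 := tri_d c ea eb 1 0 x y in let f2 := tri_d c ea eb 0 1 x y in
  on_curve c ea eb Rb p /\ (f1 <> 0 \/ f2 <> 0) /\
  tri_d c ea eb 2 0 x y * f2 ^ 2 - 2 * tri_d c ea eb 1 1 x y * f1 * f2
    + tri_d c ea eb 0 2 x y * f1 ^ 2 = 0.

Definition close (e : R) (p q : R * R) : Prop :=
  Rabs (fst p - fst q) < e /\ Rabs (snd p - snd q) < e.

Definition isolated_in (S : R * R -> Prop) (p : R * R) : Prop :=
  S p /\ exists r, 0 < r /\ forall q, S q -> close r p q -> q = p.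

Definition special_pt c ea eb Rb (p : R * R) : Prop :=
  isolated_in (inflection_pt c ea eb Rb) p \/
  isolated_in (vtangent_pt c ea eb Rb) p \/
  isolated_in (singular_pt c ea eb Rb) p.

Definition eps_approx (e : R) (L : list (R * R)) (S : R * R -> Prop) : Prop :=
  (forall p, S p -> exists q, In q L /\ close e q p) /\
  (forall q, In q L -> exists p, S p /\ close e q p).

(* BSS-style machine over R with bit operations.                       *)
(* Memory: real registers rm, bit registers bm, address/index registers *)
(* am (used for indirect addressing of rm and bm).                      *)
(* Cost: every instruction acting on real registers (arithmetic,        *)
(* constant, move, comparison) counts as one arithmetic operation;      *)
(* every instruction on bits / address registers / control counts as    *)
(* one bit operation.                                                   *)

Inductive rop := RAdd | RSub | RMul | RDiv.

Inductive instr :=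
| IArith (o : rop) (d s1 s2 : nat)
| IConst (b : bool) (d : nat)
| IMove (d s : nat)
| ILe (s1 s2 t : nat)
| INand (d s1 s2 : nat)
| IBSet (b : bool) (d : nat)
| IBJump (s t : nat)
| IAInc (p : nat)
| IADec (p : nat)
| IACopy (p q : nat)
| IAJz (p t : nat)
| IJmp (t : nat).

Definition program := list instr.

Record mstate := MState {
  pc : nat; rm : nat -> R; bm : nat -> bool; am : nat -> nat;
  arith_ops : nat; bit_ops : nat }.

Definition upd {A} (f : nat -> A) (k : nat) (v : A) : nat -> A :=
  fun n => if Nat.eqb n k then v else f n.

Definition eval_rop (o : rop) (x y : R) : R :=
  match o with
  | RAdd => x + y | RSub => x - y | RMul => x * y
  | RDiv => if Req_EM_T y 0 then 0 else x / y
  end.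

Definition halted (P : program) (s : mstate) : Prop := (length P <= pc s)%nat.

Definition exec (i : instr) (s : mstate) : mstate :=
  let 'MState k r b a na nb := s in
  match i with
  | IArith o d s1 s2 =>
      MState (S k) (upd r (a d) (eval_rop o (r (a s1)) (r (a s2)))) b a (S na) nb
  | IConst bb d => MState (S k) (upd r (a d) (if bb then 1 else 0)) b a (S na) nb
  | IMove d s1 => MState (S k) (upd r (a d) (r (a s1))) b a (S na) nb
  | ILe s1 s2 t =>
      MState (if Rle_dec (r (a s1)) (r (a s2)) then t else S k) r b a (S na) nb
  | INand d s1 s2 =>
      MState (S k) r (upd b (a d) (negb (andb (b (a s1)) (b (a s2))))) a na (S nb)
  | IBSet bb d => MState (S k) r (upd b (a d) bb) a na (S nb)
  | IBJump s1 t => MState (if b (a s1) then t else S k) r b a na (S nb)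
  | IAInc p => MState (S k) r b (upd a p (S (a p))) na (S nb)
  | IADec p => MState (S k) r b (upd a p (Nat.pred (a p))) na (S nb)
  | IACopy p q => MState (S k) r b (upd a p (a q)) na (S nb)
  | IAJz p t => MState (if Nat.eqb (a p) 0 then t else S k) r b a na (S nb)
  | IJmp t => MState t r b a na (S nb)
  end.

Definition step (P : program) (s : mstate) : mstate :=
  match nth_error P (pc s) with
  | Some i => exec i s
  | None => s
  end.

Fixpoint run (P : program) (n : nat) (s : mstate) : mstate :=
  match n with O => s | S n' => run P n' (step P s) end.

(* Input encoding of (f, Rb, e):
   rm 0,1,2 = coefficients c 0, c 1, c 2;  rm 3 = Rb;  rm 4 = e;
   exponent k in (ea 0, eb 0, ea 1, eb 1, ea 2, eb 2) (k = 0..5) is given in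
   binary: its j-th bit (least significant first) is bm (6*j + k);
   am 0 = number of bits L = log2 D + 1 (all exponents are < 2^L).
   Everything else is 0 / false; cost counters start at 0. *)
Definition exps (ea eb : nat -> nat) (k : nat) : nat :=
  match k with
  | 0 => ea 0%nat | 1 => eb 0%nat | 2 => ea 1%nat | 3 => eb 1%nat
  | 4 => ea 2%nat | _ => eb 2%nat end.

Definition init_state (c : nat -> R) (ea eb : nat -> nat) (Rb e : R) : mstate :=
  MState 0
    (fun n => match n with
              | 0 => c 0%nat | 1 => c 1%nat | 2 => c 2%nat | 3 => Rb | 4 => e
              | _ => 0 end)
    (fun n => Nat.testbit (exps ea eb (Nat.modulo n 6)) (Nat.div n 6))
    (fun n => match n with 0 => S (Nat.log2 (tdeg ea eb)) | _ => 0%nat end)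
    0 0.

Definition output (s : mstate) : list (R * R) :=
  map (fun i => (rm s (2 * i)%nat, rm s (2 * i + 1)%nat)) (seq 0 (am s 0%nat)).

(* Main.v *)
(* Where the exponent vectors are not collinear, the ratio of two monomials is a parameter [t] on the
   part of the curve in the open quadrant, and both coordinates are products of rational powers of
   linear functions of [t]. Inflection becomes an integer cubic equation in [t], and a vertical
   tangent a linear one. Special points on the axes, and those with collinear exponents, come from
   equations in one variable with two or three terms.

   A root of the cubic is located by exact tests only: powers of linear forms in the root are
   computed by repeated squaring modulo the cubic and their signs are decided by comparisons with
   rational functions of the coefficients, so that membership in the box is decided without approximation. Coordinates are
   then approximated by solving equations [A y^p + B y^k + C = 0] with a convex left-hand side: a
   search over doubly exponential scales finds the magnitude of the root, [O(log D)] bisections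
   reach the basin of quadratic convergence, and Newton's method does the rest. Each of the
   [O(log D + log log (R / e))] steps needs one evaluation, that is, [O(log D)] operations. *)
Require Import Defs.
From Stdlib Require Import Reals List Psatz ZArith ClassicalEpsilon Ranalysis5.
Import ListNotations.
Open Scope R_scope.

(** * Programs over the reals *)

(** The bound on bit operations does not involve [R / e], so the numerical work must not touch bit
    or address registers. The exponents are converted once into real numbers; from then on loop
    counters, jumps and integer tests are real arithmetic.

    The output may contain only points near special points, so membership in the closed box and
    isolatedness cannot be decided up to an error. Hence the sign tests are exact, and hence lines
    (where all points are inflections) and collinear exponents (where special points form arcs) are
    treated separately: there a point of the quadrant is isolated only if the box cuts off its
    neighbours.

    A coordinate is accurate only if both linear functions of [t] are relatively accurate, although
    they may be small. The equation for [t] has integer coefficients of size polynomial in the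
    degree, so its roots stay polynomially far from the zeros 0 and -1 of these functions unless
    they equal them. The real coefficients of [f] only scale the two functions and drop out of
    relative errors; hence they do not enter the cost. *)

Inductive aexp (V : Type) : Type :=
| AV (v : V)
| AK (b : bool)
| AO (o : rop) (a b : aexp V).
Arguments AV {V} v. Arguments AK {V} b. Arguments AO {V} o a b.

Definition fun5 (V W : Type) : Type := V -> V -> V -> V -> V -> W.

(* In [Loop n a1 .. a5 c1 c2 body] the state [a1 .. a5] is updated by [body] while [c1 <= c2], at most
   [n] times. *)
Inductive prog (V : Type) : Type :=
| Ret (a1 a2 a3 a4 a5 : aexp V)
| Let (a : aexp V) (k : V -> prog V)
| Bind (p : prog V) (k : fun5 V (prog V))
| If (a b : aexp V) (p q : prog V)
| Loop (n a1 a2 a3 a4 a5 : aexp V) (c1 c2 : fun5 V (aexp V)) (body : fun5 V (prog V)).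
Arguments Ret {V} a1 a2 a3 a4 a5. Arguments Let {V} a k. Arguments Bind {V} p k.
Arguments If {V} a b p q. Arguments Loop {V} n a1 a2 a3 a4 a5 c1 c2 body.

Definition tup : Type := (R * R * R * R * R)%type.

Fixpoint aden (a : aexp R) : R :=
  match a with
  | AV v => v
  | AK b => if b then 1 else 0
  | AO o a b => eval_rop o (aden a) (aden b)
  end.

Fixpoint loopd (N : nat) (c1 c2 : tup -> R) (f : tup -> tup) (s : tup) : tup :=
  match N with
  | O => s
  | S N' => if Rle_dec (c1 s) (c2 s) then loopd N' c1 c2 f (f s) else s
  end.

(** Loop counters are real: a compiled loop subtracts 1 as long as the counter is at least 1, which
    gives this many passes, and none for a negative counter. *)
Definition nfl (v : R) : nat := Z.to_nat (Int_part v).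

Fixpoint den (p : prog R) : tup :=
  match p with
  | Ret a1 a2 a3 a4 a5 => (aden a1, aden a2, aden a3, aden a4, aden a5)
  | Let a k => den (k (aden a))
  | Bind p k => let '(a, b, c, d, e) := den p in den (k a b c d e)
  | If a b p q => if Rle_dec (aden a) (aden b) then den p else den q
  | Loop n a1 a2 a3 a4 a5 c1 c2 body =>
      loopd (nfl (aden n))
        (fun s => let '(a, b, c, d, e) := s in aden (c1 a b c d e))
        (fun s => let '(a, b, c, d, e) := s in aden (c2 a b c d e))
        (fun s => let '(a, b, c, d, e) := s in den (body a b c d e))
        (aden a1, aden a2, aden a3, aden a4, aden a5)
  end.

Fixpoint asz {V} (a : aexp V) : nat :=
  match a with AV _ => 1 | AK _ => 1 | AO _ a b => asz a + asz b + 1 end.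

(** The constants count compiled instructions. A full pass spends two on the counter test, one on
    the condition, five on moving the new state and three on decrementing and jumping back. The
    exits through the counter and through the condition take 3 and 4 besides the evaluation of the
    condition. *)
Fixpoint loopc (N : nat) (c1 c2 : tup -> R) (f : tup -> tup) (z1 z2 w : tup -> nat)
    (s : tup) : nat :=
  match N with
  | O => 3
  | S N' => if Rle_dec (c1 s) (c2 s)
            then 11 + z1 s + z2 s + w s + loopc N' c1 c2 f z1 z2 w (f s)
            else 4 + z1 s + z2 s
  end.

Fixpoint cost (p : prog R) : nat :=
  match p with
  | Ret a1 a2 a3 a4 a5 => asz a1 + asz a2 + asz a3 + asz a4 + asz a5
  | Let a k => asz a + cost (k (aden a)) + 5
  | Bind p k => let '(a, b, c, d, e) := den p in cost p + cost (k a b c d e) + 5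
  | If a b p q => if Rle_dec (aden a) (aden b)
                  then asz a + asz b + 1 + cost p
                  else asz a + asz b + 2 + cost q
  | Loop n a1 a2 a3 a4 a5 c1 c2 body =>
      asz n + (asz a1 + asz a2 + asz a3 + asz a4 + asz a5) + 5 +
      loopc (nfl (aden n))
        (fun s => let '(a, b, c, d, e) := s in aden (c1 a b c d e))
        (fun s => let '(a, b, c, d, e) := s in aden (c2 a b c d e))
        (fun s => let '(a, b, c, d, e) := s in den (body a b c d e))
        (fun s => let '(a, b, c, d, e) := s in asz (c1 a b c d e))
        (fun s => let '(a, b, c, d, e) := s in asz (c2 a b c d e))
        (fun s => let '(a, b, c, d, e) := s in cost (body a b c d e))
        (aden a1, aden a2, aden a3, aden a4, aden a5)
  end.

(** A program describes one candidate point: a flag followed by the two coordinates. The number of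
    points written thus varies although the list of programs is fixed. *)
Definition emits (s : tup) : list (R * R) :=
  let '(f, x, y, _, _) := s in if Rle_dec 1 f then [(x, y)] else [].

(** * Compilation *)

(* Program variable [r] lives in the real register [r + RB], which is reached through the address
   register [r + AB]; real registers below [RB] hold the output. *)
Definition AB := 3%nat.
Definition RB := 64%nat.

Fixpoint cexp (a : aexp nat) (r : nat) : program :=
  match a with
  | AV v => [IMove (r + AB) (v + AB)]
  | AK b => [IConst b (r + AB)]
  | AO o a b => cexp a r ++ cexp b (S r) ++ [IArith o (r + AB) (r + AB) (S r + AB)]
  end%nat.

Definition mov5 (s r : nat) : program :=
  [IMove (r + AB) (s + AB); IMove (S r + AB) (S s + AB); IMove (S (S r) + AB) (S (S s) + AB);
   IMove (3 + r + AB) (3 + s + AB); IMove (4 + r + AB) (4 + s + AB)]%nat.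

Definition cexp5 (a1 a2 a3 a4 a5 : aexp nat) (r : nat) : program :=
  (cexp a1 r ++ cexp a2 (S r) ++ cexp a3 (S (S r)) ++ cexp a4 (3 + r) ++ cexp a5 (4 + r))%nat.

Definition at5 {W} (f : fun5 nat W) (r : nat) : W :=
  f r (S r) (S (S r)) (3 + r)%nat (4 + r)%nat.

(** Jump targets are absolute, hence the offset [o]. Results land in the five registers from [r] on,
    temporaries above them. A jump is written as a comparison of a register with itself: it is
    charged as an arithmetic operation, so that compiled programs perform no bit operation, whatever
    the number of passes. *)
Fixpoint cprog (p : prog nat) (o r : nat) : program :=
  match p with
  | Ret a1 a2 a3 a4 a5 => cexp5 a1 a2 a3 a4 a5 r
  | Let a k =>
      let c := cexp a r in
      c ++ cprog (k r) (o + length c) (S r) ++ mov5 (S r) r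
  | Bind p k =>
      let c := cprog p o r in
      c ++ cprog (k r (S r) (S (S r)) (3 + r) (4 + r)) (o + length c) (5 + r)
      ++ mov5 (5 + r) r
  | If a b p q =>
      let c := cexp a r ++ cexp b (S r) in
      let o1 := o + length c + 1 in
      let cq := cprog q o1 r in
      let o2 := o1 + length cq + 1 in
      let cp := cprog p o2 r in
      c ++ [ILe (r + AB) (S r + AB) o2] ++ cq
        ++ [ILe (r + AB) (r + AB) (o2 + length cp)] ++ cp
  | Loop n a1 a2 a3 a4 a5 c1 c2 body =>
      let init := cexp n r ++ cexp5 a1 a2 a3 a4 a5 (S r) in
      let o1 := o + length init in
      let t := 6 + r in
      let cc := cexp (at5 c1 (S r)) t ++ cexp (at5 c2 (S r)) (S t) in
      let o2 := o1 + 3 in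
      let o3 := o2 + length cc + 2 in
      let cb := cprog (body (S r) (S (S r)) (3 + r) (4 + r) (5 + r)) o3 t in
      let oe := o3 + length cb + 8 in
      init ++
      [IConst true (t + AB); ILe (t + AB) (r + AB) o2; ILe (r + AB) (r + AB) oe] ++
      cc ++ [ILe (t + AB) (S t + AB) o3; ILe (r + AB) (r + AB) oe] ++
      cb ++ mov5 t (S r) ++
      [IConst true (t + AB); IArith RSub (r + AB) (r + AB) (t + AB);
       ILe (r + AB) (r + AB) o1] ++
      mov5 (S r) r
  end%nat.

(** Here address registers 0 and 1 are the number of points written and the next free output
    register; [IMove 1 _] stores through the latter. *)
Definition emit_code (o r : nat) : program :=
  [IConst true (5 + r + AB); ILe (5 + r + AB) (r + AB) (o + 3); ILe (r + AB) (r + AB) (o + 8);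
   IMove 1 (S r + AB); IAInc 1; IMove 1 (S (S r) + AB); IAInc 1; IAInc 0]%nat.

Fixpoint lcomp (l : list (prog nat)) (o r : nat) : program :=
  match l with
  | [] => []
  | p :: l => let c := cprog p o r in
      c ++ emit_code (o + length c) r ++ lcomp l (o + length c + 8) r
  end%nat.

(** Exclusive upper bounds for the variables touched. Their maximum over the whole program is the
    number of address registers to be initialised. *)
Fixpoint amr (a : aexp nat) (r : nat) : nat :=
  match a with
  | AV _ => S r | AK _ => S r
  | AO _ a b => Nat.max (amr a r) (amr b (S r))
  end.

Definition amr5 (a1 a2 a3 a4 a5 : aexp nat) (r : nat) : nat :=
  Nat.max (amr a1 r) (Nat.max (amr a2 (S r)) (Nat.max (amr a3 (S (S r)))
    (Nat.max (amr a4 (3 + r)) (amr a5 (4 + r)))))%nat.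

Fixpoint mr (p : prog nat) (r : nat) : nat :=
  match p with
  | Ret a1 a2 a3 a4 a5 => amr5 a1 a2 a3 a4 a5 r
  | Let a k => Nat.max (amr a r) (Nat.max (mr (k r) (S r)) (6 + r))
  | Bind p k =>
      Nat.max (mr p r) (Nat.max (mr (k r (S r) (S (S r)) (3 + r) (4 + r)) (5 + r)) (10 + r))
  | If a b p q =>
      Nat.max (Nat.max (amr a r) (amr b (S r))) (Nat.max (mr p r) (mr q r))
  | Loop n a1 a2 a3 a4 a5 c1 c2 body =>
      Nat.max (Nat.max (amr n r) (amr5 a1 a2 a3 a4 a5 (S r)))
      (Nat.max (Nat.max (amr (at5 c1 (S r)) (6 + r)) (amr (at5 c2 (S r)) (S (6 + r))))
      (Nat.max (mr (body (S r) (S (S r)) (3 + r) (4 + r) (5 + r)) (6 + r)) (11 + r)))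
  end%nat.

Fixpoint lmr (l : list (prog nat)) (r : nat) : nat :=
  match l with [] => 0 | p :: l => Nat.max (mr p r) (Nat.max (6 + r) (lmr l r)) end%nat.

(* A polymorphic program has an instance over register names and one over real values; these
   relations say that two instances agree when names and values are matched as in [G]. *)
Definition ctx := list (nat * R).

Inductive aeq (G : ctx) : aexp nat -> aexp R -> Prop :=
| aeq_V n x : In (n, x) G -> aeq G (AV n) (AV x)
| aeq_K b : aeq G (AK b) (AK b)
| aeq_O o a b a' b' : aeq G a a' -> aeq G b b' -> aeq G (AO o a b) (AO o a' b').

Definition ext5 (G : ctx) n1 n2 n3 n4 n5 x1 x2 x3 x4 x5 : ctx :=
  (n1, x1) :: (n2, x2) :: (n3, x3) :: (n4, x4) :: (n5, x5) :: G.

Inductive peq : ctx -> prog nat -> prog R -> Prop :=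
| peq_Ret G a1 a2 a3 a4 a5 b1 b2 b3 b4 b5 :
    aeq G a1 b1 -> aeq G a2 b2 -> aeq G a3 b3 -> aeq G a4 b4 -> aeq G a5 b5 ->
    peq G (Ret a1 a2 a3 a4 a5) (Ret b1 b2 b3 b4 b5)
| peq_Let G a b k k' :
    aeq G a b -> (forall n x, peq ((n, x) :: G) (k n) (k' x)) ->
    peq G (Let a k) (Let b k')
| peq_Bind G p q k k' :
    peq G p q ->
    (forall n1 n2 n3 n4 n5 x1 x2 x3 x4 x5,
       peq (ext5 G n1 n2 n3 n4 n5 x1 x2 x3 x4 x5) (k n1 n2 n3 n4 n5) (k' x1 x2 x3 x4 x5)) ->
    peq G (Bind p k) (Bind q k')
| peq_If G a b p q a' b' p' q' :
    aeq G a a' -> aeq G b b' -> peq G p p' -> peq G q q' ->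
    peq G (If a b p q) (If a' b' p' q')
| peq_Loop G n a1 a2 a3 a4 a5 c1 c2 body n' b1 b2 b3 b4 b5 d1 d2 body' :
    aeq G n n' ->
    aeq G a1 b1 -> aeq G a2 b2 -> aeq G a3 b3 -> aeq G a4 b4 -> aeq G a5 b5 ->
    (forall n1 n2 n3 n4 n5 x1 x2 x3 x4 x5,
       aeq (ext5 G n1 n2 n3 n4 n5 x1 x2 x3 x4 x5) (c1 n1 n2 n3 n4 n5) (d1 x1 x2 x3 x4 x5)) ->
    (forall n1 n2 n3 n4 n5 x1 x2 x3 x4 x5,
       aeq (ext5 G n1 n2 n3 n4 n5 x1 x2 x3 x4 x5) (c2 n1 n2 n3 n4 n5) (d2 x1 x2 x3 x4 x5)) ->
    (forall n1 n2 n3 n4 n5 x1 x2 x3 x4 x5,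
       peq (ext5 G n1 n2 n3 n4 n5 x1 x2 x3 x4 x5)
         (body n1 n2 n3 n4 n5) (body' x1 x2 x3 x4 x5)) ->
    peq G (Loop n a1 a2 a3 a4 a5 c1 c2 body) (Loop n' b1 b2 b3 b4 b5 d1 d2 body').

(** * Correctness of the compiled code *)

Definition code_at (P : program) (o : nat) (c : program) : Prop :=
  forall i, (i < length c)%nat -> nth_error P (o + i) = nth_error c i.

Lemma code_at_app P o c d :
  code_at P o (c ++ d) <-> code_at P o c /\ code_at P (o + length c) d.
Proof.
  unfold code_at; split.
  - intros H; split; intros i Hi.
    + rewrite H by (rewrite length_app; lia). now apply nth_error_app1.
    + rewrite <- Nat.add_assoc, H by (rewrite length_app; lia).
      rewrite nth_error_app2 by lia. f_equal; lia.
  - intros [H1 H2] i Hi. rewrite length_app in Hi.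
    destruct (Nat.lt_ge_cases i (length c)).
    + rewrite nth_error_app1 by lia. now apply H1.
    + rewrite nth_error_app2 by lia. rewrite <- H2 by lia. f_equal; lia.
Qed.

Lemma code_at_cons P o i c :
  code_at P o (i :: c) <-> nth_error P o = Some i /\ code_at P (S o) c.
Proof.
  change (i :: c) with ([i] ++ c). rewrite code_at_app. rewrite Nat.add_1_r. split; intros [H1 H2]; split; trivial.
  - specialize (H1 0%nat). rewrite Nat.add_0_r in H1. apply H1. simpl; lia.
  - intros j Hj. simpl in Hj. assert (j = 0)%nat by lia. subst. now rewrite Nat.add_0_r.
Qed.

Lemma run_add P m n s : run P (m + n) s = run P n (run P m s).
Proof. revert s; induction m; intros; simpl; auto. Qed.

(** The length of a run is forgotten: all costs are recorded in the counters of the state. *)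
Definition reach (P : program) (s s' : mstate) : Prop := exists k, run P k s = s'.

Lemma reach_refl P s : reach P s s.
Proof. now exists 0%nat. Qed.

Lemma reach_trans P s1 s2 s3 : reach P s1 s2 -> reach P s2 s3 -> reach P s1 s3.
Proof. intros [m <-] [n <-]. exists (m + n)%nat. apply run_add. Qed.

Lemma reach_step P i k r b a na nb s' :
  nth_error P k = Some i ->
  reach P (exec i (MState k r b a na nb)) s' -> reach P (MState k r b a na nb) s'.
Proof.
  intros H [n Hn]. exists (S n). simpl. unfold step. simpl. now rewrite H.
Qed.

(** Indirect addressing is used as if it were direct: address register [i + AB] points to real
    register [i + RB] once and for all. *)
Definition good (a : nat -> nat) (N : nat) : Prop :=
  forall i, (i < N)%nat -> a (i + AB)%nat = (i + RB)%nat.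

Definition holds (G : ctx) (rm : nat -> R) (r : nat) : Prop :=
  forall n x, In (n, x) G -> rm (n + RB)%nat = x /\ (n < r)%nat.

(** Everything below the working registers is untouched: the variables in scope, but also the output
    area, which lies below [RB]. *)
Definition same (rm rm' : nat -> R) (r : nat) : Prop :=
  forall j, (j < r + RB)%nat -> rm' j = rm j.

Lemma holds_same G rm rm' r r' : holds G rm r -> same rm rm' r -> (r <= r')%nat -> holds G rm' r'.
Proof.
  intros H S Hr n x Hin. destruct (H n x Hin) as [H1 H2]. split; [|lia].
  rewrite S by lia. exact H1.
Qed.

Lemma holds_cons G rm r n x :
  holds G rm r -> rm (n + RB)%nat = x -> (n < r)%nat -> holds ((n, x) :: G) rm r.
Proof. intros H H1 H2 m y [E|Hin]; [injection E as -> ->; auto|now apply H]. Qed.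

Lemma same_trans a b c r r' : same a b r -> same b c r' -> (r <= r')%nat -> same a c r.
Proof. intros H1 H2 Hr j Hj. rewrite H2 by lia. now apply H1. Qed.

Lemma same_le a b r r' : same a b r -> (r' <= r)%nat -> same a b r'.
Proof. intros H Hr j Hj. apply H; lia. Qed.

Lemma same_refl a r : same a a r.
Proof. intros j _; reflexivity. Qed.

Lemma upd_eq {A} (f : nat -> A) k v : upd f k v k = v.
Proof. unfold upd. now rewrite Nat.eqb_refl. Qed.

Lemma upd_neq {A} (f : nat -> A) k v j : j <> k -> upd f k v j = f j.
Proof. unfold upd. intros H. now destruct (Nat.eqb_spec j k). Qed.

Lemma same_upd a r k v : (r + RB <= k)%nat -> same a (upd a k v) r.
Proof. intros H j Hj. apply upd_neq. lia. Qed.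

Lemma amr_gt a r : (r < amr a r)%nat.
Proof.
  revert r; induction a; intros r; simpl; try lia. specialize (IHa1 r). lia.
Qed.

(** Registers are used as a stack: the second operand is evaluated one register higher, so that the
    first result survives. *)
Lemma cexp_ok G a a' : aeq G a a' -> forall P o r rm b am na nb N,
  code_at P o (cexp a r) -> good am N -> (amr a r <= N)%nat -> holds G rm r ->
  exists rm', reach P (MState o rm b am na nb)
      (MState (o + length (cexp a r)) rm' b am (na + asz a') nb)
    /\ rm' (r + RB)%nat = aden a' /\ same rm rm' r.
Proof.
  induction 1 as [n x Hin|b0|op a b a' b' Ha IHa Hb IHb];
    intros P o r rm b1 am na nb N Hc Hg Hm Hh; cbn [cexp] in Hc; cbn [amr] in Hm.
  - apply code_at_cons in Hc as [Hc _]. destruct (Hh n x Hin) as [Hx Hn].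
    exists (upd rm (r + RB)%nat x). split; [|split].
    + eapply reach_step; [exact Hc|]. cbn [exec cexp asz length]. rewrite !Hg by lia. rewrite Hx.
      replace (o + 1)%nat with (S o) by lia. replace (na + 1)%nat with (S na) by lia.
      apply reach_refl.
    + apply upd_eq.
    + apply same_upd; lia.
  - apply code_at_cons in Hc as [Hc _].
    exists (upd rm (r + RB)%nat (if b0 then 1 else 0)). split; [|split].
    + eapply reach_step; [exact Hc|]. cbn [exec cexp asz length]. rewrite !Hg by lia.
      replace (o + 1)%nat with (S o) by lia. replace (na + 1)%nat with (S na) by lia.
      apply reach_refl.
    + apply upd_eq.
    + apply same_upd; lia.
  - apply code_at_app in Hc as [Hc1 Hc]. apply code_at_app in Hc as [Hc2 Hc].
    apply code_at_cons in Hc as [Hc3 _].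
    destruct (IHa P o r rm b1 am na nb N Hc1 Hg ltac:(lia) Hh) as (rm1 & R1 & E1 & S1).
    assert (Hh1 : holds G rm1 (S r)) by (eapply holds_same; [eassumption|eassumption|lia]).
    destruct (IHb P _ (S r) rm1 b1 am (na + asz a')%nat nb N Hc2 Hg ltac:(lia) Hh1)
      as (rm2 & R2 & E2 & S2).
    exists (upd rm2 (r + RB)%nat (eval_rop op (aden a') (aden b'))). split; [|split].
    + eapply reach_trans; [exact R1|]. eapply reach_trans; [exact R2|].
      eapply reach_step; [exact Hc3|]. cbn [exec].
      pose proof (amr_gt b (S r)).
      rewrite !Hg by lia. rewrite E2, (S2 (r + RB)%nat) by lia. rewrite E1.
      cbn [cexp]. rewrite !length_app. replace (S (o + length (cexp a r) + length (cexp b (S r))))%nat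
        with (o + (length (cexp a r) + (length (cexp b (S r)) + 1)))%nat by lia.
      replace (S (na + asz a' + asz b'))%nat with (na + asz (AO op a' b'))%nat
        by (simpl; lia).
      apply reach_refl.
    + apply upd_eq.
    + eapply same_trans; [exact S1| |apply le_n].
      intros j Hj. rewrite upd_neq by lia. apply S2. lia.
Qed.

Definition res5 (rm : nat -> R) (r : nat) (s : tup) : Prop :=
  let '(a, b, c, d, e) := s in
  rm (r + RB)%nat = a /\ rm (S r + RB)%nat = b /\ rm (S (S r) + RB)%nat = c /\
  rm (3 + r + RB)%nat = d /\ rm (4 + r + RB)%nat = e.

Lemma res5_same rm rm' r r' s : res5 rm r s -> same rm rm' r' -> (5 + r <= r')%nat -> res5 rm' r s.
Proof.
  destruct s as [[[[a b] c] d] e]. intros (H1 & H2 & H3 & H4 & H5) S Hr.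
  repeat split; rewrite S by lia; assumption.
Qed.

Lemma cexp5_ok G a1 a2 a3 a4 a5 b1 b2 b3 b4 b5 P o r rm b am na nb N :
  aeq G a1 b1 -> aeq G a2 b2 -> aeq G a3 b3 -> aeq G a4 b4 -> aeq G a5 b5 ->
  code_at P o (cexp5 a1 a2 a3 a4 a5 r) -> good am N -> (amr5 a1 a2 a3 a4 a5 r <= N)%nat ->
  holds G rm r ->
  exists rm', reach P (MState o rm b am na nb)
      (MState (o + length (cexp5 a1 a2 a3 a4 a5 r)) rm' b am
         (na + (asz b1 + asz b2 + asz b3 + asz b4 + asz b5)) nb)
    /\ res5 rm' r (aden b1, aden b2, aden b3, aden b4, aden b5) /\ same rm rm' r.
Proof.
  unfold cexp5, amr5. intros A1 A2 A3 A4 A5 Hc Hg Hm Hh.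
  apply code_at_app in Hc as [Hc1 Hc]. apply code_at_app in Hc as [Hc2 Hc].
  apply code_at_app in Hc as [Hc3 Hc]. apply code_at_app in Hc as [Hc4 Hc5].
  destruct (cexp_ok _ _ _ A1 P _ r rm b am na nb N Hc1 Hg ltac:(lia) Hh) as (m1 & R1 & E1 & S1).
  assert (L4 : (amr a4 (3 + r) <= N)%nat) by lia.
  assert (L5 : (amr a5 (4 + r) <= N)%nat) by lia.
  assert (H1 : holds G m1 (S r)) by (eapply holds_same; [eassumption|eassumption|lia]).
  destruct (cexp_ok _ _ _ A2 P _ _ m1 b am (na + asz b1) nb N Hc2 Hg ltac:(lia) H1)%nat
    as (m2 & R2 & E2 & S2).
  assert (H2 : holds G m2 (S (S r))) by (eapply holds_same; [eassumption|eassumption|lia]).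
  destruct (cexp_ok _ _ _ A3 P _ _ m2 b am (na + asz b1 + asz b2) nb N Hc3 Hg ltac:(lia) H2)%nat
    as (m3 & R3 & E3 & S3).
  assert (H3 : holds G m3 (3 + r)) by (eapply holds_same; [eassumption|eassumption|lia]).
  destruct (cexp_ok _ _ _ A4 P _ _ m3 b am (na + asz b1 + asz b2 + asz b3) nb N Hc4 Hg L4 H3)%nat as (m4 & R4 & E4 & S4).
  assert (H4 : holds G m4 (4 + r)) by (eapply holds_same; [eassumption|eassumption|lia]).
  destruct (cexp_ok _ _ _ A5 P _ _ m4 b am (na + asz b1 + asz b2 + asz b3 + asz b4) nb N Hc5 Hg L5 H4)%nat as (m5 & R5 & E5 & S5).
  exists m5. split; [|split].
  - do 4 (eapply reach_trans; [eassumption|]). rewrite !length_app.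
    match goal with |- reach _ _ ?s => match type of R5 with reach _ _ ?s' =>
      replace s with s'; [exact R5|f_equal; lia] end end.
  - repeat split; trivial.
    + rewrite S5, S4, S3, S2 by lia; exact E1.
    + rewrite S5, S4, S3 by lia; exact E2.
    + rewrite S5, S4 by lia; exact E3.
    + rewrite S5 by lia; exact E4.
  - intros j Hj. rewrite S5, S4, S3, S2, S1 by lia. reflexivity.
Qed.

Lemma move_ok P o s r rm b am na nb N :
  nth_error P o = Some (IMove (r + AB)%nat (s + AB)%nat) -> good am N ->
  (r < N)%nat -> (s < N)%nat ->
  exists rm', reach P (MState o rm b am na nb) (MState (S o) rm' b am (S na) nb)
    /\ rm' (r + RB)%nat = rm (s + RB)%nat
    /\ (forall j, j <> (r + RB)%nat -> rm' j = rm j).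
Proof.
  intros Hc Hg Hr Hs. exists (upd rm (r + RB)%nat (rm (s + RB)%nat)). split; [|split].
  - eapply reach_step; [exact Hc|]. cbn [exec]. rewrite (Hg r), (Hg s) by lia.
    apply reach_refl.
  - apply upd_eq.
  - intros j Hj. now apply upd_neq.
Qed.

Lemma mov5_ok P o s r rm b am na nb N t :
  code_at P o (mov5 s r) -> good am N -> (r < s)%nat -> (5 + s <= N)%nat -> res5 rm s t ->
  exists rm', reach P (MState o rm b am na nb) (MState (5 + o) rm' b am (5 + na) nb)
    /\ res5 rm' r t /\ same rm rm' r.
Proof.
  destruct t as [[[[x1 x2] x3] x4] x5]. intros Hc Hg Hr HN (H1 & H2 & H3 & H4 & H5).
  apply code_at_cons in Hc as [Hc1 Hc]. apply code_at_cons in Hc as [Hc2 Hc].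
  apply code_at_cons in Hc as [Hc3 Hc]. apply code_at_cons in Hc as [Hc4 Hc].
  apply code_at_cons in Hc as [Hc5 _].
  destruct (move_ok _ _ _ _ rm b am na nb N Hc1 Hg) as (m1 & R1 & E1 & F1); [lia|lia|].
  destruct (move_ok _ _ _ _ m1 b am (S na) nb N Hc2 Hg) as (m2 & R2 & E2 & F2); [lia|lia|].
  destruct (move_ok _ _ _ _ m2 b am (S (S na)) nb N Hc3 Hg) as (m3 & R3 & E3 & F3); [lia|lia|].
  destruct (move_ok _ _ _ _ m3 b am (3 + na) nb N Hc4 Hg) as (m4 & R4 & E4 & F4); [lia|lia|].
  destruct (move_ok _ _ _ _ m4 b am (4 + na) nb N Hc5 Hg) as (m5 & R5 & E5 & F5); [lia|lia|].
  exists m5. split; [|split].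
  - do 4 (eapply reach_trans; [eassumption|]). exact R5.
  - repeat split.
    + rewrite F5, F4, F3, F2, E1 by lia. exact H1.
    + rewrite F5, F4, F3, E2, F1 by lia. exact H2.
    + rewrite F5, F4, E3, F2, F1 by lia. exact H3.
    + rewrite F5, E4, F3, F2, F1 by lia. exact H4.
    + rewrite E5, F4, F3, F2, F1 by lia. exact H5.
  - intros j Hj. rewrite F5, F4, F3, F2, F1 by lia. reflexivity.
Qed.

Lemma holds_ext5 G rm r s :
  holds G rm r -> res5 rm r s ->
  let '(a, b, c, d, e) := s in
  holds (ext5 G r (S r) (S (S r)) (3 + r) (4 + r) a b c d e) rm (5 + r).
Proof.
  destruct s as [[[[x1 x2] x3] x4] x5]. intros H (H1 & H2 & H3 & H4 & H5).
  assert (H' : holds G rm (5 + r)) by (eapply holds_same; [exact H|apply same_refl|lia]).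
  repeat (apply holds_cons; [|assumption|lia]). exact H'.
Qed.

Lemma nfl_lt v : v < 1 -> nfl v = 0%nat.
Proof.
  intros H. unfold nfl. destruct (base_Int_part v) as [H1 H2].
  assert (IZR (Int_part v) < 1) by lra. apply lt_IZR in H0. lia.
Qed.

Lemma nfl_ge v : 1 <= v -> nfl v = S (nfl (v - 1)).
Proof.
  intros H. unfold nfl. destruct (base_Int_part v) as [H1 H2].
  assert (E : Int_part (v - 1) = (Int_part v - 1)%Z).
  { symmetry. apply Int_part_spec. rewrite minus_IZR. lra. }
  assert (0 < IZR (Int_part v)) by lra. apply lt_IZR in H0. lia.
Qed.

Lemma reach_ile P k s1 s2 t r b am na nb N s' :
  nth_error P k = Some (ILe (s1 + AB)%nat (s2 + AB)%nat t) -> good am N ->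
  (s1 < N)%nat -> (s2 < N)%nat ->
  reach P (MState (if Rle_dec (r (s1 + RB)%nat) (r (s2 + RB)%nat) then t else S k)
             r b am (S na) nb) s' ->
  reach P (MState k r b am na nb) s'.
Proof.
  intros H Hg H1 H2 HR. eapply reach_step; [exact H|]. cbn [exec].
  rewrite (Hg s1), (Hg s2) by lia. exact HR.
Qed.

Lemma reach_jmp P k s1 t r b am na nb s' :
  nth_error P k = Some (ILe s1 s1 t) ->
  reach P (MState t r b am (S na) nb) s' -> reach P (MState k r b am na nb) s'.
Proof.
  intros H HR. eapply reach_step; [exact H|]. cbn [exec].
  destruct (Rle_dec _ _) as [_|n]; [exact HR|]. exfalso. apply n, Rle_refl.
Qed.

Lemma reach_eq P s s1 s2 : reach P s s1 -> s1 = s2 -> reach P s s2.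
Proof. now intros H <-. Qed.

Lemma reach_l P s s1 s2 : s = s1 -> reach P s1 s2 -> reach P s s2.
Proof. now intros ->. Qed.

(** The arithmetic counter grows by exactly [cost q] and the bit counter not at all; the latter is
    what keeps [R / e] out of the bit bound. *)
Definition prog_ok (G : ctx) (p : prog nat) (q : prog R) : Prop :=
  forall P o r rm b am na nb N,
  code_at P o (cprog p o r) -> good am N -> (mr p r <= N)%nat -> holds G rm r ->
  exists rm', reach P (MState o rm b am na nb)
      (MState (o + length (cprog p o r)) rm' b am (na + cost q) nb)
    /\ res5 rm' r (den q) /\ same rm rm' r.

(** The code of the loop stays fixed while the remaining passes decrease, so the induction is on
    [nfl] of the counter, with the counter value, the memory and the state generalised. *)
Lemma loop_ok G (c1 c2 : fun5 nat (aexp nat)) body d1 d2 body' :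
  (forall n1 n2 n3 n4 n5 x1 x2 x3 x4 x5,
     aeq (ext5 G n1 n2 n3 n4 n5 x1 x2 x3 x4 x5) (c1 n1 n2 n3 n4 n5) (d1 x1 x2 x3 x4 x5)) ->
  (forall n1 n2 n3 n4 n5 x1 x2 x3 x4 x5,
     aeq (ext5 G n1 n2 n3 n4 n5 x1 x2 x3 x4 x5) (c2 n1 n2 n3 n4 n5) (d2 x1 x2 x3 x4 x5)) ->
  (forall n1 n2 n3 n4 n5 x1 x2 x3 x4 x5,
     prog_ok (ext5 G n1 n2 n3 n4 n5 x1 x2 x3 x4 x5)
       (body n1 n2 n3 n4 n5) (body' x1 x2 x3 x4 x5)) ->
  forall P r b am nb N o1 o2 o3 oe,
  let t := (6 + r)%nat in
  let cc := cexp (at5 c1 (S r)) t ++ cexp (at5 c2 (S r)) (S t) in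
  let cb := cprog (body (S r) (S (S r)) (3 + r) (4 + r) (5 + r))%nat o3 t in
  o2 = (o1 + 3)%nat -> o3 = (o2 + length cc + 2)%nat -> oe = (o3 + length cb + 8)%nat ->
  code_at P o1
      ([IConst true (t + AB); ILe (t + AB) (r + AB) o2; ILe (r + AB) (r + AB) oe] ++
      cc ++ [ILe (t + AB) (S t + AB) o3; ILe (r + AB) (r + AB) oe] ++
      cb ++ mov5 t (S r) ++
      [IConst true (t + AB); IArith RSub (r + AB) (r + AB) (t + AB);
       ILe (r + AB) (r + AB) o1])%nat ->
  good am N -> (amr (at5 c1 (S r)) t <= N)%nat -> (amr (at5 c2 (S r)) (S t) <= N)%nat ->
  (mr (body (S r) (S (S r)) (3 + r) (4 + r) (5 + r)) t <= N)%nat -> (11 + r <= N)%nat ->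
  forall n v rm s na, nfl v = n -> rm (r + RB)%nat = v -> holds G rm r -> res5 rm (S r) s ->
  exists rm', reach P (MState o1 rm b am na nb) (MState oe rm' b am (na + 
      loopc n
        (fun s => let '(a, b, c, d, e) := s in aden (d1 a b c d e))
        (fun s => let '(a, b, c, d, e) := s in aden (d2 a b c d e))
        (fun s => let '(a, b, c, d, e) := s in den (body' a b c d e))
        (fun s => let '(a, b, c, d, e) := s in asz (d1 a b c d e))
        (fun s => let '(a, b, c, d, e) := s in asz (d2 a b c d e))
        (fun s => let '(a, b, c, d, e) := s in cost (body' a b c d e)) s) nb)
    /\ res5 rm' (S r) (loopd n
        (fun s => let '(a, b, c, d, e) := s in aden (d1 a b c d e))
        (fun s => let '(a, b, c, d, e) := s in aden (d2 a b c d e))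
        (fun s => let '(a, b, c, d, e) := s in den (body' a b c d e)) s)
    /\ same rm rm' r.
Proof.
  intros A1 A2 HB P r b am nb N o1 o2 o3 oe t cc cb Eo2 Eo3 Eoe Hc Hg M1 M2 M3 M4.
  apply code_at_cons in Hc as [K1 Hc]. apply code_at_cons in Hc as [K2 Hc].
  apply code_at_cons in Hc as [K3 Hc]. apply code_at_app in Hc as [Kcc Hc].
  apply code_at_app in Kcc as [Kc1 Kc2].
  apply code_at_cons in Hc as [K4 Hc]. apply code_at_cons in Hc as [K5 Hc].
  apply code_at_app in Hc as [Kb Hc]. apply code_at_app in Hc as [Km Hc].
  apply code_at_cons in Hc as [K6 Hc]. apply code_at_cons in Hc as [K7 Hc].
  apply code_at_cons in Hc as [K8 _].
  assert (Lcc : length cc = (length (cexp (at5 c1 (S r)) t) + length (cexp (at5 c2 (S r)) (S t)))%nat)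
    by (unfold cc; apply length_app).
  induction n as [|n IH]; intros v rm s na Hn Hv Hh Hs.
  - exists (upd rm (t + RB)%nat 1). split; [|split].
    + eapply reach_step; [exact K1|]. cbn [exec]. rewrite (Hg t) by lia.
      eapply (reach_ile _ _ t r); [exact K2|exact Hg|lia|lia|].
      rewrite upd_eq, upd_neq by lia. rewrite Hv.
      destruct (Rle_dec 1 v) as [H|_]. { rewrite nfl_ge in Hn by lra. discriminate. }
      eapply reach_jmp; [exact K3|]. eapply reach_eq; [apply reach_refl|].
      cbn [loopc]. f_equal; lia.
    + eapply res5_same; [exact Hs| apply (same_upd _ t)|]; lia.
    + apply same_upd; lia.
  - assert (H1v : 1 <= v) by (destruct (Rle_dec 1 v); [assumption|rewrite nfl_lt in Hn by lra; discriminate]).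
    pose (rm0 := upd rm (t + RB)%nat 1).
    assert (S0 : same rm rm0 t) by (apply same_upd; lia).
    assert (Hh1 : holds G rm0 (S r)) by (eapply holds_same; [exact Hh|eapply same_le; [exact S0|lia]|lia]).
    assert (Hs1 : res5 rm0 (S r) s) by (eapply res5_same; [exact Hs|exact S0|lia]).
    pose proof (holds_ext5 _ _ _ _ Hh1 Hs1) as Hx.
    destruct s as [[[[x1 x2] x3] x4] x5].
    assert (Hx' : holds (ext5 G (S r) (S (S r)) (S (S (S r))) (3 + S r) (4 + S r) x1 x2 x3 x4 x5) rm0 t)
      by tauto. clear Hx. rename Hx' into Hx.
    destruct (cexp_ok _ _ _ (A1 _ _ _ _ _ x1 x2 x3 x4 x5) P _ t rm0 b am (na + 2)%nat nb N Kc1 Hg M1 Hx)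
      as (m1 & R1 & E1 & S1).
    assert (Hx1 : holds (ext5 G (S r) (S (S r)) (S (S (S r))) (3 + S r) (4 + S r) x1 x2 x3 x4 x5) m1 (S t))
      by (eapply holds_same; [exact Hx|exact S1|lia]).
    destruct (cexp_ok _ _ _ (A2 _ _ _ _ _ x1 x2 x3 x4 x5) P _ (S t) m1 b am
      (na + 2 + asz (d1 x1 x2 x3 x4 x5))%nat nb N Kc2 Hg M2 Hx1) as (m2 & R2 & E2 & S2).
    set (v1 := aden (d1 x1 x2 x3 x4 x5)) in *. set (v2 := aden (d2 x1 x2 x3 x4 x5)) in *.
    set (z1 := asz (d1 x1 x2 x3 x4 x5)) in *. set (z2 := asz (d2 x1 x2 x3 x4 x5)) in *.
    (* The part of a pass shared by both outcomes of the condition, up to the conditional jump. *)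
    assert (F : forall s', reach P (MState (if Rle_dec v1 v2 then o3
        else S (S (S (S o1)) + length cc)) m2 b am (na + 3 + z1 + z2) nb) s' ->
        reach P (MState o1 rm b am na nb) s').
    { intros s' HR. eapply reach_step; [exact K1|]. cbn [exec]. rewrite (Hg t) by lia.
      eapply (reach_ile _ _ t r); [exact K2|exact Hg|lia|lia|].
      rewrite upd_eq, upd_neq by lia. rewrite Hv.
      destruct (Rle_dec 1 v) as [_|H]; [|contradiction].
      eapply reach_trans; [eapply reach_l; [|exact R1]; unfold rm0; f_equal; lia|].
      eapply reach_trans; [exact R2|].
      eapply (reach_ile _ _ t (S t)); [|exact Hg|lia|lia|].
      { rewrite Lcc, Nat.add_assoc in K4. exact K4. }
      rewrite (S2 (t + RB)%nat), E1, E2 by lia.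
      eapply reach_l; [|exact HR].
      f_equal; [|lia]. destruct (Rle_dec v1 v2); [reflexivity|].
      rewrite Lcc. unfold at5. lia. }
    assert (Sm2 : same rm m2 t).
    { intros j Hj. rewrite S2, S1, S0 by lia. reflexivity. }
    assert (Hs2 : res5 m2 (S r) (x1, x2, x3, x4, x5)).
    { eapply res5_same; [exact Hs1|eapply same_trans; [exact S1|exact S2|]|]; lia. }
    cbn [loopc loopd]. fold v1 v2 z1 z2. destruct (Rle_dec v1 v2) as [Hle|Hle].
    + assert (Hx2 : holds (ext5 G (S r) (S (S r)) (S (S (S r))) (3 + S r) (4 + S r) x1 x2 x3 x4 x5) m2 t)
        by (eapply holds_same; [exact Hx|eapply same_trans; [exact S1|exact S2|]|]; lia).
      assert (Kb' : code_at P o3 cb).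
      { replace o3 with (S (S (S (S (S o1)) + length cc))) by lia. exact Kb. }
      assert (Km' : code_at P (o3 + length cb) (mov5 t (S r))).
      { replace (o3 + length cb)%nat with (S (S (S (S (S o1)) + length cc)) + length cb)%nat by lia.
        exact Km. }
      destruct (HB (S r) (S (S r)) (3 + r) (4 + r) (5 + r) x1 x2 x3 x4 x5
        P o3 t m2 b am (na + 3 + z1 + z2) nb N Kb' Hg M3 Hx2)%nat as (m3 & R3 & E3 & S3).
      destruct (mov5_ok P (o3 + length cb) t (S r) m3 b am
        (na + 3 + z1 + z2 + cost (body' x1 x2 x3 x4 x5)) nb N
        (den (body' x1 x2 x3 x4 x5)) Km' Hg ltac:(lia) ltac:(lia) E3)%nat as (m4 & R4 & E4 & S4).
      assert (Lm : length (mov5 t (S r)) = 5%nat) by tauto. assert (Hv4 : m4 (r + RB)%nat = v).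
      { rewrite S4, S3, Sm2 by lia. exact Hv. }
      pose (m5 := upd (upd m4 (t + RB)%nat 1) (r + RB)%nat (v - 1)).
      assert (S5 : same rm m5 r).
      { intros j Hj. unfold m5. rewrite !upd_neq by lia. rewrite S4, S3, Sm2 by lia. reflexivity. }
      assert (Hs5 : res5 m5 (S r) (den (body' x1 x2 x3 x4 x5))).
      { unfold m5. revert E4. destruct (den (body' x1 x2 x3 x4 x5)) as [[[[y1 y2] y3] y4] y5].
        intros (Q1 & Q2 & Q3 & Q4 & Q5). repeat split; rewrite !upd_neq by lia; assumption. }
      destruct (IH (v - 1) m5 (den (body' x1 x2 x3 x4 x5))
        (na + 11 + z1 + z2 + cost (body' x1 x2 x3 x4 x5))%nat) as (m6 & R6 & E6 & S6).
      { rewrite nfl_ge in Hn by lra. now injection Hn. }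
      { apply upd_eq. }
      { eapply holds_same; [exact Hh|exact S5|lia]. }
      { exact Hs5. }
      exists m6. split; [|split].
      * apply F. eapply reach_trans; [exact R3|]. eapply reach_trans; [exact R4|].
        eapply reach_l; [|eapply reach_step; [exact K6|]]. { f_equal; lia. }
        eapply reach_step; [exact K7|]. cbn [exec].
        rewrite (Hg t), (Hg r) by lia. rewrite upd_eq, upd_neq, Hv4 by lia.
        eapply reach_jmp; [exact K8|].
        eapply reach_l; [|eapply reach_eq; [exact R6|]]; f_equal; lia.
      * exact E6.
      * eapply same_trans; [exact S5|exact S6|lia].
    + exists m2. split; [|split]; [|exact Hs2|eapply same_le; [exact Sm2|lia]].
      apply F. eapply reach_jmp; [exact K5|].
      eapply reach_l; [|apply reach_refl]. f_equal; lia.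
Qed.

(** The induction is on the relation and not on a program, because binders hold functions: in their
    cases the context is extended by the registers just written together with the values they
    received. *)
Lemma cprog_ok G p q : peq G p q -> prog_ok G p q.
Proof.
  induction 1 as [G a1 a2 a3 a4 a5 b1 b2 b3 b4 b5 A1 A2 A3 A4 A5
    |G a a' k k' A _ IHk|G p q k k' _ IHp _ IHk|G a b p q a' b' p' q' A B _ IHp _ IHq
    |G n a1 a2 a3 a4 a5 c1 c2 body n' b1 b2 b3 b4 b5 d1 d2 body' A0 A1 A2 A3 A4 A5 D1 D2 _ IHb];
    intros P o r rm b0 am na nb N Hc Hg Hm Hh; cbn [cprog mr] in Hc, Hm; cbn [den cost cprog].
  - eapply cexp5_ok; eassumption.
  - apply code_at_app in Hc as [Hc1 Hc]. apply code_at_app in Hc as [Hc2 Hc3].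
    destruct (cexp_ok _ _ _ A P _ r rm b0 am na nb N Hc1 Hg ltac:(lia) Hh) as (m1 & R1 & E1 & S1).
    assert (H1 : holds ((r, aden a') :: G) m1 (S r)).
    { apply holds_cons; [|exact E1|lia]. eapply holds_same; [exact Hh|exact S1|lia]. }
    destruct (IHk r (aden a') P _ (S r) m1 b0 am (na + asz a')%nat nb N Hc2 Hg ltac:(lia) H1)
      as (m2 & R2 & E2 & S2).
    destruct (mov5_ok _ _ _ _ m2 b0 am (na + asz a' + cost (k' (aden a')))%nat nb N _ Hc3 Hg
      ltac:(lia) ltac:(lia) E2) as (m3 & R3 & E3 & S3).
    exists m3. split; [|split].
    + eapply reach_trans; [exact R1|]. eapply reach_trans; [exact R2|].
      eapply reach_eq; [exact R3|]. rewrite !length_app. cbn [mov5 length]. f_equal; lia.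
    + exact E3.
    + intros j Hj. rewrite S3, S2, S1 by lia. reflexivity.
  - apply code_at_app in Hc as [Hc1 Hc]. apply code_at_app in Hc as [Hc2 Hc3].
    destruct (IHp P _ r rm b0 am na nb N Hc1 Hg ltac:(lia) Hh) as (m1 & R1 & E1 & S1).
    assert (H0 : holds G m1 r) by (eapply holds_same; [exact Hh|exact S1|lia]).
    pose proof (holds_ext5 _ _ _ _ H0 E1) as H1.
    destruct (den q) as [[[[x1 x2] x3] x4] x5].
    destruct (IHk _ _ _ _ _ x1 x2 x3 x4 x5 P _ _ m1 b0 am (na + cost q)%nat nb N Hc2 Hg ltac:(lia) H1)
      as (m2 & R2 & E2 & S2).
    destruct (mov5_ok _ _ _ _ m2 b0 am (na + cost q + cost (k' x1 x2 x3 x4 x5))%nat nb N _ Hc3 Hg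
      ltac:(lia) ltac:(lia) E2) as (m3 & R3 & E3 & S3).
    exists m3. split; [|split].
    + eapply reach_trans; [exact R1|]. eapply reach_trans; [exact R2|].
      eapply reach_eq; [exact R3|]. rewrite !length_app. cbn [mov5 length]. f_equal; lia.
    + exact E3.
    + intros j Hj. rewrite S3, S2, S1 by lia. reflexivity.
  - apply code_at_app in Hc as [Hc1 Hc]. apply code_at_app in Hc1 as [Hca Hcb].
    apply code_at_cons in Hc as [K1 Hc]. apply code_at_app in Hc as [Hcq Hc]. apply code_at_cons in Hc as [K2 Hcp]. destruct (cexp_ok _ _ _ A P _ r rm b0 am na nb N Hca Hg ltac:(lia) Hh) as (m1 & R1 & E1 & S1).
    assert (H1 : holds G m1 (S r)) by (eapply holds_same; [exact Hh|exact S1|lia]).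
    destruct (cexp_ok _ _ _ B P _ (S r) m1 b0 am (na + asz a')%nat nb N Hcb Hg ltac:(lia) H1)
      as (m2 & R2 & E2 & S2).
    assert (S02 : same rm m2 r) by (intros j Hj; rewrite S2, S1 by lia; reflexivity).
    assert (H2 : holds G m2 r) by (eapply holds_same; [exact Hh|exact S02|lia]).
    pose proof (amr_gt b (S r)) as Hmb.
    set (L := length (cexp a r ++ cexp b (S r))) in *.
    assert (EL : L = (length (cexp a r) + length (cexp b (S r)))%nat) by (unfold L; apply length_app).
    set (cq := cprog q (o + L + 1) r) in *.
    set (cp := cprog p (o + L + 1 + length cq + 1) r) in *.
    assert (F : forall s', reach P (MState (if Rle_dec (aden a') (aden b') then (o + L + 1 + length cq + 1)%nat
        else (o + L + 1)%nat) m2 b0 am (na + asz a' + asz b' + 1) nb) s' ->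
        reach P (MState o rm b0 am na nb) s').
    { intros s' HR. eapply reach_trans; [exact R1|]. eapply reach_trans; [exact R2|].
      eapply (reach_ile _ _ r (S r)); [|exact Hg|lia|lia|].
      { rewrite EL, Nat.add_assoc in K1. exact K1. }
      rewrite (S2 (r + RB)%nat), E1, E2 by lia.
      eapply reach_l; [|exact HR]. f_equal; [|lia].
      destruct (Rle_dec _ _); lia. }
    destruct (Rle_dec (aden a') (aden b')).
    + assert (Kp : code_at P (o + L + 1 + length cq + 1) cp).
      { replace (o + L + 1 + length cq + 1)%nat with (S (S (o + L) + length cq)) by lia.
        exact Hcp. }
      destruct (IHp P (o + L + 1 + length cq + 1)%nat r m2 b0 am (na + asz a' + asz b' + 1)%nat nb N
        Kp Hg ltac:(lia) H2) as (m3 & R3 & E3 & S3).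
      exists m3. split; [|split]; [|exact E3|eapply same_trans; [exact S02|exact S3|lia]].
      apply F. eapply reach_eq; [exact R3|]. fold cp. rewrite !length_app. cbn [length]. f_equal; lia.
    + assert (Kq : code_at P (o + L + 1) cq).
      { replace (o + L + 1)%nat with (S (o + L)) by lia. exact Hcq. }
      destruct (IHq P (o + L + 1)%nat r m2 b0 am (na + asz a' + asz b' + 1)%nat nb N
        Kq Hg ltac:(lia) H2) as (m3 & R3 & E3 & S3).
      exists m3. split; [|split]; [|exact E3|eapply same_trans; [exact S02|exact S3|lia]].
      apply F. eapply reach_trans; [exact R3|]. fold cq.
      eapply reach_l; [|eapply reach_eq; [eapply reach_jmp; [exact K2|apply reach_refl]|]].
      * f_equal; lia.
      * rewrite !length_app. cbn [length]. f_equal; lia.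
  - apply code_at_app in Hc as [Hi Hc]. apply code_at_app in Hi as [Hi1 Hi2].
    destruct (cexp_ok _ _ _ A0 P _ r rm b0 am na nb N Hi1 Hg ltac:(lia) Hh) as (m1 & R1 & E1 & S1).
    assert (H1 : holds G m1 (S r)) by (eapply holds_same; [exact Hh|exact S1|lia]).
    destruct (cexp5_ok _ _ _ _ _ _ _ _ _ _ _ P _ (S r) m1 b0 am (na + asz n')%nat nb N
      A1 A2 A3 A4 A5 Hi2 Hg ltac:(lia) H1) as (m2 & R2 & E2 & S2).
    assert (S02 : same rm m2 r) by (intros j Hj; rewrite S2, S1 by lia; reflexivity).
    assert (H2 : holds G m2 r) by (eapply holds_same; [exact Hh|exact S02|lia]).
    assert (Hv : m2 (r + RB)%nat = aden n') by (rewrite S2 by lia; exact E1).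
    set (ini := cexp n r ++ cexp5 a1 a2 a3 a4 a5 (S r)) in *.
    assert (Li : length ini = (length (cexp n r) + length (cexp5 a1 a2 a3 a4 a5 (S r)))%nat)
      by (unfold ini; apply length_app).
    set (cc := cexp (at5 c1 (S r)) (6 + r) ++ cexp (at5 c2 (S r)) (S (6 + r))) in *.
    set (cb := cprog (body (S r) (S (S r)) (3 + r) (4 + r) (5 + r))%nat
      (o + length ini + 3 + length cc + 2)%nat (6 + r)%nat) in *.
    rewrite !app_assoc in Hc. apply code_at_app in Hc as [Hl Hm5]. rewrite <- !app_assoc in Hl.
    destruct (loop_ok G c1 c2 body d1 d2 body' D1 D2 IHb P r b0 am nb N
      (o + length ini) (o + length ini + 3) (o + length ini + 3 + length cc + 2)
      (o + length ini + 3 + length cc + 2 + length cb + 8) eq_refl eq_refl eq_refl Hl Hg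
      ltac:(lia) ltac:(lia) ltac:(lia) ltac:(lia) (nfl (aden n')) (aden n') m2
      (aden b1, aden b2, aden b3, aden b4, aden b5)
      (na + asz n' + (asz b1 + asz b2 + asz b3 + asz b4 + asz b5)) eq_refl Hv H2 E2)%nat
      as (m3 & R3 & E3 & S3).
    assert (Km5 : code_at P (o + length ini + 3 + length cc + 2 + length cb + 8) (mov5 (S r) r)).
    { match type of Hm5 with code_at _ ?x _ => match goal with |- code_at _ ?y _ =>
        replace y with x; [exact Hm5|] end end.
      rewrite !length_app. cbn [length mov5]. lia. }
    match type of R3 with reach _ _ (MState _ _ _ _ ?u _) =>
      destruct (mov5_ok P _ (S r) r m3 b0 am u nb N _ Km5 Hg ltac:(lia) ltac:(lia) E3)
        as (m4 & R4 & E4 & S4) end.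
    exists m4. split; [|split].
    + eapply reach_trans; [exact R1|]. eapply reach_trans; [exact R2|].
      eapply reach_trans; [eapply reach_l; [|exact R3]; f_equal; lia|].
      eapply reach_eq; [exact R4|]. rewrite !length_app. cbn [length mov5].
      f_equal; lia.
    + exact E4.
    + intros j Hj. rewrite S4, S3, S02 by lia. reflexivity.
Qed.

Definition Out (out : list (R * R)) (rm : nat -> R) (am : nat -> nat) : Prop :=
  am 0%nat = length out /\ am 1%nat = (2 * length out)%nat /\
  forall i, (i < length out)%nat ->
    (rm (2 * i)%nat, rm (2 * i + 1)%nat) = nth i out (0, 0).

Lemma Out_output out rm am k b na nb :
  Out out rm am -> output (MState k rm b am na nb) = out.
Proof.
  intros (H0 & H1 & H2). unfold output. cbn [Defs.rm Defs.am]. apply nth_ext with (d := (0, 0)) (d' := (0, 0)).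
  { now rewrite length_map, length_seq. }
  intros n Hn. rewrite length_map, length_seq in Hn.
  rewrite <- H2 by lia.
  set (f := fun i => (rm (2 * i)%nat, rm (2 * i + 1)%nat)).
  rewrite (nth_indep _ (0, 0) (f 0%nat)) by (now rewrite length_map, length_seq).
  rewrite (map_nth f), seq_nth by lia. reflexivity.
Qed.

Lemma Out_same out rm rm' am r : Out out rm am -> same rm rm' r -> (2 * length out <= RB)%nat ->
  Out out rm' am.
Proof.
  intros (H0 & H1 & H2) S HL. repeat split; trivial. intros i Hi.
  rewrite !S by lia. now apply H2.
Qed.

Lemma good_upd am N k v : good am N -> (k < AB)%nat -> good (upd am k v) N.
Proof. intros Hg Hk i Hi. rewrite upd_neq by lia. now apply Hg. Qed.

Lemma emit_ok P o r rm b am na nb N s out :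
  code_at P o (emit_code o r) -> good am N -> (6 + r <= N)%nat -> res5 rm r s -> Out out rm am ->
  (2 * (length out + 1) <= RB)%nat ->
  exists rm' am' na' nb', reach P (MState o rm b am na nb) (MState (o + 8) rm' b am' na' nb') /\
    good am' N /\ (forall G, holds G rm r -> holds G rm' r) /\ Out (out ++ emits s) rm' am' /\
    (na' <= na + 4)%nat /\ (nb' <= nb + 3)%nat.
Proof.
  destruct s as [[[[f x] y] u] v]. intros Hc Hg HN (H1 & H2 & H3 & _) HO HL.
  pose proof HO as (O0 & O1 & O2).
  apply code_at_cons in Hc as [K1 Hc]. apply code_at_cons in Hc as [K2 Hc].
  apply code_at_cons in Hc as [K3 Hc]. apply code_at_cons in Hc as [K4 Hc].
  apply code_at_cons in Hc as [K5 Hc]. apply code_at_cons in Hc as [K6 Hc].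
  apply code_at_cons in Hc as [K7 Hc]. apply code_at_cons in Hc as [K8 _].
  pose (m := upd rm (5 + r + RB)%nat 1).
  assert (Sm : same rm m (5 + r)) by (apply same_upd; lia).
  assert (F : forall s', reach P (MState (if Rle_dec 1 f then o + 3 else S (S o))%nat m b am (na + 2) nb) s' ->
    reach P (MState o rm b am na nb) s').
  { intros s' HR. eapply reach_step; [exact K1|]. cbn [exec]. rewrite (Hg (5 + r)%nat) by lia.
    eapply (reach_ile _ _ (5 + r) r); [exact K2|exact Hg|lia|lia|]. fold m.
    rewrite (Sm (r + RB)%nat), H1 by lia. replace (m (5 + r + RB)%nat) with 1 by (symmetry; apply upd_eq).
    eapply reach_l; [|exact HR]. f_equal; lia. }
  unfold emits. destruct (Rle_dec 1 f) as [Hf|Hf].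
  - set (k := (2 * length out)%nat) in *.
    pose (m1 := upd m k x). pose (m2 := upd m1 (S k) y).
    pose (a1 := upd am 1%nat (S k)). pose (a2 := upd a1 1%nat (S (S k))).
    pose (a3 := upd a2 0%nat (S (length out))).
    assert (G1 : good a1 N) by (apply good_upd; [exact Hg|unfold AB; lia]).
    assert (G3 : good a3 N) by (repeat apply good_upd; trivial; unfold AB; lia).
    exists m2, a3, (na + 4)%nat, (nb + 3)%nat. split; [|split; [exact G3|split; [|split; [|lia]]]].
    + apply F. replace (o + 3)%nat with (S (S (S o))) by lia.
      eapply reach_step; [exact K4|]. cbn [exec].
      rewrite (Hg (S r)), (Sm (S r + RB)%nat), H2, O1 by lia. fold m1.
      eapply reach_step; [exact K5|]. cbn [exec]. rewrite O1. fold a1.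
      eapply reach_step; [exact K6|]. cbn [exec].
      rewrite (G1 (S (S r))) by lia.
      replace (m1 (S (S r) + RB)%nat) with y by (unfold m1; rewrite upd_neq, Sm by lia; now symmetry).
      eapply reach_step; [exact K7|]. cbn [exec].
      replace (a1 1%nat) with (S k) by tauto. fold m2 a2.
      eapply reach_step; [exact K8|]. cbn [exec].
      replace (a2 0%nat) with (length out) by (unfold a2, a1; now rewrite !upd_neq).
      eapply reach_eq; [apply reach_refl|]. f_equal; lia.
    + intros G HG n z Hin. destruct (HG n z Hin) as [E1 E2]. split; [|exact E2].
      unfold m2, m1. rewrite !upd_neq, Sm by lia. exact E1.
    + unfold Out. rewrite length_app. cbn [length]. split; [unfold a3; rewrite upd_eq; lia|].
      split; [unfold a3, a2; rewrite upd_neq, upd_eq; lia|].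
      intros i Hi. unfold m2, m1. destruct (Nat.eq_dec i (length out)) as [->|Hne].
      * rewrite app_nth2, Nat.sub_diag by lia. fold k. replace (k + 1)%nat with (S k) by lia.
        rewrite upd_eq, upd_neq, upd_eq by lia. reflexivity.
      * rewrite app_nth1 by lia. rewrite !upd_neq, !Sm by lia. apply O2. lia.
  - exists m, am, (na + 3)%nat, nb. rewrite app_nil_r.
    split; [|split; [exact Hg|split; [|split; [|lia]]]].
    + apply F. eapply reach_jmp; [exact K3|]. eapply reach_eq; [apply reach_refl|]. f_equal; lia.
    + intros G HG. eapply holds_same; [exact HG|eapply same_le; [exact Sm|lia]|lia].
    + eapply Out_same; [exact HO|exact Sm|lia].
Qed.

(** The bound by [RB] keeps the output clear of the program variables, which later programs of the
    list still read. *)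
Lemma lcomp_ok G l l' : Forall2 (peq G) l l' -> forall P o r rm b am na nb N out,
  code_at P o (lcomp l o r) -> good am N -> (lmr l r <= N)%nat -> holds G rm r ->
  Out out rm am -> (2 * (length out + length l') <= RB)%nat ->
  exists rm' am' na' nb', reach P (MState o rm b am na nb)
      (MState (o + length (lcomp l o r)) rm' b am' na' nb')
    /\ Out (out ++ flat_map (fun q => emits (den q)) l') rm' am'
    /\ (na' <= na + list_sum (map (fun q => cost q + 4) l'))%nat /\ (nb' <= nb + 3 * length l')%nat.
Proof.
  induction 1 as [|p q l l' Hp _ IH]; intros P o r rm b am na nb N out Hc Hg Hm Hh HO HR;
    cbn [lcomp lmr flat_map map] in *.
  - exists rm, am, na, nb. rewrite app_nil_r. split; [|split; [exact HO|simpl; lia]].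
    eapply reach_eq; [apply reach_refl|]. simpl. f_equal; lia.
  - apply code_at_app in Hc as [Hc1 Hc]. apply code_at_app in Hc as [Hc2 Hc3].
    destruct (cprog_ok _ _ _ Hp P _ r rm b am na nb N Hc1 Hg ltac:(lia) Hh) as (m1 & R1 & E1 & S1).
    assert (Q : (length (emits (den q)) <= 1)%nat).
    { unfold emits. destruct (den q) as [[[[f x] y] u] v]. destruct (Rle_dec 1 f); simpl; lia. }
    cbn [length] in HR.
    destruct (emit_ok P _ r m1 b am (na + cost q) nb N (den q) out Hc2 Hg ltac:(lia) E1)%nat
      as (m2 & a2 & n2 & b2 & R2 & G2 & H2 & O2 & N2 & B2).
    { eapply Out_same; [exact HO|exact S1|lia]. } { lia. }
    destruct (IH P (o + length (cprog p o r) + 8) r m2 b a2 n2 b2 N (out ++ emits (den q)) Hc3 G2 ltac:(lia))%nat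
      as (m3 & a3 & n3 & b3 & R3 & O3 & N3 & B3).
    { apply H2. eapply holds_same; [exact Hh|exact S1|lia]. } { exact O2. }
    { rewrite length_app. lia. }
    exists m3, a3, n3, b3. split; [|split; [now rewrite app_assoc|simpl; lia]].
    eapply reach_trans; [exact R1|]. eapply reach_trans; [exact R2|]. eapply reach_eq; [exact R3|].
    rewrite !length_app. cbn [length emit_code]. f_equal; lia.
Qed.

(** * Initialising addresses and loading the input *)

Definition addr_code (N : nat) : program :=
  repeat (IAInc AB) RB ++
  flat_map (fun i => [IACopy (S i + AB) (i + AB); IAInc (S i + AB)]) (seq 0 N).

(** The input occupies the registers where the output will go, so it is moved away. Address register
    2 is the read pointer and is returned to 0, ready to run through the bits. *)
Definition copy_code : program :=
  flat_map (fun i => [IMove (i + AB) 2; IAInc 2]) (seq 0 5) ++ repeat (IADec 2) 5.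

Definition bitstep (k o : nat) : program :=
  [IBJump 2 (o + 2); IJmp (o + 3); IArith RAdd (5 + k + AB) (5 + k + AB) (12 + AB); IAInc 2]%nat.

(** Conversion from binary to real: register 12 holds the power of 2 of the current bit and is added
    to every exponent whose bit is set, register 11 counts the bits, register 13 is the constant 1.
    Only here does the number of bit operations depend on the degree. Address register 0 ends at 0,
    as required of the output counter. *)
Definition bitloop (o : nat) : program :=
  (IAJz 0 (o + 29) ::
   flat_map (fun k => bitstep k (o + 1 + 4 * k)) (seq 0 6) ++
   [IArith RAdd (12 + AB) (12 + AB) (12 + AB); IArith RAdd (11 + AB) (11 + AB) (13 + AB);
    IADec 0; IJmp o])%nat.

Definition setup (N : nat) : program :=
  let a := addr_code N ++ copy_code ++ [IConst true (12 + AB)%nat; IConst true (13 + AB)%nat] in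
  a ++ bitloop (length a).

Lemma repeat_inc P o x n r b am na nb :
  code_at P o (repeat (IAInc x) n) ->
  exists am', reach P (MState o r b am na nb) (MState (o + n) r b am' na (nb + n)) /\
    am' x = (am x + n)%nat /\ forall j, j <> x -> am' j = am j.
Proof.
  revert o am nb. induction n as [|n IH]; intros o am nb Hc; cbn [repeat] in Hc.
  - exists am. rewrite !Nat.add_0_r. split; [apply reach_refl|auto].
  - apply code_at_cons in Hc as [K Hc]. destruct (IH _ (upd am x (S (am x))) (S nb) Hc) as (a & R1 & E1 & F1).
    exists a. split; [|split].
    + eapply reach_step; [exact K|]. eapply reach_eq; [exact R1|]. f_equal; lia.
    + rewrite E1, upd_eq. lia.
    + intros j Hj. rewrite F1, upd_neq by lia. reflexivity.
Qed.

Lemma repeat_dec P o x n r b am na nb :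
  code_at P o (repeat (IADec x) n) ->
  exists am', reach P (MState o r b am na nb) (MState (o + n) r b am' na (nb + n)) /\
    am' x = (am x - n)%nat /\ forall j, j <> x -> am' j = am j.
Proof.
  revert o am nb. induction n as [|n IH]; intros o am nb Hc; cbn [repeat] in Hc.
  - exists am. rewrite !Nat.add_0_r. split; [apply reach_refl|split; [lia|auto]].
  - apply code_at_cons in Hc as [K Hc].
    destruct (IH _ (upd am x (Nat.pred (am x))) (S nb) Hc) as (a & R1 & E1 & F1).
    exists a. split; [|split].
    + eapply reach_step; [exact K|]. eapply reach_eq; [exact R1|]. f_equal; lia.
    + rewrite E1, upd_eq. lia.
    + intros j Hj. rewrite F1, upd_neq by lia. reflexivity.
Qed.

Lemma addr_ok P o N r b am na nb :
  code_at P o (addr_code N) -> am AB = 0%nat ->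
  exists am', reach P (MState o r b am na nb)
      (MState (o + length (addr_code N)) r b am' na (nb + RB + 2 * N)) /\
    good am' (S N) /\ forall j, (j < AB)%nat -> am' j = am j.
Proof.
  unfold addr_code. intros Hc H0. apply code_at_app in Hc as [Hc1 Hc2].
  destruct (repeat_inc _ _ _ _ r b am na nb Hc1) as (a1 & R1 & E1 & F1).
  enough (W : forall n, (n <= N)%nat -> exists am', reach P (MState (o + RB) r b a1 na (nb + RB))
      (MState (o + RB + 2 * n) r b am' na (nb + RB + 2 * n)) /\
    good am' (S n) /\ forall j, (j < AB)%nat -> am' j = am j).
  { destruct (W N (le_n N)) as (a2 & R2 & G2 & F2). exists a2.
    split; [|split; assumption]. eapply reach_trans; [exact R1|].
    eapply reach_eq; [exact R2|].
    rewrite length_app, repeat_length, (flat_map_constant_length (c := 2)) by tauto.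
    rewrite length_seq. f_equal; lia. }
  assert (A : forall n, (n < N)%nat -> nth_error P (o + RB + 2 * n) = Some (IACopy (S n + AB)%nat (n + AB)%nat)
      /\ nth_error P (S (o + RB + 2 * n)) = Some (IAInc (S n + AB)%nat)).
  { intros n Hn. replace N with (n + S (N - n - 1))%nat in Hc2 by lia.
    rewrite seq_app, flat_map_app in Hc2. apply code_at_app in Hc2 as [_ Hc2].
    rewrite (flat_map_constant_length (c := 2)) in Hc2 by tauto.
    rewrite length_seq, Nat.mul_comm in Hc2. apply code_at_cons in Hc2 as [K1 Hc2]. apply code_at_cons in Hc2 as [K2 _]. now split. }
  induction n as [|n IH]; intros Hn.
  - exists a1. split; [|split].
    + eapply reach_eq; [apply reach_refl|]. f_equal; lia.
    + intros i Hi. replace i with 0%nat by lia. rewrite Nat.add_0_l, E1, H0. lia.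
    + intros j Hj. apply F1. lia.
  - destruct (IH ltac:(lia)) as (a2 & R2 & G2 & F2). destruct (A n ltac:(lia)) as [K1 K2].
    set (a3 := upd a2 (S n + AB)%nat (a2 (n + AB)%nat)).
    exists (upd a3 (S n + AB)%nat (S (a3 (S n + AB)%nat))). split; [|split].
    + eapply reach_trans; [exact R2|]. eapply reach_step; [exact K1|]. eapply reach_step; [exact K2|]. cbn [exec]. eapply reach_eq; [apply reach_refl|].
      f_equal; lia.
    + intros i Hi. destruct (Nat.eq_dec i (S n)) as [->|Hne].
      * rewrite upd_eq. unfold a3. rewrite upd_eq, G2 by lia. lia.
      * rewrite upd_neq by lia. unfold a3. rewrite upd_neq by lia. apply G2. lia.
    + intros j Hj. rewrite upd_neq by lia. unfold a3. rewrite upd_neq by lia. now apply F2.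
Qed.

Lemma copy_ok P o r b am na nb N :
  code_at P o copy_code -> good am N -> (5 <= N)%nat -> am 2%nat = 0%nat ->
  exists r' am', reach P (MState o r b am na nb) (MState (o + 15) r' b am' (na + 5) (nb + 10)) /\
    good am' N /\ (forall j, (j < AB)%nat -> am' j = am j) /\
    (forall i, (i < 5)%nat -> r' (i + RB)%nat = r i) /\
    (forall j, (5 + RB <= j)%nat -> r' j = r j).
Proof.
  intros Hc Hg HN H0. apply code_at_app in Hc as [Hc1 Hc2].
  assert (A : forall n, (n < 5)%nat -> nth_error P (o + 2 * n) = Some (IMove (n + AB)%nat 2)
      /\ nth_error P (S (o + 2 * n)) = Some (IAInc 2)).
  { intros n Hn. replace 5%nat with (n + S (5 - n - 1))%nat in Hc1 by lia.
    rewrite seq_app, flat_map_app in Hc1. apply code_at_app in Hc1 as [_ Hc1].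
    rewrite (flat_map_constant_length (c := 2)) in Hc1 by tauto.
    rewrite length_seq, Nat.mul_comm in Hc1. apply code_at_cons in Hc1 as [K1 Hc1]. apply code_at_cons in Hc1 as [K2 _]. now split. }
  assert (W : forall n, (n <= 5)%nat -> exists r' am', reach P (MState o r b am na nb)
      (MState (o + 2 * n) r' b am' (na + n) (nb + n)) /\
    good am' N /\ am' 2%nat = n /\ (forall j, (j < 2)%nat -> am' j = am j) /\
    (forall i, (i < n)%nat -> r' (i + RB)%nat = r i) /\
    (forall j, (j < RB)%nat \/ (n + RB <= j)%nat -> r' j = r j)).
  { induction n as [|n IH]; intros Hn.
    - exists r, am. split; [|repeat split; auto; lia]. eapply reach_eq; [apply reach_refl|]. f_equal; lia.
    - destruct (IH ltac:(lia)) as (r1 & a1 & R1 & G1 & E1 & F1 & V1 & W1).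
      destruct (A n ltac:(lia)) as [K1 K2].
      exists (upd r1 (n + RB)%nat (r n)), (upd a1 2%nat (S n)). split; [|split; [|split; [|split; [|split]]]].
      + eapply reach_trans; [exact R1|]. eapply reach_step; [exact K1|]. cbn [exec].
        rewrite (G1 n), E1, (W1 n) by (unfold RB; lia).
        eapply reach_step; [exact K2|]. cbn [exec]. rewrite E1.
        eapply reach_eq; [apply reach_refl|]. f_equal; lia.
      + apply good_upd; [exact G1|unfold AB; lia].
      + apply upd_eq.
      + intros j Hj. rewrite upd_neq by lia. now apply F1.
      + intros i Hi. destruct (Nat.eq_dec i n) as [->|Hne]; [apply upd_eq|].
        rewrite upd_neq by lia. apply V1. lia.
      + intros j Hj. rewrite upd_neq by lia. apply W1. lia. }
  destruct (W 5%nat (le_n 5)) as (r1 & a1 & R1 & G1 & E1 & F1 & V1 & W1).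
  assert (Hc2' : code_at P (o + 2 * 5) (repeat (IADec 2) 5)) by exact Hc2.
  destruct (repeat_dec _ _ _ _ r1 b a1 (na + 5)%nat (nb + 5)%nat Hc2') as (a2 & R2 & E2 & F2).
  exists r1, a2. split; [|split; [|split; [|split]]].
  - eapply reach_trans; [exact R1|]. eapply reach_eq; [exact R2|]. f_equal; lia.
  - intros i Hi. rewrite F2 by (unfold AB; lia). now apply G1.
  - intros j Hj. unfold AB in Hj. destruct (Nat.eq_dec j 2) as [->|Hne]; [lia|].
    rewrite F2, F1 by lia. reflexivity.
  - exact V1.
  - intros j Hj. apply W1. lia.
Qed.

Lemma bitstep_ok P o k r b am na nb N :
  code_at P o (bitstep k o) -> good am N -> (13 <= N)%nat -> (k < 6)%nat ->
  exists r' am' na' nb', reach P (MState o r b am na nb) (MState (o + 4) r' b am' na' nb') /\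
    (na' <= na + 1)%nat /\ (nb' <= nb + 3)%nat /\
    good am' N /\ am' 2%nat = S (am 2%nat) /\ (forall j, (j < 2)%nat -> am' j = am j) /\
    r' (5 + k + RB)%nat = r (5 + k + RB)%nat + (if b (am 2%nat) then r (12 + RB)%nat else 0) /\
    (forall j, j <> (5 + k + RB)%nat -> r' j = r j).
Proof.
  intros Hc Hg HN Hk. apply code_at_cons in Hc as [K1 Hc]. apply code_at_cons in Hc as [K2 Hc].
  apply code_at_cons in Hc as [K3 Hc]. apply code_at_cons in Hc as [K4 _].
  assert (Hg' : good (upd am 2%nat (S (am 2%nat))) N) by (apply good_upd; [exact Hg|unfold AB; lia]).
  destruct (b (am 2%nat)) eqn:Eb.
  - exists (upd r (5 + k + RB)%nat (r (5 + k + RB)%nat + r (12 + RB)%nat)),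
      (upd am 2%nat (S (am 2%nat))), (S na), (S (S nb)).
    split; [|repeat split; try lia].
    + eapply reach_step; [exact K1|]. cbn [exec]. rewrite Eb.
      eapply reach_l; [|eapply reach_step; [exact K3|]]. { f_equal; lia. }
      cbn [exec eval_rop]. rewrite (Hg (5 + k)%nat), (Hg 12%nat) by lia.
      eapply reach_step; [exact K4|]. cbn [exec]. eapply reach_eq; [apply reach_refl|]. f_equal; lia.
    + exact Hg'.
    + intros j Hj. now rewrite upd_neq by lia.
    + apply upd_eq.
    + intros j Hj. now rewrite upd_neq.
  - exists r, (upd am 2%nat (S (am 2%nat))), na, (3 + nb)%nat.
    split; [|repeat split; try lia].
    + eapply reach_step; [exact K1|]. cbn [exec]. rewrite Eb.
      eapply reach_step; [exact K2|]. cbn [exec].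
      eapply reach_l; [|eapply reach_step; [exact K4|]]. { f_equal; lia. }
      cbn [exec]. eapply reach_eq; [apply reach_refl|]. f_equal; lia.
    + exact Hg'.
    + intros j Hj. now rewrite upd_neq by lia.
    + lra.
Qed.

Lemma mod_pow2_S a j :
  (a mod 2 ^ S j = a mod 2 ^ j + 2 ^ j * Nat.b2n (Nat.testbit a j))%nat.
Proof.
  rewrite Nat.testbit_spec'. rewrite Nat.pow_succ_r', (Nat.mul_comm 2).
  rewrite Nat.Div0.mod_mul_r. reflexivity.
Qed.

(** Before bit [j] is read, the registers hold the exponents modulo [2 ^ j]. *)
Lemma bitloop_ok P o N X b :
  code_at P o (bitloop o) -> (14 <= N)%nat ->
  (forall n, b n = Nat.testbit (X (n mod 6)) (n / 6))%nat ->
  forall Lb j r am na nb,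
  good am N -> am 0%nat = Lb -> am 1%nat = 0%nat -> am 2%nat = (6 * j)%nat ->
  (forall k, (k < 6)%nat -> r (5 + k + RB)%nat = INR (X k mod 2 ^ j)) ->
  r (11 + RB)%nat = INR j -> r (12 + RB)%nat = 2 ^ j -> r (13 + RB)%nat = 1 ->
  exists r' am' na' nb', reach P (MState o r b am na nb) (MState (o + 29) r' b am' na' nb') /\
    (na' <= na + 8 * Lb)%nat /\ (nb' <= nb + 21 * Lb + 1)%nat /\
    good am' N /\ am' 0%nat = 0%nat /\ am' 1%nat = 0%nat /\
    (forall k, (k < 6)%nat -> r' (5 + k + RB)%nat = INR (X k mod 2 ^ (j + Lb))) /\
    r' (11 + RB)%nat = INR (j + Lb) /\ r' (12 + RB)%nat = 2 ^ (j + Lb) /\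
    (forall i, (i < 5)%nat -> r' (i + RB)%nat = r (i + RB)%nat).
Proof.
  intros Hc HN Hb. apply code_at_cons in Hc as [K0 Hc].
  apply code_at_app in Hc as [Hs Hc].
  assert (Ls : length (flat_map (fun k => bitstep k (o + 1 + 4 * k)) (seq 0 6)) = 24%nat) by tauto.
  apply code_at_cons in Hc as [K1 Hc]. apply code_at_cons in Hc as [K2 Hc].
  apply code_at_cons in Hc as [K3 Hc]. apply code_at_cons in Hc as [K4 _].
  assert (A : forall n, (n < 6)%nat -> code_at P (o + 1 + 4 * n) (bitstep n (o + 1 + 4 * n))).
  { intros n Hn. replace 6%nat with (n + S (6 - n - 1))%nat in Hs by lia.
    rewrite seq_app, flat_map_app in Hs. apply code_at_app in Hs as [_ Hs].
    rewrite (flat_map_constant_length (c := 4)) in Hs by tauto.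
    rewrite length_seq, Nat.mul_comm in Hs. apply code_at_app in Hs as [Hs _]. replace (o + 1 + 4 * n)%nat with (S o + 4 * n)%nat at 1 by lia. exact Hs. }
  induction Lb as [|Lb IH]; intros j r am na nb Hg H0 H1 H2 Hk HL HT HO.
  - exists r, am, na, (S nb). split.
    { eapply reach_step; [exact K0|]. cbn [exec]. rewrite H0. apply reach_refl. }
    rewrite (Nat.add_0_r j). repeat split; auto; lia.
  - assert (W : forall n, (n <= 6)%nat -> exists r' am' na' nb',
      reach P (MState o r b am na nb) (MState (o + 1 + 4 * n) r' b am' na' nb') /\
      (na' <= na + n)%nat /\ (nb' <= nb + 3 * n + 1)%nat /\
      good am' N /\ am' 0%nat = S Lb /\ am' 1%nat = 0%nat /\ am' 2%nat = (6 * j + n)%nat /\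
      (forall k, (k < n)%nat -> r' (5 + k + RB)%nat = INR (X k mod 2 ^ S j)) /\
      (forall k, (n <= k < 6)%nat -> r' (5 + k + RB)%nat = INR (X k mod 2 ^ j)) /\
      (forall i, (i < 5)%nat \/ (11 <= i)%nat -> r' (i + RB)%nat = r (i + RB)%nat)).
    { induction n as [|n IHn]; intros Hn.
      - exists r, am, na, (S nb). split.
        { eapply reach_step; [exact K0|]. cbn [exec]. rewrite H0. cbn [Nat.eqb].
          eapply reach_eq; [apply reach_refl|]. f_equal; lia. }
        repeat split; auto; try lia. intros k Hk'. apply Hk. lia.
      - destruct (IHn ltac:(lia)) as (r1 & a1 & n1 & b1 & R1 & B1 & B2 & G1 & E0 & E1 & E2 & V1 & V2 & V3).
        destruct (bitstep_ok P _ n r1 b a1 n1 b1 N (A n ltac:(lia)) G1 ltac:(lia) ltac:(lia))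
          as (r2 & a2 & n2 & b2 & R2 & C1 & C2 & G2 & F2 & F3 & F4 & F5).
        exists r2, a2, n2, b2. split.
        { eapply reach_trans; [exact R1|]. eapply reach_eq; [exact R2|]. f_equal; lia. }
        split; [lia|]. split; [lia|]. split; [exact G2|].
        split; [rewrite F3 by lia; exact E0|]. split; [rewrite F3 by lia; exact E1|].
        split; [lia|]. split; [|split].
        + intros k Hk'. destruct (Nat.eq_dec k n) as [->|Hne].
          * rewrite F4, V2 by lia. rewrite (V3 12%nat) by lia. rewrite HT, E2, Hb.
            replace ((6 * j + n) mod 6)%nat with n
              by (apply (Nat.mod_unique _ _ j); lia).
            replace ((6 * j + n) / 6)%nat with j
              by (apply (Nat.div_unique _ _ _ n); lia).
            rewrite mod_pow2_S, plus_INR, mult_INR, pow_INR.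
            replace (INR 2) with 2 by tauto.
            destruct (Nat.testbit (X n) j); simpl (INR (Nat.b2n _)); lra.
          * rewrite F5 by lia. apply V1. lia.
        + intros k Hk'. rewrite F5 by lia. apply V2. lia.
        + intros i Hi. rewrite F5 by lia. now apply V3. }
    destruct (W 6%nat (le_n 6)) as (r1 & a1 & n1 & b1 & R1 & B1 & B2 & G1 & E0 & E1 & E2 & V1 & V2 & V3).
    set (r2 := upd r1 (12 + RB)%nat (r1 (12 + RB)%nat + r1 (12 + RB)%nat)).
    set (r3 := upd r2 (11 + RB)%nat (r2 (11 + RB)%nat + r2 (13 + RB)%nat)).
    set (a2 := upd a1 0%nat (Nat.pred (a1 0%nat))).
    destruct (IH (S j) r3 a2 (n1 + 2)%nat (b1 + 2)%nat)
      as (r4 & a4 & n4 & b4 & R4 & C1 & C2 & G4 & D0 & D1 & U1 & U2 & U3 & U4).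
    + apply good_upd; [exact G1|unfold AB; lia].
    + unfold a2. rewrite upd_eq. lia.
    + exact E1.
    + unfold a2. rewrite upd_neq by lia. lia.
    + intros k Hk'. unfold r3, r2. rewrite !upd_neq by lia. now apply V1.
    + unfold r3. rewrite upd_eq. unfold r2. rewrite !upd_neq by lia.
      rewrite (V3 11%nat), (V3 13%nat), HL, HO, S_INR by lia. reflexivity.
    + unfold r3. rewrite upd_neq by lia. unfold r2. rewrite upd_eq, (V3 12%nat), HT by lia. simpl; lra.
    + unfold r3, r2. rewrite !upd_neq, (V3 13%nat) by lia. exact HO.
    + exists r4, a4, n4, b4. split.
      { eapply reach_trans; [exact R1|].
        eapply reach_l; [|eapply reach_step; [exact K1|]]. { f_equal; lia. }
        cbn [exec eval_rop]. rewrite (G1 12%nat) by lia. eapply reach_step; [exact K2|]. cbn [exec eval_rop].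
        rewrite (G1 11%nat), (G1 13%nat) by lia. eapply reach_step; [exact K3|]. eapply reach_step; [exact K4|]. cbn [exec].
        eapply reach_l; [|exact R4]. f_equal; lia. }
      rewrite <- (Nat.add_succ_comm j Lb). repeat split; auto; try lia.
      intros i Hi. rewrite U4 by lia. unfold r3, r2. rewrite !upd_neq by lia. apply V3. lia.
Qed.

(** Besides the input, the conversion leaves the number of bits and the power of 2 above all
    exponents in registers 11 and 12. *)
Definition start_ctx (c : nat -> R) (ea eb : nat -> nat) (Rb e : R) : ctx :=
  let L := S (Nat.log2 (tdeg ea eb)) in
  combine (seq 0 13)
    [c 0%nat; c 1%nat; c 2%nat; Rb; e; INR (ea 0%nat); INR (eb 0%nat); INR (ea 1%nat);
     INR (eb 1%nat); INR (ea 2%nat); INR (eb 2%nat); INR L; 2 ^ L].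

Lemma exps_small ea eb k :
  (exps ea eb k < 2 ^ S (Nat.log2 (tdeg ea eb)))%nat.
Proof.
  assert (H : (exps ea eb k <= tdeg ea eb)%nat).
  { unfold tdeg. destruct k as [|[|[|[|[|k]]]]]; simpl; lia. }
  destruct (Nat.eq_dec (tdeg ea eb) 0) as [E|E].
  - rewrite E in *. simpl. lia.
  - pose proof (Nat.log2_spec (tdeg ea eb) ltac:(lia)). lia.
Qed.

Lemma setup_ok P N c ea eb Rb e :
  (14 <= N)%nat -> code_at P 0 (setup N) ->
  let L := S (Nat.log2 (tdeg ea eb)) in
  exists r am na nb, reach P (init_state c ea eb Rb e)
      (MState (length (setup N)) r
         (fun n => Nat.testbit (exps ea eb (Nat.modulo n 6)) (Nat.div n 6)) am na nb) /\
    (na <= 8 * L + 7)%nat /\ (nb <= 21 * L + 2 * N + 75)%nat /\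
    good am N /\ am 0%nat = 0%nat /\ am 1%nat = 0%nat /\
    holds (start_ctx c ea eb Rb e) r 13.
Proof.
  intros HN Hc L. unfold setup in Hc. set (ac := addr_code N) in *.
  rewrite <- !app_assoc in Hc. apply code_at_app in Hc as [Ha Hc].
  apply code_at_app in Hc as [Hcp Hc]. apply code_at_cons in Hc as [K1 Hc].
  apply code_at_cons in Hc as [K2 Hl]. unfold init_state. set (bb := fun n => Nat.testbit (exps ea eb (Nat.modulo n 6)) (Nat.div n 6)) in *.
  match goal with |- context [MState 0 ?r ?b ?a 0 0] => set (r0 := r); set (a0 := a) end.
  destruct (addr_ok P 0 N r0 bb a0 0 0 Ha eq_refl)%nat as (a1 & R1 & G1 & F1). assert (G1' : good a1 N) by (intros i Hi; apply G1; lia).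
  assert (C1 : length copy_code = 15%nat) by tauto.
  destruct (copy_ok P _ r0 bb a1 0 (0 + RB + 2 * N) N Hcp G1' ltac:(lia))%nat
    as (r2 & a2 & R2 & G2 & F2 & V2 & W2).
  { rewrite F1 by (unfold AB; lia). reflexivity. }
  set (r3 := upd r2 (12 + RB)%nat 1).
  set (r4 := upd r3 (13 + RB)%nat 1).
  match type of Hl with code_at _ _ (bitloop ?x) =>
    assert (EL : x = (0 + length ac + 15 + 2)%nat)
      by (rewrite !length_app; cbn [length]; rewrite C1; lia); rewrite EL in Hl end.
  assert (Hl' : code_at P (0 + length ac + 15 + 2) (bitloop (0 + length ac + 15 + 2))).
  { replace (0 + length ac + 15 + 2)%nat with (S (S (0 + length ac + 15))) at 1 by lia. exact Hl. }
  destruct (bitloop_ok P _ N (exps ea eb) bb Hl' HN) with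
    (Lb := L) (j := 0%nat) (r := r4) (am := a2) (na := (0 + 5 + 2)%nat)
    (nb := (0 + RB + 2 * N + 10)%nat)
    as (r5 & a5 & n5 & b5 & R5 & B1 & B2 & G5 & E0 & E1 & U1 & U2 & U3 & U4).
  { reflexivity. }
  { exact G2. }
  { rewrite F2, F1 by (unfold AB; lia). reflexivity. }
  { rewrite F2, F1 by (unfold AB; lia). reflexivity. }
  { rewrite F2, F1 by (unfold AB; lia). reflexivity. }
  { intros k Hk. unfold r4, r3. rewrite !upd_neq, W2 by lia.
    reflexivity. }
  { unfold r4, r3. rewrite !upd_neq, W2 by lia. reflexivity. }
  { tauto. }
  { apply upd_eq. }
  exists r5, a5, n5, b5. split.
  { eapply reach_trans; [exact R1|]. eapply reach_trans; [exact R2|].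
    eapply reach_l; [|eapply reach_step; [exact K1|]]. { f_equal; lia. }
    cbn [exec]. rewrite (G2 12%nat) by lia. eapply reach_step; [exact K2|]. cbn [exec]. rewrite (G2 13%nat) by lia. eapply reach_l; [|eapply reach_eq; [exact R5|]].
    - f_equal; lia.
    - f_equal. unfold setup. fold ac. rewrite !length_app, C1. cbn [length].
      change (length (bitloop (length ac + (15 + 2)))) with 29%nat. lia. }
  split; [lia|]. split; [unfold RB in *; lia|]. split; [exact G5|]. split; [exact E0|].
  split; [exact E1|].
  assert (V : forall i, (i < 5)%nat -> r5 (i + RB)%nat = r0 i).
  { intros i Hi. rewrite U4 by lia. unfold r4, r3. rewrite !upd_neq by lia. now apply V2. }
  assert (X : forall k, (k < 6)%nat -> r5 (5 + k + RB)%nat = INR (exps ea eb k)).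
  { intros k Hk. rewrite U1 by lia. rewrite Nat.add_0_l, Nat.mod_small; [reflexivity|].
    apply exps_small. }
  intros n x Hin. repeat (destruct Hin as [Hin|Hin]; [injection Hin as <- <-; split; [|lia]|]); [..|destruct Hin].
  - exact (V 0%nat ltac:(lia)).
  - exact (V 1%nat ltac:(lia)).
  - exact (V 2%nat ltac:(lia)).
  - exact (V 3%nat ltac:(lia)).
  - exact (V 4%nat ltac:(lia)).
  - exact (X 0%nat ltac:(lia)).
  - exact (X 1%nat ltac:(lia)).
  - exact (X 2%nat ltac:(lia)).
  - exact (X 3%nat ltac:(lia)).
  - exact (X 4%nat ltac:(lia)).
  - exact (X 5%nat ltac:(lia)).
  - exact U2.
  - exact U3.
Qed.

(** The five results of the initial program stay in registers 13 to 17, where every program of the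
    list reads them; each of these starts afresh at register 18. *)
Definition program_of (i : prog nat) (l : list (prog nat)) : program :=
  let N := Nat.max 18 (Nat.max (mr i 13) (lmr l 18)) in
  let o := length (setup N) in
  setup N ++ cprog i o 13 ++ lcomp l (o + length (cprog i o 13)) 18.

Lemma program_of_ok i i' l l' z1 z2 z3 z4 z5 c ea eb Rb e :
  peq (start_ctx c ea eb Rb e) i i' -> den i' = (z1, z2, z3, z4, z5) ->
  Forall2 (peq (ext5 (start_ctx c ea eb Rb e) 13 14 15 16 17 z1 z2 z3 z4 z5)) l l' ->
  (2 * length l' <= RB)%nat ->
  let P := program_of i l in
  let L := S (Nat.log2 (tdeg ea eb)) in
  exists n, let s := run P n (init_state c ea eb Rb e) in
    halted P s /\ output s = flat_map (fun q => emits (den q)) l' /\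
    (arith_ops s <= 8 * L + 7 + cost i' + list_sum (map (fun q => cost q + 4) l'))%nat /\
    (bit_ops s <= 21 * L + 2 * Nat.max 18 (Nat.max (mr i 13) (lmr l 18)) + 75 + 3 * length l')%nat.
Proof.
  intros Hi Di Hl HE P L. set (N := Nat.max 18 (Nat.max (mr i 13) (lmr l 18))). set (o := length (setup N)).
  assert (HP : forall Q, code_at Q 0 Q) by (intros Q j _; reflexivity).
  specialize (HP P). apply code_at_app in HP as [H1 HP]. apply code_at_app in HP as [H2 H3].
  destruct (setup_ok P N c ea eb Rb e ltac:(lia) H1)
    as (r & am & na & nb & R1 & B1 & B2 & G & A0 & A1 & HH).
  destruct (cprog_ok _ _ _ Hi P _ 13%nat r
    (fun n => Nat.testbit (exps ea eb (Nat.modulo n 6)) (Nat.div n 6)) am na nb N H2 G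
    ltac:(lia) HH) as (r2 & R2 & E2 & S2).
  assert (HH2 : holds (start_ctx c ea eb Rb e) r2 13) by (eapply holds_same; [exact HH|exact S2|lia]).
  pose proof (holds_ext5 _ _ _ _ HH2 E2) as HX. rewrite Di in HX.
  destruct (lcomp_ok _ _ _ Hl P (o + length (cprog i o 13)) 18%nat r2
    (fun n => Nat.testbit (exps ea eb (Nat.modulo n 6)) (Nat.div n 6)) am (na + cost i')%nat nb N [] H3 G
    ltac:(lia) HX) as (r3 & a3 & n3 & b3 & R3 & O3 & C1 & C2).
  { repeat split; trivial. simpl. intros j Hj. lia. }
  { exact HE. }
  destruct (reach_trans _ _ _ _ R1 (reach_trans _ _ _ _ R2 R3)) as [k Hk].
  exists k. rewrite Hk. split; [|split; [|split]].
  - unfold halted, P, program_of. fold N o. rewrite !length_app. simpl. lia.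
  - apply Out_output. exact O3.
  - simpl. lia.
  - simpl. lia.
Qed.

(** * Root finding *)

(* [2 ^ fib n] grows doubly exponentially and is stepped down by a single division. *)
Fixpoint fib (n : nat) : nat :=
  match n with O => 0 | S m => match m with O => 1 | S k => fib m + fib k end end.

Lemma fib_SS n : fib (S (S n)) = (fib (S n) + fib n)%nat.
Proof. reflexivity. Qed.

Lemma fib_mono n : (fib n <= fib (S n))%nat.
Proof. destruct n; [simpl; lia|]. rewrite fib_SS. lia. Qed.

Lemma pow2_pos n : 0 < 2 ^ n.
Proof. apply pow_lt; lra. Qed.

Lemma pow2_ge1 n : 1 <= 2 ^ n.
Proof. apply pow_R1_Rle; lra. Qed.

(** * Search, bisection and Newton steps for a convex increasing function *)

Section RootFinder.

Variables (F F1 F2 : R -> R) (y0 N rho : R).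
Hypothesis HF : forall y, y0 < y -> derivable_pt_lim F y (F1 y).
Hypothesis HF1 : forall y, y0 < y -> derivable_pt_lim F1 y (F2 y).
Hypothesis F1_pos : forall y, y0 < y -> 0 < F1 y.
Hypothesis F2_nonneg : forall y, y0 < y -> 0 <= F2 y.
Hypothesis F2_bound : forall y, y0 < y -> F2 y * (y - y0) <= N * F1 y.

(** Nothing is said about [F] at [y0] itself: for [y0 = 0] the powers have no meaningful value
    there. So the root may coincide with [y0], and the equation is claimed only if it lies
    beyond. *)
Definition is_root : Prop :=
  y0 <= rho /\ (forall y, y0 < y -> (0 <= F y <-> rho <= y)) /\ (y0 < rho -> F rho = 0).

Hypothesis Hrho : is_root.

Definition search_inv (o : R) (i : nat) (d G H : R) : Prop :=
  G = 2 ^ fib (S i) /\ H = 2 ^ fib i /\ 0 < d /\ o + d < rho <= o + d * G.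

(** The distance from [o] to the root is known up to the factor [G], and one test at [d * H] leaves
    the factor [H] or the factor [G / H]. The latter is the next smaller power of the sequence,
    hence at most [H], so both outcomes continue with the pair [H], [G / H]. *)
Lemma search_step o i d G H :
  y0 <= o -> search_inv o (S i) d G H ->
  search_inv o i (if Rle_dec 0 (F (o + d * H)) then d else d * H) H (G / H).
Proof.
  intros Ho (-> & -> & Hd & H1 & H2).
  assert (E : 2 ^ fib (S (S i)) / 2 ^ fib (S i) = 2 ^ fib i).
  { rewrite fib_SS, pow_add. field. apply pow_nonzero; lra. }
  pose proof (pow2_ge1 (fib (S i))) as G1. pose proof (pow2_pos (fib i)) as G2.
  assert (Hy : y0 < o + d * 2 ^ fib (S i)) by nra.
  destruct Hrho as (_ & R1 & _). specialize (R1 _ Hy).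
  rewrite E. split; [reflexivity|]. split; [reflexivity|].
  destruct (Rle_dec 0 _) as [Hle|Hgt].
  - lra.
  - split; [nra|]. split.
    + lra.
    + rewrite fib_SS, pow_add in H2.
      assert (2 ^ fib i <= 2 ^ fib (S i)) by (apply Rle_pow; [lra|apply fib_mono]).
      assert (d * (2 ^ fib (S i) * 2 ^ fib i) <= d * 2 ^ fib (S i) * 2 ^ fib (S i)).
      { nra. }
      lra.
Qed.

Lemma bisect_step o d i lo hi :
  y0 <= o -> 0 < d ->
  o + d <= lo /\ lo < rho <= hi /\ hi - lo = d / 2 ^ i ->
  let m := (lo + hi) / 2 in
  let lo' := if Rle_dec 0 (F m) then lo else m in
  let hi' := if Rle_dec 0 (F m) then m else hi in
  o + d <= lo' /\ lo' < rho <= hi' /\ hi' - lo' = d / 2 ^ S i.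
Proof.
  intros Ho Hd (H1 & H2 & H3) m lo' hi'. unfold lo', hi', m.
  destruct Hrho as (_ & R1 & _). specialize (R1 ((lo + hi) / 2) ltac:(lra)).
  assert (E : d / 2 ^ S i = (hi - lo) / 2).
  { rewrite H3. simpl. field. apply pow_nonzero; lra. }
  destruct (Rle_dec 0 _) as [Hle|Hgt].
  - apply R1 in Hle. lra.
  - assert ((lo + hi) / 2 < rho).
    { destruct (Rlt_le_dec ((lo + hi) / 2) rho); [assumption|]. exfalso. apply Hgt, R1. assumption. }
    lra.
Qed.

Lemma F1_mono a b : y0 < a -> a <= b -> F1 a <= F1 b.
Proof.
  intros Ha [Hab|<-]; [|lra].
  destruct (MVT_cor2 F1 F2 a b Hab) as (c & E & Hc).
  { intros c Hc. apply HF1. lra. }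
  assert (0 <= F2 c) by (apply F2_nonneg; lra). nra.
Qed.

(** Two applications of the mean value theorem give the new error as
    [(y - rho) * (F2 b * (y - a)) / F1 y] with [rho < a < b < y]. As [b - y0] is at least [d] and
    [F1] increases, the bound on [F2] makes [F2 b / F1 y] at most [N / d]. *)
Lemma newton_step d y :
  0 < d -> y0 + d <= rho -> rho <= y ->
  let y' := y - F y / F1 y in
  rho <= y' /\ y' - rho <= N / d * (y - rho) ^ 2.
Proof.
  intros Hd Hr Hy y'. destruct Hrho as (_ & _ & R0). specialize (R0 ltac:(lra)).
  assert (P1 : 0 < F1 y) by (apply F1_pos; lra).
  destruct Hy as [Hy|Hy].
  2: { unfold y'. subst y. rewrite R0. split; [lra|]. lra. }
  destruct (MVT_cor2 F F1 rho y Hy) as (a & Ea & Ha). { intros c Hc. apply HF. lra. }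
  destruct (MVT_cor2 F1 F2 a y) as (b & Eb & Hb). { lra. } { intros c Hc. apply HF1. lra. }
  assert (E : y' - rho = (y - rho) * (F2 b * (y - a)) / F1 y).
  { unfold y'. rewrite <- Eb. replace (F y) with (F1 a * (y - rho)) by lra. field. lra. }
  assert (B0 : 0 <= F2 b) by (apply F2_nonneg; lra).
  assert (B1 : F2 b * d <= N * F1 y).
  { apply Rle_trans with (N * F1 b).
    - apply Rle_trans with (F2 b * (b - y0)); [apply Rmult_le_compat_l; lra|]. apply F2_bound; lra.
    - apply Rmult_le_compat_l; [|apply F1_mono; lra].
      assert (Q : F2 b * (b - y0) <= N * F1 b) by (apply F2_bound; lra).
      assert (0 < F1 b) by (apply F1_pos; lra).
      destruct (Rle_lt_dec 0 N); [assumption|]. exfalso. nra. }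
  assert (P2 : 0 < / F1 y) by now apply Rinv_0_lt_compat.
  assert (P3 : 0 < / d) by now apply Rinv_0_lt_compat.
  split.
  - enough (0 <= y' - rho) by lra. rewrite E. apply Rmult_le_pos; [|lra]. apply Rmult_le_pos; [lra|]. apply Rmult_le_pos; lra.
  - rewrite E.
    apply Rle_trans with ((y - rho) * (F2 b * (y - rho)) / F1 y).
    { apply Rmult_le_compat_r; [lra|]. apply Rmult_le_compat_l; [lra|].
      apply Rmult_le_compat_l; lra. }
    replace ((y - rho) * (F2 b * (y - rho)) / F1 y)
      with ((y - rho) ^ 2 * (F2 b * d) * (/ F1 y * / d)) by (field; lra).
    replace (N / d * (y - rho) ^ 2)
      with ((y - rho) ^ 2 * (N * F1 y) * (/ F1 y * / d)) by (field; lra).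
    apply Rmult_le_compat_r; [apply Rmult_le_pos; lra|].
    apply Rmult_le_compat_l; [apply pow2_ge_0|exact B1].
Qed.

(** In units of [d / N] each step squares the error. *)
Lemma newton_inv d i y :
  0 < N -> 0 < d -> y0 + d <= rho ->
  rho <= y /\ N / d * (y - rho) <= (1 / 2) ^ (2 ^ i) ->
  let y' := y - F y / F1 y in
  rho <= y' /\ N / d * (y' - rho) <= (1 / 2) ^ (2 ^ S i).
Proof.
  intros HN Hd Hr [H1 H2] y'. destruct (newton_step d y Hd Hr H1) as [H3 H4]. fold y' in H3, H4.
  split; [exact H3|].
  assert (P : 0 < N / d) by (apply Rdiv_lt_0_compat; lra).
  rewrite Nat.pow_succ_r', Nat.mul_comm, pow_mult. assert (0 <= N / d * (y - rho)) by nra.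
  apply Rle_trans with ((N / d * (y - rho)) * (N / d * (y - rho))).
  - nra.
  - nra.
Qed.

End RootFinder.

(** Newton's method gains [2 ^ n] binary digits in [n] steps; by this inequality they make up for
    the whole range [2 ^ fib (S n)] of the search. *)
Lemma fib_le_pow n : (fib (S n) <= 2 ^ n)%nat.
Proof.
  enough (H : (fib n <= 2 ^ n /\ fib (S n) <= 2 ^ n)%nat) by apply H.
  induction n as [|n [H1 H2]]; [simpl; lia|].
  rewrite fib_SS, Nat.pow_succ_r'. lia.
Qed.

(** The sequence doubles every two steps, which bounds the number of search steps by the logarithm
    of the exponent. *)
Lemma fib_double n : (2 ^ n <= fib (S (2 * n)) /\ 2 ^ n <= fib (S (S (2 * n))))%nat.
Proof.
  induction n as [|n [H1 H2]]; [simpl; lia|].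
  replace (2 * S n)%nat with (S (S (2 * n))) by lia.
  rewrite (fib_SS (S (S (2 * n)))), (fib_SS (S (2 * n))), Nat.pow_succ_r'. lia.
Qed.

(** * Convex functions with two powers *)

Definition Phi (A p B k C y : R) : R := A * Rpower y p + B * Rpower y k + C.
Definition Phi1 (A p B k y : R) : R := A * (p * Rpower y (p - 1)) + B * (k * Rpower y (k - 1)).
Definition Phi2 (A p B k y : R) : R :=
  A * (p * ((p - 1) * Rpower y (p - 1 - 1))) + B * (k * ((k - 1) * Rpower y (k - 1 - 1))).

Lemma Phi_deriv A p B k C y : 0 < y -> derivable_pt_lim (Phi A p B k C) y (Phi1 A p B k y).
Proof.
  intros Hy. unfold Phi1.
  replace (A * (p * Rpower y (p - 1)) + B * (k * Rpower y (k - 1)))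
    with (A * (p * Rpower y (p - 1)) + B * (k * Rpower y (k - 1)) + 0) by ring.
  apply (derivable_pt_lim_plus (fun y => A * Rpower y p + B * Rpower y k) (fun _ => C)).
  - apply (derivable_pt_lim_plus (fun y => A * Rpower y p) (fun y => B * Rpower y k));
      apply (derivable_pt_lim_scal (fun y => Rpower y _)); now apply derivable_pt_lim_power.
  - apply derivable_pt_lim_const.
Qed.

Lemma Phi1_deriv A p B k y : 0 < y -> derivable_pt_lim (Phi1 A p B k) y (Phi2 A p B k y).
Proof.
  intros Hy. apply (derivable_pt_lim_plus (fun y => A * (p * Rpower y (p - 1)))
    (fun y => B * (k * Rpower y (k - 1))));
  apply (derivable_pt_lim_scal (fun y => _ * Rpower y _));
  apply (derivable_pt_lim_scal (fun y => Rpower y _)); now apply derivable_pt_lim_power.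
Qed.

Lemma Rpower_m1 y p : 0 < y -> Rpower y (p - 1) = Rpower y p / y.
Proof.
  intros Hy. unfold Rminus. rewrite Rpower_plus, Rpower_Ropp, Rpower_1 by lra. reflexivity.
Qed.

(* [y0] is the critical point of [Phi], or [0] when [Phi] is monotone. *)
Definition convex_class (A p B k y0 : R) : Prop :=
  0 < B /\ 1 <= k /\
  ((0 <= p * A /\ y0 = 0 /\ (A = 0 \/ 0 < A /\ 1 <= p)) \/
   (p * A < 0 /\ p <= 1 /\ p <= k - 1 /\ 0 < y0 /\
    p * A * Rpower y0 p + k * B * Rpower y0 k = 0)).

Lemma convex_class_nonneg A p B k y0 : convex_class A p B k y0 -> 0 <= y0.
Proof. intros (_ & _ & [(_ & -> & _)|(_ & _ & _ & H & _)]); lra. Qed.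

Lemma Rpower_pos x y : 0 < Rpower x y.
Proof. apply exp_pos. Qed.

(** The monotone case holds term by term. Otherwise put [r = y / y0]: at the critical point both
    terms of the derivative have the same size, so everything is expressed by [a = r ^ k] and
    [b = r ^ p] with the common factor [S]. The hypothesis [p <= k - 1] gives [b * r <= a], which
    makes the slope [a - b] at least [a * (r - 1) / r], and this is linear in the distance from the
    critical point. *)
Lemma convex_ineqs A p B k y0 y :
  convex_class A p B k y0 -> y0 < y ->
  0 < Phi1 A p B k y /\ 0 <= Phi2 A p B k y /\
  Phi2 A p B k y * (y - y0) <= (Rabs p + k) * Phi1 A p B k y.
Proof.
  intros HC Hy. pose proof (convex_class_nonneg _ _ _ _ _ HC) as Hy0.
  assert (Py : 0 < y) by lra. destruct HC as (HB & Hk & HC).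
  unfold Phi1, Phi2. rewrite !Rpower_m1 by lra.
  set (u := Rpower y p). set (v := Rpower y k).
  assert (Pu : 0 < u) by apply Rpower_pos. assert (Pv : 0 < v) by apply Rpower_pos.
  set (w := / y). assert (Pw : 0 < w) by now apply Rinv_0_lt_compat.
  assert (Ew : w * y = 1) by (unfold w; field; lra).
  unfold Rdiv. fold w.
  set (V := B * v * w). assert (PV : 0 < V) by (unfold V; repeat apply Rmult_lt_0_compat; assumption).
  pose proof (Rle_abs p) as Hp. pose proof (Rle_abs (- p)) as Hp'. rewrite Rabs_Ropp in Hp'.
  set (T := Rabs p) in *. assert (HT : 0 <= T) by lra.
  destruct HC as [(HpA & -> & HA)|(HpA & Hp1 & Hpk & Py0 & HD)].
  - set (U := A * u * w).
    replace (A * (p * (u * w)) + B * (k * (v * w))) with (p * U + k * V) by (unfold U, V; ring).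
    replace (A * (p * ((p - 1) * (u * w * w))) + B * (k * ((k - 1) * (v * w * w))))
      with ((p * (p - 1) * U + k * (k - 1) * V) * w) by (unfold U, V; ring).
    assert (HU : 0 <= p * U /\ 0 <= p * (p - 1) * U /\ p * (p - 1) * U <= T * (p * U)).
    { destruct HA as [->|[PA Hp2]]; [unfold U; split; [|split]; apply Req_le; ring|].
      assert (PU : 0 < U) by (unfold U; repeat apply Rmult_lt_0_compat; assumption).
      assert (0 < p * U) by nra. split; [nra|]. split; [|nra].
      apply Rmult_le_pos; [nra|lra]. }
    destruct HU as (U1 & U2 & U3).
    assert (0 <= k * (k - 1) * V) by (apply Rmult_le_pos; [nra|lra]).
    assert (k * V > 0) by nra.
    split; [lra|]. split; [apply Rmult_le_pos; lra|].
    nra.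
  - set (r := y * / y0).
    assert (Piy : 0 < / y0) by now apply Rinv_0_lt_compat.
    assert (Er : r * y0 = y) by (unfold r; field; lra).
    assert (Hr : 1 < r) by nra.
    assert (Eu : u = Rpower r p * Rpower y0 p).
    { unfold u. rewrite Rpower_mult_distr by lra. f_equal. lra. }
    assert (Ev : v = Rpower r k * Rpower y0 k).
    { unfold v. rewrite Rpower_mult_distr by lra. f_equal. lra. }
    set (S := k * B * Rpower y0 k).
    assert (PS : 0 < S).
    { apply Rmult_lt_0_compat; [nra|apply Rpower_pos]. }
    set (a := Rpower r k) in *. set (b := Rpower r p) in *.
    assert (Pb : 0 < b) by apply Rpower_pos. assert (Pa : 0 < a) by apply Rpower_pos.
    assert (Hab : b * r <= a).
    { unfold a, b. rewrite <- (Rpower_1 r) at 2 by lra. rewrite <- Rpower_plus.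
      apply Rle_Rpower; lra. }
    assert (E1 : p * A * u = - (S * b)) by (rewrite Eu; unfold S; nra).
    assert (E2 : k * B * v = S * a) by (rewrite Ev; unfold S; ring).
    replace (A * (p * (u * w)) + B * (k * (v * w))) with ((p * A * u + k * B * v) * w) by ring.
    replace (A * (p * ((p - 1) * (u * w * w))) + B * (k * ((k - 1) * (v * w * w))))
      with (((p - 1) * (p * A * u) + (k - 1) * (k * B * v)) * (w * w)) by ring.
    rewrite E1, E2.
    replace (- (S * b) + S * a) with (S * (a - b)) by ring.
    replace ((p - 1) * - (S * b) + (k - 1) * (S * a))
      with (S * ((1 - p) * b + (k - 1) * a)) by ring.
    assert (Dab : 0 < a - b) by nra.
    assert (P1 : 0 <= (1 - p) * b + (k - 1) * a) by nra.
    split; [apply Rmult_lt_0_compat; [nra|lra]|].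
    split; [apply Rmult_le_pos; [apply Rmult_le_pos; lra|nra]|].
    assert (Q1 : ((1 - p) * b + (k - 1) * a) * (y - y0) <= (k - p) * (a - b) * y).
    { rewrite <- Er. assert (X1 : (1 - p) * b + (k - 1) * a <= (k - p) * a) by nra.
      assert (X2 : a * (r - 1) <= (a - b) * r) by nra.
      apply Rle_trans with ((k - p) * a * ((r - 1) * y0)).
      { nra. }
      replace ((k - p) * a * ((r - 1) * y0)) with ((k - p) * y0 * (a * (r - 1))) by ring.
      replace ((k - p) * (a - b) * (r * y0)) with ((k - p) * y0 * ((a - b) * r)) by ring.
      apply Rmult_le_compat_l; [nra|exact X2]. }
    assert (Q2 : (k - p) * (a - b) <= (T + k) * (a - b)) by nra.
    replace (S * ((1 - p) * b + (k - 1) * a) * (w * w) * (y - y0))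
      with (S * (w * w) * (((1 - p) * b + (k - 1) * a) * (y - y0))) by ring.
    apply Rle_trans with (S * (w * w) * ((k - p) * (a - b) * y)).
    { apply Rmult_le_compat_l; [|exact Q1]. apply Rmult_le_pos; [lra|nra]. }
    replace (S * (w * w) * ((k - p) * (a - b) * y)) with (S * w * ((k - p) * (a - b)) * (w * y)) by ring.
    rewrite Ew, Rmult_1_r.
    replace ((T + k) * (S * (a - b) * w)) with (S * w * ((T + k) * (a - b))) by ring.
    apply Rmult_le_compat_l; [nra|exact Q2].
Qed.

(* Notation, bounded loops, and tests as programs *)
Declare Scope aexp_scope.
Delimit Scope aexp_scope with A.
Bind Scope aexp_scope with aexp.
Notation "x + y" := (AO RAdd x y) : aexp_scope.
Notation "x - y" := (AO RSub x y) : aexp_scope.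
Notation "x * y" := (AO RMul x y) : aexp_scope.
Notation "x / y" := (AO RDiv x y) : aexp_scope.
Notation "# x" := (AV x) (at level 1, format "# x") : aexp_scope.
Notation "0" := (AK false) : aexp_scope.
Notation "1" := (AK true) : aexp_scope.
Arguments Ret {V} (a1 a2 a3 a4 a5)%_A.
Arguments Let {V} a%_A k.
Arguments If {V} (a b)%_A p q.

(** Division by 0 yields 0 on the machine; this agrees with [Rinv_0], so the two divisions coincide
    everywhere. *)
Lemma eval_div x y : eval_rop RDiv x y = x / y.
Proof.
  unfold eval_rop. destruct (Req_EM_T y 0) as [->|]; [|reflexivity].
  unfold Rdiv. rewrite Rinv_0. ring.
Qed.

Ltac aden_simpl :=
  cbn [aden]; repeat rewrite eval_div; cbn [eval_rop].

Definition one_of (x : R) : tup := (x, 0, 0, 0, 0).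

Definition Ret1 {V} (a : aexp V) : prog V := Ret a 0 0 0 0.

Definition zero5 {V} : fun5 V (aexp V) := fun _ _ _ _ _ => AK false.

Definition For {V} (n : aexp V) (a1 a2 a3 a4 a5 : aexp V) (body : fun5 V (prog V)) : prog V :=
  Loop n a1 a2 a3 a4 a5 zero5 zero5 body.
Arguments For {V} (n a1 a2 a3 a4 a5)%_A body.

Lemma nfl_INR n : nfl (INR n) = n.
Proof. unfold nfl. rewrite Int_part_INR. apply Nat2Z.id. Qed.

Lemma loopd_ind (I : nat -> tup -> Prop) n c1 c2 f s :
  (forall s, c1 s <= c2 s) -> I O s -> (forall i s, (i < n)%nat -> I i s -> I (S i) (f s)) ->
  I n (loopd n c1 c2 f s).
Proof.
  intros Hc. revert I s. induction n as [|n IH]; intros I s H0 HS; simpl; [exact H0|].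
  destruct (Rle_dec (c1 s) (c2 s)) as [_|n0]; [|exfalso; apply n0, Hc].
  apply (IH (fun i => I (S i))).
  - apply HS; [lia|exact H0].
  - intros i s' Hi. apply HS. lia.
Qed.

Lemma den_For (I : nat -> tup -> Prop) N (n a1 a2 a3 a4 a5 : aexp R) body :
  aden n = INR N ->
  I O (aden a1, aden a2, aden a3, aden a4, aden a5) ->
  (forall i a b c d e, (i < N)%nat -> I i (a, b, c, d, e) -> I (S i) (den (body a b c d e))) ->
  I N (den (For n a1 a2 a3 a4 a5 body)).
Proof.
  intros Hn H0 HS. unfold For. cbn [den]. rewrite Hn, nfl_INR. apply loopd_ind.
  - intros [[[[a b] c] d] e]. apply Rle_refl.
  - exact H0.
  - intros i [[[[a b] c] d] e]. apply HS.
Qed.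

(** Tests get a syntax of their own so that correctness can be argued with their meaning as
    propositions instead of flags and nested branches. *)
Inductive form (V : Type) : Type :=
| FLe (a b : aexp V)
| FAnd (f g : form V)
| FOr (f g : form V)
| FNot (f : form V).
Arguments FLe {V} (a b)%_A. Arguments FAnd {V} f g. Arguments FOr {V} f g. Arguments FNot {V} f.

Definition FLt {V} (a b : aexp V) : form V := FNot (FLe b a).
Definition FEq {V} (a b : aexp V) : form V := FAnd (FLe a b) (FLe b a).
Arguments FLt {V} (a b)%_A. Arguments FEq {V} (a b)%_A.

Fixpoint fsem (f : form R) : Prop :=
  match f with
  | FLe a b => aden a <= aden b
  | FAnd f g => fsem f /\ fsem g
  | FOr f g => fsem f \/ fsem g
  | FNot f => ~ fsem f
  end.

(** All subformulas are evaluated, even if the outcome is already decided. A quotient prepared for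
    one branch may then be meaningless in another, which is harmless since division is total. *)
Fixpoint fprog {V} (f : form V) : prog V :=
  match f with
  | FLe a b => If a b (Ret1 1%A) (Ret1 0%A)
  | FAnd f g => Bind (fprog f) (fun x _ _ _ _ => Bind (fprog g) (fun y _ _ _ _ => Ret1 (#x * #y)%A))
  | FOr f g => Bind (fprog f) (fun x _ _ _ _ => Bind (fprog g) (fun y _ _ _ _ =>
      Ret1 (#x + #y - #x * #y)%A))
  | FNot f => Bind (fprog f) (fun x _ _ _ _ => Ret1 (1 - #x)%A)
  end.

Definition fl (P : Prop) : R := if excluded_middle_informative P then 1 else 0.

Lemma fl_iff P Q : (P <-> Q) -> fl P = fl Q.
Proof.
  intros H. unfold fl.
  destruct (excluded_middle_informative P), (excluded_middle_informative Q); tauto.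
Qed.

Lemma fl_true P : P -> fl P = 1.
Proof. intros H. unfold fl. destruct (excluded_middle_informative P); tauto. Qed.

Lemma fl_false P : ~ P -> fl P = 0.
Proof. intros H. unfold fl. destruct (excluded_middle_informative P); tauto. Qed.

Lemma fl_ge1 P : 1 <= fl P <-> P.
Proof.
  unfold fl. destruct (excluded_middle_informative P); split; intros; try tauto; lra.
Qed.

Lemma den_fprog f : den (fprog f) = one_of (fl (fsem f)).
Proof.
  assert (T : forall P : Prop, P -> fl P = 1) by apply fl_true.
  assert (F : forall P : Prop, ~ P -> fl P = 0) by apply fl_false.
  induction f as [a b|f IHf g IHg|f IHf g IHg|f IHf]; cbn [fprog den fsem].
  - destruct (Rle_dec _ _); cbn [Ret1 den aden]; [rewrite T|rewrite F]; trivial.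
  - rewrite IHf. rewrite IHg. unfold one_of. cbn [Ret1 den aden eval_rop].
    destruct (classic (fsem f)), (classic (fsem g)).
    all: rewrite ?(T (fsem f)), ?(T (fsem g)), ?(F (fsem f)), ?(F (fsem g)) by tauto.
    all: rewrite ?T, ?F by tauto; repeat f_equal; ring.
  - rewrite IHf. rewrite IHg. unfold one_of. cbn [Ret1 den aden eval_rop].
    destruct (classic (fsem f)), (classic (fsem g)).
    all: rewrite ?(T (fsem f)), ?(T (fsem g)), ?(F (fsem f)), ?(F (fsem g)) by tauto.
    all: rewrite ?T, ?F by tauto; repeat f_equal; ring.
  - rewrite IHf. unfold one_of. cbn [Ret1 den aden eval_rop].
    destruct (classic (fsem f)).
    all: rewrite ?(T (fsem f)), ?(F (fsem f)) by tauto.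
    all: rewrite ?T, ?F by tauto; repeat f_equal; ring.
Qed.

Lemma fsem_Lt a b : fsem (FLt a b) <-> aden a < aden b.
Proof. split; [apply Rnot_le_lt|apply Rlt_not_le]. Qed.

Lemma fsem_Eq a b : fsem (FEq a b) <-> aden a = aden b.
Proof. simpl. split; [intros []; lra|lra]. Qed.

(** * Powers and sparse equations *)

(* [gW], [gT = 2 ^ gW]: bound on the bit length of exponents; [gK], [gG], [gH]: number of steps of
   the doubly exponential search, with [gG] and [gH] the two top powers [2 ^ fib _]. *)
Record glob (V : Type) := Glob { gW : V; gT : V; gK : V; gG : V; gH : V }.
Arguments Glob {V} gW gT gK gG gH. Arguments gW {V} g. Arguments gT {V} g.
Arguments gK {V} g. Arguments gG {V} g. Arguments gH {V} g.

Definition glob_ok (g : glob R) (w n : nat) : Prop :=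
  gW g = INR w /\ gT g = 2 ^ w /\ gK g = INR n /\ gG g = 2 ^ fib (S n) /\ gH g = 2 ^ fib n.

(** Square and multiply from the top. The bits of the exponent are recovered from its real value by
    comparing with the halved powers [t], so that no bit register is read. *)
Definition pow_m {V} (g : glob V) (x n : V) : prog V :=
  Bind (For #(gW g) 1 #n #(gT g) 0 0 (fun a m t _ _ =>
    Let (#t / (1 + 1)) (fun h =>
      If #h #m (Ret (#a * #a * #x) (#m - #h) #h 0 0) (Ret (#a * #a) #m #h 0 0))))
  (fun a _ _ _ _ => Ret1 #a%A).

Lemma den_pow g w n x N : glob_ok g w n -> (N < 2 ^ w)%nat ->
  den (pow_m g x (INR N)) = one_of (x ^ N).
Proof.
  intros (HW & HT & _) HN. unfold pow_m. cbn [den].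
  (* [q] consists of the leading bits of [N] read so far, [m] is the remainder below them. *)
  assert (H := den_For (fun i s => exists q m, (N = q * 2 ^ (w - i) + m)%nat /\ (m < 2 ^ (w - i))%nat /\
    s = (x ^ q, INR m, 2 ^ (w - i), 0, 0)) w #(gW g)%A 1%A #(INR N)%A #(gT g)%A 0%A 0%A
    (fun a m t _ _ =>
      Let (#t / (1 + 1)) (fun h =>
      If #h #m (Ret (#a * #a * #x) (#m - #h) #h 0 0) (Ret (#a * #a) #m #h 0 0)))).
  destruct H as (q & m & E & Hm & Es).
  - exact HW.
  - exists 0%nat, N. rewrite Nat.sub_0_r. split; [lia|]. split; [exact HN|].
    rewrite HT. reflexivity.
  - intros i a b c d e Hi (q & m & E & Hm & Es). injection Es as -> -> -> -> ->.
    cbn [den]. cbn [aden]. rewrite eval_div. cbn [eval_rop].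
    replace (w - i)%nat with (S (w - S i)) in * by lia.
    set (h := (w - S i)%nat) in *.
    replace (2 ^ S h / (1 + 1)) with (2 ^ h) by (simpl; lra).
    rewrite Nat.pow_succ_r' in E, Hm.
    assert (Eh : INR (2 ^ h) = 2 ^ h) by (rewrite pow_INR; f_equal; simpl; lra).
    destruct (Rle_dec (2 ^ h) (INR m)) as [Hle|Hgt].
    + rewrite <- Eh in Hle. apply INR_le in Hle.
      exists (q * 2 + 1)%nat, (m - 2 ^ h)%nat. split; [lia|]. split; [lia|].
      rewrite minus_INR, Eh by lia.
      rewrite pow_add, Nat.mul_comm, pow_mult. replace (x ^ q * x ^ q * x) with ((x * (x * 1)) ^ q * (x * 1)); [reflexivity|].
      rewrite Rmult_1_r, Rpow_mult_distr. ring.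
    + rewrite <- Eh in Hgt. assert (m < 2 ^ h)%nat.
      { destruct (Nat.lt_ge_cases m (2 ^ h)); [assumption|]. exfalso. apply Hgt, le_INR. assumption. }
      exists (q * 2)%nat, m. split; [lia|]. split; [lia|].
      rewrite Nat.mul_comm, pow_mult. replace (x ^ q * x ^ q) with ((x * (x * 1)) ^ q); [reflexivity|].
      rewrite Rmult_1_r, Rpow_mult_distr. ring.
  - rewrite Es. rewrite Nat.sub_diag in *. simpl in *.
    replace q with N by lia. reflexivity.
Qed.

Definition zpow {V} (g : glob V) (x p : V) : prog V :=
  If 0 #p (pow_m g x p)
    (Let (0 - #p) (fun q => Bind (pow_m g x q) (fun r _ _ _ _ => Ret1 (1 / #r)%A))).

Definition is_int (p : R) : Prop := exists z : Z, p = IZR z.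
Definition small_int (w : nat) (p : R) : Prop := is_int p /\ Rabs p < 2 ^ w.

Lemma is_int_INR n : is_int (INR n).
Proof. exists (Z.of_nat n). apply INR_IZR_INZ. Qed.
Lemma is_int_IZR z : is_int (IZR z).
Proof. now exists z. Qed.
Lemma is_int_plus x y : is_int x -> is_int y -> is_int (x + y).
Proof. intros [a ->] [b ->]. exists (a + b)%Z. now rewrite plus_IZR. Qed.
Lemma is_int_mult x y : is_int x -> is_int y -> is_int (x * y).
Proof. intros [a ->] [b ->]. exists (a * b)%Z. now rewrite mult_IZR. Qed.
Lemma is_int_opp x : is_int x -> is_int (- x).
Proof. intros [a ->]. exists (- a)%Z. now rewrite opp_IZR. Qed.
Lemma is_int_minus x y : is_int x -> is_int y -> is_int (x - y).
Proof. intros Hx Hy. apply is_int_plus, is_int_opp; assumption. Qed.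

Lemma small_int_nat w p : small_int w p -> exists N, (N < 2 ^ w)%nat /\ Rabs p = INR N /\
  (0 <= p -> p = INR N) /\ (p < 0 -> - p = INR N).
Proof.
  intros [[z ->] Hz]. exists (Z.to_nat (Z.abs z)).
  rewrite <- abs_IZR in Hz. assert (E : INR (Z.to_nat (Z.abs z)) = Rabs (IZR z)).
  { rewrite INR_IZR_INZ, Z2Nat.id by lia. apply abs_IZR. }
  rewrite E. split; [|split; [reflexivity|split; intros H]].
  - apply INR_lt. rewrite E, <- abs_IZR, pow_INR. exact Hz.
  - rewrite Rabs_right; [reflexivity|lra].
  - rewrite Rabs_left; [reflexivity|lra].
Qed.

Lemma den_zpow g w n x p : glob_ok g w n -> 0 < x -> small_int w p ->
  den (zpow g x p) = one_of (Rpower x p).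
Proof.
  intros Hg Hx Hp. destruct (small_int_nat _ _ Hp) as (N & HN & _ & H1 & H2).
  unfold zpow. cbn [den aden eval_rop]. destruct (Rle_dec 0 p) as [Hle|Hgt].
  - rewrite (H1 Hle), (den_pow _ _ _ _ _ Hg HN), Rpower_pow by lra. reflexivity.
  - assert (Hn : p < 0) by lra. replace (0 - p) with (- p) by ring. rewrite (H2 Hn), (den_pow _ _ _ _ _ Hg HN).
    unfold one_of. cbn [den Ret1 aden]. rewrite eval_div.
    replace p with (- INR N) by lra.
    rewrite Rpower_Ropp, Rpower_pow by lra. unfold Rdiv. rewrite Rmult_1_l. reflexivity.
Qed.

Record poly3 (V : Type) := Poly3 { cA : V; cp : V; cB : V; ck : V; cC : V }.
Arguments Poly3 {V} cA cp cB ck cC. Arguments cA {V} p. Arguments cp {V} p.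
Arguments cB {V} p. Arguments ck {V} p. Arguments cC {V} p.

(** The second component is [y] times the derivative: it is formed from the same two powers as the
    value, and Newton's quotient absorbs the factor. *)
Definition ev {V} (g : glob V) (f : poly3 V) (y : V) : prog V :=
  Bind (zpow g y (cp f)) (fun u _ _ _ _ => Bind (zpow g y (ck f)) (fun v _ _ _ _ =>
    Ret (#(cA f) * #u + #(cB f) * #v + #(cC f))
        (#(cA f) * (#(cp f) * #u) + #(cB f) * (#(ck f) * #v)) 0 0 0)).

Definition PhiR (f : poly3 R) : R -> R := Phi (cA f) (cp f) (cB f) (ck f) (cC f).
Definition Phi1R (f : poly3 R) : R -> R := Phi1 (cA f) (cp f) (cB f) (ck f).
Definition Phi2R (f : poly3 R) : R -> R := Phi2 (cA f) (cp f) (cB f) (ck f).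

Lemma den_ev g w n f y : glob_ok g w n -> 0 < y -> small_int w (cp f) -> small_int w (ck f) ->
  den (ev g f y) = (PhiR f y, y * Phi1R f y, 0, 0, 0).
Proof.
  intros Hg Hy Hp Hk. unfold ev. cbn [den].
  rewrite (den_zpow _ _ _ _ _ Hg Hy Hp). rewrite (den_zpow _ _ _ _ _ Hg Hy Hk). cbn [den aden eval_rop]. apply (f_equal2 (fun a b => (a, b, 0, 0, 0))); [reflexivity|].
  unfold Phi1R, Phi1. rewrite !Rpower_m1 by lra. field. lra.
Qed.

(* Search, bisection, Newton; by convexity Newton's iterates started above the root decrease. *)
Definition solve {V} (g : glob V) (f : poly3 V) (o ep : V) : prog V :=
  Let (#ep / (1 + 1)) (fun h =>
  Let (#o + #h) (fun y => Bind (ev g f y) (fun v _ _ _ _ =>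
  If 0 #v (Ret1 #y)
  (Bind (For #(gK g) #h #(gG g) #(gH g) 0 0 (fun d G H _ _ =>
     Let (#o + #d * #H) (fun y => Bind (ev g f y) (fun v _ _ _ _ =>
       If 0 #v (Ret #d #H (#G / #H) 0 0) (Ret (#d * #H) #H (#G / #H) 0 0)))))
   (fun d _ _ _ _ =>
    Bind (For #(gW g) (#o + #d) (#o + #d + #d) 0 0 0 (fun lo hi _ _ _ =>
      Let ((#lo + #hi) / (1 + 1)) (fun m => Bind (ev g f m) (fun v _ _ _ _ =>
        If 0 #v (Ret #lo #m 0 0 0) (Ret #m #hi 0 0 0)))))
    (fun _ hi _ _ _ =>
     For #(gK g) #hi 0 0 0 0 (fun y _ _ _ _ =>
       Bind (ev g f y) (fun v v1 _ _ _ => Ret1 (#y - #y * #v / #v1))))))))).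

Definition poly_ok (w : nat) (f : poly3 R) (y0 : R) : Prop :=
  convex_class (cA f) (cp f) (cB f) (ck f) y0 /\ small_int w (cp f) /\ small_int w (ck f) /\
  2 * (Rabs (cp f) + ck f) <= 2 ^ w.

(** One number [n] governs search and Newton: the search covers distances up to
    [ep / 2 * 2 ^ fib (S n)], so the scale [d] on which it ends is at most that, while the last
    Newton error is at most [d * (1 / 2) ^ (2 ^ n)] and hence at most [ep / 2]. In between, [w]
    bisections of an interval of length [d] suffice because [2 * N <= 2 ^ w]. *)
Lemma den_solve g w n f y0 rho o ep :
  glob_ok g w n -> poly_ok w f y0 -> is_root (PhiR f) y0 rho -> 0 < ep ->
  y0 <= o <= y0 + ep / 2 -> rho <= o + ep / 2 * 2 ^ fib (S n) ->
  exists y, den (solve g f o ep) = one_of y /\ rho <= y <= rho + ep.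
Proof.
  intros Hg (HC & Hp & Hk & HNw) HR Hep Ho Hrho.
  pose proof (convex_class_nonneg _ _ _ _ _ HC) as Hy0.
  assert (E : forall y, y0 < y -> den (ev g f y) = (PhiR f y, y * Phi1R f y, 0, 0, 0)).
  { intros y Hy. apply (den_ev _ _ _ _ _ Hg); trivial; lra. }
  destruct Hg as (HW & HT & HK & HG & HH).
  unfold solve. cbn [den]. aden_simpl. replace (1 + 1) with 2 by ring.
  rewrite E by lra. destruct (Rle_dec 0 (PhiR f (o + ep / 2))) as [Hle|Hgt].
  (* At this exit the root is at most [o + ep / 2] and at least [y0], which lies no more than
     [ep / 2] below [o]. *)
  { exists (o + ep / 2). split; [reflexivity|].
    destruct HR as (R0 & R1 & _). apply R1 in Hle; [|lra]. lra. }
  assert (Hgt' : o + ep / 2 < rho).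
  { destruct (Rlt_le_dec (o + ep / 2) rho); [assumption|]. exfalso. apply Hgt.
    apply HR; lra. }
  match goal with |- context [den (For ?z1 ?z2 ?z3 ?z4 ?z5 ?z6 ?z7)] =>
    pose proof (den_For (fun i s => exists d G H, s = (d, G, H, 0, 0) /\
      search_inv rho o (n - i) d G H) n z1 z2 z3 z4 z5 z6 z7) as I1;
    set (D1 := den (For z1 z2 z3 z4 z5 z6 z7)) in * end.
  destruct I1 as (d & G & H & Es & HS).
  { exact HK. }
  { exists (ep / 2), (2 ^ fib (S n)), (2 ^ fib n). rewrite HG, HH. split; [reflexivity|].
    rewrite Nat.sub_0_r. repeat split; lra. }
  { intros i a b c d e Hi (d' & G & H & Es & HS). injection Es as -> -> -> -> ->.
    replace (n - i)%nat with (S (n - S i)) in HS by lia.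
    assert (Hd : 0 < d' /\ 0 < H).
    { destruct HS as (_ & -> & Hd & _). split; [exact Hd|apply pow2_pos]. }
    destruct Hd as [Hd1 Hd2].
    cbn [den]. aden_simpl. rewrite E by nra. pose proof (search_step (PhiR f) y0 rho HR o _ _ _ _ (proj1 Ho) HS) as HS'.
    destruct (Rle_dec 0 (PhiR f (o + d' * H))); cbn [den]; aden_simpl;
      do 3 eexists; (split; [reflexivity|exact HS']). }
  rewrite Es. clear D1 Es.
  rewrite Nat.sub_diag in HS. destruct HS as (-> & -> & Hd & HS1 & HS2).
  (* The final pair is [2 ^ fib 1 = 2] and [2 ^ fib 0 = 1]: the root lies between [o + d] and
     [o + d * 2]. *)
  simpl fib in HS2. match goal with |- context [den (For ?z1 ?z2 ?z3 ?z4 ?z5 ?z6 ?z7)] =>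
    pose proof (den_For (fun i s => exists lo hi, s = (lo, hi, 0, 0, 0) /\
      (o + d <= lo /\ lo < rho <= hi /\ hi - lo = d / 2 ^ i)) w z1 z2 z3 z4 z5 z6 z7) as I2;
    set (D2 := den (For z1 z2 z3 z4 z5 z6 z7)) in * end.
  destruct I2 as (lo & hi & Es & HS).
  { exact HW. }
  { aden_simpl. do 2 eexists. split; [reflexivity|]. lra. }
  { intros i a b c d' e Hi (lo & hi & Es & HS). injection Es as -> -> -> -> ->.
    cbn [den]. aden_simpl. rewrite E by lra. pose proof (bisect_step (PhiR f) y0 rho HR o d i lo hi (proj1 Ho) Hd HS) as HS'.
    cbv zeta in HS'. replace (1 + 1) with 2 by ring.
    destruct (Rle_dec 0 (PhiR f ((lo + hi) / 2))); cbn [den aden];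
      do 2 eexists; (split; [reflexivity|exact HS']). }
  rewrite Es. clear D2 Es. set (N := Rabs (cp f) + ck f) in *.
  assert (HN : 1 <= N).
  { unfold N. destruct HC as (_ & Hk1 & _). pose proof (Rabs_pos (cp f)). lra. }
  assert (CI : forall y, y0 < y -> 0 < Phi1R f y /\ 0 <= Phi2R f y /\
      Phi2R f y * (y - y0) <= N * Phi1R f y).
  { intros y Hy. apply convex_ineqs; assumption. }
  match goal with |- context [den (For ?z1 ?z2 ?z3 ?z4 ?z5 ?z6 ?z7)] =>
    pose proof (den_For (fun i s => exists y, s = one_of y /\
      (rho <= y /\ N / d * (y - rho) <= (1 / 2) ^ (2 ^ i))) n z1 z2 z3 z4 z5 z6 z7) as I3;
    set (D3 := den (For z1 z2 z3 z4 z5 z6 z7)) in * end.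
  destruct I3 as (y & Es & Hy1 & Hy2).
  { exact HK. }
  { exists hi. split; [reflexivity|]. split; [lra|]. simpl (2 ^ 0)%nat. destruct HS as (S1 & S2 & S3).
    apply Rle_trans with (N / d * (d / 2 ^ w)).
    { apply Rmult_le_compat_l; [|lra]. apply Rlt_le, Rdiv_lt_0_compat; lra. }
    apply Rmult_le_reg_r with (2 * 2 ^ w); [lra|].
    replace (N / d * (d / 2 ^ w) * (2 * 2 ^ w)) with (2 * N) by (field; lra).
    lra. }
  { intros i a b c d' e Hi (y & Es & HI). injection Es as -> -> -> -> ->.
    destruct HI as [HI1 HI2].
    cbn [den]. rewrite E by lra. cbn [den Ret1]. aden_simpl.
    destruct (CI y ltac:(lra)) as (C1 & _).
    replace (y * PhiR f y / (y * Phi1R f y)) with (PhiR f y / Phi1R f y) by (field; lra).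
    eexists. split; [reflexivity|].
    apply (newton_inv (PhiR f) (Phi1R f) (Phi2R f) y0 N rho); trivial; try lra.
    - intros z Hz. apply Phi_deriv. lra.
    - intros z Hz. apply Phi1_deriv. lra.
    - intros z Hz. apply CI. assumption.
    - intros z Hz. apply CI. assumption.
    - intros z Hz. apply CI. assumption. }
  exists y. rewrite Es. split; [reflexivity|]. split; [exact Hy1|].
  assert (HG2 : 2 ^ fib (S n) * (1 / 2) ^ (2 ^ n) <= 1).
  { apply Rle_trans with (2 ^ (2 ^ n) * (1 / 2) ^ (2 ^ n)).
    - apply Rmult_le_compat_r; [apply pow_le; lra|]. apply Rle_pow; [lra|apply fib_le_pow].
    - rewrite <- Rpow_mult_distr. replace (2 * (1 / 2)) with 1 by field. rewrite pow1. lra. }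
  set (q := (1 / 2) ^ (2 ^ n)) in *. assert (Hq : 0 < q) by (apply pow_lt; lra).
  assert (X1 : y - rho <= d * q).
  { apply Rmult_le_compat_l with (r := d / N) in Hy2; [|apply Rlt_le, Rdiv_lt_0_compat; lra].
    replace (d / N * (N / d * (y - rho))) with (y - rho) in Hy2 by (field; lra).
    apply Rle_trans with (d / N * q); [exact Hy2|]. apply Rmult_le_compat_r; [lra|].
    apply Rmult_le_reg_r with N; [lra|]. unfold Rdiv. rewrite Rmult_assoc, Rinv_l by lra. nra. }
  assert (X2 : d * q <= ep / 2 * 2 ^ fib (S n) * q) by nra.
  assert (X3 : ep / 2 * (2 ^ fib (S n) * q) <= ep / 2 * 1) by nra.
  lra.
Qed.

Lemma binomial_root w B k x : 0 < B -> 1 <= k -> 0 < x -> B * Rpower x k = 1 ->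
  small_int w k -> 2 * k <= 2 ^ w ->
  poly_ok w (Poly3 0 0 B k (0 - 1)) 0 /\ is_root (PhiR (Poly3 0 0 B k (0 - 1))) 0 x.
Proof.
  intros HB Hk Hx Ex Hki Hkw.
  assert (HPhi : forall y, PhiR (Poly3 0 0 B k (0 - 1)) y = B * Rpower y k - 1).
  { intros y. unfold PhiR, Phi. simpl. ring. }
  split; [split; [|split; [|split]]; cbn [cA cp cB ck cC]|split; [lra|split]].
  - split; [exact HB|]. split; [exact Hk|]. left. lra.
  - split; [apply (is_int_IZR 0)|rewrite Rabs_R0; apply pow2_pos].
  - exact Hki.
  - rewrite Rabs_R0. lra.
  - intros y Hy. rewrite HPhi. split; intros H.
    + destruct (Rle_lt_dec x y); [assumption|]. exfalso.
      assert (Rpower y k < Rpower x k) by (apply Rlt_Rpower_l; lra). nra.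
    + assert (Rpower x k <= Rpower y k) by (apply Rle_Rpower_l; lra). nra.
  - intros _. rewrite HPhi. lra.
Qed.

(** If the derivatives of the two powers have opposite signs, the search has to start at the
    critical point, which is not known. It solves an equation [B y^(k - p) = 1] of the monotone
    kind, is approximated from above to within [ep / 2], and then serves as origin. *)
Definition lr {V} (g : glob V) (f : poly3 V) (ep : V) : prog V :=
  Let 0 (fun z =>
  If 0 (#(cp f) * #(cA f)) (solve g f z ep)
  (Let (#(ck f) * #(cB f) / (0 - #(cp f) * #(cA f))) (fun B => Let (#(ck f) - #(cp f)) (fun k =>
   Let (0 - 1) (fun c => Let (#ep / (1 + 1)) (fun h =>
   Bind (solve g (Poly3 z z B k c) z h) (fun o _ _ _ _ => solve g f o ep))))))).

(** The reach contains [ep / 4] because the critical point is computed with half the tolerance. *)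
Lemma den_lr g w n f y0 rho ep :
  glob_ok g w n -> poly_ok w f y0 -> is_root (PhiR f) y0 rho -> 0 < ep ->
  rho <= ep / 4 * 2 ^ fib (S n) ->
  exists y, den (lr g f ep) = one_of y /\ rho <= y <= rho + ep.
Proof.
  intros Hg Hf HR Hep Hrho. pose proof (pow2_pos (fib (S n))) as HG.
  assert (HG2 : 0 < ep * 2 ^ fib (S n)) by nra.
  unfold lr. cbn [den]. aden_simpl. replace (1 + 1) with 2 by ring.
  destruct Hf as (HC & Hp & Hk & HNw). destruct HC as (HB & Hk1 & HC).
  assert (Hf : poly_ok w f y0) by (repeat split; try assumption; apply Hp || apply Hk).
  destruct (Rle_dec 0 (cp f * cA f)) as [Hle|Hgt].
  - destruct HC as [(_ & E0 & _)|(Hlt & _)]; [|lra].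
    apply (den_solve _ w n _ y0 rho); trivial; lra.
  - destruct HC as [(H0 & _)|(Hlt & Hp1 & Hpk & Hy0 & HD)]; [lra|].
    set (B := ck f * cB f / (0 - cp f * cA f)). set (k := ck f - cp f).
    assert (HBp : 0 < B) by (apply Rdiv_lt_0_compat; [nra|lra]).
    assert (Ey : B * Rpower y0 k = 1).
    { unfold B, k, Rminus. rewrite Rpower_plus, Rpower_Ropp.
      pose proof (Rpower_pos y0 (cp f)). 
      replace (ck f * cB f / (0 + - (cp f * cA f)) * (Rpower y0 (ck f) * / Rpower y0 (cp f)))
        with (ck f * cB f * Rpower y0 (ck f) / (- (cp f * cA f * Rpower y0 (cp f)))) by (field; split; nra).
      replace (ck f * cB f * Rpower y0 (ck f)) with (- (cp f * cA f * Rpower y0 (cp f))) by lra.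
      field. nra. }
    assert (Hk' : 1 <= k) by (unfold k; lra).
    pose proof (Rle_abs (- cp f)) as Habs. rewrite Rabs_Ropp in Habs.
    assert (Hki : small_int w k).
    { split; [apply is_int_minus; [apply Hk|apply Hp]|]. rewrite Rabs_right by lra.
      unfold k in *. lra. }
    destruct (binomial_root w B k y0 HBp Hk' Hy0 Ey Hki) as [Hok Hroot]; [unfold k; lra|].
    destruct (den_solve g w n (Poly3 0 0 B k (0 - 1)) 0 y0 0 (ep / 2) Hg Hok Hroot)
      as (o & Eo & Ho); try lra.
    + destruct HR as (HR & _). lra.
    + rewrite Eo. apply (den_solve _ w n _ y0 rho); trivial; try lra.
Qed.

(** * Exact tests at the roots of a cubic *)

Definition cub (P Q z : R) : R := z * z * z + P * z + Q.

(* The roots covered are the middle one and a nonnegative largest one; the others have this form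
   after the substitution of [- z] for [z]. *)
Definition kroot (mid : bool) (P Q z : R) : Prop :=
  cub P Q z = 0 /\ if mid then 3 * z * z + P < 0 else 0 <= z /\ 0 <= 3 * z * z + P.

Definition cub_e {V} (P Q r : V) : aexp V := (#r * #r * #r + #P * #r + #Q)%A.
Definition cub1_e {V} (P r : V) : aexp V := ((1 + 1 + 1) * #r * #r + #P)%A.

(** The value and the derivative of the cubic at [r] locate [r] relative to the critical points.
    Between them the cubic decreases through the middle root, so that [z <= r] means a value at most
    0 there; [far] says that [r] is not to the left of any critical point, where the cubic
    increases. *)
Definition root_le {V} (mid : bool) (P Q r : V) : form V :=
  let far := FAnd (FLe 0 #r) (FLe 0 (cub1_e P r)) in
  if mid then FOr far (FAnd (FLe (cub1_e P r) 0) (FLe (cub_e P Q r) 0))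
  else FAnd (FLe 0 (cub_e P Q r)) far.

Definition root_eq {V} (mid : bool) (P Q r : V) : form V :=
  FAnd (FEq (cub_e P Q r) 0)
    (if mid then FLt (cub1_e P r) 0 else FAnd (FLe 0 #r) (FLe 0 (cub1_e P r))).

Lemma kroot_le mid P Q z r : kroot mid P Q z -> (fsem (root_le mid P Q r) <-> z <= r).
Proof.
  unfold kroot, root_le, cub. intros [E H].
  assert (F : r * r * r + P * r + Q = (r - z) * (r * r + r * z + z * z + P)) by lra.
  destruct mid; cbn [fsem cub_e cub1_e aden eval_rop]; rewrite F;
    replace (1 + 1 + 1) with 3 by ring.
  - split.
    + intros [[H1 H2]|[H1 H2]].
      * nra.
      * destruct (Rle_lt_dec z r); [assumption|]. exfalso.
        assert (r * r + r * z + z * z + P < 0) by nra. nra.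
    + intros Hr. destruct (Rle_lt_dec (3 * r * r + P) 0) as [H1|H1].
      * right. split; [exact H1|]. assert (r * r + r * z + z * z + P <= 0) by nra. nra.
      * nra.
  - destruct H as [H1 H2]. split.
    + intros (A1 & A2 & A3). destruct (Rle_lt_dec z r); [assumption|]. exfalso.
      assert (0 < r * r + r * z + z * z + P) by nra. nra.
    + intros Hr. assert (0 <= r * r + r * z + z * z + P) by nra. repeat split; nra.
Qed.

(** The exact comparison applies to each of the two roots with the other one as the point of
    comparison. *)
Lemma kroot_unique mid P Q z z' : kroot mid P Q z -> kroot mid P Q z' -> z = z'.
Proof.
  intros H H'. apply Rle_antisym.
  - apply (kroot_le mid P Q z z' H). revert H'. unfold kroot, root_le, cub. intros [E H'].
    destruct mid; cbn [fsem cub_e cub1_e aden eval_rop];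
      replace (1 + 1 + 1) with 3 by ring; [right|]; lra.
  - apply (kroot_le mid P Q z' z H'). revert H. unfold kroot, root_le, cub. intros [E H].
    destruct mid; cbn [fsem cub_e cub1_e aden eval_rop];
      replace (1 + 1 + 1) with 3 by ring; [right|]; lra.
Qed.

Lemma kroot_eq mid P Q z r : kroot mid P Q z -> (fsem (root_eq mid P Q r) <-> z = r).
Proof.
  intros H. assert (X : fsem (root_eq mid P Q r) <-> kroot mid P Q r).
  { unfold root_eq, kroot, cub. cbn [fsem]. rewrite fsem_Eq.
    destruct mid; [rewrite fsem_Lt|cbn [fsem]];
      cbn [cub_e cub1_e aden eval_rop]; replace (1 + 1 + 1) with 3 by ring; tauto. }
  rewrite X. split; [now apply kroot_unique|now intros <-].
Qed.

(** The suffix [np] stands for nonpositive. The root of the cubic is compared with the zero [r] of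
    the linear form; for negative [b] the condition is [r <= z], which also needs the test for
    equality. *)
Definition lin_np {V} (mid : bool) (P Q b c : V) : prog V :=
  Let ((0 - #c) / #b) (fun r => fprog
    (FOr (FAnd (FEq #b 0) (FLe #c 0))
    (FOr (FAnd (FLt 0 #b) (root_le mid P Q r))
         (FAnd (FLt #b 0) (FOr (FNot (root_le mid P Q r)) (root_eq mid P Q r)))))).

Lemma den_lin_np mid P Q z b c : kroot mid P Q z ->
  den (lin_np mid P Q b c) = one_of (fl (b * z + c <= 0)).
Proof.
  intros H. unfold lin_np. cbn [den]. rewrite den_fprog. f_equal. apply fl_iff.
  cbn [fsem]. rewrite fsem_Eq, !fsem_Lt, (kroot_le _ _ _ z), (kroot_eq _ _ _ z) by tauto.
  aden_simpl. set (r := (0 - c) / b).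
  destruct (Rtotal_order b 0) as [Hb|[Hb|Hb]].
  - assert (E : b * r = - c) by (unfold r; field; lra).
    split; [intros [X|[X|X]]; try lra|].
    + nra.
    + nra.
  - nra.
  - assert (E : b * r = - c) by (unfold r; field; lra).
    split; [intros [X|[X|X]]; try lra; nra|].
    intros X. right. left. split; [assumption|]. nra.
Qed.

(** Multiplying by [z - r] with [r = v / w] removes the square, and the cubic equation makes the
    third power linear. So the quadratic form has the sign of the linear form [b * z + c], up to the
    sign of [z - r]; for [z = r] it is evaluated directly. *)
Definition quad_np {V} (mid : bool) (P Q u v w : V) : prog V :=
  If (#w * #w) 0 (lin_np mid P Q v u)
  (Let (#v / #w) (fun r =>
   Let (#u - #r * #v - #w * #P) (fun b => Let (0 - #r * #u - #w * #Q) (fun c =>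
   Let (0 - #b) (fun b' => Let (0 - #c) (fun c' =>
   Bind (lin_np mid P Q b c) (fun l _ _ _ _ =>
   Bind (lin_np mid P Q b' c') (fun l' _ _ _ _ => fprog
     (FOr (FAnd (root_eq mid P Q r) (FLe (#u + #v * #r + #w * #r * #r) 0))
     (FOr (FAnd (FNot (root_le mid P Q r)) (FLe 1 #l))
          (FAnd (FAnd (root_le mid P Q r) (FNot (root_eq mid P Q r))) (FLe 1 #l')))))))))))).

Lemma den_quad_np mid P Q z u v w : kroot mid P Q z ->
  den (quad_np mid P Q u v w) = one_of (fl (u + v * z + w * z * z <= 0)).
Proof.
  intros H. unfold quad_np. cbn [den]. aden_simpl.
  destruct (Rle_dec (w * w) 0) as [Hw|Hw].
  { rewrite (den_lin_np _ _ _ z) by tauto. f_equal. apply fl_iff.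
    assert (w = 0) by nra. subst w. split; intros; lra. }
  set (r := v / w). set (b := u - r * v - w * P). set (c := 0 - r * u - w * Q).
  assert (Hw0 : w <> 0) by nra.
  rewrite (den_lin_np _ _ _ z) by tauto. unfold one_of at 1.
  rewrite (den_lin_np _ _ _ z) by tauto. unfold one_of at 1.
  rewrite den_fprog. f_equal. apply fl_iff. cbn [fsem].
  rewrite (kroot_le _ _ _ z), (kroot_eq _ _ _ z) by tauto.
  aden_simpl. rewrite !fl_ge1.
  assert (E : b * z + c = (u + v * z + w * z * z) * (z - r)).
  { destruct H as [E _]. unfold cub in E.
    replace (b * z + c) with (b * z + c + w * (z * z * z + P * z + Q)) by nra.
    unfold b, c. replace v with (r * w) by (unfold r; field; assumption). ring. }
  rewrite E. replace ((0 - b) * z + (0 - c)) with ((u + v * z + w * z * z) * (r - z)) by lra.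
  set (X := u + v * z + w * z * z).
  destruct (Rtotal_order z r) as [Hz|[Hz|Hz]].
  - nra.
  - subst z. fold X. split; [intros [Y|[Y|Y]]; lra|]. intros Y. left. split; [reflexivity|exact Y].
  - nra.
Qed.

(* The power [(b0 + b1 z) ^ n] at a root [z] of the cubic, as [u + v z + w z^2]. *)
Definition modpow {V} (g : glob V) (P Q b0 b1 n : V) : prog V :=
  For #(gW g) 1 0 0 #n #(gT g) (fun u v w m t =>
    Let (#t / (1 + 1)) (fun h => Let (#v * #w + #w * #v) (fun c3 => Let (#w * #w) (fun c4 =>
    Let (#u * #u - #Q * #c3) (fun u' =>
    Let (#u * #v + #v * #u - #P * #c3 - #Q * #c4) (fun v' =>
    Let (#u * #w + #v * #v + #w * #u - #P * #c4) (fun w' =>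
      If #h #m
        (Ret (#u' * #b0 - #Q * (#w' * #b1)) (#v' * #b0 + #u' * #b1 - #P * (#w' * #b1))
             (#w' * #b0 + #v' * #b1) (#m - #h) #h)
        (Ret #u' #v' #w' #m #h)))))))).

Lemma den_modpow g w n P Q b0 b1 N z : glob_ok g w n -> (N < 2 ^ w)%nat -> cub P Q z = 0 ->
  exists u v w m t, den (modpow g P Q b0 b1 (INR N)) = (u, v, w, m, t) /\
    u + v * z + w * z * z = (b0 + b1 * z) ^ N.
Proof.
  intros (HW & HT & _) HN Hz. unfold cub in Hz. unfold modpow.
  match goal with |- context [den (For ?z1 ?z2 ?z3 ?z4 ?z5 ?z6 ?z7)] =>
    pose proof (den_For (fun i s => exists q m u v w', (N = q * 2 ^ (w - i) + m)%nat /\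
      (m < 2 ^ (w - i))%nat /\ s = (u, v, w', INR m, 2 ^ (w - i)) /\
      u + v * z + w' * z * z = (b0 + b1 * z) ^ q) w z1 z2 z3 z4 z5 z6 z7) as I1;
    set (D1 := den (For z1 z2 z3 z4 z5 z6 z7)) in * end.
  destruct I1 as (q & m & u & v & w' & E & Hm & Es & EV).
  - exact HW.
  - exists 0%nat, N, 1, 0, 0. rewrite Nat.sub_0_r. split; [lia|]. split; [exact HN|].
    rewrite HT. split; [reflexivity|]. ring.
  - intros i a b c d e Hi (q & m & u & v & w' & E & Hm & Es & EV). injection Es as -> -> -> -> ->.
    cbn [den]. aden_simpl.
    replace (w - i)%nat with (S (w - S i)) in * by lia.
    set (h := (w - S i)%nat) in *.
    replace (2 ^ S h / (1 + 1)) with (2 ^ h) by (simpl; lra).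
    rewrite Nat.pow_succ_r' in E, Hm.
    assert (Eh : INR (2 ^ h) = 2 ^ h) by (rewrite pow_INR; f_equal; simpl; lra).
    set (u' := u * u - Q * (v * w' + w' * v)).
    set (v' := u * v + v * u - P * (v * w' + w' * v) - Q * (w' * w')).
    set (w2 := u * w' + v * v + w' * u - P * (w' * w')).
    assert (EV' : u' + v' * z + w2 * z * z = (b0 + b1 * z) ^ (q * 2)).
    { rewrite pow_mult. rewrite <- EV. unfold u', v', w2.
      set (k := z * z * z + P * z + Q) in Hz.
      apply Rminus_diag_uniq.
      (* The two sides differ by an explicit multiple of the cubic. *)
      match goal with |- ?l = 0 => replace l with (- (v * w' + w' * v + w' * w' * z) * k)
        by (unfold k; ring) end. rewrite Hz. ring. }
    destruct (Rle_dec (2 ^ h) (INR m)) as [Hle|Hgt].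
    + rewrite <- Eh in Hle. apply INR_le in Hle.
      exists (q * 2 + 1)%nat, (m - 2 ^ h)%nat. do 3 eexists. split; [lia|]. split; [lia|].
      rewrite minus_INR, Eh by lia. split; [reflexivity|].
      rewrite pow_add, <- EV'. set (k := z * z * z + P * z + Q) in Hz.
      apply Rminus_diag_uniq.
      match goal with |- ?l = 0 => replace l with (- (w2 * b1) * k) by (unfold k; ring) end.
      rewrite Hz. ring.
    + rewrite <- Eh in Hgt. assert (m < 2 ^ h)%nat.
      { destruct (Nat.lt_ge_cases m (2 ^ h)); [assumption|]. exfalso. apply Hgt, le_INR. assumption. }
      exists (q * 2)%nat, m. do 3 eexists. split; [lia|]. split; [lia|].
      split; [reflexivity|]. exact EV'.
  - rewrite Es, Nat.sub_diag. do 5 eexists. split; [reflexivity|].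
    rewrite Nat.sub_diag in E, Hm. simpl in E, Hm. replace N with q by lia. exact EV.
Qed.

Definition qmul {V} (P Q u1 v1 w1 u2 v2 w2 : V) : prog V :=
  Let (#v1 * #w2 + #w1 * #v2) (fun c3 => Let (#w1 * #w2) (fun c4 =>
    Ret (#u1 * #u2 - #Q * #c3) (#u1 * #v2 + #v1 * #u2 - #P * #c3 - #Q * #c4)
        (#u1 * #w2 + #v1 * #v2 + #w1 * #u2 - #P * #c4) 0 0)).

Lemma den_qmul P Q u1 v1 w1 u2 v2 w2 z : cub P Q z = 0 ->
  exists u v w, den (qmul P Q u1 v1 w1 u2 v2 w2) = (u, v, w, 0, 0) /\
    u + v * z + w * z * z = (u1 + v1 * z + w1 * z * z) * (u2 + v2 * z + w2 * z * z).
Proof.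
  intros Hz. unfold cub in Hz. unfold qmul. cbn [den]. aden_simpl.
  do 3 eexists. split; [reflexivity|].
  set (k := z * z * z + P * z + Q) in Hz.
  apply Rminus_diag_uniq.
  match goal with |- ?l = 0 =>
    replace l with (- (v1 * w2 + w1 * v2 + w1 * w2 * z) * k) by (unfold k; ring) end.
  rewrite Hz. ring.
Qed.

(** Negative powers would require inverses modulo the cubic; they are moved to the other side of the
    inequality instead. *)
Definition split_sign {V} (q : V) : prog V :=
  If 0 #q (Ret #q 0 0 0 0) (Ret 0 (0 - #q) 0 0 0).

Lemma den_split_sign w q : small_int w q -> exists N M, (N < 2 ^ w)%nat /\ (M < 2 ^ w)%nat /\
  den (split_sign q) = (INR N, INR M, 0, 0, 0) /\ q = INR N - INR M.
Proof.
  intros Hq. destruct (small_int_nat _ _ Hq) as (N & HN & _ & H1 & H2).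
  assert (H0 : (0 < 2 ^ w)%nat) by lia.
  unfold split_sign. cbn [den]. aden_simpl. destruct (Rle_dec 0 q) as [Hle|Hgt].
  - exists N, 0%nat. rewrite <- (H1 Hle). simpl.
    repeat split; trivial. ring.
  - exists 0%nat, N. rewrite <- H2 by lra. simpl.
    split; [assumption|]. split; [assumption|]. split; [|ring].
    apply (f_equal (fun x => (0, x, 0, 0, 0))). ring.
Qed.

(** Cleared of denominators, the inequality reads [T1^n1 T2^n2 - M T1^m1 T2^m2 <= 0], and modulo the
    cubic the left-hand side is a quadratic form in the root. *)
Definition box_test {V} (g : glob V) (mid : bool) (P Q b0 b1 d0 d1 q1 q2 M : V) : prog V :=
  Bind (split_sign q1) (fun n1 m1 _ _ _ => Bind (split_sign q2) (fun n2 m2 _ _ _ =>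
  Bind (modpow g P Q b0 b1 n1) (fun u1 v1 w1 _ _ =>
  Bind (modpow g P Q d0 d1 n2) (fun u2 v2 w2 _ _ =>
  Bind (modpow g P Q b0 b1 m1) (fun u3 v3 w3 _ _ =>
  Bind (modpow g P Q d0 d1 m2) (fun u4 v4 w4 _ _ =>
  Bind (qmul P Q u1 v1 w1 u2 v2 w2) (fun u5 v5 w5 _ _ =>
  Bind (qmul P Q u3 v3 w3 u4 v4 w4) (fun u6 v6 w6 _ _ =>
  Let (#u5 - #M * #u6) (fun u => Let (#v5 - #M * #v6) (fun v => Let (#w5 - #M * #w6) (fun w =>
  quad_np mid P Q u v w))))))))))).

Lemma Rpower_split T N M : 0 < T -> Rpower T (INR N - INR M) = T ^ N / T ^ M.
Proof.
  intros H. unfold Rminus. rewrite Rpower_plus, Rpower_Ropp, !Rpower_pow by lra. reflexivity.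
Qed.

Lemma den_box_test g w n mid P Q z b0 b1 d0 d1 q1 q2 M :
  glob_ok g w n -> kroot mid P Q z -> small_int w q1 -> small_int w q2 ->
  0 < b0 + b1 * z -> 0 < d0 + d1 * z ->
  den (box_test g mid P Q b0 b1 d0 d1 q1 q2 M) =
  one_of (fl (Rpower (b0 + b1 * z) q1 * Rpower (d0 + d1 * z) q2 <= M)).
Proof.
  intros Hg HK Hq1 Hq2 HT1 HT2. pose proof (proj1 HK) as Hz.
  destruct (den_split_sign _ _ Hq1) as (n1 & m1 & B1 & B1' & E1 & ->).
  destruct (den_split_sign _ _ Hq2) as (n2 & m2 & B2 & B2' & E2 & ->).
  unfold box_test. cbn [den]. rewrite E1, E2.
  destruct (den_modpow g w n P Q b0 b1 n1 z Hg B1 Hz) as (u1 & v1 & w1 & x1 & y1 & F1 & G1).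
  destruct (den_modpow g w n P Q d0 d1 n2 z Hg B2 Hz) as (u2 & v2 & w2 & x2 & y2 & F2 & G2).
  destruct (den_modpow g w n P Q b0 b1 m1 z Hg B1' Hz) as (u3 & v3 & w3 & x3 & y3 & F3 & G3).
  destruct (den_modpow g w n P Q d0 d1 m2 z Hg B2' Hz) as (u4 & v4 & w4 & x4 & y4 & F4 & G4).
  rewrite F1, F2, F3, F4.
  destruct (den_qmul P Q u1 v1 w1 u2 v2 w2 z Hz) as (u5 & v5 & w5 & F5 & G5).
  destruct (den_qmul P Q u3 v3 w3 u4 v4 w4 z Hz) as (u6 & v6 & w6 & F6 & G6).
  rewrite F5, F6. rewrite (den_quad_np _ _ _ z) by tauto. aden_simpl. f_equal. apply fl_iff.
  rewrite !Rpower_split by lra.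
  set (T1 := b0 + b1 * z) in *. set (T2 := d0 + d1 * z) in *.
  rewrite G1, G2 in G5. rewrite G3, G4 in G6.
  replace (u5 - M * u6 + (v5 - M * v6) * z + (w5 - M * w6) * z * z)
    with ((u5 + v5 * z + w5 * z * z) - M * (u6 + v6 * z + w6 * z * z)) by ring.
  rewrite G5, G6.
  assert (P1 : 0 < T1 ^ m1) by now apply pow_lt. assert (P2 : 0 < T2 ^ m2) by now apply pow_lt.
  assert (P3 : 0 < T1 ^ m1 * T2 ^ m2) by nra.
  replace (T1 ^ n1 / T1 ^ m1 * (T2 ^ n2 / T2 ^ m2))
    with ((T1 ^ n1 * T2 ^ n2) / (T1 ^ m1 * T2 ^ m2)) by (field; split; lra).
  set (Y := T1 ^ m1 * T2 ^ m2) in *.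
  split; intros H.
  - apply Rmult_le_reg_r with Y; [exact P3|]. unfold Rdiv. rewrite Rmult_assoc, Rinv_l by lra. lra.
  - apply Rmult_le_compat_r with (r := Y) in H; [|lra].
    unfold Rdiv in H. rewrite Rmult_assoc, Rinv_l in H by lra. lra.
Qed.

(** A [k]-th root as the zero of the increasing function [B y^k - 1], with [1 / B] the radicand. *)
Definition root_val {V} (g : glob V) (t1 t2 q1 q2 k ep : V) : prog V :=
  Bind (zpow g t1 q1) (fun u _ _ _ _ => Bind (zpow g t2 q2) (fun v _ _ _ _ =>
  Let (1 / (#u * #v)) (fun B => Let 0 (fun z => Let (0 - 1) (fun c =>
    solve g (Poly3 z z B k c) z ep))))).

Lemma den_root_val g w n t1 t2 q1 q2 k ep :
  glob_ok g w n -> 0 < t1 -> 0 < t2 -> small_int w q1 -> small_int w q2 ->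
  small_int w k -> 1 <= k -> 2 * k <= 2 ^ w -> 0 < ep ->
  let x := exp ((q1 * ln t1 + q2 * ln t2) / k) in
  x <= ep / 2 * 2 ^ fib (S n) ->
  exists y, den (root_val g t1 t2 q1 q2 k ep) = one_of y /\ x <= y <= x + ep.
Proof.
  intros Hg H1 H2 Hq1 Hq2 Hk Hk1 Hkw Hep x Hx. unfold root_val. cbn [den].
  rewrite (den_zpow _ _ _ _ _ Hg H1 Hq1). unfold one_of at 1.
  rewrite (den_zpow _ _ _ _ _ Hg H2 Hq2). unfold one_of at 1. aden_simpl.
  pose proof (Rpower_pos t1 q1) as P1. pose proof (Rpower_pos t2 q2) as P2.
  assert (Px : 0 < x) by apply exp_pos.
  assert (Ex : 1 / (Rpower t1 q1 * Rpower t2 q2) * Rpower x k = 1).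
  { unfold x. unfold Rpower at 3. rewrite ln_exp.
    replace (k * ((q1 * ln t1 + q2 * ln t2) / k)) with (q1 * ln t1 + q2 * ln t2) by (field; lra).
    rewrite exp_plus. fold (Rpower t1 q1) (Rpower t2 q2). field. lra. }
  destruct (binomial_root w (1 / (Rpower t1 q1 * Rpower t2 q2)) k x) as [Hok Hroot]; trivial.
  { apply Rdiv_lt_0_compat; [lra|nra]. }
  apply (den_solve _ w n _ 0 x); trivial; lra.
Qed.

Definition fiblog {V} (x : V) : prog V :=
  Loop #x 0%A (1 + 1)%A 1%A 0%A 0%A (fun _ G _ _ _ => #G%A) (fun _ _ _ _ _ => #x%A)
    (fun n G H _ _ => Ret (#n + 1) (#G * #H) #G 0 0).

Lemma loopd_ind' (I : nat -> tup -> Prop) N c1 c2 f s :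
  I O s -> (forall i s, c1 s <= c2 s -> I i s -> I (S i) (f s)) ->
  exists n, (n <= N)%nat /\ I n (loopd N c1 c2 f s) /\
    (n = N \/ ~ c1 (loopd N c1 c2 f s) <= c2 (loopd N c1 c2 f s)).
Proof.
  revert I s. induction N as [|N IH]; intros I s H0 HS; simpl.
  { exists 0%nat. auto. }
  destruct (Rle_dec (c1 s) (c2 s)) as [Hle|Hgt].
  - destruct (IH (fun i => I (S i)) (f s)) as (n & Hn & HI & HE).
    + now apply HS.
    + intros i s' H1 H2. now apply HS.
    + exists (S n). split; [lia|]. split; [exact HI|]. destruct HE; [left; lia|right; assumption].
  - exists 0%nat. split; [lia|]. split; [exact H0|]. right. exact Hgt.
Qed.

Lemma fib_ge n : (n <= fib (S n))%nat.
Proof.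
  enough (H : (n <= fib (S n) /\ S n <= fib (S (S n)) /\ 1 <= fib (S n))%nat) by apply H.
  induction n as [|n (H1 & H2 & H3)]; [simpl; lia|].
  rewrite (fib_SS (S n)). lia.
Qed.

(** Should the counter run out first, then [n] is the integral part of [x], and
    [x < n + 1 <= 2 ^ n <= 2 ^ fib (S n)] holds as well. So the generous bound [x] on the number of
    passes does no harm. *)
Lemma den_fiblog x : 2 <= x ->
  exists n, den (fiblog x) = (INR n, 2 ^ fib (S n), 2 ^ fib n, 0, 0) /\
    x <= 2 ^ fib (S n) /\ 2 ^ fib n <= x.
Proof.
  intros Hx. unfold fiblog. cbn [den]. cbn [aden].
  match goal with |- context [loopd ?N ?c1 ?c2 ?f ?s0] =>
    destruct (loopd_ind' (fun i s => s = (INR i, 2 ^ fib (S i), 2 ^ fib i, 0, 0) /\ 2 ^ fib i <= x)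
      N c1 c2 f s0) as (n & Hn & [E HE] & HX) end.
  - split; [simpl; replace (2 * 1) with (1 + 1) by ring; reflexivity|simpl; lra].
  - intros i s Hle [-> _]. split; [|exact Hle].
    rewrite S_INR, fib_SS, pow_add. reflexivity.
  - exists n. split; [exact E|]. split; [|exact HE]. rewrite E in HX.
    destruct HX as [HX|HX]; [|lra].
    apply Rle_trans with (2 ^ n).
    + assert (x < INR n + 1).
      { subst n. unfold nfl. destruct (base_Int_part x) as [A1 A2].
        assert (0 <= Int_part x)%Z by (apply le_IZR; assert (-1 < IZR (Int_part x)) by lra;
          apply lt_IZR in H; apply IZR_le; lia).
        rewrite INR_IZR_INZ, Z2Nat.id by lia. lra. }
      apply Rle_trans with (INR n + 1); [lra|]. clear.
      induction n as [|n IH]; [simpl; lra|]. rewrite S_INR. simpl. pose proof (pow2_ge1 n). lra.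
    + apply Rle_pow; [lra|]. apply fib_ge.
Qed.

(** * Cost *)

(** As a relation with rules for each construct, it lets unification build up the bound along a
    program, to be compared with a round number only at the end. *)
Definition cb (p : prog R) (n : nat) : Prop := (cost p <= n)%nat.

Lemma cb_Ret a1 a2 a3 a4 a5 n : (asz a1 + asz a2 + asz a3 + asz a4 + asz a5)%nat = n ->
  cb (Ret a1 a2 a3 a4 a5) n.
Proof. intros <-. apply le_n. Qed.

Lemma cb_Let a k m n : (forall x, cb (k x) n) -> asz a = m -> cb (Let a k) (m + n + 5).
Proof. intros H <-. unfold cb in *. cbn [cost]. specialize (H (aden a)). lia. Qed.

Lemma cb_Bind p k m n : cb p m -> (forall a b c d e, cb (k a b c d e) n) ->
  cb (Bind p k) (m + n + 5).
Proof.
  intros Hp Hk. unfold cb in *. cbn [cost]. destruct (den p) as [[[[a b] c] d] e].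
  specialize (Hk a b c d e). lia.
Qed.

Lemma cb_If a b p q z m n : cb p m -> cb q n -> (asz a + asz b)%nat = z ->
  cb (If a b p q) (z + 2 + m + n).
Proof. intros Hp Hq <-. unfold cb in *. cbn [cost]. destruct (Rle_dec _ _); lia. Qed.

Lemma loopc_le N c1 c2 f z1 z2 w s n : (forall s, (z1 s + z2 s + w s <= n)%nat) ->
  (loopc N c1 c2 f z1 z2 w s <= N * (11 + n) + 4 + n)%nat.
Proof.
  intros H. revert s. induction N as [|N IH]; intros s; simpl; [lia|].
  specialize (H s). destruct (Rle_dec _ _); [specialize (IH (f s))|]; lia.
Qed.

Lemma cb_For N a a1 a2 a3 a4 a5 body n z :
  aden a = INR N -> (forall a b c d e, cb (body a b c d e) n) ->
  (asz a + asz a1 + asz a2 + asz a3 + asz a4 + asz a5)%nat = z ->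
  cb (For a a1 a2 a3 a4 a5 body) (z + N * (13 + n) + 11 + n).
Proof.
  intros Ha Hb <-. unfold cb in *. unfold For. cbn [cost]. rewrite Ha, nfl_INR.
  match goal with |- context [loopc ?N ?c1 ?c2 ?f ?z1 ?z2 ?w ?s] =>
    pose proof (loopc_le N c1 c2 f z1 z2 w s (2 + n)) as HL end.
  match type of HL with ?A -> _ => assert A as HA end.
  { intros [[[[x1 x2] x3] x4] x5]. specialize (Hb x1 x2 x3 x4 x5). simpl. lia. }
  specialize (HL HA). lia.
Qed.

Lemma cb_le p m n : cb p m -> (m <= n)%nat -> cb p n.
Proof. unfold cb. lia. Qed.

Ltac cb_step :=
  match goal with
  | |- cb (Ret1 _) _ => eapply cb_Ret; cbv [asz Nat.add cub_e cub1_e]; reflexivity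
  | |- cb (Ret _ _ _ _ _) _ => eapply cb_Ret; cbv [asz Nat.add cub_e cub1_e]; reflexivity
  | |- cb (Let _ _) _ => eapply cb_Let; [intros ?|cbv [asz Nat.add cub_e cub1_e]; reflexivity]
  | |- cb (Bind _ _) _ => eapply cb_Bind; [|intros ? ? ? ? ?]
  | |- cb (If _ _ _ _) _ => eapply cb_If; [| |cbv [asz Nat.add cub_e cub1_e]; reflexivity]
  | |- cb (For _ _ _ _ _ _ _) _ => eapply cb_For; [cbn [aden]; eassumption|intros ? ? ? ? ?|cbv [asz Nat.add cub_e cub1_e]; reflexivity]
  | |- cb (fprog _) _ => cbn [fprog root_le root_eq FLt FEq]
  end.
Ltac cb_go := eapply cb_le; [repeat cb_step|].

Lemma cb_pow g x n w : gW g = INR w -> cb (pow_m g x n) (100 * (w + 1)).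
Proof. intros H. unfold pow_m. cb_go. lia. Qed.

Ltac cb_step2 := first [cb_step | eapply cb_pow; eassumption].
Ltac cb_go2 := eapply cb_le; [repeat cb_step2|].

Lemma cb_zpow g x n w : gW g = INR w -> cb (zpow g x n) (300 * (w + 1)).
Proof. intros H. unfold zpow. cb_go2. lia. Qed.

Lemma cb_ev g f y w : gW g = INR w -> cb (ev g f y) (700 * (w + 1)).
Proof.
  intros H. unfold ev. eapply cb_le; [repeat first [cb_step | eapply cb_zpow; eassumption]|]. lia.
Qed.

Lemma cb_solve g f o ep w n : gW g = INR w -> gK g = INR n ->
  cb (solve g f o ep) (4000 * ((w + 1) * (w + n + 1))).
Proof.
  intros Hw Hn. unfold solve.
  eapply cb_le; [repeat first [cb_step | eapply cb_ev; eassumption]|]. nia.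
Qed.

Lemma cb_lr g f ep w n : gW g = INR w -> gK g = INR n ->
  cb (lr g f ep) (100 * 200 * ((w + 1) * (w + n + 1))).
Proof.
  intros Hw Hn. unfold lr.
  eapply cb_le; [repeat first [cb_step | eapply cb_solve; eassumption]|].
  lia.
Qed.

Lemma cb_lin_np mid P Q b c : cb (lin_np mid P Q b c) 3000.
Proof. unfold lin_np. destruct mid; cb_go; lia. Qed.

Lemma cb_quad_np mid P Q u v w : cb (quad_np mid P Q u v w) (100 * 150).
Proof.
  unfold quad_np. destruct mid.
  - eapply cb_le; [repeat first [cb_step | eapply cb_lin_np]|]. lia.
  - eapply cb_le; [repeat first [cb_step | eapply cb_lin_np]|]. lia.
Qed.

Lemma cb_modpow g P Q b0 b1 n w : gW g = INR w -> cb (modpow g P Q b0 b1 n) (300 * (w + 1)).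
Proof. intros H. unfold modpow. cb_go. lia. Qed.

Lemma cb_box_test g mid P Q b0 b1 d0 d1 q1 q2 M w : gW g = INR w ->
  cb (box_test g mid P Q b0 b1 d0 d1 q1 q2 M) (100 * 400 * (w + 1)).
Proof.
  intros H. unfold box_test, qmul, split_sign.
  eapply cb_le; [repeat first [cb_step | eapply cb_modpow; eassumption | eapply cb_quad_np]|]. lia.
Qed.

Lemma cb_root_val g t1 t2 q1 q2 k ep w n : gW g = INR w -> gK g = INR n ->
  cb (root_val g t1 t2 q1 q2 k ep) ((100 * 50) * (w + 1) * (w + n + 1)).
Proof.
  intros Hw Hn. unfold root_val.
  eapply cb_le; [repeat first [cb_step | eapply cb_zpow; eassumption | eapply cb_solve; eassumption]|].
  lia.
Qed.

(** The cost is linear in the number of passes made, which the first component counts, and not in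
    the bound [x]. *)
Lemma cb_fiblog x n : den (fiblog x) = (INR n, 2 ^ fib (S n), 2 ^ fib n, 0, 0) ->
  cb (fiblog x) (30 * (n + 1)).
Proof.
  unfold cb, fiblog. cbn [den cost]. intros E.
  match type of E with loopd ?N ?c1 ?c2 ?f ?s = _ =>
    match goal with |- context [loopc N c1 c2 f ?z1 ?z2 ?w s] =>
      assert (H : forall M i s', fst (fst (fst (fst s'))) = INR i ->
        exists j, fst (fst (fst (fst (loopd M c1 c2 f s')))) = INR j /\
          (i <= j)%nat /\ (loopc M c1 c2 f z1 z2 w s' <= (j - i) * 30 + 10)%nat);
      [|destruct (H N 0%nat s eq_refl) as (j & Ej & _ & Hj)] end end.
  - induction M as [|M IH]; intros i [[[[x1 x2] x3] x4] x5] Hi; cbn [loopd loopc fst] in *.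
    + exists i. split; [exact Hi|]. split; lia.
    + destruct (Rle_dec _ _).
      * match goal with |- context [loopd M _ _ _ ?y] =>
          destruct (IH (S i) y) as (j & B1 & B2 & B3) end.
        { rewrite S_INR, Hi. reflexivity. }
        exists j. split; [exact B1|]. split; [lia|].
        cbn [asz cost]. eapply Nat.le_trans; [apply Nat.add_le_mono_l; exact B3|]. lia.
      * exists i. split; [exact Hi|]. split; [lia|]. cbn [asz]. lia.
  - rewrite E in Ej. apply INR_eq in Ej. eapply Nat.le_trans; [apply Nat.add_le_mono_l; exact Hj|]. cbn [asz]. lia.
Qed.

(** * Parametricity of the programs *)

Definition geq (G : ctx) (g : glob nat) (g' : glob R) : Prop :=
  In (gW g, gW g') G /\ In (gT g, gT g') G /\ In (gK g, gK g') G /\ In (gG g, gG g') G /\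
  In (gH g, gH g') G.

Definition feq (G : ctx) (f : poly3 nat) (f' : poly3 R) : Prop :=
  In (cA f, cA f') G /\ In (cp f, cp f') G /\ In (cB f, cB f') G /\ In (ck f, ck f') G /\
  In (cC f, cC f') G.

Inductive formeq (G : ctx) : form nat -> form R -> Prop :=
| formeq_Le a b a' b' : aeq G a a' -> aeq G b b' -> formeq G (FLe a b) (FLe a' b')
| formeq_And f g f' g' : formeq G f f' -> formeq G g g' -> formeq G (FAnd f g) (FAnd f' g')
| formeq_Or f g f' g' : formeq G f f' -> formeq G g g' -> formeq G (FOr f g) (FOr f' g')
| formeq_Not f f' : formeq G f f' -> formeq G (FNot f) (FNot f').

Lemma aeq_incl G G' a a' : incl G G' -> aeq G a a' -> aeq G' a a'.
Proof. intros HI. induction 1; constructor; auto. Qed.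

Lemma geq_cons x G g g' : geq G g g' -> geq (x :: G) g g'.
Proof. unfold geq. simpl. tauto. Qed.

Lemma feq_cons x G g g' : feq G g g' -> feq (x :: G) g g'.
Proof. unfold feq. simpl. tauto. Qed.

Ltac in_ctx := first [eassumption | (left; reflexivity) | (right; in_ctx)].
Ltac geq_ctx := first [eassumption | (apply geq_cons; geq_ctx)].
Ltac feq_ctx := first [eassumption | (apply feq_cons; feq_ctx) | (repeat split; cbn [cA cp cB ck cC]; in_ctx)].

Ltac pq_unfold := unfold ext5, zero5, Ret1, For, cub_e, cub1_e, FLt, FEq in *.

Ltac pq_base :=
  match goal with
  | |- In _ _ => cbn [gW gT gK gG gH cA cp cB ck cC]; in_ctx
  | |- geq _ _ _ => geq_ctx
  | |- feq _ _ _ => feq_ctx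
  | |- aeq _ _ _ => constructor
  | |- formeq _ _ _ => constructor
  | |- peq _ (Ret _ _ _ _ _) _ => constructor
  | |- peq _ (Let _ _) _ => constructor; [|intros ? ?]
  | |- peq _ (Bind _ _) _ => constructor; [|intros ? ? ? ? ? ? ? ? ? ?; unfold ext5]
  | |- peq _ (If _ _ _ _) _ => constructor
  | |- peq _ (Loop _ _ _ _ _ _ _ _ _) _ =>
      constructor; [..|intros ? ? ? ? ? ? ? ? ? ?; unfold ext5|intros ? ? ? ? ? ? ? ? ? ?; unfold ext5
                   |intros ? ? ? ? ? ? ? ? ? ?; unfold ext5]
  end.

(** The second half of a compound formula is run below the binder of the first, so the induction has
    to range over all extensions of the context. *)
Lemma peq_fprog G f f' : formeq G f f' -> peq G (fprog f) (fprog f').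
Proof.
  intros H. enough (W : forall G f f', formeq G f f' -> forall G', incl G G' ->
    peq G' (fprog f) (fprog f')) by (intros; eapply W; [eassumption|apply incl_refl]).
  induction 1; intros G' HI; cbn [fprog]; unfold Ret1.
  - repeat pq_base; eapply aeq_incl; eassumption.
  - constructor; [now apply IHformeq1|intros; unfold ext5; constructor;
      [apply IHformeq2; repeat apply incl_tl; assumption|intros; unfold ext5; repeat pq_base]].
  - constructor; [now apply IHformeq1|intros; unfold ext5; constructor;
      [apply IHformeq2; repeat apply incl_tl; assumption|intros; unfold ext5; repeat pq_base]].
  - constructor; [now apply IHformeq|intros; unfold ext5; repeat pq_base].
Qed.

Lemma geq_In G g g' : geq G g g' -> In (gW g, gW g') G /\ In (gT g, gT g') G /\
  In (gK g, gK g') G /\ In (gG g, gG g') G /\ In (gH g, gH g') G.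
Proof. exact (fun H => H). Qed.

Lemma peq_pow G g g' x x' n n' : geq G g g' -> In (x, x') G -> In (n, n') G ->
  peq G (pow_m g x n) (pow_m g' x' n').
Proof. intros (? & ? & ? & ? & ?) ? ?. unfold pow_m. pq_unfold. repeat pq_base. Qed.

Lemma peq_zpow G g g' x x' n n' : geq G g g' -> In (x, x') G -> In (n, n') G ->
  peq G (zpow g x n) (zpow g' x' n').
Proof. intros ? ? ?. unfold zpow. pq_unfold. repeat first [apply peq_pow | pq_base]. Qed.

Lemma peq_ev G g g' f f' y y' : geq G g g' -> feq G f f' -> In (y, y') G ->
  peq G (ev g f y) (ev g' f' y').
Proof.
  intros ? (? & ? & ? & ? & ?) ?. unfold ev. pq_unfold. repeat first [apply peq_zpow | pq_base].
Qed.

Lemma peq_solve G g g' f f' o o' e e' : geq G g g' -> feq G f f' -> In (o, o') G -> In (e, e') G ->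
  peq G (solve g f o e) (solve g' f' o' e').
Proof.
  intros Hg ? ? ?. pose proof Hg as (? & ? & ? & ? & ?). unfold solve. pq_unfold.
  repeat first [apply peq_ev | pq_base].
Qed.

Lemma peq_lr G g g' f f' e e' : geq G g g' -> feq G f f' -> In (e, e') G ->
  peq G (lr g f e) (lr g' f' e').
Proof.
  intros Hg Hf ?. pose proof Hf as (? & ? & ? & ? & ?). unfold lr. pq_unfold.
  repeat first [apply peq_solve | pq_base].
Qed.

Lemma formeq_root_le G mid P P' Q Q' r r' : In (P, P') G -> In (Q, Q') G -> In (r, r') G ->
  formeq G (root_le mid P Q r) (root_le mid P' Q' r').
Proof. intros. pq_unfold. destruct mid; repeat pq_base. Qed.

Lemma formeq_root_eq G mid P P' Q Q' r r' : In (P, P') G -> In (Q, Q') G -> In (r, r') G ->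
  formeq G (root_eq mid P Q r) (root_eq mid P' Q' r').
Proof. intros. pq_unfold. destruct mid; repeat pq_base. Qed.

Lemma peq_lin_np G mid P P' Q Q' b b' c c' :
  In (P, P') G -> In (Q, Q') G -> In (b, b') G -> In (c, c') G ->
  peq G (lin_np mid P Q b c) (lin_np mid P' Q' b' c').
Proof.
  intros. unfold lin_np. pq_unfold.
  repeat first [apply peq_fprog | apply formeq_root_le | apply formeq_root_eq | pq_base].
Qed.

Lemma peq_quad_np G mid P P' Q Q' u u' v v' w w' :
  In (P, P') G -> In (Q, Q') G -> In (u, u') G -> In (v, v') G -> In (w, w') G ->
  peq G (quad_np mid P Q u v w) (quad_np mid P' Q' u' v' w').
Proof.
  intros. unfold quad_np. pq_unfold.
  repeat first [apply peq_lin_np | apply peq_fprog | apply formeq_root_le | apply formeq_root_eq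
    | pq_base].
Qed.

Lemma peq_modpow G g g' P P' Q Q' b0 b0' b1 b1' n n' : geq G g g' ->
  In (P, P') G -> In (Q, Q') G -> In (b0, b0') G -> In (b1, b1') G -> In (n, n') G ->
  peq G (modpow g P Q b0 b1 n) (modpow g' P' Q' b0' b1' n').
Proof. intros (? & ? & ? & ? & ?). intros. unfold modpow. pq_unfold. repeat pq_base. Qed.

Lemma peq_box_test G g g' mid P P' Q Q' b0 b0' b1 b1' d0 d0' d1 d1' q1 q1' q2 q2' M M' :
  geq G g g' -> In (P, P') G -> In (Q, Q') G -> In (b0, b0') G -> In (b1, b1') G ->
  In (d0, d0') G -> In (d1, d1') G -> In (q1, q1') G -> In (q2, q2') G -> In (M, M') G ->
  peq G (box_test g mid P Q b0 b1 d0 d1 q1 q2 M) (box_test g' mid P' Q' b0' b1' d0' d1' q1' q2' M').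
Proof.
  intros. unfold box_test, qmul, split_sign. pq_unfold.
  repeat first [apply peq_modpow | apply peq_quad_np | pq_base].
Qed.

Lemma peq_root_val G g g' t1 t1' t2 t2' q1 q1' q2 q2' k k' e e' :
  geq G g g' -> In (t1, t1') G -> In (t2, t2') G -> In (q1, q1') G -> In (q2, q2') G ->
  In (k, k') G -> In (e, e') G ->
  peq G (root_val g t1 t2 q1 q2 k e) (root_val g' t1' t2' q1' q2' k' e').
Proof.
  intros. unfold root_val. pq_unfold.
  repeat first [apply peq_zpow | apply peq_solve | pq_base].
Qed.

Lemma peq_fiblog G x x' : In (x, x') G -> peq G (fiblog x) (fiblog x').
Proof. intros. unfold fiblog. pq_unfold. repeat pq_base. Qed.

(** * Finite sets and roots of polynomials of degree at most three *)

Lemma close_le r r' p q : close r p q -> r <= r' -> close r' p q.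
Proof. intros [H1 H2] H. split; lra. Qed.

Lemma separate (l : list (R * R)) p : exists r, 0 < r /\ forall q, In q l -> close r p q -> q = p.
Proof.
  induction l as [|q l (r & Hr & H)].
  - exists 1. split; [lra|]. intros q [].
  - destruct (excluded_middle_informative (q = p)) as [->|Hne].
    + exists r. split; [exact Hr|]. intros q [<-|Hq]; auto.
    + destruct p as [x y], q as [x' y'].
      assert (P : exists s, 0 < s /\ ~ close s (x, y) (x', y')).
      { destruct (Req_dec x x') as [->|Hx]; [destruct (Req_dec y y') as [->|Hy]; [tauto|]|].
        - exists (Rabs (y - y')). split; [apply Rabs_pos_lt; lra|]. intros [_ H2]. simpl in H2. lra.
        - exists (Rabs (x - x')). split; [apply Rabs_pos_lt; lra|]. intros [H1 _]. simpl in H1. lra. }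
      destruct P as (s & Hs & P). exists (Rmin r s).
      split; [apply Rmin_glb_lt; assumption|]. intros q [<-|Hq] Hc.
      * exfalso. apply P. eapply close_le; [exact Hc|apply Rmin_r].
      * apply H; [exact Hq|]. eapply close_le; [exact Hc|apply Rmin_l].
Qed.

Lemma linear_roots b c : b <> 0 \/ c <> 0 -> exists l, forall t, b * t + c = 0 -> In t l.
Proof.
  intros H. exists [- c / b]. intros t Ht. left.
  destruct (Req_dec b 0) as [->|Hb]; [exfalso; lra|]. field_simplify_eq; [lra|assumption].
Qed.

Lemma quadratic_roots a b c : a <> 0 \/ b <> 0 \/ c <> 0 ->
  exists l, forall t, a * t * t + b * t + c = 0 -> In t l.
Proof.
  intros H. destruct (classic (exists r, a * r * r + b * r + c = 0)) as [[r Hr]|Hn].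
  - destruct (linear_roots a (b + a * r)) as [l Hl].
    { nra. }
    exists (r :: l). intros t Ht. destruct (Req_dec t r) as [->|Hne]; [now left|]. right. apply Hl.
    apply Rmult_eq_reg_l with (t - r); [|lra]. lra.
  - exists []. intros t Ht. apply Hn. now exists t.
Qed.

Lemma cubic_roots a b c d : a <> 0 \/ b <> 0 \/ c <> 0 \/ d <> 0 ->
  exists l, forall t, a * t * t * t + b * t * t + c * t + d = 0 -> In t l.
Proof.
  intros H. destruct (classic (exists r, a * r * r * r + b * r * r + c * r + d = 0)) as [[r Hr]|Hn].
  - destruct (quadratic_roots a (b + a * r) (c + b * r + a * r * r)) as [l Hl].
    { nra. }
    exists (r :: l). intros t Ht. destruct (Req_dec t r) as [->|Hne]; [now left|]. right. apply Hl.
    apply Rmult_eq_reg_l with (t - r); [|lra]. lra.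
  - exists []. intros t Ht. apply Hn. now exists t.
Qed.

Lemma ffact_small n i : (n < i)%nat -> ffact n i = 0%nat.
Proof.
  induction i as [|i IH]; intros H; [lia|]. simpl. destruct (Nat.lt_ge_cases n i).
  - lia.
  - lia.
Qed.

(** The truncated subtraction in the exponents of [tri_d] is harmless: wherever it truncates, the
    falling factorial vanishes. *)
Lemma ffact_pow n i x : INR (ffact n i) * x ^ (n - i) * x ^ i = INR (ffact n i) * x ^ n.
Proof.
  destruct (Nat.lt_ge_cases n i).
  - rewrite ffact_small by lia. simpl. ring.
  - rewrite Rmult_assoc, <- pow_add. do 2 f_equal. lia.
Qed.

Lemma ffact1 n : INR (ffact n 1) = INR n.
Proof. simpl ffact. f_equal. lia. Qed.

Lemma ffact2 n : INR (ffact n 2) = INR n * (INR n - 1).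
Proof.
  change (ffact n 2) with (1 * (n - 0) * (n - 1))%nat. destruct n as [|n].
  - change (1 * (0 - 0) * (0 - 1))%nat with 0%nat. change (INR 0) with 0. ring.
  - replace (1 * (S n - 0) * (S n - 1))%nat with (S n * n)%nat by lia.
    rewrite mult_INR, S_INR. ring.
Qed.

Lemma pow_exp_ln x n : 0 < x -> x ^ n = exp (INR n * ln x).
Proof. intros H. rewrite <- (Rpower_pow n x H). reflexivity. Qed.

(** * Special points of the curve *)

Definition finite_in (S : R * R -> Prop) (D : R * R -> Prop) : Prop :=
  exists l, forall p, S p -> D p -> In p l.

Definition pos_pt (p : R * R) : Prop := 0 < fst p /\ 0 < snd p.

Lemma finite_isolated (S D : R * R -> Prop) p r :
  finite_in S D -> S p -> 0 < r -> (forall q, close r p q -> S q -> D q \/ q = p) ->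
  isolated_in S p.
Proof.
  intros [l Hl] HS Hr HD. split; [exact HS|]. destruct (separate l p) as (r' & Hr' & H).
  exists (Rmin r r'). split; [now apply Rmin_glb_lt|]. intros q Hq Hc.
  assert (H1 : close r p q) by (eapply close_le; [exact Hc|apply Rmin_l]).
  assert (H2 : close r' p q) by (eapply close_le; [exact Hc|apply Rmin_r]).
  destruct (HD q H1 Hq); [apply H; [apply Hl; assumption|assumption]|assumption].
Qed.

Lemma close_pos p : pos_pt p -> exists r, 0 < r /\ forall q, close r p q -> pos_pt q.
Proof.
  intros [Hx Hy]. exists (Rmin (fst p) (snd p)). split; [now apply Rmin_glb_lt|].
  intros q [H1 H2]. apply Rabs_def2 in H1, H2.
  pose proof (Rmin_l (fst p) (snd p)). pose proof (Rmin_r (fst p) (snd p)). split; lra.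
Qed.

Lemma pos_isolated (S : R * R -> Prop) p : finite_in S pos_pt -> pos_pt p -> S p -> isolated_in S p.
Proof.
  intros HF Hp HS. destruct (close_pos p Hp) as (r & Hr & H).
  apply (finite_isolated S pos_pt p r); auto.
Qed.

Lemma small_step dx dy r : 0 < r -> exists s0, 0 < s0 /\ forall s, 0 < s < s0 ->
  Rabs (s * dx) < r /\ Rabs (s * dy) < r.
Proof.
  intros Hr. pose proof (Rabs_pos dx) as P1. pose proof (Rabs_pos dy) as P2.
  set (m := Rabs dx + Rabs dy + 1). assert (Hm : 0 < m) by (unfold m; lra).
  exists (r / m). split; [now apply Rdiv_lt_0_compat|]. intros s [H1 H2].
  assert (H3 : s * m < r).
  { apply Rmult_lt_compat_r with (r := m) in H2; [|assumption].
    unfold Rdiv in H2. rewrite Rmult_assoc, Rinv_l in H2 by lra. lra. }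
  rewrite !Rabs_mult, (Rabs_right s) by lra. unfold m in H3. split; nra.
Qed.

Lemma not_isolated_dir (S : R * R -> Prop) x y dx dy s0 :
  dx <> 0 \/ dy <> 0 -> 0 < s0 -> (forall s, 0 < s < s0 -> S (x + s * dx, y + s * dy)) ->
  ~ isolated_in S (x, y).
Proof.
  intros Hd Hs0 HS [_ (r & Hr & H)]. destruct (small_step dx dy r Hr) as (s1 & Hs1 & Hsm).
  set (s := Rmin s0 s1 / 2).
  assert (0 < Rmin s0 s1) by now apply Rmin_glb_lt.
  pose proof (Rmin_l s0 s1). pose proof (Rmin_r s0 s1).
  assert (Hs : 0 < s /\ s < s0 /\ s < s1) by (unfold s; lra).
  assert (E : (x + s * dx, y + s * dy) = (x, y)).
  { apply H; [apply HS; lra|]. destruct (Hsm s) as [Q1 Q2]; [lra|]. split; simpl.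
    - replace (x - (x + s * dx)) with (- (s * dx)) by ring. now rewrite Rabs_Ropp.
    - replace (y - (y + s * dy)) with (- (s * dy)) by ring. now rewrite Rabs_Ropp. }
  injection E as E1 E2. destruct Hd as [Hd|Hd]; apply Hd.
  - nra.
  - nra.
Qed.

Lemma not_isolated_near (S : R * R -> Prop) p :
  (forall r, 0 < r -> exists q, S q /\ close r p q /\ q <> p) -> ~ isolated_in S p.
Proof.
  intros H [_ (r & Hr & HI)]. destruct (H r Hr) as (q & Hq & Hc & Hne). now apply Hne, HI.
Qed.

Lemma exp_small k x r : 0 < r -> exists s0, 0 < s0 /\ forall s, Rabs s < s0 ->
  Rabs (x * exp (k * s) - x) < r.
Proof.
  intros Hr.
  assert (HC : continuity_pt (fun s => x * exp (k * s)) 0) by reg.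
  destruct (HC r Hr) as (d & Hd & H). exists d. split; [exact Hd|]. intros s Hs.
  destruct (Req_dec s 0) as [->|Hs0].
  - rewrite Rmult_0_r, exp_0. replace (x * 1 - x) with 0 by ring. now rewrite Rabs_R0.
  - simpl in H. unfold Rdist in H.
    rewrite Rmult_0_r, exp_0, Rmult_1_r in H. apply H. split.
    + split; [exact I|auto].
    + now rewrite Rminus_0_r.
Qed.

(** * The curve in the open quadrant *)

Section Curve.

Variables (c : nat -> R) (ea eb : nat -> nat) (Rb : R).
Hypothesis Htri : is_trinomial c ea eb.
Hypothesis HRb : 0 < Rb.

Notation f := (tri_d c ea eb).
Notation a := (fun t => INR (ea t)).
Notation b := (fun t => INR (eb t)).

Definition mono (t : nat) (x y : R) : R := c t * x ^ ea t * y ^ eb t.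

Definition sum3 (F : nat -> R) : R := F 0%nat + F 1%nat + F 2%nat.

(** In the quadrant a partial derivative is multiplied by the matching powers of [x] and [y]: its
    effect on each monomial is then a factor polynomial in the exponents. *)
Definition M0 x y : R := sum3 (fun t => mono t x y).
Definition Ma x y : R := sum3 (fun t => a t * mono t x y).
Definition Mb x y : R := sum3 (fun t => b t * mono t x y).
Definition Maa x y : R := sum3 (fun t => a t * (a t - 1) * mono t x y).
Definition Mab x y : R := sum3 (fun t => a t * b t * mono t x y).
Definition Mbb x y : R := sum3 (fun t => b t * (b t - 1) * mono t x y).

Lemma tri_d_scaled i j x y :
  x ^ i * y ^ j * f i j x y =
  sum3 (fun t => INR (ffact (ea t) i) * INR (ffact (eb t) j) * mono t x y).
Proof.
  unfold tri_d, sum3, mono. simpl sum_f_R0.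
  assert (T : forall t, x ^ i * y ^ j *
      (c t * INR (ffact (ea t) i) * INR (ffact (eb t) j) * x ^ (ea t - i) * y ^ (eb t - j))
    = INR (ffact (ea t) i) * INR (ffact (eb t) j) * (c t * x ^ ea t * y ^ eb t)).
  { intros t.
    replace (x ^ i * y ^ j *
      (c t * INR (ffact (ea t) i) * INR (ffact (eb t) j) * x ^ (ea t - i) * y ^ (eb t - j)))
      with (c t * (INR (ffact (ea t) i) * x ^ (ea t - i) * x ^ i) *
        (INR (ffact (eb t) j) * y ^ (eb t - j) * y ^ j)) by ring.
    rewrite !ffact_pow. ring. }
  rewrite !Rmult_plus_distr_l, !T. reflexivity.
Qed.

Lemma f00 x y : f 0 0 x y = M0 x y.
Proof.
  pose proof (tri_d_scaled 0 0 x y) as H. simpl in H. rewrite !Rmult_1_l in H. rewrite H.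
  unfold M0, sum3. ring.
Qed.

Lemma f10 x y : x * f 1 0 x y = Ma x y.
Proof.
  pose proof (tri_d_scaled 1 0 x y) as H. rewrite pow_1, pow_O, Rmult_1_r in H. rewrite H.
  unfold Ma, sum3. rewrite !ffact1. simpl (INR (ffact _ 0)). ring.
Qed.

Lemma f01 x y : y * f 0 1 x y = Mb x y.
Proof.
  pose proof (tri_d_scaled 0 1 x y) as H. rewrite pow_1, pow_O, Rmult_1_l in H. rewrite H.
  unfold Mb, sum3. rewrite !ffact1. simpl (INR (ffact _ 0)). ring.
Qed.

Lemma f20 x y : x * x * f 2 0 x y = Maa x y.
Proof.
  pose proof (tri_d_scaled 2 0 x y) as H. rewrite pow_O, Rmult_1_r in H.
  replace (x ^ 2) with (x * x) in H by ring. rewrite H.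
  unfold Maa, sum3. rewrite !ffact2. simpl (INR (ffact _ 0)). ring.
Qed.

Lemma f02 x y : y * y * f 0 2 x y = Mbb x y.
Proof.
  pose proof (tri_d_scaled 0 2 x y) as H. rewrite pow_O, Rmult_1_l in H.
  replace (y ^ 2) with (y * y) in H by ring. rewrite H.
  unfold Mbb, sum3. rewrite !ffact2. simpl (INR (ffact _ 0)). ring.
Qed.

Lemma f11 x y : x * y * f 1 1 x y = Mab x y.
Proof.
  pose proof (tri_d_scaled 1 1 x y) as H. rewrite !pow_1 in H. rewrite H.
  unfold Mab, sum3. rewrite !ffact1. ring.
Qed.

Definition box x y : Prop := 0 <= x <= Rb /\ 0 <= y <= Rb.
(** The curvature form times [x^2 y^2]. *)
Definition Hess (x y : R) : R :=
  Maa x y * Mb x y ^ 2 - 2 * Mab x y * Ma x y * Mb x y + Mbb x y * Ma x y ^ 2.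

Lemma sing_pos x y : 0 < x -> 0 < y ->
  (singular_pt c ea eb Rb (x, y) <-> box x y /\ M0 x y = 0 /\ Ma x y = 0 /\ Mb x y = 0).
Proof.
  intros Hx Hy. unfold singular_pt, on_curve, in_box, box. cbn [fst snd].
  rewrite f00, <- f10, <- f01. split.
  - nra.
  - nra.
Qed.

Lemma vtan_pos x y : 0 < x -> 0 < y ->
  (vtangent_pt c ea eb Rb (x, y) <-> box x y /\ M0 x y = 0 /\ Mb x y = 0 /\ Ma x y <> 0).
Proof.
  intros Hx Hy. unfold vtangent_pt, on_curve, in_box, box. cbn [fst snd].
  rewrite f00, <- f10, <- f01. split.
  - nra.
  - nra.
Qed.

Lemma infl_pos x y : 0 < x -> 0 < y ->
  (inflection_pt c ea eb Rb (x, y) <->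
   box x y /\ M0 x y = 0 /\ (Ma x y <> 0 \/ Mb x y <> 0) /\ Hess x y = 0).
Proof.
  intros Hx Hy. unfold inflection_pt, on_curve, in_box, box, Hess. cbn [fst snd].
  rewrite f00, <- f10, <- f01, <- f20, <- f02, <- f11.
  set (f1 := f 1 0 x y). set (f2 := f 0 1 x y).
  set (h := f 2 0 x y * f2 ^ 2 - 2 * f 1 1 x y * f1 * f2 + f 0 2 x y * f1 ^ 2).
  replace (x * x * f 2 0 x y * (y * f2) ^ 2 - 2 * (x * y * f 1 1 x y) * (x * f1) * (y * f2) +
    y * y * f 0 2 x y * (x * f1) ^ 2) with (x * x * (y * y) * h) by (unfold h; ring).
  assert (Hxy : 0 < x * x * (y * y)) by (apply Rmult_lt_0_compat; nra).
  split.
  - nra.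
  - nra.
Qed.

Definition a1 := INR (ea 1) - INR (ea 0).
Definition b1 := INR (eb 1) - INR (eb 0).
Definition a2 := INR (ea 2) - INR (ea 0).
Definition b2 := INR (eb 2) - INR (eb 0).
Definition Dt := a1 * b2 - a2 * b1.

(** With the monomials in the ratio [1 : t : - (1 + t)] and monomial 0 scaled to 1, these are
    [x f1], [y f2] and the scaled curvature form; [moments_param] verifies it. *)
Definition al t := (a1 - a2) * t - a2.
Definition be t := (b1 - b2) * t - b2.
Definition Ecub t := Dt * Dt * (t * (1 + t)) - al t * be t * (al t + be t).

Lemma c_neq t : (t < 3)%nat -> c t <> 0.
Proof. apply (proj1 Htri). Qed.

Lemma mono_neq t x y : (t < 3)%nat -> 0 < x -> 0 < y -> mono t x y <> 0.
Proof.
  intros Ht Hx Hy. pose proof (c_neq t Ht).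
  pose proof (pow_lt x (ea t) Hx). pose proof (pow_lt y (eb t) Hy).
  repeat apply Rmult_integral_contrapositive_currified; lra.
Qed.

(** On the curve, [T1] and [T2] are the monomials [x^a1 y^b1] and [x^a2 y^b2]; [Xt] and [Yt] solve
    for the coordinates in logarithms by Cramer's rule. *)
Definition T1 t := c 0%nat / c 1%nat * t.
Definition T2 t := - (c 0%nat / c 2%nat) * (1 + t).
Definition Xt t := exp ((b2 * ln (T1 t) - b1 * ln (T2 t)) / Dt).
Definition Yt t := exp ((a1 * ln (T2 t) - a2 * ln (T1 t)) / Dt).

Lemma mono_exp t x y : 0 < x -> 0 < y ->
  mono t x y = c t * exp (INR (ea t) * ln x + INR (eb t) * ln y).
Proof.
  intros Hx Hy. unfold mono. rewrite !pow_exp_ln, exp_plus by lra. ring.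
Qed.

Lemma mono_ratio t x y : 0 < x -> 0 < y ->
  mono t x y / c t = mono 0 x y / c 0%nat *
    exp ((INR (ea t) - INR (ea 0)) * ln x + (INR (eb t) - INR (eb 0)) * ln y) \/ c t = 0.
Proof.
  intros Hx Hy. destruct (Req_dec (c t) 0) as [E|E]; [now right|left].
  assert (E0 : c 0%nat <> 0) by (apply c_neq; lia).
  rewrite !mono_exp by lra.
  replace (INR (ea t) * ln x + INR (eb t) * ln y) with
    ((INR (ea 0) * ln x + INR (eb 0) * ln y) +
     ((INR (ea t) - INR (ea 0)) * ln x + (INR (eb t) - INR (eb 0)) * ln y)) by ring.
  rewrite exp_plus. field. split; assumption.
Qed.

(* On the curve, [t] is the ratio of the monomials 1 and 0; conversely the ratios determine
   [ln x] and [ln y] through a linear system of determinant [Dt]. *)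
Lemma param_of_point x y : Dt <> 0 -> 0 < x -> 0 < y -> M0 x y = 0 ->
  let t := mono 1 x y / mono 0 x y in
  0 < T1 t /\ 0 < T2 t /\ x = Xt t /\ y = Yt t /\
  mono 1 x y = t * mono 0 x y /\ mono 2 x y = - (1 + t) * mono 0 x y.
Proof.
  intros HD Hx Hy H0 t.
  assert (N0 : mono 0 x y <> 0) by (apply mono_neq; auto; lia).
  assert (C0 : c 0%nat <> 0) by (apply c_neq; lia).
  assert (C1 : c 1%nat <> 0) by (apply c_neq; lia).
  assert (C2 : c 2%nat <> 0) by (apply c_neq; lia).
  assert (E1 : mono 1 x y = t * mono 0 x y) by (unfold t; field; assumption).
  assert (E2 : mono 2 x y = - (1 + t) * mono 0 x y) by (unfold M0, sum3 in H0; lra).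
  destruct (mono_ratio 1 x y Hx Hy) as [R1|R1]; [|contradiction].
  destruct (mono_ratio 2 x y Hx Hy) as [R2|R2]; [|contradiction].
  fold a1 b1 in R1. fold a2 b2 in R2.
  assert (F1 : T1 t = exp (a1 * ln x + b1 * ln y)).
  { unfold T1. rewrite E1 in R1. apply Rmult_eq_reg_l with (mono 0 x y / c 0%nat).
    - rewrite <- R1. field. split; assumption.
    - apply Rmult_integral_contrapositive_currified; [assumption|now apply Rinv_neq_0_compat]. }
  assert (F2 : T2 t = exp (a2 * ln x + b2 * ln y)).
  { unfold T2. rewrite E2 in R2. apply Rmult_eq_reg_l with (mono 0 x y / c 0%nat).
    - rewrite <- R2. field. split; assumption.
    - apply Rmult_integral_contrapositive_currified; [assumption|now apply Rinv_neq_0_compat]. }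
  split; [rewrite F1; apply exp_pos|]. split; [rewrite F2; apply exp_pos|].
  split; [|split; [|split; assumption]].
  - unfold Xt. rewrite F1, F2, !ln_exp.
    replace ((b2 * (a1 * ln x + b1 * ln y) - b1 * (a2 * ln x + b2 * ln y)) / Dt) with (ln x)
      by (unfold Dt in *; field; assumption).
    symmetry. now apply exp_ln.
  - unfold Yt. rewrite F1, F2, !ln_exp.
    replace ((a1 * (a2 * ln x + b2 * ln y) - a2 * (a1 * ln x + b1 * ln y)) / Dt) with (ln y)
      by (unfold Dt in *; field; assumption).
    symmetry. now apply exp_ln.
Qed.

Lemma point_of_param t : Dt <> 0 -> 0 < T1 t -> 0 < T2 t ->
  let x := Xt t in let y := Yt t in
  0 < x /\ 0 < y /\ mono 1 x y = t * mono 0 x y /\ mono 2 x y = - (1 + t) * mono 0 x y.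
Proof.
  intros HD H1 H2 x y.
  assert (Hx : 0 < x) by apply exp_pos. assert (Hy : 0 < y) by apply exp_pos.
  split; [exact Hx|]. split; [exact Hy|].
  assert (C0 : c 0%nat <> 0) by (apply c_neq; lia).
  assert (C1 : c 1%nat <> 0) by (apply c_neq; lia).
  assert (C2 : c 2%nat <> 0) by (apply c_neq; lia).
  destruct (mono_ratio 1 x y Hx Hy) as [R1|R1]; [|contradiction].
  destruct (mono_ratio 2 x y Hx Hy) as [R2|R2]; [|contradiction].
  fold a1 b1 in R1. fold a2 b2 in R2.
  assert (Lx : ln x = (b2 * ln (T1 t) - b1 * ln (T2 t)) / Dt) by (unfold x, Xt; apply ln_exp).
  assert (Ly : ln y = (a1 * ln (T2 t) - a2 * ln (T1 t)) / Dt) by (unfold y, Yt; apply ln_exp).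
  assert (F1 : a1 * ln x + b1 * ln y = ln (T1 t)).
  { rewrite Lx, Ly. unfold Dt in *. field. assumption. }
  assert (F2 : a2 * ln x + b2 * ln y = ln (T2 t)).
  { rewrite Lx, Ly. unfold Dt in *. field. assumption. }
  rewrite F1, exp_ln in R1 by lra. rewrite F2, exp_ln in R2 by lra.
  unfold T1 in R1. unfold T2 in R2. split.
  - apply Rmult_eq_reg_r with (/ c 1%nat); [|now apply Rinv_neq_0_compat].
    unfold Rdiv in R1 at 1. rewrite R1. field. split; assumption.
  - apply Rmult_eq_reg_r with (/ c 2%nat); [|now apply Rinv_neq_0_compat].
    unfold Rdiv in R2 at 1. rewrite R2. field. split; assumption.
Qed.

Lemma moments_param t x y :
  mono 1 x y = t * mono 0 x y -> mono 2 x y = - (1 + t) * mono 0 x y ->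
  M0 x y = 0 /\ Ma x y = al t * mono 0 x y /\ Mb x y = be t * mono 0 x y /\
  Hess x y = Ecub t * mono 0 x y ^ 3.
Proof.
  intros E1 E2. unfold M0, Ma, Mb, Hess, Maa, Mab, Mbb, Ma, Mb, sum3. rewrite E1, E2.
  unfold Ecub, al, be, Dt, a1, a2, b1, b2. repeat split; ring.
Qed.

(** Eliminating the coefficients from [al t = be t = 0] leaves [Dt * t = 0]. Consequently the curve
    is smooth in the quadrant unless the exponents are collinear. *)
Lemma al_be_not_both t : Dt <> 0 -> T1 t <> 0 -> T2 t <> 0 -> al t <> 0 \/ be t <> 0.
Proof.
  intros HD H1 H2. destruct (Req_dec (al t) 0) as [Ha|]; [|tauto]. right. intros Hb.
  assert (t <> 0) by (intros ->; apply H1; unfold T1; ring).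
  apply HD. unfold al, be, Dt in *.
  apply Rmult_eq_reg_r with t; [|assumption].
  replace ((a1 * b2 - a2 * b1) * t) with ((a1 - a2) * t * b2 - a2 * ((b1 - b2) * t)) by ring.
  replace ((a1 - a2) * t) with a2 by lra. replace ((b1 - b2) * t) with b2 by lra. ring.
Qed.

Lemma infl_iff_param x y : Dt <> 0 -> 0 < x -> 0 < y ->
  (inflection_pt c ea eb Rb (x, y) <->
   exists t, Ecub t = 0 /\ 0 < T1 t /\ 0 < T2 t /\ x = Xt t /\ y = Yt t /\ box x y).
Proof.
  intros HD Hx Hy. rewrite infl_pos by lra. split.
  - intros (HB & H0 & _ & HH). destruct (param_of_point x y HD Hx Hy H0) as (P1 & P2 & Ex & Ey & E1 & E2).
    set (t := mono 1 x y / mono 0 x y) in *. exists t.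
    destruct (moments_param t x y E1 E2) as (_ & _ & _ & F). rewrite F in HH.
    assert (N0 : mono 0 x y <> 0) by (apply mono_neq; auto; lia).
    apply Rmult_integral in HH. destruct HH as [HH|HH]; [tauto|].
    exfalso. now apply (pow_nonzero _ 3 N0).
  - intros (t & HE & P1 & P2 & -> & -> & HB).
    destruct (point_of_param t HD P1 P2) as (_ & _ & E1 & E2).
    destruct (moments_param t _ _ E1 E2) as (F0 & Fa & Fb & FH).
    split; [exact HB|]. split; [exact F0|]. rewrite Fa, Fb, FH, HE.
    assert (N0 : mono 0 (Xt t) (Yt t) <> 0) by (apply mono_neq; auto; lia).
    split; [|ring].
    destruct (al_be_not_both t HD) as [A|A]; try lra; [left|right];
      now apply Rmult_integral_contrapositive_currified.
Qed.

Lemma vtan_iff_param x y : Dt <> 0 -> 0 < x -> 0 < y ->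
  (vtangent_pt c ea eb Rb (x, y) <->
   exists t, be t = 0 /\ 0 < T1 t /\ 0 < T2 t /\ x = Xt t /\ y = Yt t /\ box x y).
Proof.
  intros HD Hx Hy. rewrite vtan_pos by lra. split.
  - intros (HB & H0 & HH & _). destruct (param_of_point x y HD Hx Hy H0) as (P1 & P2 & Ex & Ey & E1 & E2).
    set (t := mono 1 x y / mono 0 x y) in *. exists t.
    destruct (moments_param t x y E1 E2) as (_ & _ & F & _). rewrite F in HH.
    assert (N0 : mono 0 x y <> 0) by (apply mono_neq; auto; lia).
    apply Rmult_integral in HH. tauto.
  - intros (t & HE & P1 & P2 & -> & -> & HB).
    destruct (point_of_param t HD P1 P2) as (_ & _ & E1 & E2).
    destruct (moments_param t _ _ E1 E2) as (F0 & Fa & Fb & FH).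
    split; [exact HB|]. split; [exact F0|]. rewrite Fa, Fb, HE.
    assert (N0 : mono 0 (Xt t) (Yt t) <> 0) by (apply mono_neq; auto; lia).
    split; [ring|].
    destruct (al_be_not_both t HD) as [A|A]; try lra.
    now apply Rmult_integral_contrapositive_currified.
Qed.

Lemma no_sing_pos x y : Dt <> 0 -> 0 < x -> 0 < y -> ~ singular_pt c ea eb Rb (x, y).
Proof.
  intros HD Hx Hy HS. apply sing_pos in HS; [|assumption|assumption].
  destruct HS as (_ & H0 & Ha & Hb).
  destruct (param_of_point x y HD Hx Hy H0) as (P1 & P2 & Ex & Ey & E1 & E2).
  set (t := mono 1 x y / mono 0 x y) in *.
  destruct (moments_param t x y E1 E2) as (_ & Fa & Fb & _).
  assert (N0 : mono 0 x y <> 0) by (apply mono_neq; auto; lia).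
  rewrite Fa in Ha. rewrite Fb in Hb.
  apply Rmult_integral in Ha, Hb. destruct (al_be_not_both t HD); try lra; tauto.
Qed.

Definition e3 := - ((a1 - a2) * (b1 - b2) * (a1 - a2 + (b1 - b2))).
Definition e2 := Dt * Dt - ((a1 - a2) * (b1 - b2) * (- a2 - b2) +
  ((a1 - a2) * - b2 + - a2 * (b1 - b2)) * (a1 - a2 + (b1 - b2))).
Definition e1 := Dt * Dt - (a2 * b2 * (a1 - a2 + (b1 - b2)) +
  ((a1 - a2) * - b2 + - a2 * (b1 - b2)) * (- a2 - b2)).
Definition e0 := - (a2 * b2 * (- a2 - b2)).

Lemma Ecub_eq t : Ecub t = e3 * t * t * t + e2 * t * t + e1 * t + e0.
Proof. unfold Ecub, al, be, e3, e2, e1, e0. ring. Qed.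

(** The cubic vanishes identically, so every point of the curve in the quadrant is an inflection
    point. *)
Definition line_case : Prop := Dt <> 0 /\ e3 = 0 /\ e2 = 0 /\ e1 = 0 /\ e0 = 0.

Lemma infl_finite : Dt <> 0 -> ~ line_case -> finite_in (inflection_pt c ea eb Rb) pos_pt.
Proof.
  intros HD HL. destruct (cubic_roots e3 e2 e1 e0) as [l Hl].
  { unfold line_case in HL. tauto. }
  exists (map (fun t => (Xt t, Yt t)) l). intros [x y] HS [Hx Hy]. apply infl_iff_param in HS; try assumption.
  destruct HS as (t & HE & _ & _ & -> & -> & _). apply in_map_iff. exists t. split; [reflexivity|].
  apply Hl. rewrite <- Ecub_eq. exact HE.
Qed.

Lemma vtan_finite : Dt <> 0 -> finite_in (vtangent_pt c ea eb Rb) pos_pt.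
Proof.
  intros HD. destruct (linear_roots (b1 - b2) (- b2)) as [l Hl].
  { destruct (Req_dec (b1 - b2) 0); [|tauto]. right. intros E. apply HD. unfold Dt.
    replace b1 with b2 by lra. replace b2 with 0 by lra. ring. }
  exists (map (fun t => (Xt t, Yt t)) l). intros [x y] HS [Hx Hy]. apply vtan_iff_param in HS; try assumption.
  destruct HS as (t & HE & _ & _ & -> & -> & _). apply in_map_iff. exists t. split; [reflexivity|].
  apply Hl. unfold be in HE. lra.
Qed.

Lemma exps_neq i j : (i < 3)%nat -> (j < 3)%nat -> i <> j -> ea i <> ea j \/ eb i <> eb j.
Proof.
  intros Hi Hj Hij. destruct (Nat.eq_dec (ea i) (ea j)) as [E1|]; [|tauto].
  right. intros E2. apply (proj2 Htri i j Hi Hj Hij). congruence.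
Qed.

Definition perm3 (i j r : nat) : Prop :=
  (i < 3 /\ j < 3 /\ r < 3 /\ i <> j /\ i <> r /\ j <> r)%nat.

Lemma sum3_perm F i j r : perm3 i j r -> sum3 F = F i + F j + F r.
Proof.
  intros (Hi & Hj & Hr & H1 & H2 & H3). unfold sum3.
  destruct i as [|[|[|i]]], j as [|[|[|j]]], r as [|[|[|r]]]; try lia; ring.
Qed.

(** The polynomial is a monomial times a linear polynomial. The leading and the constant coefficient
    of the cubic are products of three factors each. Of the nine choices of a vanishing factor in
    both, the three at equal positions contradict [Dt <> 0]; in the other six the remaining
    coefficients fix the exponents, one choice for each assignment of the three roles. *)
Lemma line_case_shape : line_case -> exists i j r, perm3 i j r /\
  ea j = S (ea i) /\ eb j = eb i /\ ea r = ea i /\ eb r = S (eb i).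
Proof.
  intros (HD & H3 & H2 & H1 & H0).
  assert (Fin : forall i j r, perm3 i j r ->
    INR (ea j) = INR (ea i) + 1 -> INR (eb j) = INR (eb i) ->
    INR (ea r) = INR (ea i) -> INR (eb r) = INR (eb i) + 1 ->
    exists i j r, perm3 i j r /\
      ea j = S (ea i) /\ eb j = eb i /\ ea r = ea i /\ eb r = S (eb i)).
  { intros i j r P Q1 Q2 Q3 Q4. exists i, j, r. split; [exact P|].
    rewrite <- S_INR in Q1, Q4. repeat split; apply INR_eq; assumption. }
  assert (Z : forall k u, k <> 0 -> k * u = 0 -> u = 0).
  { intros k u Hk E. apply Rmult_integral in E. tauto. }
  unfold e3, e2, e1, e0, Dt in *.
  assert (C3 : a1 - a2 = 0 \/ b1 - b2 = 0 \/ a1 - a2 + (b1 - b2) = 0).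
  { apply Ropp_eq_0_compat in H3. rewrite Ropp_involutive in H3.
    apply Rmult_integral in H3 as [H3|H3]; [apply Rmult_integral in H3|]; tauto. }
  assert (C0 : a2 = 0 \/ b2 = 0 \/ - a2 - b2 = 0).
  { apply Ropp_eq_0_compat in H0. rewrite Ropp_involutive in H0.
    apply Rmult_integral in H0 as [H0|H0]; [apply Rmult_integral in H0|]; tauto. }
  destruct C3 as [C3|[C3|C3]], C0 as [C0|[C0|C0]].
  - nra.
  - assert (N1 : a2 * b1 <> 0) by nra.
    assert (E1 : a1 = a2) by lra.
    assert (F1 : a2 + 1 = 0).
    { apply (Z (a2 * b1 * b1)); [intros E; apply N1; nra|].
      rewrite <- H2, C0, E1. ring. }
    assert (F2 : b1 - 1 = 0).
    { nra. }
    apply (Fin 2 0 1)%nat; [unfold perm3; lia|..]; unfold a1, b1, a2, b2 in *; lra.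
  - assert (E1 : a1 = a2) by lra. assert (E2 : b2 = - a2) by lra.
    assert (N1 : a2 * (b1 - b2) <> 0) by nra.
    assert (F1 : a2 + 1 = 0).
    { apply (Z (a2 * (b1 - b2) * (b1 - b2))); [intros E; apply N1; nra|].
      rewrite <- H2, E1, E2. ring. }
    assert (F2 : b1 - b2 + 1 = 0).
    { nra. }
    apply (Fin 1 0 2)%nat; [unfold perm3; lia|..]; unfold a1, b1, a2, b2 in *; lra.
  - assert (N1 : a1 * b2 <> 0) by nra.
    assert (E1 : b1 = b2) by lra.
    assert (F1 : b2 + 1 = 0).
    { apply (Z (a1 * b2 * a1)); [intros E; apply N1; nra|]. rewrite <- H2, C0, E1. ring. }
    assert (F2 : a1 - 1 = 0).
    { nra. }
    apply (Fin 2 1 0)%nat; [unfold perm3; lia|..]; unfold a1, b1, a2, b2 in *; lra.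
  - nra.
  - assert (E1 : b1 = b2) by lra. assert (E2 : b2 = - a2) by lra.
    assert (N1 : (a1 - a2) * b2 <> 0) by nra.
    assert (F1 : b2 + 1 = 0).
    { apply (Z ((a1 - a2) * b2 * (a1 - a2))); [intros E; apply N1; nra|].
      rewrite <- H2, E1, E2. ring. }
    assert (F2 : a1 - a2 + 1 = 0).
    { nra. }
    apply (Fin 1 2 0)%nat; [unfold perm3; lia|..]; unfold a1, b1, a2, b2 in *; lra.
  - assert (E1 : b2 = b1 + a1) by lra.
    assert (N1 : a1 * b2 <> 0) by nra.
    assert (F1 : b2 - 1 = 0).
    { apply (Z (a1 * b2 * a1)); [intros E; apply N1; nra|]. rewrite <- H2, C0, E1. ring. }
    assert (F2 : a1 - 1 = 0).
    { nra. }
    apply (Fin 0 1 2)%nat; [unfold perm3; lia|..]; unfold a1, b1, a2, b2 in *; lra.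
  - assert (E1 : a2 = a1 + b1) by lra.
    assert (N1 : a2 * b1 <> 0) by nra.
    assert (F1 : a2 - 1 = 0).
    { apply (Z (a2 * b1 * b1)); [intros E; apply N1; nra|]. rewrite <- H2, C0, E1. ring. }
    assert (F2 : b1 - 1 = 0).
    { nra. }
    apply (Fin 0 2 1)%nat; [unfold perm3; lia|..]; unfold a1, b1, a2, b2 in *; lra.
  - nra.
Qed.

Lemma infl_of_line x y : line_case -> 0 < x -> 0 < y -> box x y -> M0 x y = 0 ->
  inflection_pt c ea eb Rb (x, y).
Proof.
  intros (HD & H3 & H2 & H1 & H0) Hx Hy HB HM. apply infl_iff_param; trivial.
  destruct (param_of_point x y HD Hx Hy HM) as (P1 & P2 & Ex & Ey & _).
  eexists. split; [|repeat split; eassumption || apply HB].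
  rewrite Ecub_eq, H3, H2, H1, H0. ring.
Qed.

(* The direction [(- dy, dx)] of a line can be followed inside the box unless it leaves the box at
   a corner. *)
Lemma box_dir x y dx dy : 0 < x <= Rb -> 0 < y <= Rb -> dx <> 0 -> dy <> 0 ->
  x < Rb \/ y < Rb \/ 0 < dx * dy ->
  exists sg s0, (sg = 1 \/ sg = -1) /\ 0 < s0 /\ forall s, 0 < s < s0 ->
    0 < x + s * (sg * dx) <= Rb /\ 0 < y + s * (sg * dy) <= Rb.
Proof.
  intros Hx Hy Hdx Hdy Hc.
  assert (W : exists sg, (sg = 1 \/ sg = -1) /\ (x < Rb \/ sg * dx <= 0) /\ (y < Rb \/ sg * dy <= 0)).
  { destruct (Rlt_le_dec x Rb) as [X|X].
    - destruct (Rle_lt_dec dy 0); [exists 1|exists (-1)]; repeat split; first [left; lra | right; lra].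
    - destruct (Rle_lt_dec dx 0); [exists 1|exists (-1)].
      + nra.
      + nra. }
  destruct W as (sg & Hsg & WX & WY).
  set (k := Rmin (Rmin x y) (Rmin (if Rlt_dec x Rb then Rb - x else 1) (if Rlt_dec y Rb then Rb - y else 1))).
  assert (K : 0 < k /\ k <= x /\ k <= y /\ (x < Rb -> k <= Rb - x) /\ (y < Rb -> k <= Rb - y)).
  { unfold k; clear k. repeat split.
    - repeat apply Rmin_glb_lt; try lra; destruct (Rlt_dec _ _); lra.
    - eapply Rle_trans; [apply Rmin_l|apply Rmin_l].
    - eapply Rle_trans; [apply Rmin_l|apply Rmin_r].
    - intros H. eapply Rle_trans; [apply Rmin_r|]. eapply Rle_trans; [apply Rmin_l|].
      destruct (Rlt_dec x Rb); [lra|contradiction].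
    - intros H. eapply Rle_trans; [apply Rmin_r|]. eapply Rle_trans; [apply Rmin_r|].
      destruct (Rlt_dec y Rb); [lra|contradiction]. }
  destruct K as (K0 & K1 & K2 & K3 & K4). destruct (small_step (sg * dx) (sg * dy) k K0) as (s0 & Hs0 & HS).
  exists sg, s0. split; [exact Hsg|]. split; [exact Hs0|]. intros s Hs.
  destruct (HS s Hs) as [A1 A2]. apply Rabs_def2 in A1, A2. split; split; try lra.
  - destruct WX as [WX|WX]; [specialize (K3 WX); lra|]. nra.
  - destruct WY as [WY|WY]; [specialize (K4 WY); lra|]. nra.
Qed.

Lemma M0_line i j r x y : perm3 i j r ->
  ea j = S (ea i) -> eb j = eb i -> ea r = ea i -> eb r = S (eb i) ->
  M0 x y = x ^ ea i * y ^ eb i * (c i + c j * x + c r * y) /\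
  Ma x y = INR (ea i) * M0 x y + c j * (x ^ ea j * y ^ eb j) /\
  Mb x y = INR (eb i) * M0 x y + c r * (x ^ ea r * y ^ eb r).
Proof.
  intros P E1 E2 E3 E4. unfold M0, Ma, Mb. rewrite !(sum3_perm _ i j r P). unfold mono.
  rewrite E1, E2, E3, E4, !S_INR. simpl. repeat split; ring.
Qed.

(** All points of the line are inflections, so an isolated one is a point where the line meets the
    box alone. In the open quadrant this is the corner [(Rb, Rb)] on a line of negative slope, that
    is, with coefficients [c j], [c r] of equal sign. *)
Lemma infl_isolated_line x y : line_case -> 0 < x -> 0 < y ->
  (isolated_in (inflection_pt c ea eb Rb) (x, y) <->
   x = Rb /\ y = Rb /\ M0 x y = 0 /\ 0 < Ma x y * Mb x y).
Proof.
  intros HL Hx Hy. destruct (line_case_shape HL) as (i & j & r & P & E1 & E2 & E3 & E4).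
  assert (ML := fun x y => M0_line i j r x y P E1 E2 E3 E4).
  assert (Cj : c j <> 0) by (apply c_neq, P). assert (Cr : c r <> 0) by (apply c_neq, P).
  assert (PP : forall x y, 0 < x -> 0 < y -> forall m n, 0 < x ^ m * y ^ n).
  { intros. apply Rmult_lt_0_compat; now apply pow_lt. }
  assert (HZ : forall x y, 0 < x -> 0 < y -> (M0 x y = 0 <-> c i + c j * x + c r * y = 0)).
  { intros u v Hu Hv. rewrite (proj1 (ML u v)). pose proof (PP u v Hu Hv (ea i) (eb i)).
    split; intros H0; [apply Rmult_integral in H0; lra|rewrite H0; ring]. }
  assert (HP : M0 x y = 0 -> (0 < Ma x y * Mb x y <-> 0 < c j * c r)).
  { intros H0. destruct (ML x y) as (_ & -> & ->). set (p1 := x ^ ea j * y ^ eb j). set (p2 := x ^ ea r * y ^ eb r).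
    assert (0 < p1) by now apply PP. assert (0 < p2) by now apply PP.
    assert (0 < p1 * p2) by nra. split; intros; nra. }
  split.
  - intros HI. assert (HS := proj1 HI). apply infl_pos in HS; trivial.
    destruct HS as ([HBx HBy] & H0 & _).
    destruct (classic (x < Rb \/ y < Rb \/ c j * c r < 0)) as [HC|HC].
    + exfalso. destruct (box_dir x y (c r) (- c j)) as (sg & s0 & Hsg & Hs0 & HS); trivial.
      { lra. } { lra. } { lra. }
      { lra. }
      revert HI. apply (not_isolated_dir _ x y (sg * c r) (sg * - c j) s0); trivial.
      { nra. }
      intros s Hs. destruct (HS s Hs) as [B1 B2].
      apply infl_of_line; trivial; try tauto; try lra. { split; lra. }
      apply HZ; try lra. apply HZ in H0; trivial. nra.
    + nra.
  - intros (-> & -> & H0 & HPos). apply HP in HPos; [|exact H0].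
    assert (HB : box Rb Rb) by (split; lra).
    split; [now apply infl_of_line|].
    exists Rb. split; [exact HRb|]. intros [u v] HS [H1 H2]. simpl in H1, H2.
    apply Rabs_def2 in H1, H2. apply infl_pos in HS; try lra.
    destruct HS as ([Bu Bv] & H0' & _).
    apply HZ in H0; trivial. apply HZ in H0'; try lra.
    assert (Rb - u = 0 /\ Rb - v = 0); [|f_equal; lra].
    split; nra.
Qed.

(** * Collinear exponent vectors *)

Lemma collinear_ratio : Dt = 0 -> exists k, a2 = k * a1 /\ b2 = k * b1 /\ k <> 0 /\ k <> 1.
Proof.
  intros HD. unfold Dt in HD.
  assert (N01 : a1 <> 0 \/ b1 <> 0).
  { destruct (exps_neq 0 1) as [H|H]; try lia; [left|right]; unfold a1, b1; intros E;
      apply H, INR_eq; lra. }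
  assert (N02 : a2 <> 0 \/ b2 <> 0).
  { destruct (exps_neq 0 2) as [H|H]; try lia; [left|right]; unfold a2, b2; intros E;
      apply H, INR_eq; lra. }
  assert (N12 : a1 <> a2 \/ b1 <> b2).
  { destruct (exps_neq 1 2) as [H|H]; try lia; [left|right]; unfold a1, b1, a2, b2; intros E;
      apply H, INR_eq; lra. }
  assert (W : exists k, a2 = k * a1 /\ b2 = k * b1).
  { destruct (Req_dec a1 0) as [E|E].
    - destruct N01 as [N|N]; [contradiction|]. exists (b2 / b1). split; [|field; assumption].
      rewrite E in *. apply Rmult_eq_reg_r with b1; [lra|assumption].
    - exists (a2 / a1). split; [field; assumption|].
      apply Rmult_eq_reg_r with a1; [|assumption]. field_simplify; [lra|assumption]. }
  destruct W as (k & K1 & K2). exists k. repeat split; trivial.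
  - nra.
  - nra.
Qed.

(** All differences of exponent vectors are parallel to [(a1, b1)], so this one-parameter group
    scales the three monomials by a common factor. It therefore preserves every condition that
    defines special points, except membership in the box. *)
Lemma flow x y th : Dt = 0 -> 0 < x -> 0 < y ->
  exists g, 0 < g /\ forall t, (t < 3)%nat ->
    mono t (x * exp (b1 * th)) (y * exp (- a1 * th)) = g * mono t x y.
Proof.
  intros HD Hx Hy. exists (exp ((INR (ea 0) * b1 - INR (eb 0) * a1) * th)). split; [apply exp_pos|].
  pose proof (exp_pos (b1 * th)). pose proof (exp_pos (- a1 * th)).
  assert (0 < x * exp (b1 * th)) by nra. assert (0 < y * exp (- a1 * th)) by nra.
  intros t Ht. rewrite !mono_exp by lra. rewrite !ln_mult, !ln_exp by lra.
  rewrite <- Rmult_assoc, (Rmult_comm (exp _) (c t)), Rmult_assoc, <- exp_plus.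
  do 2 f_equal. unfold Dt, a1, b1, a2, b2 in *.
  destruct t as [|[|[|t]]]; [ring|ring| |lia]. 
  enough (E : (INR (ea 2) - INR (ea 0)) * (INR (eb 1) - INR (eb 0)) * th =
    (INR (eb 2) - INR (eb 0)) * (INR (ea 1) - INR (ea 0)) * th) by lra. 
  f_equal. lra.
Qed.

Lemma flow_moments x y th : Dt = 0 -> 0 < x -> 0 < y ->
  exists g, 0 < g /\
    let x' := x * exp (b1 * th) in let y' := y * exp (- a1 * th) in
    M0 x' y' = g * M0 x y /\ Ma x' y' = g * Ma x y /\ Mb x' y' = g * Mb x y /\
    Hess x' y' = g ^ 3 * Hess x y.
Proof.
  intros HD Hx Hy. destruct (flow x y th HD Hx Hy) as (g & Hg & H). exists g. split; [exact Hg|].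
  unfold Hess, M0, Ma, Mb, Maa, Mab, Mbb, sum3.
  rewrite !H by lia. repeat split; ring.
Qed.

(** The flow leaves the box in both time directions only at the corner [(Rb, Rb)] and only if its
    velocity components have opposite signs, that is, if [a1 * b1 > 0]; otherwise [sg] is a
    direction that stays inside. *)
Lemma collinear_not_isolated (S : R * R -> Prop) x y :
  Dt = 0 -> 0 < x -> 0 < y -> S (x, y) ->
  (forall u v, 0 < u -> 0 < v -> S (u, v) -> box u v) ->
  (forall th, box (x * exp (b1 * th)) (y * exp (- a1 * th)) ->
     S (x * exp (b1 * th), y * exp (- a1 * th))) ->
  x < Rb \/ y < Rb \/ a1 * b1 <= 0 -> ~ isolated_in S (x, y).
Proof.
  intros HD Hx Hy HS HB HF HC. destruct (HB x y Hx Hy HS) as [Bx By].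
  apply not_isolated_near. intros r Hr.
  assert (N01 : a1 <> 0 \/ b1 <> 0).
  { destruct (exps_neq 0 1) as [H|H]; try lia; [left|right]; unfold a1, b1; intros E;
      apply H, INR_eq; lra. }
  assert (W : exists sg, (sg = 1 \/ sg = -1) /\ (x < Rb \/ b1 * sg <= 0) /\ (y < Rb \/ - a1 * sg <= 0)).
  { destruct (Rlt_le_dec x Rb) as [X|X].
    - destruct (Rle_lt_dec a1 0); [exists (-1)|exists 1]; repeat split; first [left; lra | right; lra].
    - destruct (Rlt_le_dec y Rb) as [Y|Y].
      + destruct (Rle_lt_dec b1 0); [exists 1|exists (-1)]; repeat split; first [left; lra | right; lra].
      + destruct (Rtotal_order b1 0) as [Q|[Q|Q]].
        * exists 1. split; [now left|]. split; right; nra.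
        * destruct (Rle_lt_dec a1 0); [exists (-1)|exists 1];
            (split; [first [now left | now right]|]); split; right; lra.
        * exists (-1). split; [now right|]. split; right; nra. }
  destruct W as (sg & Hsg & WX & WY).
  set (k := Rmin r (Rmin (if Rlt_dec x Rb then Rb - x else 1) (if Rlt_dec y Rb then Rb - y else 1))).
  assert (K : 0 < k /\ k <= r /\ (x < Rb -> k <= Rb - x) /\ (y < Rb -> k <= Rb - y)).
  { unfold k; clear k. repeat split.
    - repeat apply Rmin_glb_lt; try lra; destruct (Rlt_dec _ _); lra.
    - apply Rmin_l.
    - intros H. eapply Rle_trans; [apply Rmin_r|]. eapply Rle_trans; [apply Rmin_l|].
      destruct (Rlt_dec x Rb); [lra|contradiction].
    - intros H. eapply Rle_trans; [apply Rmin_r|]. eapply Rle_trans; [apply Rmin_r|].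
      destruct (Rlt_dec y Rb); [lra|contradiction]. }
  destruct K as (K0 & K1 & K3 & K4). destruct (exp_small b1 x k K0) as (s1 & Hs1 & A1). destruct (exp_small (- a1) y k K0) as (s2 & Hs2 & A2).
  set (s := Rmin s1 s2 / 2).
  assert (Hs : 0 < s /\ s < s1 /\ s < s2).
  { unfold s. assert (0 < Rmin s1 s2) by now apply Rmin_glb_lt.
    pose proof (Rmin_l s1 s2). pose proof (Rmin_r s1 s2). lra. }
  assert (Hab : Rabs (sg * s) = s).
  { destruct Hsg as [->| ->]; [rewrite Rmult_1_l; apply Rabs_right; lra|].
    replace (-1 * s) with (- s) by ring. rewrite Rabs_Ropp. apply Rabs_right; lra. }
  specialize (A1 (sg * s) ltac:(lra)). specialize (A2 (sg * s) ltac:(lra)).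
  set (u := x * exp (b1 * (sg * s))) in *. set (v := y * exp (- a1 * (sg * s))) in *.
  assert (Pu : 0 < u) by (apply Rmult_lt_0_compat; [assumption|apply exp_pos]).
  assert (Pv : 0 < v) by (apply Rmult_lt_0_compat; [assumption|apply exp_pos]).
  assert (D1 := Rabs_def2 _ _ A1). assert (D2 := Rabs_def2 _ _ A2).
  assert (mono_exp_le : forall z, z <= 0 -> exp z <= 1).
  { intros z [Hz|Hz]; [rewrite <- exp_0; left; now apply exp_increasing|rewrite Hz, exp_0; lra]. }
  exists (u, v). split; [|split].
  - apply (HF (sg * s)). fold u v. split; (split; [lra|]).
    + destruct WX as [WX|WX]; [specialize (K3 WX); lra|].
      assert (exp (b1 * (sg * s)) <= 1) by (apply mono_exp_le; nra). unfold u. nra.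
    + destruct WY as [WY|WY]; [specialize (K4 WY); lra|].
      assert (exp (- a1 * (sg * s)) <= 1) by (apply mono_exp_le; nra). unfold v. nra.
  - split; simpl; rewrite Rabs_minus_sym; lra.
  - intros E. injection E as E1 E2. assert (Z : forall w z, 0 < w -> w * exp z = w -> z = 0).
    { intros w z Hw Ez. apply exp_inv. rewrite exp_0. apply Rmult_eq_reg_l with w; lra. }
    apply Z in E1, E2; trivial.
    assert (Hss : sg * s <> 0) by (destruct Hsg as [->| ->]; lra).
    apply Rmult_integral in E1, E2. destruct N01; lra.
Qed.

(** Up to a monomial factor the equation involves [x^a1 y^b1] only, so at a zero the scaled gradient
    is a multiple [q] of [(a1, b1)], and the curvature form becomes a multiple of [q ^ 3]. *)
Lemma collinear_moments x y : Dt = 0 -> M0 x y = 0 ->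
  exists k q, a2 = k * a1 /\ b2 = k * b1 /\ Ma x y = a1 * q /\ Mb x y = b1 * q /\
    q = mono 1 x y + k * mono 2 x y /\ Hess x y = - (a1 * b1 * (a1 + b1)) * q ^ 3 /\ k <> 0 /\ k <> 1.
Proof.
  intros HD H0. destruct (collinear_ratio HD) as (k & K1 & K2 & K3 & K4).
  exists k, (mono 1 x y + k * mono 2 x y).
  assert (E0 : mono 0 x y = - mono 1 x y - mono 2 x y) by (unfold M0, sum3 in H0; lra).
  assert (Ea1 : INR (ea 1) = INR (ea 0) + a1) by (unfold a1; ring).
  assert (Eb1 : INR (eb 1) = INR (eb 0) + b1) by (unfold b1; ring).
  assert (Ea2 : INR (ea 2) = INR (ea 0) + k * a1) by (rewrite <- K1; unfold a2; ring).
  assert (Eb2 : INR (eb 2) = INR (eb 0) + k * b1) by (rewrite <- K2; unfold b2; ring).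
  unfold Hess, Ma, Mb, Maa, Mab, Mbb, sum3. rewrite Ea1, Ea2, Eb1, Eb2, E0.
  repeat split; trivial; ring.
Qed.

(** At a singular point the ratio of monomials 1 and 0 is forced, and it determines
    [a1 ln x + b1 ln y]. So all singular points of the quadrant lie on one orbit of the flow. *)
Lemma sing_level x y x' y' : Dt = 0 -> 0 < x -> 0 < y -> 0 < x' -> 0 < y' ->
  M0 x y = 0 -> Ma x y = 0 -> Mb x y = 0 -> M0 x' y' = 0 -> Ma x' y' = 0 -> Mb x' y' = 0 ->
  a1 * ln x + b1 * ln y = a1 * ln x' + b1 * ln y'.
Proof.
  intros HD Hx Hy Hx' Hy' H0 H1 H2 H0' H1' H2'.
  assert (N01 : a1 <> 0 \/ b1 <> 0).
  { destruct (exps_neq 0 1) as [H|H]; try lia; [left|right]; unfold a1, b1; intros E;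
      apply H, INR_eq; lra. }
  assert (C0 : c 0%nat <> 0) by (apply c_neq; lia).
  assert (C1 : c 1%nat <> 0) by (apply c_neq; lia).
  destruct (collinear_ratio HD) as (k0 & K1 & K2 & K3 & K4).
  assert (W : forall u v, 0 < u -> 0 < v -> M0 u v = 0 -> Ma u v = 0 -> Mb u v = 0 ->
    exp (a1 * ln u + b1 * ln v) = - k0 / (k0 - 1) * (c 0%nat / c 1%nat)).
  { intros u v Hu Hv M M1 M2. destruct (collinear_moments u v HD M) as (k & q & Q1 & Q2 & Q3 & Q4 & Q5 & _).
    assert (k = k0).
    { destruct N01 as [N|N]; [apply Rmult_eq_reg_r with a1|apply Rmult_eq_reg_r with b1]; lra. }
    subst k. assert (q = 0).
    { destruct N01 as [N|N]; [apply Rmult_eq_reg_l with a1|apply Rmult_eq_reg_l with b1]; lra. }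
    assert (E1 : (k0 - 1) * mono 1 u v = - k0 * mono 0 u v).
    { unfold M0, sum3 in M. replace (mono 0 u v) with (- mono 1 u v - mono 2 u v) by lra. lra. }
    destruct (mono_ratio 1 u v Hu Hv) as [R1|R1]; [|contradiction]. fold a1 b1 in R1.
    assert (N0 : mono 0 u v <> 0) by (apply mono_neq; auto; lia).
    apply Rmult_eq_reg_l with (mono 0 u v / c 0%nat).
    - rewrite <- R1. replace (mono 1 u v) with (- k0 * mono 0 u v / (k0 - 1)).
      + field. repeat split; trivial. lra.
      + rewrite <- E1. field. lra.
    - apply Rmult_integral_contrapositive_currified; [assumption|now apply Rinv_neq_0_compat]. }
  apply exp_inv. rewrite !W by lra. reflexivity.
Qed.

(** Only the corner can be isolated. There [a1 * b1 > 0] makes the curvature nonzero at a smooth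
    point, and a zero of [Mb] is also a zero of [Ma], so neither an inflection nor a vertical
    tangent is possible. A singular corner is isolated because the orbit that carries the singular
    points meets the box only there. *)
Lemma special_collinear x y : Dt = 0 -> 0 < x -> 0 < y ->
  (special_pt c ea eb Rb (x, y) <->
   x = Rb /\ y = Rb /\ M0 x y = 0 /\ Ma x y = 0 /\ Mb x y = 0 /\ 0 < a1 * b1).
Proof.
  intros HD Hx Hy. split.
  - assert (Corner : forall S : R * R -> Prop, isolated_in S (x, y) ->
      (forall u v, 0 < u -> 0 < v -> S (u, v) -> box u v) ->
      (forall th, box (x * exp (b1 * th)) (y * exp (- a1 * th)) ->
         S (x * exp (b1 * th), y * exp (- a1 * th))) -> x = Rb /\ y = Rb /\ 0 < a1 * b1).
    { intros S HS HB HF. destruct (HB x y Hx Hy (proj1 HS)) as [Bx By].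
      destruct (classic (x < Rb \/ y < Rb \/ a1 * b1 <= 0)) as [HC|HC].
      - exfalso. assert (HS0 := proj1 HS). revert HS. now apply collinear_not_isolated.
      - lra. }
    assert (FP : forall th, 0 < x * exp (b1 * th) /\ 0 < y * exp (- a1 * th)).
    { intros th. split; apply Rmult_lt_0_compat; trivial; apply exp_pos. }
    intros [HS|[HS|HS]].
    + exfalso. destruct (Corner _ HS) as (-> & -> & HC).
      * intros u v Hu Hv Hi. now apply infl_pos in Hi.
      * intros th HB. destruct (FP th) as [F1 F2]. apply infl_pos; trivial.
        assert (HI := proj1 HS). apply infl_pos in HI; trivial. destruct HI as (_ & H0 & H1 & H2).
        destruct (flow_moments x y th HD Hx Hy) as (g & Hg & -> & -> & -> & ->).
        rewrite H0, H2. repeat split; try apply HB; try ring.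
        destruct H1; [left|right]; apply Rmult_integral_contrapositive_currified; lra.
      * assert (HI := proj1 HS). apply infl_pos in HI; trivial. destruct HI as (_ & H0 & H1 & H2).
        destruct (collinear_moments Rb Rb HD H0) as (k & q & _ & _ & Ea & Eb & _ & EH & _).
        rewrite EH in H2.
        assert (q <> 0) by nra.
        apply Rmult_integral in H2. destruct H2 as [H2|H2]; [|now apply (pow_nonzero q 3)].
        assert (a1 * b1 * (a1 + b1) <> 0) by nra. lra.
    + exfalso. destruct (Corner _ HS) as (-> & -> & HC).
      * intros u v Hu Hv Hi. now apply vtan_pos in Hi.
      * intros th HB. destruct (FP th) as [F1 F2]. apply vtan_pos; trivial.
        assert (HI := proj1 HS). apply vtan_pos in HI; trivial. destruct HI as (_ & H0 & H1 & H2).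
        destruct (flow_moments x y th HD Hx Hy) as (g & Hg & -> & -> & -> & _).
        rewrite H0, H1. repeat split; try apply HB; try ring.
        apply Rmult_integral_contrapositive_currified; lra.
      * assert (HI := proj1 HS). apply vtan_pos in HI; trivial. destruct HI as (_ & H0 & H1 & H2).
        destruct (collinear_moments Rb Rb HD H0) as (k & q & _ & _ & Ea & Eb & _).
        rewrite Eb in H1. apply Rmult_integral in H1. destruct H1 as [H1|H1]; [rewrite H1 in HC; lra|].
        apply H2. rewrite Ea, H1. ring.
    + assert (HI := proj1 HS). apply sing_pos in HI; trivial. destruct HI as (_ & H0 & H1 & H2).
      destruct (Corner _ HS) as (-> & -> & HC); [| |tauto].
      * intros u v Hu Hv Hi. now apply sing_pos in Hi.
      * intros th HB. destruct (FP th) as [F1 F2]. apply sing_pos; trivial.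
        destruct (flow_moments x y th HD Hx Hy) as (g & Hg & -> & -> & -> & _).
        rewrite H0, H1, H2. repeat split; try apply HB; ring.
  - intros (-> & -> & H0 & H1 & H2 & HC). right; right.
    assert (HB : box Rb Rb) by (split; lra).
    split; [apply sing_pos; tauto|]. exists Rb. split; [exact HRb|].
    intros [u v] HS [C1 C2]. simpl in C1, C2. apply Rabs_def2 in C1, C2.
    apply sing_pos in HS; try lra. destruct HS as ([Bu Bv] & H0' & H1' & H2').
    pose proof (sing_level Rb Rb u v HD HRb HRb ltac:(lra) ltac:(lra) H0 H1 H2 H0' H1' H2') as HLv.
    assert (L1 : ln u <= ln Rb) by (destruct (proj2 Bu) as [Q| ->]; [left; apply ln_increasing; lra|lra]).
    assert (L2 : ln v <= ln Rb) by (destruct (proj2 Bv) as [Q| ->]; [left; apply ln_increasing; lra|lra]).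
    assert (Q : a1 * (ln Rb - ln u) + b1 * (ln Rb - ln v) = 0) by lra.
    assert (Q' : (a1 * a1) * (ln Rb - ln u) + (a1 * b1) * (ln Rb - ln v) = 0).
    { transitivity (a1 * (a1 * (ln Rb - ln u) + b1 * (ln Rb - ln v))); [ring|]. rewrite Q. ring. }
    assert (0 < a1 * a1) by nra.
    set (du := ln Rb - ln u) in *. set (dv := ln Rb - ln v) in *.
    assert (0 <= du) by (unfold du; lra). assert (0 <= dv) by (unfold dv; lra).
    assert (0 <= a1 * a1 * du) by nra.
    assert (0 <= a1 * b1 * dv) by nra.
    assert (Z1 : a1 * a1 * du = 0) by lra. assert (Z2 : a1 * b1 * dv = 0) by lra.
    apply Rmult_integral in Z1, Z2. destruct Z1 as [Z1|Z1]; [lra|]. destruct Z2 as [Z2|Z2]; [lra|].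
    f_equal; apply ln_inv; unfold du, dv in *; lra.
Qed.

(** * Points on the axis [x = 0] *)

Definition indic (n i : nat) : R := if Nat.eq_dec n i then 1 else 0.

Lemma indic_eq n i : n = i -> indic n i = 1.
Proof. intros ->. unfold indic. destruct (Nat.eq_dec i i); tauto. Qed.

Lemma indic_neq n i : n <> i -> indic n i = 0.
Proof. intros H. unfold indic. destruct (Nat.eq_dec n i); tauto. Qed.

Lemma zero_pow0 n : INR (ffact n 0) * 0 ^ (n - 0) = indic n 0.
Proof. destruct n; [rewrite indic_eq by lia|rewrite indic_neq by lia]; simpl; ring. Qed.

Lemma zero_pow1 n : INR (ffact n 1) * 0 ^ (n - 1) = indic n 1.
Proof.
  destruct n as [|[|n]];
    [rewrite indic_neq by lia|rewrite indic_eq by lia|rewrite indic_neq by lia]; simpl; ring.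
Qed.

Lemma zero_pow2 n : INR (ffact n 2) * 0 ^ (n - 2) = 2 * indic n 2.
Proof.
  destruct n as [|[|[|n]]];
    [rewrite indic_neq by lia|rewrite indic_neq by lia|rewrite indic_eq by lia|rewrite indic_neq by lia];
    simpl; ring.
Qed.

(* [G k] is the coefficient of [x ^ k] in [f]; [G1] and [G2] are [y] and [y ^ 2] times its derivatives. *)
Definition G k y := sum3 (fun t => indic (ea t) k * (c t * y ^ eb t)).
Definition G1 k y := sum3 (fun t => indic (ea t) k * (INR (eb t) * (c t * y ^ eb t))).
Definition G2 k y := sum3 (fun t => indic (ea t) k * (INR (eb t) * (INR (eb t) - 1) * (c t * y ^ eb t))).

Lemma f_axis i j y : y ^ j * f i j 0 y =
  sum3 (fun t => INR (ffact (ea t) i) * 0 ^ (ea t - i) * (INR (ffact (eb t) j) * (c t * y ^ eb t))).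
Proof.
  unfold tri_d, sum3. simpl sum_f_R0. rewrite !Rmult_plus_distr_l.
  assert (T : forall t, y ^ j *
      (c t * INR (ffact (ea t) i) * INR (ffact (eb t) j) * 0 ^ (ea t - i) * y ^ (eb t - j)) =
    INR (ffact (ea t) i) * 0 ^ (ea t - i) * (INR (ffact (eb t) j) * (c t * y ^ eb t))).
  { intros t.
    replace (y ^ j * (c t * INR (ffact (ea t) i) * INR (ffact (eb t) j) * 0 ^ (ea t - i) * y ^ (eb t - j)))
      with (INR (ffact (ea t) i) * 0 ^ (ea t - i) * c t * (INR (ffact (eb t) j) * y ^ (eb t - j) * y ^ j))
      by ring.
    rewrite ffact_pow. ring. }
  rewrite !T. reflexivity.
Qed.

Lemma f00_axis y : f 0 0 0 y = G 0 y.
Proof.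
  pose proof (f_axis 0 0 y) as H. rewrite pow_O, Rmult_1_l in H. rewrite H.
  unfold G, sum3. rewrite !zero_pow0. simpl (INR (ffact _ 0)). ring.
Qed.
Lemma f10_axis y : f 1 0 0 y = G 1 y.
Proof.
  pose proof (f_axis 1 0 y) as H. rewrite pow_O, Rmult_1_l in H. rewrite H.
  unfold G, sum3. rewrite !zero_pow1. simpl (INR (ffact _ 0)). ring.
Qed.
Lemma f20_axis y : f 2 0 0 y = 2 * G 2 y.
Proof.
  pose proof (f_axis 2 0 y) as H. rewrite pow_O, Rmult_1_l in H. rewrite H.
  unfold G, sum3. rewrite !zero_pow2. simpl (INR (ffact _ 0)). ring.
Qed.
Lemma f01_axis y : y * f 0 1 0 y = G1 0 y.
Proof.
  pose proof (f_axis 0 1 y) as H. rewrite pow_1 in H. rewrite H.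
  unfold G1, sum3. rewrite !zero_pow0, !ffact1. ring.
Qed.
Lemma f11_axis y : y * f 1 1 0 y = G1 1 y.
Proof.
  pose proof (f_axis 1 1 y) as H. rewrite pow_1 in H. rewrite H.
  unfold G1, sum3. rewrite !zero_pow1, !ffact1. ring.
Qed.
Lemma f02_axis y : y * y * f 0 2 0 y = G2 0 y.
Proof.
  pose proof (f_axis 0 2 y) as H. replace (y ^ 2) with (y * y) in H by ring. rewrite H.
  unfold G2, sum3. rewrite !zero_pow0, !ffact2. ring.
Qed.

Definition Hess0 y := 2 * G 2 y * G1 0 y ^ 2 - 2 * G1 1 y * G 1 y * G1 0 y + G2 0 y * G 1 y ^ 2.

Lemma sing_axis y : 0 < y ->
  (singular_pt c ea eb Rb (0, y) <-> y <= Rb /\ G 0 y = 0 /\ G 1 y = 0 /\ G1 0 y = 0).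
Proof.
  intros Hy. unfold singular_pt, on_curve, in_box. cbn [fst snd].
  rewrite f00_axis, f10_axis, <- f01_axis. split.
  - nra.
  - nra.
Qed.

Lemma vtan_axis y : 0 < y ->
  (vtangent_pt c ea eb Rb (0, y) <-> y <= Rb /\ G 0 y = 0 /\ G 1 y <> 0 /\ G1 0 y = 0).
Proof.
  intros Hy. unfold vtangent_pt, on_curve, in_box. cbn [fst snd].
  rewrite f00_axis, f10_axis, <- f01_axis. split.
  - nra.
  - nra.
Qed.

Lemma infl_axis y : 0 < y ->
  (inflection_pt c ea eb Rb (0, y) <->
   y <= Rb /\ G 0 y = 0 /\ (G 1 y <> 0 \/ G1 0 y <> 0) /\ Hess0 y = 0).
Proof.
  intros Hy. unfold inflection_pt, on_curve, in_box, Hess0. cbn [fst snd].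
  rewrite f00_axis, f10_axis, f20_axis, <- f01_axis, <- f11_axis, <- f02_axis.
  set (g1 := G 1 y). set (h := f 0 1 0 y). set (g2 := G 2 y).
  set (k := 2 * g2 * h ^ 2 - 2 * f 1 1 0 y * g1 * h + f 0 2 0 y * g1 ^ 2).
  replace (2 * g2 * (y * h) ^ 2 - 2 * (y * f 1 1 0 y) * g1 * (y * h) + y * y * f 0 2 0 y * g1 ^ 2)
    with (y * y * k) by (unfold k; ring).
  split.
  - nra.
  - intros (HB & H0 & H1 & H2). apply Rmult_integral in H2.
    assert (0 < y * y) by nra.
    repeat split; try tauto; try lra.
    destruct H1 as [H1|H1]; [left; assumption|right]. intros E. apply H1. rewrite E. ring.
Qed.

(** The power of [x] dividing the polynomial: the axis belongs to the curve exactly if it is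
    positive. *)
Definition kmin := Nat.min (ea 0) (Nat.min (ea 1) (ea 2)).

Lemma kmin_le t : (t < 3)%nat -> (kmin <= ea t)%nat.
Proof. unfold kmin. intros H. destruct t as [|[|[|t]]]; lia. Qed.

Lemma kmin_shape :
  (forall t, (t < 3)%nat -> ea t = kmin) \/
  (exists i j r, perm3 i j r /\ ea i = kmin /\ ea j = kmin /\ (kmin < ea r)%nat) \/
  (exists i j r, perm3 i j r /\ ea i = kmin /\ (kmin < ea j)%nat /\ (kmin < ea r)%nat).
Proof.
  pose proof (kmin_le 0 ltac:(lia)). pose proof (kmin_le 1 ltac:(lia)). pose proof (kmin_le 2 ltac:(lia)).
  assert (ea 0 = kmin \/ ea 1 = kmin \/ ea 2 = kmin)%nat by (unfold kmin; lia).
  destruct (Nat.eq_dec (ea 0) kmin), (Nat.eq_dec (ea 1) kmin), (Nat.eq_dec (ea 2) kmin); try lia.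
  - left. intros t Ht. destruct t as [|[|[|t]]]; lia.
  - right; left. exists 0%nat, 1%nat, 2%nat. unfold perm3. lia.
  - right; left. exists 0%nat, 2%nat, 1%nat. unfold perm3. lia.
  - right; right. exists 0%nat, 1%nat, 2%nat. unfold perm3. lia.
  - right; left. exists 1%nat, 2%nat, 0%nat. unfold perm3. lia.
  - right; right. exists 1%nat, 0%nat, 2%nat. unfold perm3. lia.
  - right; right. exists 2%nat, 0%nat, 1%nat. unfold perm3. lia.
Qed.

Lemma G_low k y : (k < kmin)%nat -> G k y = 0 /\ G1 k y = 0 /\ G2 k y = 0.
Proof.
  intros H. unfold G, G1, G2, sum3.
  assert (T : forall t, (t < 3)%nat -> indic (ea t) k = 0).
  { intros t Ht. apply indic_neq. pose proof (kmin_le t Ht). lia. }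
  rewrite !T by lia. repeat split; ring.
Qed.

Lemma term_neq t y : (t < 3)%nat -> 0 < y -> c t * y ^ eb t <> 0.
Proof.
  intros Ht Hy. pose proof (c_neq t Ht). pose proof (pow_lt y (eb t) Hy).
  apply Rmult_integral_contrapositive_currified; lra.
Qed.

Lemma G_deriv k y : 0 < y -> derivable_pt_lim (G k) y (G1 k y / y).
Proof.
  intros Hy. unfold G1, sum3.
  assert (T : forall g n, derivable_pt_lim (fun y => g * y ^ n) y (g * (INR n * y ^ n) / y)).
  { intros g n. replace (g * (INR n * y ^ n) / y) with (g * (INR n * y ^ Nat.pred n)).
    - apply (derivable_pt_lim_scal (fun y => y ^ n)). apply derivable_pt_lim_pow.
    - destruct n; [simpl; field; lra|]. simpl Nat.pred. simpl (y ^ S n). field. lra. }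
  set (g := fun t => indic (ea t) k * c t).
  assert (E : forall z, G k z = g 0%nat * z ^ eb 0 + g 1%nat * z ^ eb 1 + g 2%nat * z ^ eb 2)
    by (intros z; unfold G, sum3, g; ring).
  assert (D : derivable_pt_lim (fun z => g 0%nat * z ^ eb 0 + g 1%nat * z ^ eb 1 + g 2%nat * z ^ eb 2) y
    (g 0%nat * (INR (eb 0) * y ^ eb 0) / y + g 1%nat * (INR (eb 1) * y ^ eb 1) / y
     + g 2%nat * (INR (eb 2) * y ^ eb 2) / y)).
  { apply (derivable_pt_lim_plus (fun z => g 0%nat * z ^ eb 0 + g 1%nat * z ^ eb 1)
      (fun z => g 2%nat * z ^ eb 2)); [apply (derivable_pt_lim_plus (fun z => g 0%nat * z ^ eb 0)
      (fun z => g 1%nat * z ^ eb 1))|]; apply T. }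
  intros e He. destruct (D e He) as [d Hd]. exists d. intros h Hh Hhd.
  specialize (Hd h Hh Hhd). rewrite !E.
  match goal with |- Rabs (_ - ?u) < _ => match type of Hd with Rabs (_ - ?v) < _ =>
    replace u with v; [exact Hd|] end end.
  unfold g. field. lra.
Qed.

Lemma G_isolated_zero k y : 0 < y -> G k y = 0 -> G1 k y <> 0 ->
  exists r, 0 < r /\ forall z, Rabs (z - y) < r -> G k z = 0 -> z = y.
Proof.
  intros Hy H0 H1. pose proof (G_deriv k y Hy) as D. set (l := G1 k y / y) in *.
  assert (Hl : l <> 0).
  { apply Rmult_integral_contrapositive_currified; [assumption|]. apply Rinv_neq_0_compat. lra. }
  destruct (D (Rabs l / 2)) as [d Hd]. { pose proof (Rabs_pos_lt l Hl). lra. }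
  exists d. split; [apply cond_pos|]. intros z Hz E.
  destruct (Req_dec z y) as [|Hne]; [assumption|]. exfalso.
  specialize (Hd (z - y) ltac:(lra) Hz). replace (y + (z - y)) with z in Hd by ring.
  rewrite E, H0 in Hd. replace ((0 - 0) / (z - y) - l) with (- l) in Hd by lra.
  rewrite Rabs_Ropp in Hd. pose proof (Rabs_pos_lt l Hl). lra.
Qed.

Lemma G_nonzero_near k y : 0 < y -> G k y <> 0 ->
  exists r, 0 < r /\ forall z, Rabs (z - y) < r -> G k z <> 0.
Proof.
  intros Hy HG. assert (HC : continuity_pt (G k) y).
  { apply derivable_continuous_pt. exists (G1 k y / y). now apply G_deriv. }
  destruct (HC (Rabs (G k y))) as (d & Hd & H). { now apply Rabs_pos_lt. }
  exists d. split; [exact Hd|]. intros z Hz E.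
  destruct (Req_dec z y) as [->|Hne]; [contradiction|].
  specialize (H z). rewrite E in H.
  assert (Q : Rabs (0 - G k y) < Rabs (G k y)).
  { apply H. split; [split; [exact I|auto]|exact Hz]. }
  rewrite Rminus_0_l, Rabs_Ropp in Q. lra.
Qed.

Lemma two_terms_simple i j y m n : 0 < y -> (i < 3)%nat -> (j < 3)%nat -> i <> j -> ea i = ea j ->
  m = c i * y ^ eb i -> n = c j * y ^ eb j ->
  m + n = 0 -> INR (eb i) * m + INR (eb j) * n <> 0.
Proof.
  intros Hy Hi Hj Hij He Em En H0 H1.
  assert (Nm : m <> 0) by (subst m; now apply term_neq).
  assert (E : (INR (eb i) - INR (eb j)) * m = 0) by nra.
  apply Rmult_integral in E. destruct E as [E|E]; [|contradiction].
  destruct (exps_neq i j Hi Hj Hij) as [H|H]; [contradiction|]. apply H, INR_eq. lra.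
Qed.

Lemma Dt_perm i j r : perm3 i j r ->
  (Dt = 0 <-> (INR (ea j) - INR (ea i)) * (INR (eb r) - INR (eb i)) -
    (INR (ea r) - INR (ea i)) * (INR (eb j) - INR (eb i)) = 0).
Proof.
  intros (Hi & Hj & Hr & H1 & H2 & H3). unfold Dt, a1, a2, b1, b2.
  destruct i as [|[|[|i]]]; try lia; destruct j as [|[|[|j]]]; try lia;
    destruct r as [|[|[|r]]]; try lia; split; intros; lra.
Qed.

Lemma Dt_two_equal i j r : perm3 i j r -> ea i = ea j -> ea r <> ea i -> Dt <> 0.
Proof.
  intros P E N HD. apply (Dt_perm i j r P) in HD. rewrite <- E in HD.
  destruct P as (Hi & Hj & Hr & H1 & H2 & H3).
  assert (Q : (INR (ea r) - INR (ea i)) * (INR (eb j) - INR (eb i)) = 0) by lra.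
  apply Rmult_integral in Q. destruct Q as [Q|Q].
  - apply N, INR_eq. lra.
  - destruct (exps_neq i j Hi Hj H1) as [H|H]; [contradiction|]. apply H, INR_eq. lra.
Qed.

Lemma Dt_all_equal : (forall t, (t < 3)%nat -> ea t = ea 0%nat) -> Dt = 0.
Proof.
  intros H. unfold Dt, a1, a2. rewrite (H 1%nat), (H 2%nat) by lia. ring.
Qed.

Lemma G_sum k i j r y : perm3 i j r ->
  G k y = indic (ea i) k * (c i * y ^ eb i) + indic (ea j) k * (c j * y ^ eb j) + indic (ea r) k * (c r * y ^ eb r) /\
  G1 k y = indic (ea i) k * (INR (eb i) * (c i * y ^ eb i)) + indic (ea j) k * (INR (eb j) * (c j * y ^ eb j))
    + indic (ea r) k * (INR (eb r) * (c r * y ^ eb r)) /\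
  G2 k y = indic (ea i) k * (INR (eb i) * (INR (eb i) - 1) * (c i * y ^ eb i))
    + indic (ea j) k * (INR (eb j) * (INR (eb j) - 1) * (c j * y ^ eb j))
    + indic (ea r) k * (INR (eb r) * (INR (eb r) - 1) * (c r * y ^ eb r)).
Proof. intros P. unfold G, G1, G2. rewrite !(sum3_perm _ i j r P). auto. Qed.

(** Unless the exponents are collinear, at most two terms attain the lowest power of [x], and a
    binomial with two different exponents has only simple roots away from 0. *)
Lemma G_simple y : 0 < y -> Dt <> 0 -> G kmin y = 0 -> G1 kmin y <> 0.
Proof.
  intros Hy HD H0. destruct kmin_shape as [H|[(i & j & r & P & Hi & Hj & Hr)|(i & j & r & P & Hi & Hj & Hr)]].
  - exfalso. apply HD, Dt_all_equal. intros t Ht. rewrite !H by lia. reflexivity.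
  - destruct (G_sum kmin i j r y P) as (E0 & E1 & _). rewrite (indic_eq (ea i)), (indic_eq (ea j)), (indic_neq (ea r)) in * by lia.
    intros HE. destruct P as (P1 & P2 & P3 & P4 & P5 & P6).
    apply (two_terms_simple i j y _ _ Hy P1 P2 P4 ltac:(lia) eq_refl eq_refl); lra.
  - exfalso. destruct (G_sum kmin i j r y P) as (E0 & _). rewrite E0 in H0.
    rewrite (indic_eq (ea i)), (indic_neq (ea j)), (indic_neq (ea r)) in H0 by lia.
    apply (term_neq i y); [apply P|exact Hy|lra].
Qed.

Lemma all_equal_moments k x y : (forall t, (t < 3)%nat -> ea t = k) ->
  M0 x y = x ^ k * G k y /\ Ma x y = INR k * M0 x y /\ Mb x y = x ^ k * G1 k y /\
  Maa x y = INR k * (INR k - 1) * M0 x y /\ Mab x y = INR k * Mb x y.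
Proof.
  intros H. unfold M0, Ma, Mb, Maa, Mab, G, G1, sum3, mono. rewrite !H by lia.
  rewrite (indic_eq k k eq_refl). repeat split; ring.
Qed.

(** For [kmin = 0] a multiple zero of [G 0] requires that all terms be free of [x], and then [f1]
    vanishes too; for positive [kmin] the neighbours on the axis are vertical tangents as well. *)
Lemma isolated_vtan_axis y : 0 < y -> ~ isolated_in (vtangent_pt c ea eb Rb) (0, y).
Proof.
  intros Hy HI. assert (HS := proj1 HI). apply vtan_axis in HS; [|exact Hy].
  destruct HS as (HB & H0 & H1 & H2).
  destruct (Nat.eq_dec kmin 0) as [K|K].
  - rewrite <- K in H0, H2. destruct (Req_dec Dt 0) as [HD|HD].
    + destruct kmin_shape as [H|[(i & j & r & P & Hi & Hj & Hr)|(i & j & r & P & Hi & Hj & Hr)]].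
      * apply H1. unfold G, sum3. rewrite !H by lia. rewrite !(indic_neq kmin 1) by lia. ring.
      * apply (Dt_two_equal i j r); trivial; lia.
      * destruct (G_sum kmin i j r y P) as (E0 & _). rewrite E0 in H0.
        rewrite (indic_eq (ea i)), (indic_neq (ea j)), (indic_neq (ea r)) in H0 by lia.
        apply (term_neq i y); [apply P|exact Hy|lra].
    + now apply (G_simple y Hy HD).
  - destruct (G_nonzero_near 1 y Hy H1) as (r & Hr & HN).
    revert HI. apply (not_isolated_dir _ 0 y 0 (-1) (Rmin r y)); [lra|now apply Rmin_glb_lt|].
    intros s Hs. pose proof (Rmin_l r y). pose proof (Rmin_r r y).
    rewrite Rmult_0_r, Rplus_0_r. apply vtan_axis; [lra|].
    destruct (G_low 0 (y + s * -1)) as (-> & -> & _); [lia|].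
    repeat split; try lra. apply HN. replace (y + s * -1 - y) with (- s) by ring.
    rewrite Rabs_Ropp, Rabs_right; lra.
Qed.

(** For [kmin = 0] a singular point lies on a horizontal line of singular points, and for
    [kmin >= 2] the axis itself is one. For [kmin = 1] the singular points of the axis are the zeros
    of [G 1]; a multiple zero requires that all terms have the same power of [x], and then again a
    horizontal line is singular. *)
Lemma isolated_sing_axis y : 0 < y ->
  (isolated_in (singular_pt c ea eb Rb) (0, y) <->
   y <= Rb /\ kmin = 1%nat /\ G 1 y = 0 /\ G1 1 y <> 0).
Proof.
  intros Hy. split.
  - intros HI. assert (HS := proj1 HI). apply sing_axis in HS; [|exact Hy].
    destruct HS as (HB & H0 & H1 & H2). split; [exact HB|].
    destruct (Nat.eq_dec kmin 0) as [K|K].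
    { exfalso. rewrite <- K in H0, H2. destruct (Req_dec Dt 0) as [HD|HD].
      - destruct kmin_shape as [H|[(i & j & r & P & Hi & Hj & Hr)|(i & j & r & P & Hi & Hj & Hr)]].
        + revert HI. apply (not_isolated_dir _ 0 y 1 0 Rb); [lra|exact HRb|].
          intros s Hs. rewrite Rmult_0_r, Rmult_1_r, Rplus_0_r, Rplus_0_l.
          apply sing_pos; try lra. destruct (all_equal_moments kmin s y H) as (E0 & Ea & Eb & _).
          rewrite Ea, Eb, E0, H0, H2. repeat split; try lra; ring.
        + apply (Dt_two_equal i j r); trivial; lia.
        + destruct (G_sum kmin i j r y P) as (E0 & _). rewrite E0 in H0.
          rewrite (indic_eq (ea i)), (indic_neq (ea j)), (indic_neq (ea r)) in H0 by lia.
          apply (term_neq i y); [apply P|exact Hy|lra].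
      - now apply (G_simple y Hy HD). }
    destruct (Nat.eq_dec kmin 1) as [K1|K1].
    + split; [exact K1|]. split; [exact H1|]. intros HE.
      destruct (Req_dec Dt 0) as [HD|HD]; [|rewrite <- K1 in *; now apply (G_simple y Hy HD)].
      destruct kmin_shape as [H|[(i & j & r & P & Hi & Hj & Hr)|(i & j & r & P & Hi & Hj & Hr)]].
      * revert HI. apply (not_isolated_dir _ 0 y 1 0 Rb); [lra|exact HRb|].
        intros s Hs. rewrite Rmult_0_r, Rmult_1_r, Rplus_0_r, Rplus_0_l.
        apply sing_pos; try lra. destruct (all_equal_moments kmin s y H) as (E0 & Ea & Eb & _).
        rewrite Ea, Eb, E0, K1, H1, HE. repeat split; try lra; ring.
      * apply (Dt_two_equal i j r); trivial; lia.
      * destruct (G_sum kmin i j r y P) as (E0 & _). rewrite K1, H1 in E0.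
        rewrite (indic_eq (ea i)), (indic_neq (ea j)), (indic_neq (ea r)) in E0 by lia.
        apply (term_neq i y); [apply P|exact Hy|lra].
    + exfalso. revert HI. apply (not_isolated_dir _ 0 y 0 (-1) y); [lra|exact Hy|].
      intros s Hs. rewrite Rmult_0_r, Rplus_0_r. apply sing_axis; [lra|].
      destruct (G_low 0 (y + s * -1)) as (-> & -> & _); [lia|].
      destruct (G_low 1 (y + s * -1)) as (-> & _); [lia|]. repeat split; lra.
  - intros (HB & K & H0 & H1).
    assert (HS : singular_pt c ea eb Rb (0, y)).
    { apply sing_axis; [exact Hy|]. destruct (G_low 0 y) as (-> & -> & _); [lia|]. tauto. }
    split; [exact HS|].
    destruct (G_isolated_zero 1 y Hy H0 H1) as (r & Hr & HZ).
    exists (Rmin r y). split; [now apply Rmin_glb_lt|].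
    intros [u v] HS' [C1 C2]. simpl in C1, C2.
    pose proof (Rmin_l r y). pose proof (Rmin_r r y).
    assert (Hv : 0 < v) by (apply Rabs_def2 in C2; lra).
    assert (Hu : 0 <= u) by (destruct HS' as ((HB' & _) & _); apply HB').
    rewrite Rabs_minus_sym in C2.
    destruct Hu as [Hu|<-].
    + exfalso. destruct (Req_dec Dt 0) as [HD|HD]; [|now apply (no_sing_pos u v HD Hu Hv)].
      destruct kmin_shape as [H'|[(i & j & q & P & Hi & Hj & Hq)|(i & j & q & P & Hi & Hj & Hq)]].
      * apply sing_pos in HS'; trivial. destruct HS' as (_ & E0 & _ & E2).
        destruct (all_equal_moments kmin u v H') as (F0 & _ & F2 & _).
        rewrite K in F0, F2. rewrite F0 in E0. rewrite F2 in E2. apply Rmult_integral in E0, E2. destruct E0 as [E0|E0]; [lra|]. destruct E2 as [E2|E2]; [lra|].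
        apply HZ in E0; [|lra]. subst v. contradiction.
      * apply (Dt_two_equal i j q); trivial; lia.
      * destruct (G_sum kmin i j q y P) as (E0 & _). rewrite K, H0 in E0.
        rewrite (indic_eq (ea i)), (indic_neq (ea j)), (indic_neq (ea q)) in E0 by lia.
        apply (term_neq i y); [apply P|exact Hy|lra].
    + apply sing_axis in HS'; [|exact Hv]. destruct HS' as (_ & _ & E & _).
      f_equal. apply HZ; [lra|exact E].
Qed.

(* Symmetric way to say, when exactly two terms are free of [x], what [infl_cond_perm] states. *)
Definition infl_cond (thr : nat) : Prop :=
  (thr <= ea 0 + ea 1 + ea 2 \/
   (ea 0 + ea 1 + ea 2 = 1 /\
    eb 0 + eb 1 + eb 2 = 3 * ((if Nat.eq_dec (ea 0) 0 then 0 else eb 0) +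
      (if Nat.eq_dec (ea 1) 0 then 0 else eb 1) + (if Nat.eq_dec (ea 2) 0 then 0 else eb 2)) + 1))%nat.

Lemma infl_cond_perm thr i j r : perm3 i j r -> ea i = 0%nat -> ea j = 0%nat -> (0 < ea r)%nat ->
  (infl_cond thr <-> (thr <= ea r)%nat \/ ea r = 1%nat /\ (eb i + eb j = 2 * eb r + 1)%nat).
Proof.
  intros (Hi & Hj & Hr & H1 & H2 & H3) Ei Ej Er. unfold infl_cond.
  destruct i as [|[|[|i]]]; try lia; destruct j as [|[|[|j]]]; try lia;
    destruct r as [|[|[|r]]]; try lia;
    destruct (Nat.eq_dec (ea 0) 0), (Nat.eq_dec (ea 1) 0), (Nat.eq_dec (ea 2) 0); lia.
Qed.

(** A line of positive slope through [(0, Rb)]: it leaves the box at that point. *)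
Definition corner_axis : Prop := line_case /\ G 0 Rb = 0 /\ G 1 Rb * G1 0 Rb < 0.

(** The main case has two terms free of [x] and a third one with the power [ea r]. For [ea r >= 3]
    the curvature form vanishes on the curve, for [ea r = 2] it is a nonzero multiple of the square
    of [f2], and for [ea r = 1] it factors, where [eb i + eb j - (2 * eb r + 1)] is the only factor
    that can be 0. If all terms are free of [x], the curve consists of horizontal lines; if only one
    is, it does not meet the open half-axis. *)
Lemma isolated_infl_axis y : 0 < y ->
  (isolated_in (inflection_pt c ea eb Rb) (0, y) <->
   y <= Rb /\
   ((~ line_case /\ kmin = 0%nat /\ G 0 y = 0 /\ G1 0 y <> 0 /\ infl_cond 3) \/
    (y = Rb /\ corner_axis))).
Proof.
  intros Hy. unfold corner_axis. destruct (Nat.eq_dec kmin 0) as [K|K].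
  2: { split.
    - intros HI. exfalso. assert (HS := proj1 HI). apply infl_axis in HS; [|exact Hy].
      destruct HS as (HB & H0 & H1 & H2).
      destruct (G_low 0 y) as (_ & E1 & _); [lia|]. assert (HG : G 1 y <> 0) by tauto.
      destruct (G_nonzero_near 1 y Hy HG) as (r & Hr & HN).
      revert HI. apply (not_isolated_dir _ 0 y 0 (-1) (Rmin r y)); [lra|now apply Rmin_glb_lt|].
      intros s Hs. pose proof (Rmin_l r y). pose proof (Rmin_r r y).
      rewrite Rmult_0_r, Rplus_0_r. apply infl_axis; [lra|]. unfold Hess0.
      destruct (G_low 0 (y + s * -1)) as (-> & -> & ->); [lia|].
      split; [lra|]. split; [lra|]. split; [|ring]. left.
      apply HN. replace (y + s * -1 - y) with (- s) by ring.
      rewrite Rabs_Ropp, Rabs_right; lra.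
    - intros (HB & [H|(_ & _ & _ & H)]); [tauto|].
      exfalso. destruct (G_low 0 Rb) as (_ & E & _); [lia|]. rewrite E in H. lra. }
  destruct kmin_shape as [H|[(i & j & r & P & Hi & Hj & Hr)|(i & j & r & P & Hi & Hj & Hr)]];
    rewrite K in *.
  - assert (HD : Dt = 0) by (apply Dt_all_equal; intros t Ht; rewrite !H by lia; reflexivity).
    split.
    + intros HI. exfalso. assert (HS := proj1 HI). apply infl_axis in HS; [|exact Hy].
      destruct HS as (HB & H0 & H1 & _).
      assert (E1 : G 1 y = 0).
      { unfold G, sum3. rewrite !H by lia. rewrite !(indic_neq 0 1) by lia. ring. }
      revert HI. apply (not_isolated_dir _ 0 y 1 0 Rb); [lra|exact HRb|].
      intros s Hs. rewrite Rmult_0_r, Rmult_1_r, Rplus_0_r, Rplus_0_l.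
      apply infl_pos; try lra. unfold Hess.
      destruct (all_equal_moments 0 s y H) as (F0 & Fa & Fb & Faa & Fab).
      rewrite Faa, Fab, Fa, Fb, F0, H0. repeat split; try lra.
    + intros (_ & [(_ & _ & _ & _ & HC)|(_ & HL & _)]); exfalso.
      * unfold infl_cond in HC. rewrite !H in HC by lia. lia.
      * now apply (proj1 HL).
  - assert (HD : Dt <> 0) by (apply (Dt_two_equal i j r); trivial; lia).
    assert (HC := infl_cond_perm 3 i j r P Hi Hj Hr). rewrite HC.
    assert (PP := P). destruct PP as (P1 & P2 & P3 & P4 & P5 & P6).
    assert (Simp : forall y, 0 < y -> G 0 y = 0 -> G1 0 y <> 0)
      by (intros z Hz Ez; rewrite <- K in *; now apply G_simple).
    assert (Mem : inflection_pt c ea eb Rb (0, y) <-> y <= Rb /\ G 0 y = 0 /\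
      ((3 <= ea r)%nat \/ ea r = 1%nat /\ (eb i + eb j = 2 * eb r + 1)%nat)).
    { rewrite infl_axis by exact Hy. unfold Hess0.
      destruct (G_sum 0 i j r y P) as (E00 & E01 & E02).
      destruct (G_sum 1 i j r y P) as (E10 & E11 & _). destruct (G_sum 2 i j r y P) as (E20 & _).
      rewrite (indic_eq (ea i)), (indic_eq (ea j)), (indic_neq (ea r)) in E00, E01, E02 by lia.
      rewrite (indic_neq (ea i)), (indic_neq (ea j)) in E10, E11, E20 by lia.
      destruct (Nat.lt_ge_cases (ea r) 3) as [R3|R3].
      - destruct (Nat.eq_dec (ea r) 1) as [R1|R1].
        + rewrite (indic_eq (ea r)) in E10, E11 by lia. rewrite (indic_neq (ea r)) in E20 by lia.
          assert (Nr : c r * y ^ eb r <> 0) by now apply term_neq.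
          set (mr := c r * y ^ eb r) in *. set (mi := c i * y ^ eb i) in *. set (mj := c j * y ^ eb j) in *.
          (* At a zero the two terms free of [x] are opposite; this is what makes the form
             factor. *)
          assert (Key : G 0 y = 0 -> (2 * G 2 y * G1 0 y ^ 2 - 2 * G1 1 y * G 1 y * G1 0 y +
            G2 0 y * G 1 y ^ 2 = (INR (eb i) - INR (eb j)) * (mi * mr * mr) *
              (INR (eb i) + INR (eb j) - (2 * INR (eb r) + 1)))).
          { intros H0. rewrite E20, E01, E11, E10, E02. assert (mj = - mi) as -> by lra. ring. }
          assert (Nmi : mi <> 0) by now apply term_neq.
          split.
          * intros (HB & H0 & _ & HH). repeat split; trivial. right. split; [exact R1|].
            rewrite Key in HH by exact H0.
            apply Rmult_integral in HH. destruct HH as [HH|HH].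
            { exfalso. apply Rmult_integral in HH. destruct HH as [HH|HH].
              - destruct (exps_neq i j P1 P2 P4) as [Q|Q]; [lia|]. apply Q, INR_eq. lra.
              - apply Rmult_integral in HH. destruct HH as [HH|HH]; [|contradiction].
                apply Rmult_integral in HH. tauto. }
            apply INR_eq. rewrite !plus_INR, mult_INR. simpl (INR 2). simpl (INR 1). lra.
          * intros (HB & H0 & [Hx|(_ & Hx)]); [lia|]. split; [exact HB|]. split; [exact H0|].
            split; [right; now apply Simp|]. rewrite Key by exact H0.
            apply (f_equal INR) in Hx. rewrite !plus_INR, mult_INR in Hx.
            simpl (INR 2) in Hx. simpl (INR 1) in Hx.
            replace (INR (eb i) + INR (eb j) - (2 * INR (eb r) + 1)) with 0 by lra. ring.
        + rewrite (indic_neq (ea r)) in E10, E11 by lia. rewrite (indic_eq (ea r)) in E20 by lia.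
          assert (Nr : c r * y ^ eb r <> 0) by now apply term_neq.
          split.
          * intros (HB & H0 & _ & HH). exfalso. pose proof (Simp y Hy H0) as HN.
            rewrite E11, E10, E20 in HH.
            assert (HH' : c r * y ^ eb r * (G1 0 y * G1 0 y) = 0) by lra.
            apply Rmult_integral in HH'. destruct HH' as [HH'|HH']; [contradiction|].
            apply Rmult_integral in HH'. tauto.
          * lia.
      - rewrite (indic_neq (ea r)) in E10, E11, E20 by lia.
        split.
        + tauto.
        + intros (HB & H0 & _). split; [exact HB|]. split; [exact H0|].
          split; [right; now apply Simp|]. rewrite E20, E10, E11. ring. }
    destruct (classic line_case) as [HL|HL].
    + destruct (line_case_shape HL) as (i' & j' & r' & Q & L1 & L2 & L3 & L4).
      assert (EK : ea i' = 0%nat).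
      { assert (In' : (kmin = ea i')%nat).
        { destruct kmin_shape as [H'|[(u & v & w & P' & Hu & _)|(u & v & w & P' & Hu & _)]].
          - symmetry. apply H'. apply Q.
          - destruct Q as (Q1 & Q2 & Q3 & Q4 & Q5 & Q6). destruct P' as (U1 & _).
            assert (u = i' \/ u = j' \/ u = r') as [->|[->| ->]] by lia; lia.
          - destruct Q as (Q1 & Q2 & Q3 & Q4 & Q5 & Q6). destruct P' as (U1 & _).
            assert (u = i' \/ u = j' \/ u = r') as [->|[->| ->]] by lia; lia. }
        lia. }
      destruct (G_sum 0 i' j' r' y Q) as (E00 & E01 & _).
      destruct (G_sum 1 i' j' r' y Q) as (E10 & _).
      rewrite (indic_eq (ea i')), (indic_neq (ea j')), (indic_eq (ea r')) in E00, E01 by lia.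
      rewrite (indic_neq (ea i')), (indic_eq (ea j')), (indic_neq (ea r')) in E10 by lia.
      rewrite L4 in E00, E01. rewrite L2 in E10. simpl (y ^ S _) in E00, E01. rewrite S_INR in E01.
      set (w := y ^ eb i') in *. assert (Hw : 0 < w) by now apply pow_lt.
      assert (E0' : G 0 y = w * (c i' + c r' * y)) by lra.
      assert (PQ : G 0 y = 0 -> G 1 y * G1 0 y = w * w * y * (c j' * c r')).
      { intros H0. rewrite E0' in H0. apply Rmult_integral in H0. destruct H0 as [H0|H0]; [lra|].
        rewrite E10, E01. replace (c i') with (- (c r' * y)) by lra. ring. }
      assert (Cj : c j' <> 0) by (apply c_neq, Q). assert (Cr : c r' <> 0) by (apply c_neq, Q).
      assert (HZ : forall x y, 0 < x -> 0 < y -> (M0 x y = 0 <-> c i' + c j' * x + c r' * y = 0)).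
      { intros u v Hu Hv. rewrite (proj1 (M0_line i' j' r' u v Q L1 L2 L3 L4)).
        pose proof (pow_lt u (ea i') Hu) as W1. pose proof (pow_lt v (eb i') Hv) as W2.
        assert (0 < u ^ ea i' * v ^ eb i') by nra.
        split; intros H0; [apply Rmult_integral in H0; lra|rewrite H0; ring]. }
      split.
      * intros HI. assert (HS := proj1 HI). rewrite Mem in HS. destruct HS as (HB & H0 & _).
        split; [exact HB|]. right.
        assert (H0' : c i' + c r' * y = 0).
        { nra. }
        destruct (classic (y < Rb \/ 0 < c j' * c r')) as [HC'|HC'].
        -- exfalso.
           (* The orientation of the line that points into the quadrant. *)
           set (sg := if Rlt_dec 0 (c r') then 1 else -1).
           assert (Hsg : 0 < sg * c r' /\ sg * sg = 1).
           { unfold sg. destruct (Rlt_dec 0 (c r')); split; lra. }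
           clearbody sg.
           set (kk := Rmin (Rmin Rb y) (if Rlt_dec y Rb then Rb - y else 1)).
           assert (KK : 0 < kk /\ kk <= Rb /\ kk <= y /\ (y < Rb -> kk <= Rb - y)).
           { repeat split.
             - repeat apply Rmin_glb_lt; try lra. destruct (Rlt_dec _ _); lra.
             - eapply Rle_trans; [apply Rmin_l|apply Rmin_l].
             - eapply Rle_trans; [apply Rmin_l|apply Rmin_r].
             - intros Z. eapply Rle_trans; [apply Rmin_r|]. destruct (Rlt_dec y Rb); [lra|contradiction]. }
           destruct KK as (K1 & K2 & K3 & K4). destruct (small_step (sg * c r') (sg * - c j') kk K1) as (s0 & Hs0 & HSm).
           revert HI. apply (not_isolated_dir _ 0 y (sg * c r') (sg * - c j') s0); [left; lra|exact Hs0|].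
           intros s Hs. destruct (HSm s Hs) as [A1 A2]. apply Rabs_def2 in A1, A2.
           assert (0 < s * (sg * c r')) by nra.
           apply infl_of_line; trivial; try lra.
           ++ split; [lra|]. split; [lra|].
              destruct HC' as [HC'|HC']; [specialize (K4 HC'); lra|].
              nra.
           ++ apply HZ; lra.
        -- assert (EY : y = Rb) by lra. subst y.
           split; [reflexivity|]. split; [exact HL|]. split; [exact H0|]. assert (c j' * c r' <> 0) by nra.
           assert (0 < w * w * Rb) by (apply Rmult_lt_0_compat; nra). nra.
      * intros (HB & [(X & _)|(-> & _ & H0 & HN)]); [contradiction|].
        assert (Wp : 0 < w * w * Rb) by (apply Rmult_lt_0_compat; nra).
        assert (CN : c j' * c r' < 0) by nra.
        assert (H0' : c i' + c r' * Rb = 0).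
        { nra. }
        assert (HS : inflection_pt c ea eb Rb (0, Rb)).
        { apply Mem. split; [lra|]. split; [exact H0|]. right.
          destruct Q as (Q1 & Q2 & Q3 & Q4 & Q5 & Q6).
          assert (r = j') as ->.
          { assert (r = i' \/ r = j' \/ r = r') as [->|[->| ->]] by lia; [lia|reflexivity|lia]. }
          split; [lia|].
          assert ((i = i' /\ j = r') \/ (i = r' /\ j = i')) as [[-> ->]|[-> ->]] by lia; lia. }
        split; [exact HS|].
        destruct (G_isolated_zero 0 Rb HRb H0 (Simp Rb HRb H0)) as (q & Hq & HZ0).
        exists (Rmin q Rb). split; [now apply Rmin_glb_lt|].
        intros [u v] HS' [C1 C2]. simpl in C1, C2.
        pose proof (Rmin_l q Rb). pose proof (Rmin_r q Rb).
        assert (Hv : 0 < v) by (apply Rabs_def2 in C2; lra).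
        assert (Hu : 0 <= u) by (destruct HS' as ((HB' & _) & _); apply HB').
        destruct Hu as [Hu|<-].
        -- exfalso. apply infl_pos in HS'; trivial. destruct HS' as ([_ Bv] & E0 & _).
           apply HZ in E0; trivial.
           nra.
        -- f_equal. apply HZ0; [rewrite Rabs_minus_sym; lra|].
           apply infl_axis in HS'; [|exact Hv]. tauto.
    + split.
      * intros HI. apply proj1, Mem in HI. destruct HI as (HB & H0 & HX).
        split; [exact HB|]. left. repeat split; trivial. now apply Simp.
      * intros (HB & [(_ & _ & H0 & H1 & HX)|(_ & X & _)]); [|contradiction].
        assert (HS : inflection_pt c ea eb Rb (0, y)) by tauto.
        destruct (G_isolated_zero 0 y Hy H0 H1) as (q & Hq & HZ0).
        apply (finite_isolated _ pos_pt (0, y) (Rmin q y)); trivial.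
        -- now apply infl_finite.
        -- now apply Rmin_glb_lt.
        -- intros [u v] [C1 C2] HS'. simpl in C1, C2.
           pose proof (Rmin_l q y). pose proof (Rmin_r q y).
           assert (Hv : 0 < v) by (apply Rabs_def2 in C2; lra).
           assert (Hu : 0 <= u) by (destruct HS' as ((HB' & _) & _); apply HB').
           destruct Hu as [Hu|<-]; [left; split; assumption|right].
           f_equal. apply HZ0; [rewrite Rabs_minus_sym; lra|].
           apply infl_axis in HS'; [|exact Hv]. tauto.
  - assert (N0 : G 0 y <> 0).
    { destruct (G_sum 0 i j r y P) as (E0 & _). rewrite E0.
      rewrite (indic_eq (ea i)), (indic_neq (ea j)), (indic_neq (ea r)) by lia.
      pose proof (term_neq i y ltac:(apply P) Hy). lra. }
    split.
    + intros HI. apply proj1 in HI. apply infl_axis in HI; tauto.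
    + intros (_ & [H|(-> & H)]); tauto.
Qed.
End Curve.

(** * Exchanging the coordinates *)

Lemma trinomial_swap c ea eb : is_trinomial c ea eb -> is_trinomial c eb ea.
Proof.
  intros [H1 H2]. split; [exact H1|]. intros i j Hi Hj Hij E. apply (H2 i j Hi Hj Hij).
  congruence.
Qed.

Lemma tri_d_swap c ea eb i j x y : tri_d c eb ea j i y x = tri_d c ea eb i j x y.
Proof. unfold tri_d. simpl sum_f_R0. ring. Qed.

Definition swap (p : R * R) : R * R := (snd p, fst p).

Lemma isolated_swap (S S' : R * R -> Prop) p : (forall q, S' (swap q) <-> S q) ->
  (isolated_in S' (swap p) <-> isolated_in S p).
Proof.
  intros H. destruct p as [x y]. unfold isolated_in. rewrite H. unfold swap. simpl. split.
  - intros [HS (r & Hr & HI)]. split; [exact HS|]. exists r. split; [exact Hr|].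
    intros [u v] Hq [C1 C2]. apply H in Hq. assert (E : swap (u, v) = (y, x)) by (apply HI; [exact Hq|split; simpl; assumption]).
    unfold swap in E. simpl in E. congruence.
  - intros [HS (r & Hr & HI)]. split; [exact HS|]. exists r. split; [exact Hr|].
    intros [u v] Hq [C1 C2]. assert (E : (v, u) = (x, y)).
    { apply HI; [apply H; exact Hq|split; simpl; assumption]. }
    congruence.
Qed.

Lemma sing_swap c ea eb Rb p : singular_pt c eb ea Rb (swap p) <-> singular_pt c ea eb Rb p.
Proof.
  destruct p as [x y]. unfold singular_pt, on_curve, in_box, swap. rewrite !(tri_d_swap c ea eb). tauto.
Qed.

Lemma infl_swap c ea eb Rb p : inflection_pt c eb ea Rb (swap p) <-> inflection_pt c ea eb Rb p.
Proof.
  destruct p as [x y]. unfold inflection_pt, on_curve, in_box, swap. cbn [fst snd].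
  rewrite !(tri_d_swap c ea eb).
  match goal with |- _ /\ _ /\ ?u = 0 <-> _ /\ _ /\ ?v = 0 => replace u with v by ring end. tauto.
Qed.

Lemma line_case_swap ea eb : line_case eb ea <-> line_case ea eb.
Proof.
  unfold line_case.
  assert (ED : Dt eb ea = - Dt ea eb) by (unfold Dt, a1, a2, b1, b2; ring).
  assert (E3 : e3 eb ea = e3 ea eb) by (unfold e3, Dt, a1, a2, b1, b2; ring).
  assert (E2 : e2 eb ea = e2 ea eb) by (unfold e2, Dt, a1, a2, b1, b2; ring).
  assert (E1 : e1 eb ea = e1 ea eb) by (unfold e1, Dt, a1, a2, b1, b2; ring).
  assert (E0 : e0 eb ea = e0 ea eb) by (unfold e0, Dt, a1, a2, b1, b2; ring).
  split; intros H; repeat split; try tauto; lra.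
Qed.

Lemma M_swap c ea eb x y :
  M0 c eb ea y x = M0 c ea eb x y /\ Ma c eb ea y x = Mb c ea eb x y /\
  Mb c eb ea y x = Ma c ea eb x y.
Proof. unfold M0, Ma, Mb, sum3, mono. repeat split; ring. Qed.

(** * The origin *)

Section Boundary.

Variables (c : nat -> R) (ea eb : nat -> nat) (Rb : R).
Hypothesis Htri : is_trinomial c ea eb.
Hypothesis HRb : 0 < Rb.

Let Htri' : is_trinomial c eb ea := trinomial_swap _ _ _ Htri.

Lemma vtan_yaxis x : 0 < x ->
  (vtangent_pt c ea eb Rb (x, 0) <->
   x <= Rb /\ G c eb ea 0 x = 0 /\ G c eb ea 1 x = 0 /\ G1 c eb ea 0 x <> 0).
Proof.
  intros Hx. unfold vtangent_pt, on_curve, in_box. cbn [fst snd].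
  rewrite <- (tri_d_swap c ea eb 0 0), <- (tri_d_swap c ea eb 0 1), <- (tri_d_swap c ea eb 1 0).
  rewrite f00_axis, f10_axis, <- f01_axis. split.
  - nra.
  - nra.
Qed.

(** Vertical tangency is not symmetric in the coordinates, so this axis needs its own analysis. If
    two terms are free of [y], the sum of the exponents is that of the third term: for the value 1
    the derivative [f2] is nonzero, from 2 on it vanishes on the axis. A sum of 0 means vertical
    lines, on which no point is isolated. *)
Lemma isolated_vtan_yaxis x : 0 < x ->
  (isolated_in (vtangent_pt c ea eb Rb) (x, 0) <->
   x <= Rb /\ kmin eb = 0%nat /\ G c eb ea 0 x = 0 /\ G1 c eb ea 0 x <> 0 /\
   (2 <= eb 0 + eb 1 + eb 2)%nat).
Proof.
  intros Hx. destruct (Nat.eq_dec (kmin eb) 0) as [K|K].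
  2: { split.
    - intros [HS _]. apply vtan_yaxis in HS; [|exact Hx].
      destruct (G_low c eb ea 0 x) as (_ & E & _); [lia|]. tauto.
    - tauto. }
  destruct (kmin_shape eb) as [H|[(i & j & r & P & Hi & Hj & Hr)|(i & j & r & P & Hi & Hj & Hr)]];
    rewrite K in *.
  - split.
    + intros HI. exfalso. assert (HS := proj1 HI). apply vtan_yaxis in HS; [|exact Hx].
      destruct HS as (HB & H0 & H1 & H2).
      revert HI. apply (not_isolated_dir _ x 0 0 1 Rb); [lra|exact HRb|].
      intros s Hs. rewrite Rmult_0_r, Rmult_1_r, Rplus_0_r, Rplus_0_l.
      apply vtan_pos; try lra. destruct (all_equal_moments c eb ea 0 s x H) as (F0 & Fa & Fb & _).
      destruct (M_swap c ea eb x s) as (W0 & Wa & Wb). rewrite <- W0, <- Wa, <- Wb, Fa, Fb, F0, H0.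
      repeat split; lra.
    + intros (_ & _ & _ & _ & HX). rewrite !H in HX by lia. lia.
  - assert (HD' : Dt eb ea <> 0) by (apply (Dt_two_equal c eb ea Htri' i j r); trivial; lia).
    assert (HD : Dt ea eb <> 0).
    { intros E. apply HD'. unfold Dt, a1, a2, b1, b2 in *. lra. }
    assert (ES : (eb 0 + eb 1 + eb 2)%nat = eb r).
    { destruct P as (P1 & P2 & P3 & P4 & P5 & P6).
      destruct i as [|[|[|i]]]; try lia; destruct j as [|[|[|j]]]; try lia;
        destruct r as [|[|[|r]]]; lia. }
    destruct (G_sum c eb ea 1 i j r x P) as (E10 & _).
    rewrite (indic_neq (eb i)), (indic_neq (eb j)) in E10 by lia.
    split.
    + intros [HS _]. apply vtan_yaxis in HS; [|exact Hx]. destruct HS as (HB & H0 & H1 & H2).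
      repeat split; trivial. destruct (Nat.eq_dec (eb r) 1) as [R1|R1]; [|lia].
      exfalso. rewrite (indic_eq (eb r)) in E10 by lia.
      apply (term_neq c eb ea Htri' r x); [apply P|exact Hx|lra].
    + intros (HB & _ & H0 & H1 & HX). rewrite (indic_neq (eb r)) in E10 by lia.
      assert (HS : vtangent_pt c ea eb Rb (x, 0)) by (apply vtan_yaxis; [exact Hx|]; repeat split; trivial; lra).
      destruct (G_isolated_zero c eb ea 0 x Hx H0 H1) as (q & Hq & HZ0).
      apply (finite_isolated _ pos_pt (x, 0) (Rmin q x)); trivial.
      * now apply vtan_finite.
      * now apply Rmin_glb_lt.
      * intros [u v] [C1 C2] HS'. simpl in C1, C2.
        pose proof (Rmin_l q x). pose proof (Rmin_r q x).
        assert (Hu : 0 < u) by (apply Rabs_def2 in C1; lra).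
        assert (Hv : 0 <= v) by (destruct HS' as ((HB' & _) & _); apply HB').
        destruct Hv as [Hv|<-]; [left; split; assumption|right].
        f_equal. apply HZ0; [rewrite Rabs_minus_sym; lra|].
        apply vtan_yaxis in HS'; [|exact Hu]. tauto.
  - split.
    + intros [HS _]. exfalso. apply vtan_yaxis in HS; [|exact Hx]. destruct HS as (_ & H0 & _).
      destruct (G_sum c eb ea 0 i j r x P) as (E0 & _). rewrite (indic_eq (eb i)), (indic_neq (eb j)), (indic_neq (eb r)) in E0 by lia.
      apply (term_neq c eb ea Htri' i x); [apply P|exact Hx|lra].
    + intros (_ & _ & H0 & _). exfalso.
      destruct (G_sum c eb ea 0 i j r x P) as (E0 & _). rewrite (indic_eq (eb i)), (indic_neq (eb j)), (indic_neq (eb r)) in E0 by lia.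
      apply (term_neq c eb ea Htri' i x); [apply P|exact Hx|lra].
Qed.

Theorem special_xaxis0 y : 0 < y ->
  (special_pt c ea eb Rb (0, y) <->
   y <= Rb /\
   ((kmin ea = 1%nat /\ G c ea eb 1 y = 0 /\ G1 c ea eb 1 y <> 0) \/
    (~ line_case ea eb /\ kmin ea = 0%nat /\ G c ea eb 0 y = 0 /\ G1 c ea eb 0 y <> 0 /\
     infl_cond ea eb 3) \/
    (y = Rb /\ corner_axis c ea eb Rb))).
Proof.
  intros Hy. unfold special_pt.
  rewrite (isolated_infl_axis c ea eb Rb Htri HRb y Hy),
    (isolated_sing_axis c ea eb Rb Htri HRb y Hy).
  pose proof (isolated_vtan_axis c ea eb Rb Htri HRb y Hy). tauto.
Qed.

Theorem special_yaxis0 x : 0 < x ->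
  (special_pt c ea eb Rb (x, 0) <->
   x <= Rb /\
   ((kmin eb = 1%nat /\ G c eb ea 1 x = 0 /\ G1 c eb ea 1 x <> 0) \/
    (~ line_case ea eb /\ kmin eb = 0%nat /\ G c eb ea 0 x = 0 /\ G1 c eb ea 0 x <> 0 /\
     infl_cond eb ea 3) \/
    (kmin eb = 0%nat /\ G c eb ea 0 x = 0 /\ G1 c eb ea 0 x <> 0 /\
     (2 <= eb 0 + eb 1 + eb 2)%nat) \/
    (x = Rb /\ corner_axis c eb ea Rb))).
Proof.
  intros Hx. unfold special_pt.
  rewrite <- (isolated_swap (inflection_pt c ea eb Rb) (inflection_pt c eb ea Rb) (x, 0)) by (intros; apply infl_swap).
  rewrite <- (isolated_swap (singular_pt c ea eb Rb) (singular_pt c eb ea Rb) (x, 0)) by (intros; apply sing_swap).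
  rewrite (isolated_infl_axis c eb ea Rb Htri' HRb x Hx),
    (isolated_sing_axis c eb ea Rb Htri' HRb x Hx), (isolated_vtan_yaxis x Hx), line_case_swap.
  tauto.
Qed.

Definition cf (p q : nat) : R := sum3 (fun t => indic (ea t) p * (indic (eb t) q * c t)).

Lemma f_origin i j : tri_d c ea eb i j 0 0 =
  sum3 (fun t => INR (ffact (ea t) i) * 0 ^ (ea t - i) * (INR (ffact (eb t) j) * 0 ^ (eb t - j) * c t)).
Proof. unfold tri_d, sum3. simpl sum_f_R0. ring. Qed.

Lemma f00_origin : tri_d c ea eb 0 0 0 0 = cf 0 0.
Proof. rewrite f_origin. unfold cf, sum3. rewrite !zero_pow0. ring. Qed.
Lemma f10_origin : tri_d c ea eb 1 0 0 0 = cf 1 0.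
Proof. rewrite f_origin. unfold cf, sum3. rewrite !zero_pow0, !zero_pow1. ring. Qed.
Lemma f01_origin : tri_d c ea eb 0 1 0 0 = cf 0 1.
Proof. rewrite f_origin. unfold cf, sum3. rewrite !zero_pow0, !zero_pow1. ring. Qed.
Lemma f20_origin : tri_d c ea eb 2 0 0 0 = 2 * cf 2 0.
Proof. rewrite f_origin. unfold cf, sum3. rewrite !zero_pow0, !zero_pow2. ring. Qed.
Lemma f02_origin : tri_d c ea eb 0 2 0 0 = 2 * cf 0 2.
Proof. rewrite f_origin. unfold cf, sum3. rewrite !zero_pow0, !zero_pow2. ring. Qed.
Lemma f11_origin : tri_d c ea eb 1 1 0 0 = cf 1 1.
Proof. rewrite f_origin. unfold cf, sum3. rewrite !zero_pow1. ring. Qed.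

Lemma origin_in_box : in_box Rb (0, 0).
Proof. unfold in_box. simpl. lra. Qed.

Lemma sing_origin : singular_pt c ea eb Rb (0, 0) <-> cf 0 0 = 0 /\ cf 1 0 = 0 /\ cf 0 1 = 0.
Proof.
  unfold singular_pt, on_curve. cbn [fst snd]. rewrite f00_origin, f10_origin, f01_origin.
  pose proof origin_in_box. tauto.
Qed.

Lemma vtan_origin : vtangent_pt c ea eb Rb (0, 0) <-> cf 0 0 = 0 /\ cf 0 1 = 0 /\ cf 1 0 <> 0.
Proof.
  unfold vtangent_pt, on_curve. cbn [fst snd]. rewrite f00_origin, f10_origin, f01_origin.
  pose proof origin_in_box. tauto.
Qed.

Definition hess_origin : R :=
  cf 2 0 * (cf 0 1 * cf 0 1) - cf 1 1 * cf 1 0 * cf 0 1 + cf 0 2 * (cf 1 0 * cf 1 0).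

Lemma infl_origin : inflection_pt c ea eb Rb (0, 0) <->
  cf 0 0 = 0 /\ (cf 1 0 <> 0 \/ cf 0 1 <> 0) /\ hess_origin = 0.
Proof.
  unfold inflection_pt, on_curve, hess_origin. cbn [fst snd].
  rewrite f00_origin, f10_origin, f01_origin, f20_origin, f11_origin, f02_origin.
  pose proof origin_in_box.
  match goal with |- _ /\ _ /\ ?u = 0 <-> _ /\ _ /\ ?v = 0 => replace u with (2 * v) by ring;
    assert (E : 2 * v = 0 <-> v = 0) by (split; lra) end.
  tauto.
Qed.

Lemma cf_neq p q : cf p q <> 0 <-> exists t, (t < 3)%nat /\ ea t = p /\ eb t = q.
Proof.
  unfold cf. split.
  - intros H. apply NNPP. intros HN. apply H. unfold sum3.
    assert (T : forall t, (t < 3)%nat -> indic (ea t) p * (indic (eb t) q * c t) = 0).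
    { intros t Ht. destruct (Nat.eq_dec (ea t) p) as [E1|E1]; [|rewrite indic_neq by assumption; ring].
      destruct (Nat.eq_dec (eb t) q) as [E2|E2]; [|rewrite (indic_neq (eb t)) by assumption; ring].
      exfalso. apply HN. now exists t. }
    rewrite !T by lia. ring.
  - intros (i & Hi & E1 & E2).
    assert (W : exists j r, perm3 i j r).
    { destruct i as [|[|[|i]]]; [exists 1%nat, 2%nat|exists 0%nat, 2%nat|exists 0%nat, 1%nat|]; unfold perm3; lia. }
    destruct W as (j & r & P). rewrite (sum3_perm _ i j r P).
    assert (T : forall t, (t < 3)%nat -> t <> i -> indic (ea t) p * (indic (eb t) q * c t) = 0).
    { intros t Ht Hne. destruct (exps_neq c ea eb Htri t i Ht Hi Hne) as [Q|Q].
      - rewrite (indic_neq (ea t)) by lia. ring.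
      - rewrite (indic_neq (eb t)) by lia. ring. }
    destruct P as (P1 & P2 & P3 & P4 & P5 & P6).
    rewrite (T j), (T r) by lia. rewrite (indic_eq (ea i)), (indic_eq (eb i)) by lia.
    pose proof (c_neq c ea eb Htri i Hi). lra.
Qed.

(** Close to 0 the term of lowest degree outweighs the others; the radius makes [y] times the sum of
    their coefficients smaller than the coefficient of that term. *)
Lemma sparse_nonzero_near0 (g : nat -> R) (d : nat -> nat) i : (i < 3)%nat -> g i <> 0 ->
  (forall t, (t < 3)%nat -> t <> i -> g t <> 0 -> (d i < d t)%nat) ->
  exists r, 0 < r /\ forall y, 0 < y < r -> sum3 (fun t => g t * y ^ d t) <> 0.
Proof.
  intros Hi Hg Hd.
  assert (W : exists j r, perm3 i j r).
  { destruct i as [|[|[|i]]]; [exists 1%nat, 2%nat|exists 0%nat, 2%nat|exists 0%nat, 1%nat|]; unfold perm3; lia. }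
  destruct W as (j & r & P).
  set (s := Rabs (g j) + Rabs (g r) + 1).
  assert (Hs : 0 < s) by (unfold s; pose proof (Rabs_pos (g j)); pose proof (Rabs_pos (g r)); lra).
  exists (Rmin 1 (Rabs (g i) / s)). split.
  { apply Rmin_glb_lt; [lra|]. apply Rdiv_lt_0_compat; [now apply Rabs_pos_lt|exact Hs]. }
  intros y [Hy1 Hy2]. pose proof (Rmin_l 1 (Rabs (g i) / s)). pose proof (Rmin_r 1 (Rabs (g i) / s)).
  rewrite (sum3_perm _ i j r P). intros E.
  assert (Py : 0 < y ^ d i) by now apply pow_lt.
  assert (T : forall t, (t < 3)%nat -> t <> i -> Rabs (g t * y ^ d t) <= Rabs (g t) * (y * y ^ d i)).
  { intros t Ht Hne. rewrite Rabs_mult.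
    destruct (Req_dec (g t) 0) as [Z|Z].
    - rewrite Z, Rabs_R0. lra.
    - specialize (Hd t Ht Hne Z).
      rewrite (Rabs_right (y ^ d t)) by (left; now apply pow_lt).
      apply Rmult_le_compat_l; [apply Rabs_pos|].
      replace (y * y ^ d i) with (y ^ S (d i)) by tauto.
      replace (d t) with (S (d i) + (d t - S (d i)))%nat by lia. rewrite pow_add.
      assert (0 < y ^ S (d i)) by now apply pow_lt.
      assert (y ^ (d t - S (d i)) <= 1).
      { rewrite <- (pow1 (d t - S (d i))). apply pow_incr. lra. }
      nra. }
  assert (E' : g i * y ^ d i = - (g j * y ^ d j + g r * y ^ d r)) by lra.
  apply (f_equal Rabs) in E'. rewrite Rabs_Ropp, Rabs_mult, (Rabs_right (y ^ d i)) in E' by lra.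
  destruct P as (P1 & P2 & P3 & P4 & P5 & P6).
  pose proof (Rabs_triang (g j * y ^ d j) (g r * y ^ d r)) as TR.
  pose proof (T j P2 ltac:(lia)). pose proof (T r P3 ltac:(lia)).
  assert (Q3 : y * s < Rabs (g i)).
  { apply Rmult_lt_reg_r with (/ s); [now apply Rinv_0_lt_compat|].
    rewrite Rmult_assoc, Rinv_r by lra. lra. }
  unfold s in Q3. nra.
Qed.

Lemma G_near0 : exists r, 0 < r /\ forall y, 0 < y < r -> G c ea eb (kmin ea) y <> 0.
Proof.
  assert (W : exists i, (i < 3)%nat /\ ea i = kmin ea /\
    forall t, (t < 3)%nat -> t <> i -> ea t = kmin ea -> (eb i < eb t)%nat).
  { assert (N : forall s t, (s < 3)%nat -> (t < 3)%nat -> s <> t -> ea s = ea t -> eb s <> eb t).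
    { intros s t Hs Ht Hst E. destruct (exps_neq c ea eb Htri s t Hs Ht Hst); tauto. }
    destruct (kmin_shape ea) as [H|[(i & j & r & P & Hi & Hj & Hr)|(i & j & r & P & Hi & Hj & Hr)]].
    - assert (N1 := N 0%nat 1%nat ltac:(lia) ltac:(lia) ltac:(lia) ltac:(rewrite !H by lia; reflexivity)).
      assert (N2 := N 0%nat 2%nat ltac:(lia) ltac:(lia) ltac:(lia) ltac:(rewrite !H by lia; reflexivity)).
      assert (N3 := N 1%nat 2%nat ltac:(lia) ltac:(lia) ltac:(lia) ltac:(rewrite !H by lia; reflexivity)).
      assert (Q : (eb 0 < eb 1 /\ eb 0 < eb 2 \/ eb 1 < eb 0 /\ eb 1 < eb 2 \/
        eb 2 < eb 0 /\ eb 2 < eb 1)%nat) by lia.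
      destruct Q as [Q|[Q|Q]]; [exists 0%nat|exists 1%nat|exists 2%nat];
        (split; [lia|split; [apply H; lia|]]); intros t Ht Hne _;
        destruct t as [|[|[|t]]]; lia.
    - destruct P as (P1 & P2 & P3 & P4 & P5 & P6).
      pose proof (N i j P1 P2 P4 ltac:(lia)).
      destruct (Nat.lt_ge_cases (eb i) (eb j)); [exists i|exists j];
        (split; [assumption|split; [assumption|]]); intros t Ht Hne Hk;
        assert (t = i \/ t = j \/ t = r) as [->|[->| ->]] by lia; lia.
    - destruct P as (P1 & P2 & P3 & P4 & P5 & P6). exists i.
      split; [assumption|split; [assumption|]]; intros t Ht Hne Hk.
      assert (t = i \/ t = j \/ t = r) as [->|[->| ->]] by lia; lia. }
  destruct W as (i & Hi & Ei & HW).
  destruct (sparse_nonzero_near0 (fun t => indic (ea t) (kmin ea) * c t) eb i Hi) as (r & Hr & H).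
  - rewrite (indic_eq _ _ Ei), Rmult_1_l. now apply (c_neq c ea eb Htri).
  - intros t Ht Hne Hg. destruct (Nat.eq_dec (ea t) (kmin ea)) as [E|E]; [now apply HW|].
    exfalso. apply Hg. rewrite (indic_neq _ _ E). ring.
  - exists r. split; [exact Hr|]. intros y Hy HG. apply (H y Hy).
    rewrite <- HG. unfold G, sum3. ring.
Qed.

End Boundary.

Section Origin.

Variables (c : nat -> R) (ea eb : nat -> nat) (Rb : R).
Hypothesis Htri : is_trinomial c ea eb.
Hypothesis HRb : 0 < Rb.

Let Htri' : is_trinomial c eb ea := trinomial_swap _ _ _ Htri.

Notation cf := (cf c ea eb).

(** The singular points of the quadrant lie on an orbit of the flow, and for [a1 * b1 < 0] this
    orbit runs into the origin. *)
Definition double_root : Prop :=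
  Dt ea eb = 0 /\ a1 ea * b1 eb < 0 /\
  exists x y, 0 < x /\ 0 < y /\ M0 c ea eb x y = 0 /\ Ma c ea eb x y = 0 /\ Mb c ea eb x y = 0.

Lemma f00_yaxis x : tri_d c ea eb 0 0 x 0 = G c eb ea 0 x.
Proof. rewrite <- (tri_d_swap c ea eb 0 0), f00_axis. reflexivity. Qed.

(* Near the origin, a set of curve points is controlled separately on the two axes and in the open
   quadrant. *)
Lemma near_origin (S : R * R -> Prop) r1 r2 :
  S (0, 0) -> (forall p, S p -> in_box Rb p) -> finite_in S pos_pt -> 0 < r1 -> 0 < r2 ->
  (forall y, 0 < y < r1 -> ~ S (0, y)) -> (forall x, 0 < x < r2 -> ~ S (x, 0)) ->
  isolated_in S (0, 0).
Proof.
  intros H0 HB HF Hr1 Hr2 HX HY.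
  apply (finite_isolated S pos_pt (0, 0) (Rmin r1 r2)); trivial; [now apply Rmin_glb_lt|].
  intros [u v] [C1 C2] HS. destruct (HB _ HS) as [[Bu _] [Bv _]]. simpl in *.
  pose proof (Rmin_l r1 r2). pose proof (Rmin_r r1 r2).
  apply Rabs_def2 in C1, C2. destruct Bu as [Bu|<-], Bv as [Bv|<-].
  - left. split; assumption.
  - exfalso. apply (HY u); [lra|exact HS].
  - exfalso. apply (HX v); [lra|exact HS].
  - right. reflexivity.
Qed.

Lemma cf_kmin p q : cf p q <> 0 -> (kmin ea <= p)%nat /\ (kmin eb <= q)%nat.
Proof.
  intros H. apply (cf_neq c ea eb Htri) in H. destruct H as (t & Ht & <- & <-).
  split; now apply kmin_le.
Qed.

Lemma kmin0_exists : kmin ea = 0%nat -> exists t, (t < 3)%nat /\ ea t = 0%nat.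
Proof.
  intros K. destruct (kmin_shape ea) as [H|[(i & j & r & P & Hi & _)|(i & j & r & P & Hi & _)]].
  - exists 0%nat. split; [lia|]. rewrite H; lia.
  - exists i. split; [apply P|lia].
  - exists i. split; [apply P|lia].
Qed.

(** The terms include [x] and some [y^m] with [m > 0]. A third exponent vector [(p, q)] collinear
    with these satisfies [q + p * m = m], which leaves only the two vectors themselves. *)
Lemma linear_not_collinear : cf 0 0 = 0 -> cf 1 0 <> 0 -> kmin ea = 0%nat -> Dt ea eb <> 0.
Proof.
  intros H00 H10 K. apply (cf_neq c ea eb Htri) in H10. destruct H10 as (i & Hi & Ei & Fi).
  destruct (kmin0_exists K) as (j & Hj & Ej).
  assert (Fj : (0 < eb j)%nat).
  { destruct (Nat.eq_dec (eb j) 0) as [Z|Z]; [|lia]. exfalso.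
    assert (X : cf 0 0 <> 0) by (apply (cf_neq c ea eb Htri); exists j; auto). contradiction. }
  assert (W : exists r, perm3 i j r).
  { destruct i as [|[|[|i]]]; try lia; destruct j as [|[|[|j]]]; try lia;
      first [exists 2%nat; unfold perm3; lia|exists 1%nat; unfold perm3; lia|exists 0%nat; unfold perm3; lia]. }
  destruct W as (r & P). intros HD. apply (Dt_perm ea eb i j r P) in HD.
  assert (Hr := P). destruct Hr as (_ & _ & Hr & _ & Hir & Hjr).
  rewrite Ei, Fi, Ej in HD. simpl (INR 1) in HD. simpl (INR 0) in HD.
  assert (E : INR (eb r) + INR (ea r) * INR (eb j) = INR (eb j)) by lra.
  rewrite <- mult_INR, <- plus_INR in E. apply INR_eq in E.
  destruct (exps_neq c ea eb Htri r i Hr Hi ltac:(lia)) as [Q|Q];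
    destruct (exps_neq c ea eb Htri r j Hr Hj ltac:(lia)) as [Q'|Q'];
    destruct (ea r) as [|[|n]]; try lia; nia.
Qed.

Lemma line_case_no_smooth_origin : line_case ea eb -> kmin ea = 0%nat -> kmin eb = 0%nat -> cf 0 0 <> 0.
Proof.
  intros HL K L. destruct (line_case_shape ea eb HL) as (i & j & r & P & E1 & E2 & E3 & E4).
  apply (cf_neq c ea eb Htri). exists i. split; [apply P|].
  assert (W : forall t, (t < 3)%nat -> (ea i <= ea t)%nat /\ (eb i <= eb t)%nat).
  { intros t Ht. destruct P as (P1 & P2 & P3 & P4 & P5 & P6).
    assert (t = i \/ t = j \/ t = r) as [->|[->| ->]] by lia; lia. }
  unfold kmin in K, L. pose proof (W 0%nat ltac:(lia)). pose proof (W 1%nat ltac:(lia)).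
  pose proof (W 2%nat ltac:(lia)). lia.
Qed.

Lemma curve_axis_free : kmin ea = 0%nat -> exists r, 0 < r /\ forall y, 0 < y < r ->
  ~ on_curve c ea eb Rb (0, y).
Proof.
  intros K. destruct (G_near0 c ea eb Htri) as (r & Hr & H). exists r. split; [exact Hr|].
  intros y Hy [_ E]. rewrite f00_axis in E. rewrite K in H. now apply (H y Hy).
Qed.

Lemma curve_yaxis_free : kmin eb = 0%nat -> exists r, 0 < r /\ forall x, 0 < x < r ->
  ~ on_curve c ea eb Rb (x, 0).
Proof.
  intros K. destruct (G_near0 c eb ea Htri') as (r & Hr & H). exists r. split; [exact Hr|].
  intros x Hx [_ E]. rewrite f00_yaxis in E. rewrite K in H. now apply (H x Hx).
Qed.

(** If [x] divides the polynomial, points of the axis near the origin are vertical tangents too.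
    Otherwise the curve avoids both open half-axes near the origin, and the quadrant contains
    finitely many vertical tangents. *)
Lemma isolated_vtan_origin : isolated_in (vtangent_pt c ea eb Rb) (0, 0) <->
  cf 0 0 = 0 /\ cf 1 0 <> 0 /\ cf 0 1 = 0 /\ kmin ea = 0%nat.
Proof.
  split.
  - intros HI. assert (HS := proj1 HI). apply (vtan_origin c ea eb Rb HRb) in HS.
    destruct HS as (H0 & H1 & H2). repeat split; trivial.
    destruct (Nat.eq_dec (kmin ea) 0) as [|K]; [assumption|]. exfalso.
    pose proof (proj1 (cf_kmin _ _ H2)) as K'. assert (K1 : kmin ea = 1%nat) by lia.
    destruct (G_near0 c ea eb Htri) as (r & Hr & HG). rewrite K1 in HG.
    revert HI. apply (not_isolated_dir _ 0 0 0 1 (Rmin r Rb)); [lra|now apply Rmin_glb_lt|].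
    intros s Hs. pose proof (Rmin_l r Rb). pose proof (Rmin_r r Rb).
    rewrite Rmult_0_r, Rmult_1_r, Rplus_0_l, Rplus_0_l. apply vtan_axis; trivial; [lra|].
    destruct (G_low c ea eb 0 s) as (-> & -> & _); [lia|]. repeat split; try lra. apply HG. lra.
  - intros (H0 & H1 & H2 & K).
    pose proof (proj2 (cf_kmin _ _ H1)) as L.
    destruct (curve_axis_free K) as (r1 & Hr1 & X1).
    destruct (curve_yaxis_free ltac:(lia)) as (r2 & Hr2 & X2).
    apply (near_origin _ r1 r2); trivial.
    + apply (vtan_origin c ea eb Rb HRb). tauto.
    + intros p HS. apply HS.
    + apply (vtan_finite c ea eb Rb Htri). now apply linear_not_collinear.
    + intros y Hy HS. apply (X1 y Hy). apply HS.
    + intros x Hx HS. apply (X2 x Hx). apply HS.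
Qed.

End Origin.

Section OriginSpecial.

Variables (c : nat -> R) (ea eb : nat -> nat) (Rb : R).
Hypothesis Htri : is_trinomial c ea eb.
Hypothesis HRb : 0 < Rb.

Let Htri' : is_trinomial c eb ea := trinomial_swap _ _ _ Htri.

Notation cfo := (cf c ea eb).

Lemma cf_swap p q : cf c eb ea q p = cfo p q.
Proof. unfold cf, sum3. ring. Qed.

(** Stated for an arbitrary trinomial since it is also applied with the coordinates exchanged. *)
Lemma infl_origin_kmin c' ea' eb' : is_trinomial c' ea' eb' ->
  isolated_in (inflection_pt c' ea' eb' Rb) (0, 0) -> kmin ea' = 0%nat.
Proof.
  intros Ht HI. assert (HS := proj1 HI). apply (infl_origin c' ea' eb' Rb HRb) in HS.
  destruct HS as (H0 & H1 & _).
  destruct (Nat.eq_dec (kmin ea') 0) as [|K]; [assumption|]. exfalso.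
  assert (H2 : cf c' ea' eb' 1 0 <> 0).
  { destruct H1 as [H1|H1]; [exact H1|]. exfalso. apply (cf_kmin c' ea' eb' Ht) in H1. lia. }
  pose proof (proj1 (cf_kmin c' ea' eb' Ht _ _ H2)) as K'. assert (K1 : kmin ea' = 1%nat) by lia.
  destruct (G_near0 c' ea' eb' Ht) as (r & Hr & HG). rewrite K1 in HG.
  revert HI. apply (not_isolated_dir _ 0 0 0 1 (Rmin r Rb)); [lra|now apply Rmin_glb_lt|].
  intros s Hs. pose proof (Rmin_l r Rb). pose proof (Rmin_r r Rb).
  rewrite Rmult_0_r, Rmult_1_r, Rplus_0_l, Rplus_0_l. apply infl_axis; trivial; [lra|]. unfold Hess0.
  destruct (G_low c' ea' eb' 0 s) as (-> & -> & ->); [lia|].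
  split; [lra|]. split; [reflexivity|]. split; [left; apply HG; lra|ring].
Qed.

Lemma isolated_infl_origin : isolated_in (inflection_pt c ea eb Rb) (0, 0) <->
  cfo 0 0 = 0 /\ (cfo 1 0 <> 0 \/ cfo 0 1 <> 0) /\ kmin ea = 0%nat /\ kmin eb = 0%nat /\
  hess_origin c ea eb = 0.
Proof.
  split.
  - intros HI. assert (HS := proj1 HI). apply (infl_origin c ea eb Rb HRb) in HS.
    destruct HS as (H0 & H1 & H2). repeat split; trivial.
    + now apply (infl_origin_kmin c ea eb).
    + apply (infl_origin_kmin c eb ea Htri').
      apply (isolated_swap (inflection_pt c ea eb Rb) (inflection_pt c eb ea Rb) (0, 0));
        [intros; apply infl_swap|exact HI].
  - intros (H0 & H1 & K & L & HH).
    destruct (curve_axis_free c ea eb Rb Htri K) as (r1 & Hr1 & X1).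
    destruct (curve_yaxis_free c ea eb Rb Htri L) as (r2 & Hr2 & X2).
    apply (near_origin Rb _ r1 r2); trivial.
    + apply (infl_origin c ea eb Rb HRb). tauto.
    + intros p HS. apply HS.
    + apply infl_finite; trivial.
      * destruct H1 as [H1|H1]; [now apply (linear_not_collinear c)|].
        assert (HD : Dt eb ea <> 0).
        { apply (linear_not_collinear c eb ea Htri'); trivial; rewrite cf_swap; assumption. }
        intros E. apply HD. unfold Dt, a1, a2, b1, b2 in *. lra.
      * intros HL. now apply (line_case_no_smooth_origin c ea eb Htri).
    + intros y Hy HS. apply (X1 y Hy). apply HS.
    + intros x Hx HS. apply (X2 x Hx). apply HS.
Qed.

Lemma sing_origin_kmin c' ea' eb' : is_trinomial c' ea' eb' ->
  isolated_in (singular_pt c' ea' eb' Rb) (0, 0) -> (kmin ea' <= 1)%nat.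
Proof.
  intros Ht HI. destruct (Nat.le_gt_cases (kmin ea') 1) as [|K]; [assumption|]. exfalso.
  revert HI. apply (not_isolated_dir _ 0 0 0 1 Rb); [lra|exact HRb|].
  intros s Hs. rewrite Rmult_0_r, Rmult_1_r, Rplus_0_l, Rplus_0_l. apply sing_axis; trivial; [lra|].
  destruct (G_low c' ea' eb' 0 s) as (-> & -> & _); [lia|].
  destruct (G_low c' ea' eb' 1 s) as (-> & _); [lia|]. repeat split; lra.
Qed.

Lemma sing_axis_free c' ea' eb' : is_trinomial c' ea' eb' -> (kmin ea' <= 1)%nat ->
  exists r, 0 < r /\ forall y, 0 < y < r -> ~ singular_pt c' ea' eb' Rb (0, y).
Proof.
  intros Ht K. destruct (G_near0 c' ea' eb' Ht) as (r & Hr & H). exists r. split; [exact Hr|].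
  intros y Hy HS. apply sing_axis in HS; trivial; [|lra]. destruct HS as (_ & H0 & H1 & _).
  apply (H y Hy). destruct (Nat.eq_dec (kmin ea') 0) as [->|]; [exact H0|].
  replace (kmin ea') with 1%nat by lia. exact H1.
Qed.

(** In the collinear case all singular points share the level [lam] of [a1 ln x + b1 ln y]. With
    [a1 * b1 >= 0] this function tends to infinity in absolute value at the origin; inside the
    chosen radius both logarithms are below [- (Rabs lam + 1) / w], so the level exceeds [Rabs lam]
    in absolute value. *)
Lemma no_double_root_near_origin : ~ double_root c ea eb -> exists r, 0 < r /\
  forall x y, 0 < x < r -> 0 < y < r -> ~ singular_pt c ea eb Rb (x, y).
Proof.
  intros HD. destruct (Req_dec (Dt ea eb) 0) as [E|E].
  2: { exists 1. split; [lra|]. intros x y [Hx _] [Hy _]. now apply no_sing_pos. }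
  destruct (classic (exists x y, 0 < x /\ 0 < y /\ singular_pt c ea eb Rb (x, y))) as [(x0 & y0 & Hx0 & Hy0 & HS0)|HN].
  2: { exists 1. split; [lra|]. intros x y [Hx _] [Hy _] HS. apply HN. now exists x, y. }
  apply sing_pos in HS0; trivial. destruct HS0 as (_ & A0 & A1 & A2).
  assert (HP : 0 <= a1 ea * b1 eb).
  { destruct (Rle_lt_dec 0 (a1 ea * b1 eb)) as [|HP]; [assumption|]. exfalso. apply HD.
    split; [exact E|]. split; [exact HP|]. exists x0, y0. tauto. }
  assert (N01 : a1 ea <> 0 \/ b1 eb <> 0).
  { destruct (exps_neq c ea eb Htri 0 1) as [H|H]; try lia; [left|right]; unfold a1, b1; intros Z;
      apply H, INR_eq; lra. }
  set (lam := a1 ea * ln x0 + b1 eb * ln y0).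
  set (w := Rabs (a1 ea) + Rabs (b1 eb)).
  assert (Hw : 0 < w).
  { unfold w. pose proof (Rabs_pos (a1 ea)). pose proof (Rabs_pos (b1 eb)).
    destruct N01 as [N|N]; pose proof (Rabs_pos_lt _ N); lra. }
  exists (exp (- ((Rabs lam + 1) / w))). split; [apply exp_pos|].
  intros x y [Hx1 Hx2] [Hy1 Hy2] HS. apply sing_pos in HS; trivial. destruct HS as (_ & B0 & B1 & B2).
  pose proof (sing_level c ea eb Htri x0 y0 x y E Hx0 Hy0 Hx1 Hy1 A0 A1 A2 B0 B1 B2) as HLv.
  fold lam in HLv. set (K := (Rabs lam + 1) / w) in *.
  assert (L1 : ln x < - K) by (rewrite <- (ln_exp (- K)); now apply ln_increasing).
  assert (L2 : ln y < - K) by (rewrite <- (ln_exp (- K)); now apply ln_increasing).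
  assert (HK : K * w = Rabs lam + 1) by (unfold K; field; lra).
  pose proof (Rle_abs lam). pose proof (Rle_abs (- lam)) as X. rewrite Rabs_Ropp in X.
  unfold w in HK.
  destruct (Rle_lt_dec 0 (a1 ea)) as [S1|S1], (Rle_lt_dec 0 (b1 eb)) as [S2|S2].
  - rewrite !Rabs_right in HK by lra. nra.
  - assert (a1 ea = 0) as Z by nra. rewrite Z, Rabs_R0, Rabs_left in HK by lra. nra.
  - assert (b1 eb = 0) as Z by nra. rewrite Z, Rabs_R0, Rabs_left in HK by lra. nra.
  - rewrite !Rabs_left in HK by lra. nra.
Qed.

(** A singular point is carried along the flow for a time so long that both coordinates drop below
    [d]. *)
Lemma double_root_not_isolated : double_root c ea eb ->
  ~ isolated_in (singular_pt c ea eb Rb) (0, 0).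
Proof.
  intros (HD & HN & x & y & Hx & Hy & H0 & H1 & H2). apply not_isolated_near. intros r Hr.
  assert (W : exists sg, (sg = 1 \/ sg = -1) /\ 0 < sg * - b1 eb /\ 0 < sg * a1 ea).
  { destruct (Rle_lt_dec (a1 ea) 0) as [S|S]; [exists (-1)|exists 1].
    - assert (0 < b1 eb) by nra.
      assert (a1 ea < 0) by nra.
      split; [now right|]. split; lra.
    - nra. }
  destruct W as (sg & _ & P1 & P2).
  set (p := sg * - b1 eb) in *. set (q := sg * a1 ea) in *.
  set (d := Rmin r Rb). assert (Hd : 0 < d) by now apply Rmin_glb_lt.
  set (K := Rmax ((ln x - ln d + 1) / p) ((ln y - ln d + 1) / q)).
  pose proof (Rmax_l ((ln x - ln d + 1) / p) ((ln y - ln d + 1) / q)) as K1. fold K in K1.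
  pose proof (Rmax_r ((ln x - ln d + 1) / p) ((ln y - ln d + 1) / q)) as K2. fold K in K2.
  assert (K1' : ln x - p * K < ln d).
  { apply Rmult_le_compat_l with (r := p) in K1; [|lra].
    replace (p * ((ln x - ln d + 1) / p)) with (ln x - ln d + 1) in K1 by (field; lra). lra. }
  assert (K2' : ln y - q * K < ln d).
  { apply Rmult_le_compat_l with (r := q) in K2; [|lra].
    replace (q * ((ln y - ln d + 1) / q)) with (ln y - ln d + 1) in K2 by (field; lra). lra. }
  set (th := sg * K).
  assert (U : forall z k, 0 < z -> ln z - k < ln d -> z * exp (- k) < d).
  { intros z k Hz Hk. apply exp_increasing in Hk. rewrite exp_ln in Hk by exact Hd.
    unfold Rminus in Hk. rewrite exp_plus, exp_ln in Hk by exact Hz. exact Hk. }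
  assert (Eu : b1 eb * th = - (p * K)) by (unfold p, th; ring).
  assert (Ev : - a1 ea * th = - (q * K)) by (unfold q, th; ring).
  pose proof (U x (p * K) Hx K1') as Ux. pose proof (U y (q * K) Hy K2') as Uy.
  destruct (flow_moments c ea eb x y th HD Hx Hy) as (g & Hg & F0 & F1 & F2 & _).
  rewrite Eu, Ev in *.
  set (u := x * exp (- (p * K))) in *. set (v := y * exp (- (q * K))) in *.
  assert (Pu : 0 < u) by (apply Rmult_lt_0_compat; [assumption|apply exp_pos]).
  assert (Pv : 0 < v) by (apply Rmult_lt_0_compat; [assumption|apply exp_pos]).
  pose proof (Rmin_l r Rb) as M1. pose proof (Rmin_r r Rb) as M2. fold d in M1, M2.
  exists (u, v). split; [|split].
  - apply sing_pos; trivial. rewrite F0, F1, F2, H0, H1, H2. split; [split; lra|]. repeat split; ring.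
  - split; simpl; rewrite Rminus_0_l, Rabs_Ropp, Rabs_right; lra.
  - intros Z. injection Z as Z1 Z2. lra.
Qed.

Lemma isolated_sing_origin : isolated_in (singular_pt c ea eb Rb) (0, 0) <->
  cfo 0 0 = 0 /\ cfo 1 0 = 0 /\ cfo 0 1 = 0 /\ (kmin ea <= 1)%nat /\ (kmin eb <= 1)%nat /\
  ~ double_root c ea eb.
Proof.
  split.
  - intros HI. assert (HS := proj1 HI). apply (sing_origin c ea eb Rb HRb) in HS.
    destruct HS as (H0 & H1 & H2). repeat split; trivial.
    + now apply (sing_origin_kmin c ea eb).
    + apply (sing_origin_kmin c eb ea Htri').
      apply (isolated_swap (singular_pt c ea eb Rb) (singular_pt c eb ea Rb) (0, 0));
        [intros; apply sing_swap|exact HI].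
    + intros HD. now apply double_root_not_isolated in HD.
  - intros (H0 & H1 & H2 & K & L & HD).
    destruct (sing_axis_free c ea eb Htri K) as (r1 & Hr1 & X1).
    destruct (sing_axis_free c eb ea Htri' L) as (r2 & Hr2 & X2).
    destruct (no_double_root_near_origin HD) as (r3 & Hr3 & X3).
    split; [apply (sing_origin c ea eb Rb HRb); tauto|].
    exists (Rmin r1 (Rmin r2 r3)). split; [repeat apply Rmin_glb_lt; assumption|].
    intros [u v] HS [C1 C2]. simpl in C1, C2.
    pose proof (Rmin_l r1 (Rmin r2 r3)). pose proof (Rmin_r r1 (Rmin r2 r3)).
    pose proof (Rmin_l r2 r3). pose proof (Rmin_r r2 r3).
    apply Rabs_def2 in C1, C2.
    assert (HB : 0 <= u /\ 0 <= v) by (destruct HS as ((HB & _) & _); split; apply HB).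
    destruct HB as [[Bu|<-] [Bv|<-]].
    + exfalso. apply (X3 u v); try lra. exact HS.
    + exfalso. apply (X2 u); [lra|]. apply (sing_swap c ea eb Rb (u, 0)). exact HS.
    + exfalso. apply (X1 v); [lra|exact HS].
    + reflexivity.
Qed.

Theorem special_origin : special_pt c ea eb Rb (0, 0) <->
  cfo 0 0 = 0 /\
  ((cfo 1 0 <> 0 /\ cfo 0 1 = 0 /\ kmin ea = 0%nat) \/
   ((cfo 1 0 <> 0 \/ cfo 0 1 <> 0) /\ kmin ea = 0%nat /\ kmin eb = 0%nat /\ hess_origin c ea eb = 0) \/
   (cfo 1 0 = 0 /\ cfo 0 1 = 0 /\ (kmin ea <= 1)%nat /\ (kmin eb <= 1)%nat /\ ~ double_root c ea eb)).
Proof.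
  unfold special_pt. rewrite isolated_infl_origin, isolated_sing_origin,
    (isolated_vtan_origin c ea eb Rb Htri HRb). tauto.
Qed.

Lemma special_quadrant x y : 0 < x -> 0 < y -> Dt ea eb <> 0 ->
  (special_pt c ea eb Rb (x, y) <->
   box Rb x y /\
   ((~ line_case ea eb /\ exists t, Ecub ea eb t = 0 /\ 0 < T1 c t /\ 0 < T2 c t /\
      x = Xt c ea eb t /\ y = Yt c ea eb t) \/
    (exists t, be eb t = 0 /\ 0 < T1 c t /\ 0 < T2 c t /\ x = Xt c ea eb t /\ y = Yt c ea eb t) \/
    (line_case ea eb /\ x = Rb /\ y = Rb /\ M0 c ea eb x y = 0 /\
     0 < Ma c ea eb x y * Mb c ea eb x y))).
Proof.
  intros Hx Hy HD. unfold special_pt.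
  assert (HS : ~ isolated_in (singular_pt c ea eb Rb) (x, y)).
  { intros [HS _]. now apply (no_sing_pos c ea eb Rb Htri x y). }
  assert (HV : isolated_in (vtangent_pt c ea eb Rb) (x, y) <-> vtangent_pt c ea eb Rb (x, y)).
  { split; [now intros []|]. intros H. apply pos_isolated; trivial; [|split; assumption].
    now apply (vtan_finite c ea eb Rb Htri). }
  rewrite HV, (vtan_iff_param c ea eb Rb Htri x y HD Hx Hy).
  destruct (classic (line_case ea eb)) as [HL|HL].
  - rewrite (infl_isolated_line c ea eb Rb Htri HRb x y HL Hx Hy). split.
    + intros [(-> & -> & H)|[(t & H)|H]]; [| |contradiction].
      * split; [split; lra|]. right; right. tauto.
      * split; [tauto|]. right; left. exists t. tauto.
    + intros (HB & [[H _]|[(t & H)|H]]); [contradiction| |].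
      * right; left. exists t. tauto.
      * left. tauto.
  - assert (HI : isolated_in (inflection_pt c ea eb Rb) (x, y) <-> inflection_pt c ea eb Rb (x, y)).
    { split; [now intros []|]. intros H. apply pos_isolated; trivial; [|split; assumption].
      now apply (infl_finite c ea eb Rb Htri). }
    rewrite HI, (infl_iff_param c ea eb Rb Htri x y HD Hx Hy). split.
    + intros [(t & H)|[(t & H)|H]]; [| |contradiction].
      * split; [tauto|]. left. split; [assumption|]. exists t. tauto.
      * split; [tauto|]. right; left. exists t. tauto.
    + intros (HB & [(_ & t & H)|[(t & H)|H]]); [| |tauto].
      * left. exists t. tauto.
      * right; left. exists t. tauto.
Qed.

End OriginSpecial.

(** * Real roots of a depressed cubic *)

Lemma kroot_disc mid P Q z : kroot mid P Q z ->
  if mid then 27 * Q * Q + 4 * P * P * P < 0 else Q <= 0 \/ 27 * Q * Q + 4 * P * P * P <= 0.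
Proof.
  unfold kroot, cub. intros [E H].
  destruct mid.
  (* At a root, [27 Q^2 + 4 P^3] equals [(3 z^2 + P)^2 (3 z^2 + 4 P)]. *)
  - assert (0 < (3 * z * z + P) * (3 * z * z + P)) by nra. nra.
  - destruct H as [H1 H2]. destruct (Rle_lt_dec Q 0) as [|HQ]; [left; assumption|right].
    assert (z * z + P < 0) by nra.
    assert (0 <= (3 * z * z + P) * (3 * z * z + P)) by nra. nra.
Qed.

Lemma cub_continuity P Q : continuity (cub P Q).
Proof. unfold cub. intros x. reg. Qed.

Lemma cub_root_between P Q a b : a < b -> cub P Q a <= 0 -> 0 <= cub P Q b ->
  exists z, a <= z <= b /\ cub P Q z = 0.
Proof.
  intros Hab Ha Hb. destruct Ha as [Ha|Ha]; [|exists a; split; [lra|exact Ha]].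
  destruct Hb as [Hb|Hb]; [|exists b; split; [lra|now rewrite <- Hb]].
  destruct (IVT (cub P Q) a b (cub_continuity P Q) Hab Ha Hb) as (z & Hz & E). now exists z.
Qed.

Lemma kroot_exists (mid : bool) P Q :
  (if mid then 27 * Q * Q + 4 * P * P * P < 0 else Q <= 0 \/ 27 * Q * Q + 4 * P * P * P <= 0) ->
  exists z, kroot mid P Q z.
Proof.
  (* The critical points are [y] and [- y]; if there are no real ones, [y] is 0. *)
  intros H. set (y := sqrt (Rmax 0 (- P / 3))).
  assert (Hy : 0 <= y) by apply sqrt_pos.
  assert (Ey : y * y = Rmax 0 (- P / 3)) by (apply sqrt_sqrt; apply Rmax_l).
  clearbody y. unfold Rmax in Ey.
  destruct mid.
  - assert (HP : P < 0) by nra.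
    destruct (Rle_dec 0 (- P / 3)) as [_|N]; [|lra].
    assert (Hy0 : 0 < y) by nra.
    assert (EP : P = - (3 * (y * y))) by lra.
    assert (HY3 : 0 < y * y * y) by nra.
    assert (HQ' : - (2 * (y * y * y)) < Q < 2 * (y * y * y)) by nra.
    (* The cubic decreases between its critical points, so its negative changes sign in the required
       direction. *)
    destruct (IVT (fun x => - cub P Q x) (- y) y) as (z & Hz & E).
    + intros x. unfold cub. reg.
    + lra.
    + unfold cub. rewrite EP. lra.
    + unfold cub. rewrite EP. lra.
    + exists z. assert (Ez : cub P Q z = 0) by lra. split; [exact Ez|].
      assert (z <> y) by (intros ->; unfold cub in Ez; rewrite EP in Ez; lra).
      assert (z <> - y) by (intros ->; unfold cub in Ez; rewrite EP in Ez; lra).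
      assert (0 < (y - z) * (y + z)) by nra. lra.
  - set (b := y + Rabs P + Rabs Q + 1).
    pose proof (Rle_abs P). pose proof (Rle_abs (- P)) as X1. rewrite Rabs_Ropp in X1.
    pose proof (Rle_abs Q). pose proof (Rle_abs (- Q)) as X2. rewrite Rabs_Ropp in X2.
    destruct (cub_root_between P Q y b) as (z & [Hz1 _] & E).
    + unfold b. lra.
    + unfold cub. destruct (Rle_dec 0 (- P / 3)) as [N|N].
      * assert (EP : P = - (3 * (y * y))) by lra. destruct H as [H|H].
        -- nra.
        -- rewrite EP in *. assert (0 <= y * y * y) by nra.
           assert (Q <= 2 * (y * y * y)) by nra. lra.
      * assert (y = 0) by nra. subst y.
        destruct H as [H|H]; [lra|]. nra.
    + unfold cub. assert (1 <= b) by (unfold b; lra).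
      assert (b * b >= b) by nra. assert (b * b + P >= 1 + Rabs Q) by (unfold b in *; lra).
      assert (b * (b * b + P) >= 1 * (1 + Rabs Q)) by nra. lra.
    + exists z. split; [exact E|]. split; [lra|].
      destruct (Rle_dec 0 (- P / 3)); nra.
Qed.

(** The solver finds only largest roots. The three roots sum to 0, so the middle one is minus the
    sum of the others, and the negated smallest root is the largest root of the cubic with [- Q]. *)
Lemma kroot_mid_split P Q z : kroot true P Q z ->
  exists z1 z3, kroot false P Q z1 /\ kroot false P (- Q) z3 /\ z = z3 - z1.
Proof.
  unfold kroot, cub. intros [E H]. set (d := - (3 * (z * z) + 4 * P)).
  assert (Hd : 9 * (z * z) <= d) by (unfold d; lra).
  set (r := sqrt d). assert (0 <= z * z) by nra.
  assert (Er : r * r = d) by (apply sqrt_sqrt; lra).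
  assert (Hr : 0 <= r) by apply sqrt_pos. assert (Hr3 : - r <= 3 * z <= r) by nra.
  exists ((r - z) / 2), ((r + z) / 2).
  assert (E1 : forall u, u * u + u * z + z * z + P = 0 -> u * u * u + P * u + Q = 0).
  { intros u Hu. replace (u * u * u + P * u + Q) with ((u - z) * (u * u + u * z + z * z + P) + (z * z * z + P * z + Q)) by ring.
    rewrite Hu, E. ring. }
  split; [|split].
  - split; [apply E1; unfold d in Er; nra|]. split; [lra|]. unfold d in Er. nra.
  - split; [|split; [lra|unfold d in Er; nra]].
    assert (X := E1 (- ((r + z) / 2)) ltac:(unfold d in Er; nra)). lra.
  - lra.
Qed.

(** * Points in the open quadrant *)

(* The depressed cubic as an instance of the sparse root finder. *)
Lemma cubic_poly_ok w P Q z : (4 <= w)%nat -> kroot false P Q z ->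
  exists y0, poly_ok w (Poly3 P 1 1 3 Q) y0 /\ is_root (PhiR (Poly3 P 1 1 3 Q)) y0 z.
Proof.
  intros Hw HK. assert (HK' := HK). destruct HK' as (E & H1 & H2). unfold cub in E.
  assert (F : forall y, 0 < y -> PhiR (Poly3 P 1 1 3 Q) y = (y - z) * (y * y + y * z + z * z + P)).
  { intros y Hy. unfold PhiR, Phi. cbn [cA cp cB ck cC]. rewrite Rpower_1 by lra.
    replace 3 with (INR 3) by (simpl; lra). rewrite Rpower_pow by lra. lra. }
  assert (H16 : 16 <= 2 ^ w).
  { replace 16 with (2 ^ 4) by lra. apply Rle_pow; [lra|exact Hw]. }
  assert (PO : forall y0, convex_class P 1 1 3 y0 -> poly_ok w (Poly3 P 1 1 3 Q) y0).
  { intros y0 HC. split; [exact HC|]. cbn [cp ck].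
    split; [split; [apply (is_int_IZR 1)|rewrite Rabs_R1; lra]|].
    split; [split; [apply (is_int_IZR 3)|rewrite Rabs_right; lra]|].
    rewrite Rabs_R1. lra. }
  destruct (Rle_lt_dec 0 P) as [HP|HP].
  - exists 0. split.
    + apply PO. split; [lra|]. split; [lra|]. left. split; [lra|]. split; [reflexivity|].
      destruct HP as [HP|<-]; [right; lra|left; reflexivity].
    + split; [exact H1|]. split.
      * intros y Hy. rewrite F by lra. assert (0 < y * y + y * z + z * z + P) by nra.
        split; intros X; nra.
      * intros Hz. rewrite F by lra. ring.
  - set (y0 := sqrt (- P / 3)).
    assert (Ey : y0 * y0 = - P / 3) by (apply sqrt_sqrt; lra).
    assert (Hy0 : 0 < y0) by (apply sqrt_lt_R0; lra). exists y0. split.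
    + apply PO. split; [lra|]. split; [lra|]. right. rewrite Rpower_1 by lra.
      replace (Rpower y0 3) with (y0 * y0 * y0).
      2: { replace 3 with (INR 3) by (simpl; lra). rewrite Rpower_pow by lra. ring. }
      repeat split; try lra. rewrite Ey. lra.
    + assert (y0 <= z) by nra. split; [assumption|]. split.
      * intros y Hy. rewrite F by lra. assert (0 < y * y + y * z + z * z + P) by nra.
        split; intros X; nra.
      * intros Hz. rewrite F by lra. ring.
Qed.

Definition zapp {V} (g : glob V) (mid : bool) (P Q ep : V) : prog V :=
  Let 1 (fun o => Let (1 + 1 + 1) (fun th =>
  Bind (lr g (Poly3 P o o th Q) ep) (fun z1 _ _ _ _ =>
  if mid then Let (0 - #Q) (fun Q' =>
    Bind (lr g (Poly3 P o o th Q') ep) (fun z3 _ _ _ _ => Ret1 (#z3 - #z1)%A))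
  else Ret1 #z1%A))).

Lemma den_zapp g w n mid P Q ep z : glob_ok g w n -> (4 <= w)%nat -> 0 < ep ->
  kroot mid P Q z ->
  (forall z', kroot false P Q z' \/ kroot false P (- Q) z' -> z' <= ep / 4 * 2 ^ fib (S n)) ->
  exists z', den (zapp g mid P Q ep) = one_of z' /\ Rabs (z' - z) <= ep.
Proof.
  intros Hg Hw Hep HK HB. unfold zapp. cbn [den]. aden_simpl. replace (1 + 1 + 1) with 3 by ring.
  assert (LR : forall Q' z', kroot false P Q' z' -> z' <= ep / 4 * 2 ^ fib (S n) ->
    exists y, den (lr g (Poly3 P 1 1 3 Q') ep) = one_of y /\ z' <= y <= z' + ep).
  { intros Q' z' H' B'. destruct (cubic_poly_ok w P Q' z' Hw H') as (y0 & PO & IR).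
    apply (den_lr g w n _ y0); trivial. }
  destruct mid.
  - destruct (kroot_mid_split P Q z HK) as (z1 & z3 & K1 & K3 & ->).
    destruct (LR Q z1 K1) as (y1 & E1 & B1); [apply HB; tauto|]. rewrite E1. cbn [den]. aden_simpl. replace (0 - Q) with (- Q) by ring.
    destruct (LR (- Q) z3 K3) as (y3 & E3 & B3); [apply HB; tauto|]. rewrite E3. exists (y3 - y1). split; [reflexivity|]. apply Rabs_le. lra.
  - destruct (LR Q z HK) as (y1 & E1 & B1); [apply HB; tauto|]. rewrite E1. exists y1. split; [reflexivity|]. apply Rabs_le. lra.
Qed.

(** * Size of the roots of integer cubics *)

Definition cubic (e3 e2 e1 e0 t : R) : R := e3 * t * t * t + e2 * t * t + e1 * t + e0.

Lemma int_abs_ge1 x : is_int x -> x <> 0 -> 1 <= Rabs x.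
Proof.
  intros [z ->] H. rewrite <- abs_IZR. apply (IZR_le 1).
  assert (z <> 0%Z) by (intros ->; now apply H). lia.
Qed.

Definition int_le (M x : R) : Prop := is_int x /\ Rabs x <= M.

Lemma int_le_0 M : 0 <= M -> int_le M 0.
Proof. split; [apply (is_int_IZR 0)|now rewrite Rabs_R0]. Qed.

Lemma int_le_plus M N x y : int_le M x -> int_le N y -> int_le (M + N) (x + y).
Proof.
  intros [I1 B1] [I2 B2]. split; [now apply is_int_plus|]. pose proof (Rabs_triang x y). lra.
Qed.

Lemma int_le_opp M x : int_le M x -> int_le M (- x).
Proof. intros [I1 B1]. split; [now apply is_int_opp|]. now rewrite Rabs_Ropp. Qed.

Lemma int_le_minus M N x y : int_le M x -> int_le N y -> int_le (M + N) (x - y).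
Proof. intros H1 H2. apply int_le_plus; [assumption|now apply int_le_opp]. Qed.

Lemma int_le_mult M N x y : int_le M x -> int_le N y -> int_le (M * N) (x * y).
Proof.
  intros [I1 B1] [I2 B2]. split; [now apply is_int_mult|]. rewrite Rabs_mult.
  apply Rmult_le_compat; try apply Rabs_pos; assumption.
Qed.

Lemma int_le_weaken M N x : int_le M x -> M <= N -> int_le N x.
Proof. intros [I1 B1] H. split; [assumption|lra]. Qed.

(** For [Rabs t < 1], divide by the power of [t] at the lowest nonzero coefficient. That coefficient
    is an integer, hence at least 1 in absolute value, and it equals up to sign [t] times a sum of
    at most three terms bounded by [M]. *)
Lemma root_lower M e3 e2 e1 e0 t : 1 <= M -> int_le M e3 -> int_le M e2 -> int_le M e1 -> int_le M e0 ->
  e3 <> 0 -> cubic e3 e2 e1 e0 t = 0 -> t <> 0 -> 1 / (3 * M) <= Rabs t.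
Proof.
  intros HM [I3 B3] [I2 B2] [I1 B1] [I0 B0] H3 HE Ht. unfold cubic in HE.
  assert (HM3 : 1 / (3 * M) <= 1).
  { apply Rmult_le_reg_r with (3 * M); [lra|]. unfold Rdiv. rewrite Rmult_assoc, Rinv_l by lra. lra. }
  destruct (Rle_lt_dec 1 (Rabs t)) as [|Hlt]; [lra|].
  pose proof (Rabs_pos t) as Pt.
  assert (K : 1 <= Rabs t * (3 * M)).
  { assert (Q : forall a b r, is_int a -> a <> 0 -> a + t * b = 0 -> Rabs b <= r -> r <= 3 * M ->
      1 <= Rabs t * (3 * M)).
    { intros a b r Ia Na E Hb Hr. pose proof (int_abs_ge1 a Ia Na) as G.
      replace a with (- (t * b)) in G by lra. rewrite Rabs_Ropp, Rabs_mult in G.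
      apply Rle_trans with (1 := G). apply Rmult_le_compat_l; lra. }
    assert (A2 : Rabs (e2 + t * e3) <= 2 * M).
    { pose proof (Rabs_triang e2 (t * e3)). rewrite Rabs_mult in H.
      assert (Rabs t * Rabs e3 <= 1 * Rabs e3) by (apply Rmult_le_compat_r; [apply Rabs_pos|lra]). lra. }
    assert (A1 : Rabs (e1 + t * (e2 + t * e3)) <= 3 * M).
    { pose proof (Rabs_triang e1 (t * (e2 + t * e3))). rewrite Rabs_mult in H.
      assert (Rabs t * Rabs (e2 + t * e3) <= 1 * Rabs (e2 + t * e3))
        by (apply Rmult_le_compat_r; [apply Rabs_pos|lra]). lra. }
    destruct (Req_dec e0 0) as [Z0|N0].
    2: { apply (Q e0 (e1 + t * (e2 + t * e3)) (3 * M)); trivial; lra. }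
    assert (HE1 : e1 + t * (e2 + t * e3) = 0).
    { nra. }
    destruct (Req_dec e1 0) as [Z1|N1].
    2: { apply (Q e1 (e2 + t * e3) (2 * M)); trivial; lra. }
    assert (HE2 : e2 + t * e3 = 0).
    { nra. }
    destruct (Req_dec e2 0) as [Z2|N2].
    2: { apply (Q e2 e3 M); trivial; lra. }
    exfalso. assert (t * e3 = 0) by lra. apply Rmult_integral in H. tauto. }
  apply Rmult_le_reg_r with (3 * M); [lra|]. unfold Rdiv. rewrite Rmult_assoc, Rinv_l by lra. lra.
Qed.

(** Expansion at -1. The new coefficients are bounded by [6 * M], the worst being
    [e1 - 2 e2 + 3 e3]. *)
Lemma root_lower_shift M e3 e2 e1 e0 t : 1 <= M -> int_le M e3 -> int_le M e2 -> int_le M e1 -> int_le M e0 ->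
  e3 <> 0 -> cubic e3 e2 e1 e0 t = 0 -> 1 + t <> 0 -> 1 / (18 * M) <= Rabs (1 + t).
Proof.
  intros HM H3 H2 H1 H0 N3 HE Ht.
  assert (I : forall z, int_le (Rabs (IZR z)) (IZR z)) by (intros z; split; [now exists z|lra]).
  replace (18 * M) with (3 * (6 * M)) by ring.
  assert (R1 : Rabs (-3) = 3) by (rewrite Rabs_left; lra).
  assert (R2 : Rabs (-2) = 2) by (rewrite Rabs_left; lra).
  assert (R3 : Rabs 3 = 3) by (rewrite Rabs_right; lra).
  apply (root_lower (6 * M) e3 (e2 + -3 * e3) (e1 + -2 * e2 + 3 * e3) (e0 - e1 + e2 - e3)); trivial; try lra.
  - apply int_le_weaken with M; [assumption|lra].
  - eapply int_le_weaken; [apply int_le_plus; [eassumption|apply int_le_mult; [apply I|eassumption]]|]. rewrite ?R1, ?R2, ?R3. lra.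
  - eapply int_le_weaken; [repeat apply int_le_plus; [eassumption|apply int_le_mult; [apply I|eassumption]..]|]. rewrite ?R1, ?R2, ?R3. lra.
  - eapply int_le_weaken; [apply int_le_minus; [apply int_le_plus; [apply int_le_minus|]|]; eassumption|]. lra.
  - rewrite <- HE. unfold cubic. ring.
Qed.

(** The leading coefficient is a nonzero integer, so Cauchy's bound involves no small
    denominator. *)
Lemma root_upper M e3 e2 e1 e0 t : 1 <= M -> int_le M e3 -> int_le M e2 -> int_le M e1 -> int_le M e0 ->
  e3 <> 0 -> cubic e3 e2 e1 e0 t = 0 -> Rabs t <= 1 + 3 * M.
Proof.
  intros HM [I3 B3] [I2 B2] [I1 B1] [I0 B0] H3 HE. unfold cubic in HE.
  destruct (Rle_lt_dec (Rabs t) 1) as [|Hlt]; [lra|].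
  pose proof (int_abs_ge1 e3 I3 H3) as G3. set (s := Rabs t) in *.
  assert (E : e3 * t * t * t = - (e2 * t * t + e1 * t + e0)) by lra.
  apply (f_equal Rabs) in E. rewrite Rabs_Ropp in E.
  pose proof (Rabs_triang (e2 * t * t + e1 * t) e0) as X1.
  pose proof (Rabs_triang (e2 * t * t) (e1 * t)) as X2.
  rewrite !Rabs_mult in *. fold s in E, X1, X2.
  assert (Y1 : s * s * s <= Rabs e3 * s * s * s) by (assert (0 < s * s * s) by nra; nra).
  assert (s <= 3 * M) by nra. lra.
Qed.

(** If the leading coefficient is 0, multiply by [1 + t]. The additional root -1 does not matter,
    because [T2] is positive at the parameters of interest. Three rounds turn every nonzero
    polynomial of degree at most 3 into a true cubic, so that inflections and vertical tangents
    share one treatment. *)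
Definition pad {V} (e3 e2 e1 e0 : V) : prog V :=
  If (#e3 * #e3) 0 (Ret #e2 (#e2 + #e1) (#e1 + #e0) #e0 0) (Ret #e3 #e2 #e1 #e0 0).

Lemma den_pad M e3 e2 e1 e0 : 0 <= M -> int_le M e3 -> int_le M e2 -> int_le M e1 -> int_le M e0 ->
  exists f3 f2 f1 f0, den (pad e3 e2 e1 e0) = (f3, f2, f1, f0, 0) /\
    int_le (2 * M) f3 /\ int_le (2 * M) f2 /\ int_le (2 * M) f1 /\ int_le (2 * M) f0 /\
    (forall t, 1 + t <> 0 -> (cubic f3 f2 f1 f0 t = 0 <-> cubic e3 e2 e1 e0 t = 0)) /\
    ((e3 <> 0 \/ e2 <> 0 \/ e1 <> 0 \/ e0 <> 0) -> f3 <> 0 \/ f2 <> 0 \/ f1 <> 0) /\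
    ((e3 <> 0 \/ e2 <> 0 \/ e1 <> 0) -> f3 <> 0 \/ f2 <> 0) /\
    ((e3 <> 0 \/ e2 <> 0) -> f3 <> 0).
Proof.
  intros HM H3 H2 H1 H0. unfold pad. cbn [den]. aden_simpl.
  assert (Wk : forall x, int_le M x -> int_le (2 * M) x) by (intros x Hx; apply int_le_weaken with M; [exact Hx|lra]).
  destruct (Rle_dec (e3 * e3) 0) as [Hz|Hz].
  - assert (Z : e3 = 0) by nra. subst e3.
    exists e2, (e2 + e1), (e1 + e0), e0. split; [reflexivity|].
    split; [now apply Wk|]. split; [replace (2 * M) with (M + M) by ring; now apply int_le_plus|].
    split; [replace (2 * M) with (M + M) by ring; now apply int_le_plus|]. split; [now apply Wk|].
    split.
    { intros t Ht. unfold cubic.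
      replace (e2 * t * t * t + (e2 + e1) * t * t + (e1 + e0) * t + e0)
        with ((1 + t) * (0 * t * t * t + e2 * t * t + e1 * t + e0)) by ring.
      split; intros X; [apply Rmult_integral in X; tauto|rewrite X; ring]. }
    destruct (Req_dec e2 0) as [->|N2]; [|tauto].
    destruct (Req_dec e1 0) as [->|N1].
    + lra.
    + lra.
  - assert (N : e3 <> 0) by nra. exists e3, e2, e1, e0. split; [reflexivity|].
    split; [now apply Wk|]. split; [now apply Wk|]. split; [now apply Wk|]. split; [now apply Wk|].
    split; [tauto|]. tauto.
Qed.

Definition pad3 {V} (e3 e2 e1 e0 : V) : prog V :=
  Bind (pad e3 e2 e1 e0) (fun e3 e2 e1 e0 _ => Bind (pad e3 e2 e1 e0) (fun e3 e2 e1 e0 _ =>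
    pad e3 e2 e1 e0)).

Lemma den_pad3 M e3 e2 e1 e0 : 0 <= M -> int_le M e3 -> int_le M e2 -> int_le M e1 -> int_le M e0 ->
  (e3 <> 0 \/ e2 <> 0 \/ e1 <> 0 \/ e0 <> 0) ->
  exists f3 f2 f1 f0, den (pad3 e3 e2 e1 e0) = (f3, f2, f1, f0, 0) /\
    int_le (8 * M) f3 /\ int_le (8 * M) f2 /\ int_le (8 * M) f1 /\ int_le (8 * M) f0 /\ f3 <> 0 /\
    (forall t, 1 + t <> 0 -> (cubic f3 f2 f1 f0 t = 0 <-> cubic e3 e2 e1 e0 t = 0)).
Proof.
  intros HM H3 H2 H1 H0 HN. unfold pad3. cbn [den].
  destruct (den_pad M e3 e2 e1 e0) as (f3 & f2 & f1 & f0 & -> & A3 & A2 & A1 & A0 & AR & AN & _); trivial.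
  destruct (den_pad (2 * M) f3 f2 f1 f0) as (g3 & g2 & g1 & g0 & -> & B3 & B2 & B1 & B0 & BR & _ & BN & _); trivial; [lra|].
  destruct (den_pad (2 * (2 * M)) g3 g2 g1 g0) as (h3 & h2 & h1 & h0 & -> & C3 & C2 & C1 & C0 & CR & _ & _ & CN); trivial; [lra|].
  exists h3, h2, h1, h0. replace (8 * M) with (2 * (2 * (2 * M))) by ring.
  split; [reflexivity|]. split; [assumption|]. split; [assumption|]. split; [assumption|]. split; [assumption|].
  split; [tauto|]. intros t Ht. rewrite CR, BR, AR by lra. reflexivity.
Qed.

Record env (V : Type) := Env { nc : nat -> V; na : nat -> V; nb : nat -> V; nR : V; ne : V; ng : glob V }.
Arguments Env {V} nc na nb nR ne ng. Arguments nc {V} e. Arguments na {V} e. Arguments nb {V} e.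
Arguments nR {V} e. Arguments ne {V} e. Arguments ng {V} e.

(** Exponents take [L] bits, but the work is done with [32 * L]: determinants and sums of exponents
    have to fit, and the power [2 ^ (32 * L)] also scales the tolerance of the parameter, where it
    must outweigh the bounds on the roots. The range of the search is quadratic in [Rb / e] on
    account of the inverted equations on the axes. *)
Definition env_ok (E : env R) (c : nat -> R) (ea eb : nat -> nat) (Rb e : R) (L n : nat) : Prop :=
  (forall t, (t < 3)%nat -> nc E t = c t /\ na E t = INR (ea t) /\ nb E t = INR (eb t) /\
     INR (ea t) < 2 ^ L /\ INR (eb t) < 2 ^ L) /\
  nR E = Rb /\ ne E = e /\ glob_ok (ng E) (32 * L) n /\ (1 <= L)%nat /\
  2 ^ (64 * L) * ((1 + Rb / e) * (1 + Rb / e)) <= 2 ^ fib (S n).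

Definition dif {V} (E : env V) : prog V :=
  Ret (#(na E 1%nat) - #(na E 0%nat)) (#(nb E 1%nat) - #(nb E 0%nat))
      (#(na E 2%nat) - #(na E 0%nat)) (#(nb E 2%nat) - #(nb E 0%nat))
      ((#(na E 1%nat) - #(na E 0%nat)) * (#(nb E 2%nat) - #(nb E 0%nat)) -
       (#(na E 2%nat) - #(na E 0%nat)) * (#(nb E 1%nat) - #(nb E 0%nat))).

Lemma den_dif E c ea eb Rb e L n : env_ok E c ea eb Rb e L n ->
  den (dif E) = (a1 ea, b1 eb, a2 ea, b2 eb, Dt ea eb).
Proof.
  intros (H & _). unfold dif. destruct (H 0%nat) as (_ & -> & -> & _); [lia|]. destruct (H 1%nat) as (_ & -> & -> & _); [lia|].
  destruct (H 2%nat) as (_ & -> & -> & _); [lia|]. reflexivity.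
Qed.

Definition ecoef {V} (a1 b1 a2 b2 D : V) : prog V :=
  Let (#a1 - #a2) (fun a => Let (#b1 - #b2) (fun b => Let (0 - #a2 - #b2) (fun s' =>
  Let (#a * #b2 + #a2 * #b) (fun m => 
  Ret (0 - #a * #b * (#a + #b)) (#D * #D - (#a * #b * #s' - #m * (#a + #b)))
      (#D * #D - (#a2 * #b2 * (#a + #b) - #m * #s')) (0 - #a2 * #b2 * #s') 0)))).

Lemma den_ecoef ea eb : exists x,
  den (ecoef (a1 ea) (b1 eb) (a2 ea) (b2 eb) (Dt ea eb)) = (e3 ea eb, e2 ea eb, e1 ea eb, e0 ea eb, x).
Proof.
  exists 0. unfold ecoef. cbn [den]. aden_simpl. unfold e3, e2, e1, e0.
  repeat apply (f_equal2 (@pair _ _)); ring.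
Qed.

(** * Perturbation of the coordinates *)

Lemma Rabs_le_bounds x r : Rabs x <= r -> - r <= x <= r.
Proof.
  intros H. pose proof (Rle_abs x). pose proof (Rle_abs (- x)) as H1. rewrite Rabs_Ropp in H1. lra.
Qed.

Lemma ln_close x x' eta : 0 < x -> Rabs (x' - x) <= eta * x -> eta <= 1 / 2 ->
  0 < x' /\ Rabs (ln x' - ln x) <= 2 * eta.
Proof.
  intros Hx H He. apply Rabs_le_bounds in H.
  assert (Hx' : 0 < x') by nra. split; [exact Hx'|].
  assert (He0 : 0 <= eta) by nra.
  assert (K : forall u, 0 < u -> ln u <= u - 1).
  { intros u Hu. pose proof (exp_ineq1_le (ln u)). rewrite exp_ln in H0 by lra. lra. }
  assert (D : forall a b, 0 < a -> 0 < b -> ln a - ln b = ln (a / b)).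
  { intros a b Ha Hb. unfold Rdiv. rewrite ln_mult, ln_Rinv by (try apply Rinv_0_lt_compat; assumption). ring. }
  apply Rabs_le. split.
  - pose proof (D x x' Hx Hx'). pose proof (K (x / x') (Rdiv_lt_0_compat _ _ Hx Hx')).
    assert (x / x' - 1 <= 2 * eta); [|lra].
    apply Rmult_le_reg_r with x'; [exact Hx'|].
    replace ((x / x' - 1) * x') with (x - x') by (field; lra). nra.
  - rewrite (D x' x Hx' Hx). pose proof (K (x' / x) (Rdiv_lt_0_compat _ _ Hx' Hx)).
    assert (x' / x - 1 <= eta); [|lra].
    apply Rmult_le_reg_r with x; [exact Hx|].
    replace ((x' / x - 1) * x) with (x' - x) by (field; lra). lra.
Qed.

Lemma exp_close a b th : Rabs (a - b) <= th -> th <= 1 / 2 -> Rabs (exp a - exp b) <= 2 * th * exp b.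
Proof.
  intros H Ht. apply Rabs_le_bounds in H. pose proof (exp_pos b) as Pb.
  replace (exp a) with (exp (a - b) * exp b) by (rewrite <- exp_plus; f_equal; ring).
  replace (exp (a - b) * exp b - exp b) with ((exp (a - b) - 1) * exp b) by ring.
  rewrite Rabs_mult, (Rabs_right (exp b)) by lra. apply Rmult_le_compat_r; [lra|].
  pose proof (exp_ineq1_le (a - b)) as L. pose proof (exp_ineq1_le (- (a - b))) as U.
  rewrite exp_Ropp in U. assert (U' : exp (a - b) * (1 - (a - b)) <= 1).
  { apply Rmult_le_compat_l with (r := exp (a - b)) in U; [|lra].
    rewrite Rinv_r in U by lra. lra. }
  apply Rabs_le. split; [lra|]. nra.
Qed.

(** In logarithms a coordinate is linear in [ln t1] and [ln t2] with coefficients at most [N], so a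
    relative error [eta] of both grows by a factor of order [N] only. *)
Lemma root_sens t1 t2 t1' t2' q1 q2 k N eta : 0 < t1 -> 0 < t2 ->
  Rabs (t1' - t1) <= eta * t1 -> Rabs (t2' - t2) <= eta * t2 -> eta <= 1 / 2 ->
  Rabs q1 <= N -> Rabs q2 <= N -> 1 <= k -> 4 * N * eta <= 1 / 2 ->
  let X := exp ((q1 * ln t1 + q2 * ln t2) / k) in
  Rabs (exp ((q1 * ln t1' + q2 * ln t2') / k) - X) <= 2 * (4 * N * eta) * X.
Proof.
  intros H1 H2 C1 C2 He B1 B2 Hk HN X. apply exp_close; [|exact HN].
  destruct (ln_close _ _ _ H1 C1 He) as [_ L1]. destruct (ln_close _ _ _ H2 C2 He) as [_ L2].
  replace ((q1 * ln t1' + q2 * ln t2') / k - (q1 * ln t1 + q2 * ln t2) / k)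
    with ((q1 * (ln t1' - ln t1) + q2 * (ln t2' - ln t2)) / k) by lra.
  unfold Rdiv. rewrite Rabs_mult, (Rabs_right (/ k)) by (left; apply Rinv_0_lt_compat; lra).
  pose proof (Rabs_triang (q1 * (ln t1' - ln t1)) (q2 * (ln t2' - ln t2))) as TR.
  rewrite !Rabs_mult in TR.
  assert (P1 : Rabs q1 * Rabs (ln t1' - ln t1) <= N * (2 * eta))
    by (apply Rmult_le_compat; try apply Rabs_pos; assumption).
  assert (P2 : Rabs q2 * Rabs (ln t2' - ln t2) <= N * (2 * eta))
    by (apply Rmult_le_compat; try apply Rabs_pos; assumption).
  assert (0 < / k <= 1).
  { split; [apply Rinv_0_lt_compat; lra|]. rewrite <- Rinv_1. apply Rinv_le_contravar; lra. }
  set (S := Rabs (q1 * (ln t1' - ln t1) + q2 * (ln t2' - ln t2))) in *.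
  assert (0 <= S) by apply Rabs_pos. nra.
Qed.

(** The tolerance for the parameter. The final error is a relative error times a coordinate of size
    at most [Rb], hence the ratio of [e] to [Rb + e]; the power of 2 outweighs all factors
    polynomial in the degree. *)
Definition fine {V} (E : env V) : prog V :=
  Ret1 (#(ne E) / ((#(nR E) + #(ne E)) * #(gT (ng E))))%A.

(** The parameter is [t = s * z - h] for a root [z] of the depressed cubic, so [u0 + u1 * z] and
    [v0 + v1 * z] are [T1] and [T2]. The sign [sg] makes the index [k] positive: the coordinates are
    the [k]-th roots of [T1^q1 T2^q2] and [T1^p1 T2^p2], and the box test compares these radicands
    with [M = Rb^k], with no root extracted. *)
Definition pt_blk {V} (E : env V) (mid : bool) (P Q s h a1 b1 a2 b2 D : V) : prog V :=
  Let (#(nc E 0%nat) / #(nc E 1%nat)) (fun r1 => Let (0 - #(nc E 0%nat) / #(nc E 2%nat)) (fun r2 =>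
  Let (#r1 * #s) (fun u1 => Let (0 - #r1 * #h) (fun u0 =>
  Let (#r2 * #s) (fun v1 => Let (#r2 * (1 - #h)) (fun v0 =>
  Bind (lin_np mid P Q u1 u0) (fun n1 _ _ _ _ => Bind (lin_np mid P Q v1 v0) (fun n2 _ _ _ _ =>
  If 1 #n1 (Ret1 0%A) (If 1 #n2 (Ret1 0%A)
  (Bind (If 0 #D (Ret1 1%A) (Ret1 (0 - 1)%A)) (fun sg _ _ _ _ =>
   Let (#sg * #D) (fun k => Let (#sg * #b2) (fun q1 => Let (0 - #sg * #b1) (fun q2 =>
   Let (0 - #sg * #a2) (fun p1 => Let (#sg * #a1) (fun p2 =>
   Let #(nR E) (fun R0 => Bind (zpow (ng E) R0 k) (fun M _ _ _ _ =>
   Bind (box_test (ng E) mid P Q u0 u1 v0 v1 q1 q2 M) (fun fx _ _ _ _ =>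
   Bind (box_test (ng E) mid P Q u0 u1 v0 v1 p1 p2 M) (fun fy _ _ _ _ =>
   Bind (fine E) (fun ep _ _ _ _ => Bind (zapp (ng E) mid P Q ep) (fun z _ _ _ _ =>
   Let (#u0 + #u1 * #z) (fun t1 => Let (#v0 + #v1 * #z) (fun t2 => Let (#(ne E) / (1 + 1)) (fun eh =>
   Bind (root_val (ng E) t1 t2 q1 q2 k eh) (fun x _ _ _ _ =>
   Bind (root_val (ng E) t1 t2 p1 p2 k eh) (fun y _ _ _ _ =>
   Ret (#fx * #fy) #x #y 0 0))))))))))))))))))))))))))).

(** * Correctness of the programs for single points *)

Section Blocks.

Variables (E : env R) (c : nat -> R) (ea eb : nat -> nat) (Rb e : R) (L n : nat).
Hypothesis Htri : is_trinomial c ea eb.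
Hypothesis HRb : 0 < Rb.
Hypothesis He : 0 < e.
Hypothesis HE : env_ok E c ea eb Rb e L n.

Notation T := (2 ^ L).

Lemma T_ge2 : 2 <= T.
Proof.
  destruct HE as (_ & _ & _ & _ & H & _). replace 2 with (2 ^ 1) at 1 by lra.
  apply Rle_pow; [lra|exact H].
Qed.

(** Numerical constants are absorbed by spare powers of [T]. *)
Lemma T_pow j : 2 ^ j <= T ^ j.
Proof. apply pow_incr. pose proof T_ge2. lra. Qed.

Lemma glob_E : glob_ok (ng E) (32 * L) n.
Proof. apply HE. Qed.

Lemma pow_w : 2 ^ (32 * L) = T ^ 32.
Proof. rewrite Nat.mul_comm, pow_mult. reflexivity. Qed.

Lemma gT_E : gT (ng E) = T ^ 32.
Proof. rewrite <- pow_w. apply glob_E. Qed.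

Lemma big_G : T ^ 64 * ((1 + Rb / e) * (1 + Rb / e)) <= 2 ^ fib (S n).
Proof.
  destruct HE as (_ & _ & _ & _ & _ & H). rewrite Nat.mul_comm, pow_mult in H. exact H.
Qed.

Lemma exp_dif i j : (i < 3)%nat -> (j < 3)%nat ->
  int_le T (INR (ea i) - INR (ea j)) /\ int_le T (INR (eb i) - INR (eb j)).
Proof.
  intros Hi Hj. destruct HE as (H & _). destruct (H i Hi) as (_ & _ & _ & A1 & A2).
  destruct (H j Hj) as (_ & _ & _ & B1 & B2).
  pose proof (pos_INR (ea i)). pose proof (pos_INR (ea j)).
  pose proof (pos_INR (eb i)). pose proof (pos_INR (eb j)).
  split; (split; [apply is_int_minus; apply is_int_INR|]; apply Rabs_le; lra).
Qed.

Lemma int_a1 : int_le T (a1 ea). Proof. now apply exp_dif; lia. Qed.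
Lemma int_a2 : int_le T (a2 ea). Proof. now apply exp_dif; lia. Qed.
Lemma int_b1 : int_le T (b1 eb). Proof. now apply exp_dif; lia. Qed.
Lemma int_b2 : int_le T (b2 eb). Proof. now apply exp_dif; lia. Qed.
Lemma int_a12 : int_le T (a1 ea - a2 ea).
Proof. replace (a1 ea - a2 ea) with (INR (ea 1) - INR (ea 2)) by (unfold a1, a2; ring). now apply exp_dif; lia. Qed.
Lemma int_b12 : int_le T (b1 eb - b2 eb).
Proof. replace (b1 eb - b2 eb) with (INR (eb 1) - INR (eb 2)) by (unfold b1, b2; ring). now apply exp_dif; lia. Qed.

Lemma int_Dt : int_le (2 * T ^ 2) (Dt ea eb).
Proof.
  eapply int_le_weaken.
  - apply int_le_minus; apply int_le_mult; [apply int_a1|apply int_b2|apply int_a2|apply int_b1].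
  - lra.
Qed.

Lemma int_small x : int_le (2 * T ^ 2) x -> small_int (32 * L) x /\ 2 * Rabs x <= 2 ^ (32 * L).
Proof.
  intros [I B]. unfold small_int. rewrite pow_w.
  assert (H : 8 * T ^ 2 <= T ^ 32).
  { replace 32%nat with (30 + 2)%nat by lia. rewrite pow_add. pose proof (T_pow 30).
    assert (0 <= T ^ 2) by nra. 
    apply Rmult_le_compat_r; [assumption|]. apply Rle_trans with (2 ^ 30); [simpl; lra|assumption]. }
  assert (0 < T ^ 2) by (apply pow_lt; pose proof T_ge2; lra).
  split; [split; [exact I|]|]; lra.
Qed.

Lemma int_small1 x : int_le T x -> small_int (32 * L) x.
Proof.
  intros H. apply int_small. apply int_le_weaken with T; [exact H|]. pose proof T_ge2. nra.
Qed.

Lemma den_fine : exists ep, den (fine E) = one_of ep /\ ep = e / ((Rb + e) * T ^ 32) /\ 0 < ep.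
Proof.
  destruct HE as (_ & HR & He' & _). unfold fine, Ret1. cbn [den]. aden_simpl. rewrite HR, He', gT_E.
  eexists. split; [reflexivity|]. split; [reflexivity|].
  apply Rdiv_lt_0_compat; [exact He|]. apply Rmult_lt_0_compat; [lra|].
  apply pow_lt. pose proof T_ge2. lra.
Qed.

(* With [ep] the fine accuracy, these are the only size estimates needed: the sensitivity of the
   k-th roots, the reach of the cubic solver and the reach of the k-th root extraction. *)
Lemma fine_bounds ep : ep = e / ((Rb + e) * T ^ 32) ->
  2 * (4 * T * (18 * T ^ 10 * ep)) * Rb < e / 2 /\ 4 * T * (18 * T ^ 10 * ep) <= 1 / 2 /\
  18 * T ^ 10 * ep <= 1 / 2 /\ 5 * T ^ 10 <= ep / 4 * 2 ^ fib (S n) /\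
  Rb + e <= e / 2 / 2 * 2 ^ fib (S n).
Proof.
  intros Eep. pose proof T_ge2 as HT. pose proof big_G as HG.
  set (u := e / (Rb + e)). assert (Hu0 : 0 < u) by (apply Rdiv_lt_0_compat; lra).
  assert (Eu : u * (Rb + e) = e) by (unfold u; field; lra).
  assert (Hu1 : u <= 1) by nra.
  assert (E1 : 1 + Rb / e = / u) by (unfold u; field; lra). rewrite E1 in HG.
  set (G := 2 ^ fib (S n)) in *.
  assert (P : forall j, 0 < T ^ j) by (intros j; apply pow_lt; lra).
  assert (HG' : T ^ 64 <= u * u * G).
  { apply Rmult_le_compat_l with (r := u * u) in HG; [|nra].
    replace (u * u * (T ^ 64 * (/ u * / u))) with (T ^ 64) in HG by (field; lra). exact HG. }
  assert (HG1 : T ^ 64 <= u * G).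
  { nra. }
  assert (Eep' : ep * T ^ 32 = u) by (rewrite Eep; unfold u; field; split; [pose proof (P 32%nat)|]; lra).
  (* Of the 32 powers of [T] in [ep], eleven cancel [T * T ^ 10], and the remaining 21 outweigh the
     constant [4 * 18 * 8]. *)
  assert (K1 : 4 * T * (18 * T ^ 10 * ep) <= u / 8).
  { rewrite <- Eep'. replace 32%nat with (11 + 21)%nat by lia. rewrite pow_add.
    pose proof (T_pow 21) as HP. nra. }
  split; [nra|]. split; [lra|]. split; [nra|]. split.
  - assert (E2 : ep / 4 * G * T ^ 32 = u * G / 4) by nra.
    apply Rmult_le_reg_r with (T ^ 32); [apply P|]. apply Rle_trans with (T ^ 64 / 4); [|lra].
    replace 64%nat with (10 + (32 + 22))%nat by lia. rewrite !pow_add.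
    pose proof (T_pow 22) as HP. nra.
  - assert (H64 : 4 <= T ^ 64).
    { apply Rle_trans with (2 ^ 64); [|apply T_pow]. replace 4 with (2 ^ 2) by lra. apply Rle_pow; [lra|lia]. }
    apply Rmult_le_reg_l with u; [exact Hu0|]. nra.
Qed.

Lemma one_of_coord t1 t2 t1' t2' q1 q2 k ep : ep = e / ((Rb + e) * T ^ 32) -> 0 < t1 -> 0 < t2 ->
  Rabs (t1' - t1) <= 18 * T ^ 10 * ep * t1 -> Rabs (t2' - t2) <= 18 * T ^ 10 * ep * t2 ->
  int_le T q1 -> int_le T q2 -> int_le (2 * T ^ 2) k -> 1 <= k ->
  let X := exp ((q1 * ln t1 + q2 * ln t2) / k) in X <= Rb ->
  exists x, den (root_val (ng E) t1' t2' q1 q2 k (e / 2)) = one_of x /\ Rabs (x - X) < e.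
Proof.
  intros Eep H1 H2 C1 C2 B1 B2 Bk Hk X HX.
  destruct (fine_bounds ep Eep) as (F1 & F2 & F3 & _ & F5).
  destruct (ln_close _ _ _ H1 C1 F3) as [P1 _]. destruct (ln_close _ _ _ H2 C2 F3) as [P2 _].
  pose proof (root_sens t1 t2 t1' t2' q1 q2 k T _ H1 H2 C1 C2 F3 (proj2 B1) (proj2 B2) Hk F2) as S.
  fold X in S. destruct (int_small k Bk) as [S1 S2]. rewrite Rabs_right in S2 by lra.
  assert (PX : 0 < X) by apply exp_pos.
  set (X' := exp ((q1 * ln t1' + q2 * ln t2') / k)) in *.
  assert (D : Rabs (X' - X) < e / 2).
  { nra. }
  destruct (den_root_val (ng E) (32 * L) n t1' t2' q1 q2 k (e / 2) glob_E P1 P2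
    (int_small1 q1 B1) (int_small1 q2 B2) S1 Hk S2 ltac:(lra)) as (y & Ey & Hy).
  { fold X'. apply Rabs_def2 in D. lra. }
  fold X' in Hy. exists y. split; [exact Ey|]. apply Rabs_def2 in D. apply Rabs_def1; lra.
Qed.

(** The lower bounds on [Rabs t] and [Rabs (1 + t)] turn the absolute error of the root into a
    relative error of [T1] and [T2], from which the coefficients of the polynomial cancel. *)
Lemma den_pt mid P Q s h z t : kroot mid P Q z -> s * s = 1 -> t = s * z - h ->
  (forall z', kroot false P Q z' \/ kroot false P (- Q) z' -> z' <= 5 * T ^ 10) ->
  (t <> 0 -> 1 / (18 * T ^ 10) <= Rabs t) -> (1 + t <> 0 -> 1 / (18 * T ^ 10) <= Rabs (1 + t)) ->
  Dt ea eb <> 0 ->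
  exists f x y, den (pt_blk E mid P Q s h (a1 ea) (b1 eb) (a2 ea) (b2 eb) (Dt ea eb)) = (f, x, y, 0, 0) /\
    (f = 0 \/ f = 1) /\
    (f = 1 <-> (0 < T1 c t /\ 0 < T2 c t /\ box Rb (Xt c ea eb t) (Yt c ea eb t))) /\
    (f = 1 -> close e (x, y) (Xt c ea eb t, Yt c ea eb t)).
Proof.
  intros HK Hs Et HB HL1 HL2 HD. assert (HE' := HE). destruct HE' as (Hc & HR & Hee & _).
  destruct (Hc 0%nat) as (C0 & _); [lia|]. destruct (Hc 1%nat) as (C1 & _); [lia|].
  destruct (Hc 2%nat) as (C2 & _); [lia|].
  unfold pt_blk. cbn [den]. aden_simpl. rewrite C0, C1, C2.
  set (r1 := c 0%nat / c 1%nat). set (r2 := 0 - c 0%nat / c 2%nat).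
  rewrite (den_lin_np _ _ _ z) by tauto. unfold one_of at 1.
  rewrite (den_lin_np _ _ _ z) by tauto. unfold one_of at 1.
  assert (E1 : r1 * s * z + (0 - r1 * h) = T1 c t) by (unfold T1, r1; rewrite Et; ring).
  assert (E2 : r2 * s * z + r2 * (1 - h) = T2 c t) by (unfold T2, r2; rewrite Et; ring).
  rewrite E1, E2.
  destruct (Rle_dec 1 (fl (T1 c t <= 0))) as [N1|N1].
  { rewrite fl_ge1 in N1. exists 0, 0, 0. split; [reflexivity|]. split; [now left|].
    split; [split; [lra|]|]; intros; lra. }
  destruct (Rle_dec 1 (fl (T2 c t <= 0))) as [N2|N2].
  { rewrite fl_ge1 in N2. exists 0, 0, 0. split; [reflexivity|]. split; [now left|].
    split; [split; [lra|]|]; intros; lra. }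
  rewrite fl_ge1 in N1, N2. assert (P1 : 0 < T1 c t) by lra. assert (P2 : 0 < T2 c t) by lra.
  assert (W : exists sg, (if Rle_dec 0 (Dt ea eb) then den (Ret1 1%A) else den (Ret1 (0 - 1)%A)) = one_of sg /\
    sg * sg = 1 /\ 0 < sg * Dt ea eb /\ (sg = 1 \/ sg = -1)).
  { destruct (Rle_dec 0 (Dt ea eb)).
    - exists 1. split; [reflexivity|]. split; [ring|]. split; [lra|now left].
    - exists (-1). unfold Ret1. cbn [den]. aden_simpl. split; [unfold one_of; repeat f_equal; ring|].
      split; [ring|]. split; [lra|now right]. }
  destruct W as (sg & Esg & Hsg & HkD & Csg). rewrite Esg. unfold one_of at 1.
  rewrite HR.
  set (k := sg * Dt ea eb) in *.
  assert (SG : forall M x, int_le M x -> int_le M (sg * x)).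
  { intros M x Hx. destruct Csg as [-> | ->]; [now rewrite Rmult_1_l|].
    replace (-1 * x) with (- x) by ring. now apply int_le_opp. }
  assert (SG' : forall M x, int_le M x -> int_le M (0 - sg * x)).
  { intros M x Hx. replace (0 - sg * x) with (- (sg * x)) by ring. now apply int_le_opp, SG. }
  assert (Ik : int_le (2 * T ^ 2) k) by (apply SG, int_Dt).
  assert (Hk1 : 1 <= k).
  { pose proof (int_abs_ge1 k (proj1 Ik) ltac:(lra)) as Q1. rewrite Rabs_right in Q1; lra. }
  assert (Iq1 : int_le T (sg * b2 eb)) by (apply SG, int_b2).
  assert (Iq2 : int_le T (0 - sg * b1 eb)) by (apply SG', int_b1).
  assert (Ip1 : int_le T (0 - sg * a2 ea)) by (apply SG', int_a2).
  assert (Ip2 : int_le T (sg * a1 ea)) by (apply SG, int_a1).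
  destruct (int_small k Ik) as [Sk _].
  rewrite (den_zpow _ _ _ _ _ glob_E HRb Sk). unfold one_of at 1. assert (E1' : 0 - r1 * h + r1 * s * z = T1 c t) by lra.
  assert (E2' : r2 * (1 - h) + r2 * s * z = T2 c t) by lra.
  assert (BT : forall q1 q2, int_le T q1 -> int_le T q2 ->
    den (box_test (ng E) mid P Q (0 - r1 * h) (r1 * s) (r2 * (1 - h)) (r2 * s) q1 q2 (Rpower Rb k)) =
    one_of (fl (exp ((q1 * ln (T1 c t) + q2 * ln (T2 c t)) / k) <= Rb))).
  { intros q1 q2 I1 I2.
    rewrite (den_box_test _ _ _ _ _ _ z _ _ _ _ _ _ _ glob_E HK (int_small1 _ I1) (int_small1 _ I2));
      [|rewrite E1'; exact P1|rewrite E2'; exact P2].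
    rewrite E1', E2'. f_equal. apply fl_iff. unfold Rpower. rewrite <- exp_plus.
    set (A := q1 * ln (T1 c t) + q2 * ln (T2 c t)).
    assert (X : A <= k * ln Rb <-> A / k <= ln Rb).
    { split; intros H.
      - apply Rmult_le_reg_r with k; [lra|]. unfold Rdiv. rewrite Rmult_assoc, Rinv_l by lra. lra.
      - apply Rmult_le_compat_r with (r := k) in H; [|lra].
        unfold Rdiv in H. rewrite Rmult_assoc, Rinv_l in H by lra. lra. }
    assert (Y : forall u v, exp u <= exp v <-> u <= v).
    { intros u v. split; intros [H|H].
      - left. now apply exp_lt_inv.
      - right. now apply exp_inv.
      - left. now apply exp_increasing.
      - right. now rewrite H. }
    rewrite <- (exp_ln Rb) at 2 by exact HRb. rewrite !Y. exact X. }
  rewrite (BT _ _ Iq1 Iq2). unfold one_of at 1. rewrite (BT _ _ Ip1 Ip2). unfold one_of at 1.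
  assert (EX : exp ((sg * b2 eb * ln (T1 c t) + (0 - sg * b1 eb) * ln (T2 c t)) / k) = Xt c ea eb t).
  { unfold Xt, k. f_equal. field. split; [exact HD|]. intros ->. lra. }
  assert (EY : exp (((0 - sg * a2 ea) * ln (T1 c t) + sg * a1 ea * ln (T2 c t)) / k) = Yt c ea eb t).
  { unfold Yt, k. f_equal. field. split; [exact HD|]. intros ->. lra. }
  rewrite EX, EY.
  destruct den_fine as (ep & Efine & Eep & Hep). rewrite Efine. unfold one_of at 1.
  destruct (fine_bounds ep Eep) as (F1 & F2 & F3 & F4 & F5).
  destruct (den_zapp (ng E) (32 * L) n mid P Q ep z glob_E) as (z' & Ez & Dz); trivial.
  { assert (H : (1 <= L)%nat) by apply HE. lia. }
  { intros z' Hz'. apply Rle_trans with (5 * T ^ 10); [now apply HB|exact F4]. }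
  rewrite Ez. unfold one_of at 1. rewrite Hee. replace (1 + 1) with 2 by ring.
  set (t' := s * z' - h).
  assert (Dt' : Rabs (t' - t) <= ep).
  { unfold t'. rewrite Et. replace (s * z' - h - (s * z - h)) with (s * (z' - z)) by ring.
    rewrite Rabs_mult. assert (Rabs s = 1) as ->; [|lra].
    assert (Rabs s * Rabs s = 1) by (rewrite <- Rabs_mult, Hs; apply Rabs_R1).
    pose proof (Rabs_pos s). nra. }
  assert (PT : 0 < T ^ 10) by (apply pow_lt; pose proof T_ge2; lra).
  assert (REL : forall u, u <> 0 -> (1 / (18 * T ^ 10) <= Rabs u) -> ep <= 18 * T ^ 10 * ep * Rabs u).
  { intros u _ Hu. apply Rmult_le_compat_l with (r := 18 * T ^ 10) in Hu; [|lra].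
    replace (18 * T ^ 10 * (1 / (18 * T ^ 10))) with 1 in Hu by (unfold Rdiv; rewrite Rmult_1_l, Rinv_r; lra).
    apply Rmult_le_compat_r with (r := ep) in Hu; [|lra]. rewrite Rmult_1_l in Hu.
    apply Rle_trans with (1 := Hu). right. ring. }
  assert (Nt : t <> 0) by (intros Z; unfold T1 in P1; rewrite Z in P1; lra).
  assert (N1t : 1 + t <> 0) by (intros Z; unfold T2 in P2; rewrite Z in P2; lra).
  assert (G1 : Rabs (0 - r1 * h + r1 * s * z' - T1 c t) <= 18 * T ^ 10 * ep * T1 c t).
  { replace (0 - r1 * h + r1 * s * z' - T1 c t) with (r1 * (t' - t)) by (unfold T1, t'; fold r1; rewrite Et; ring).
    rewrite Rabs_mult. replace (T1 c t) with (Rabs (r1 * t)) by (rewrite Rabs_right; [reflexivity|unfold T1 in P1; fold r1 in P1; lra]).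
    rewrite Rabs_mult. pose proof (REL t Nt (HL1 Nt)).
    apply Rle_trans with (Rabs r1 * (18 * T ^ 10 * ep * Rabs t)); [|right; ring].
    apply Rmult_le_compat_l; [apply Rabs_pos|lra]. }
  assert (G2 : Rabs (r2 * (1 - h) + r2 * s * z' - T2 c t) <= 18 * T ^ 10 * ep * T2 c t).
  { assert (Q2 : T2 c t = r2 * (1 + t)) by (unfold T2, r2; ring).
    replace (r2 * (1 - h) + r2 * s * z' - T2 c t) with (r2 * (t' - t)) by (rewrite Q2; unfold t'; rewrite Et; ring).
    rewrite Rabs_mult. replace (T2 c t) with (Rabs (r2 * (1 + t))) by (rewrite Rabs_right; [now rewrite Q2|lra]).
    rewrite Rabs_mult. pose proof (REL (1 + t) N1t (HL2 N1t)).
    apply Rle_trans with (Rabs r2 * (18 * T ^ 10 * ep * Rabs (1 + t))); [|right; ring].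
    apply Rmult_le_compat_l; [apply Rabs_pos|lra]. }
  assert (PX : 0 < Xt c ea eb t) by apply exp_pos. assert (PY : 0 < Yt c ea eb t) by apply exp_pos.
  destruct (den (root_val (ng E) (0 - r1 * h + r1 * s * z') (r2 * (1 - h) + r2 * s * z')
    (sg * b2 eb) (0 - sg * b1 eb) k (e / 2))) as [[[[x x2] x3] x4] x5] eqn:RX.
  destruct (den (root_val (ng E) (0 - r1 * h + r1 * s * z') (r2 * (1 - h) + r2 * s * z')
    (0 - sg * a2 ea) (sg * a1 ea) k (e / 2))) as [[[[y y2] y3] y4] y5] eqn:RY.
  exists (fl (Xt c ea eb t <= Rb) * fl (Yt c ea eb t <= Rb)), x, y.
  split; [reflexivity|].
  destruct (classic (Xt c ea eb t <= Rb)) as [BX|BX].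
  2: { rewrite (fl_false _ BX), Rmult_0_l. split; [now left|]. unfold box. split; [split; [lra|]|]; intros; lra. }
  destruct (classic (Yt c ea eb t <= Rb)) as [BY|BY].
  2: { rewrite (fl_false _ BY), Rmult_0_r. split; [now left|]. unfold box. split; [split; [lra|]|]; intros; lra. }
  rewrite (fl_true _ BX), (fl_true _ BY), Rmult_1_l. split; [now right|].
  split; [split; [intros _; unfold box; repeat split; lra|reflexivity]|]. intros _.
  destruct (one_of_coord _ _ _ _ _ _ _ ep Eep P1 P2 G1 G2 Iq1 Iq2 Ik Hk1) as (x' & Ex & Dx);
    [rewrite EX; exact BX|].
  destruct (one_of_coord _ _ _ _ _ _ _ ep Eep P1 P2 G1 G2 Ip1 Ip2 Ik Hk1) as (y' & Ey & Dy);
    [rewrite EY; exact BY|].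
  rewrite Ex in RX. rewrite Ey in RY. injection RX as <- _ _ _ _.
  injection RY as <- _ _ _ _. rewrite EX in Dx. rewrite EY in Dy. split; assumption.
Qed.

Definition depress {V} (f3 f2 f1 f0 : V) : prog V :=
  Let (#f2 / ((1 + 1 + 1) * #f3)) (fun h =>
  Ret #h (#f1 / #f3 - (1 + 1 + 1) * #h * #h) (#f0 / #f3 - #h * #f1 / #f3 + (1 + 1) * #h * #h * #h) 0 0).

(** One program for each kind of root: the middle one, a nonnegative largest one and, by the
    reflection [neg], a nonpositive smallest one. Whether the kind occurs is read off from the
    discriminant. *)
Definition cubic_blk {V} (E : env V) (mid neg : bool) (e3 e2 e1 e0 a1 b1 a2 b2 D : V) : prog V :=
  Bind (pad3 e3 e2 e1 e0) (fun f3 f2 f1 f0 _ => Bind (depress f3 f2 f1 f0) (fun h P Q _ _ =>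
  Let (if neg then (0 - #Q)%A else #Q%A) (fun Q' => Let (if neg then (0 - 1)%A else 1%A) (fun s =>
  Let (1 + 1 + 1) (fun th => Let (#th * #th * #th * #Q' * #Q' + (1 + 1) * (1 + 1) * #P * #P * #P) (fun d =>
  Bind (fprog (if mid then FLt #d 0 else FOr (FLe #Q' 0) (FLe #d 0))) (fun f _ _ _ _ =>
  If 1 #f (pt_blk E mid P Q' s h a1 b1 a2 b2 D) (Ret1 0%A)))))))).

Section Cubic.

Variables (k3 k2 k1 k0 : R).

Hypothesis K3 : int_le (T ^ 7) k3.
Hypothesis K2 : int_le (T ^ 7) k2.
Hypothesis K1 : int_le (T ^ 7) k1.
Hypothesis K0 : int_le (T ^ 7) k0.
Hypothesis HN : k3 <> 0 \/ k2 <> 0 \/ k1 <> 0 \/ k0 <> 0.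
Hypothesis HD : Dt ea eb <> 0.

Let blk mid neg := den (cubic_blk E mid neg k3 k2 k1 k0 (a1 ea) (b1 eb) (a2 ea) (b2 eb) (Dt ea eb)).

Definition cubic_point t p : Prop :=
  cubic k3 k2 k1 k0 t = 0 /\ 0 < T1 c t /\ 0 < T2 c t /\ p = (Xt c ea eb t, Yt c ea eb t) /\
  box Rb (Xt c ea eb t) (Yt c ea eb t).

Lemma depressed_root f3 f2 f1 f0 h P Q t : f3 <> 0 -> h = f2 / (3 * f3) -> P = f1 / f3 - 3 * h * h ->
  Q = f0 / f3 - h * f1 / f3 + 2 * h * h * h ->
  (cub P Q (t + h) = 0 <-> cubic f3 f2 f1 f0 t = 0).
Proof.
  intros H3 Hh HP HQ. assert (X : cubic f3 f2 f1 f0 t = f3 * cub P Q (t + h)).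
  { unfold cubic, cub. rewrite HP, HQ. replace f2 with (3 * f3 * h) by (rewrite Hh; field; exact H3).
    field. exact H3. }
  rewrite X. split; intros H; [rewrite H; ring|]. apply Rmult_integral in H. tauto.
Qed.

(** The sizes: coefficients start below [T ^ 7], padding multiplies them by [8 <= T ^ 3], which
    gives [M = T ^ 10]. Roots are then at most [1 + 3 * M] and the shift [h] at most [M], so roots
    of the depressed cubic are at most [5 * M]. *)
Lemma cubic_blk_kind : exists h P Q f3 f2 f1 f0, f3 <> 0 /\
  (forall t, cub P Q (t + h) = 0 <-> cubic f3 f2 f1 f0 t = 0) /\
  (forall t, 1 + t <> 0 -> (cubic f3 f2 f1 f0 t = 0 <-> cubic k3 k2 k1 k0 t = 0)) /\
  forall mid neg, (mid = true -> neg = false) ->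
    let Q' := if neg then 0 - Q else Q in let s := if neg then -1 else 1 in
    exists f x y, blk mid neg = (f, x, y, 0, 0) /\ (f = 0 \/ f = 1) /\
    ((forall z, ~ kroot mid P Q' z) -> f = 0) /\
    forall z, kroot mid P Q' z -> let t := s * z - h in
      (f = 1 <-> (0 < T1 c t /\ 0 < T2 c t /\ box Rb (Xt c ea eb t) (Yt c ea eb t))) /\
      (f = 1 -> close e (x, y) (Xt c ea eb t, Yt c ea eb t)).
Proof.
  pose proof (T_ge2) as HT.
  assert (HP7 : 0 < T ^ 7) by (apply pow_lt; lra).
  destruct (den_pad3 (T ^ 7) k3 k2 k1 k0 ltac:(lra) K3 K2 K1 K0 HN)
    as (f3 & f2 & f1 & f0 & EP & F3 & F2 & F1 & F0 & N3 & HR).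
  set (M := T ^ 10).
  assert (HM8 : 8 * T ^ 7 <= M).
  { unfold M. replace 10%nat with (3 + 7)%nat by lia. rewrite pow_add. apply Rmult_le_compat_r; [lra|].
    pose proof (T_pow 3) as X. replace (2 ^ 3) with 8 in X by ring. exact X. }
  assert (HM1 : 1 <= M) by (pose proof (pow_R1_Rle T 7 ltac:(lra)); lra).
  assert (I3 := int_le_weaken _ M _ F3 HM8). assert (I2 := int_le_weaken _ M _ F2 HM8).
  assert (I1 := int_le_weaken _ M _ F1 HM8). assert (I0 := int_le_weaken _ M _ F0 HM8).
  set (h := f2 / (3 * f3)). set (P := f1 / f3 - 3 * h * h).
  set (Q := f0 / f3 - h * f1 / f3 + 2 * h * h * h).
  exists h, P, Q, f3, f2, f1, f0. split; [exact N3|].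
  assert (DR : forall t, cub P Q (t + h) = 0 <-> cubic f3 f2 f1 f0 t = 0).
  { intros t. now apply depressed_root. }
  split; [exact DR|]. split; [exact HR|].
  assert (Hh : Rabs h <= M).
  { unfold h, Rdiv. rewrite Rabs_mult, Rabs_inv, Rabs_mult, (Rabs_right 3) by lra.
    pose proof (int_abs_ge1 f3 (proj1 I3) N3) as G. pose proof (proj2 I2) as G2.
    assert (0 < / (3 * Rabs f3) <= 1).
    { split; [apply Rinv_0_lt_compat; lra|]. rewrite <- Rinv_1. apply Rinv_le_contravar; lra. }
    nra. }
  assert (UB : forall z, cub P Q z = 0 -> Rabs z <= 5 * M).
  { intros z Hz. replace z with ((z - h) + h) in Hz by ring. apply DR in Hz.
    pose proof (root_upper M _ _ _ _ _ HM1 I3 I2 I1 I0 N3 Hz) as X.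
    pose proof (Rabs_triang (z - h) h) as Y. replace (z - h + h) with z in Y by ring. lra. }
  assert (UBn : forall z, cub P (- Q) z = 0 -> Rabs z <= 5 * M).
  { intros z Hz. rewrite <- Rabs_Ropp. apply UB. unfold cub in *. lra. }
  intros mid neg Hmn Q' s. unfold blk, cubic_blk. cbn [den]. rewrite EP.
  unfold depress. cbn [den]. aden_simpl. replace (1 + 1 + 1) with 3 by ring. replace (1 + 1) with 2 by ring.
  fold h. fold P. fold Q.
  assert (EQ : aden (if neg then (0 - #Q)%A else #Q%A) = Q') by (unfold Q'; destruct neg; reflexivity).
  assert (Es : aden (if neg then (0 - 1)%A else 1%A) = s) by (unfold s; destruct neg; simpl; ring).
  rewrite EQ, Es. set (d := 3 * 3 * 3 * Q' * Q' + 2 * 2 * P * P * P).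
  assert (Ed : d = 27 * Q' * Q' + 4 * P * P * P) by (unfold d; ring).
  rewrite den_fprog. unfold one_of.
  assert (EX : fsem (if mid then FLt #d 0 else FOr (FLe #Q' 0) (FLe #d 0)) <->
    if mid then 27 * Q' * Q' + 4 * P * P * P < 0 else Q' <= 0 \/ 27 * Q' * Q' + 4 * P * P * P <= 0).
  { rewrite <- Ed. destruct mid; [apply fsem_Lt|reflexivity]. }
  set (ok := fsem (if mid then FLt #d 0 else FOr (FLe #Q' 0) (FLe #d 0))) in *.
  destruct (classic ok) as [Hok|Hok].
  2: { rewrite (fl_false _ Hok). destruct (Rle_dec 1 0) as [X|_]; [lra|].
    exists 0, 0, 0. split; [reflexivity|]. split; [now left|]. split; [reflexivity|].
    intros z Hz. exfalso. apply Hok, EX, (kroot_disc mid P Q' z Hz). }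
  rewrite (fl_true _ Hok). destruct (Rle_dec 1 1) as [_|X]; [|lra].
  destruct (kroot_exists mid P Q' (proj1 EX Hok)) as (z & Hz).
  assert (Hs : s * s = 1) by (unfold s; destruct neg; ring).
  assert (Rt : cubic f3 f2 f1 f0 (s * z - h) = 0).
  { apply DR. destruct Hz as [Hz _].
    unfold s, Q', cub in *. destruct neg; lra. }
  destruct (den_pt mid P Q' s h z (s * z - h) Hz Hs eq_refl)
    as (f & x & y & E1 & E2 & E3 & E4); trivial.
  - intros z' Hz'. apply Rle_trans with (1 := Rle_abs z').
    assert (W : cub P Q z' = 0 \/ cub P (- Q) z' = 0).
    { destruct Hz' as [[W _]|[W _]]; unfold Q' in W; destruct neg; try tauto.
      - right. unfold cub in *. lra.
      - left. unfold cub in *. lra. }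
    destruct W as [W|W]; [now apply UB|now apply UBn].
  - intros Nt. fold M. apply Rle_trans with (1 / (3 * M)).
    + apply Rmult_le_compat_l; [lra|]. apply Rinv_le_contravar; lra.
    + now apply (root_lower M f3 f2 f1 f0).
  - intros Nt. now apply (root_lower_shift M f3 f2 f1 f0).
  - exists f, x, y. split; [exact E1|]. split; [exact E2|]. split.
    { intros HX. exfalso. now apply (HX z). }
    intros z' Hz'. rewrite (kroot_unique _ _ _ _ _ Hz' Hz). split; assumption.
Qed.

Lemma cubic_blk_sound mid neg : (mid = true -> neg = false) ->
  exists f x y, blk mid neg = (f, x, y, 0, 0) /\ (f = 0 \/ f = 1) /\
    (f = 1 -> exists t p, cubic_point t p /\ close e (x, y) p).
Proof.
  intros Hmn. destruct cubic_blk_kind as (h & P & Q & f3 & f2 & f1 & f0 & N3 & DR & HR & H).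
  destruct (H mid neg Hmn) as (f & x & y & E1 & E2 & E3 & E4).
  exists f, x, y. split; [exact E1|]. split; [exact E2|]. intros Hf.
  destruct (classic (exists z, kroot mid P (if neg then 0 - Q else Q) z)) as [[z Hz]|N].
  2: { exfalso. assert (f = 0); [|lra]. apply E3. intros z Hz. apply N. now exists z. }
  destruct (E4 z Hz) as [E5 E6]. set (t := (if neg then -1 else 1) * z - h) in *.
  exists t, (Xt c ea eb t, Yt c ea eb t). split; [|now apply E6].
  destruct (proj1 E5 Hf) as (A1 & A2 & A3). split; [|tauto].
  apply HR; [intros Z; unfold T2 in A2; rewrite Z in A2; lra|]. apply DR.
  unfold t. destruct Hz as [Hz _]. unfold cub in *. destruct neg; lra.
Qed.

(** The sign of the derivative at the shifted root and, if it is not negative, the sign of the root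
    itself tell which of the three kinds applies. *)
Lemma cubic_blk_complete t p : cubic_point t p ->
  exists mid neg f x y, (mid = true -> neg = false) /\ blk mid neg = (f, x, y, 0, 0) /\ f = 1 /\ close e (x, y) p.
Proof.
  intros (Ht & A1 & A2 & -> & A3).
  destruct cubic_blk_kind as (h & P & Q & f3 & f2 & f1 & f0 & N3 & DR & HR & H).
  assert (HZ : cub P Q (t + h) = 0).
  { apply DR, HR; [|exact Ht]. intros Z. unfold T2 in A2. rewrite Z in A2. lra. }
  assert (W : exists mid neg z, (mid = true -> neg = false) /\ kroot mid P (if neg then 0 - Q else Q) z /\
    (if neg then -1 else 1) * z - h = t).
  { destruct (Rlt_le_dec (3 * (t + h) * (t + h) + P) 0) as [S|S].
    - exists true, false, (t + h). split; [reflexivity|]. split; [now split|ring].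
    - destruct (Rle_lt_dec 0 (t + h)) as [S'|S'].
      + exists false, false, (t + h). split; [reflexivity|]. split; [now split|ring].
      + exists false, true, (- (t + h)). split; [discriminate|]. split; [|ring].
        split; [unfold cub in *; lra|]. split; lra. }
  destruct W as (mid & neg & z & Hmn & Hz & Et).
  destruct (H mid neg Hmn) as (f & x & y & E1 & E2 & E3 & E4).
  destruct (E4 z Hz) as [E5 E6]. rewrite Et in *.
  exists mid, neg, f, x, y. split; [exact Hmn|]. split; [exact E1|].
  tauto.
Qed.

End Cubic.

Lemma exp_mono u v : u <= v -> exp u <= exp v.
Proof. intros [H| ->]; [left; now apply exp_increasing|lra]. Qed.

(** * Points on the axes *)

Section TwoTerm.

Variables (A p B q : R).
Hypothesis HA : 0 <= A.
Hypothesis HB : 0 < B.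
Hypothesis Hq : 1 <= q.
Hypothesis Hp : A = 0 \/ 1 <= p \/ p <= -1.

Definition two (y : R) : R := A * Rpower y p + B * Rpower y q - 1.
Definition dtwo (y : R) : R := p * (A * Rpower y p) + q * (B * Rpower y q).

(* Below the critical value, i.e. two simple roots, when [p < 0 < q]. *)
Definition two_cond : Prop := 0 <= p * A \/
  Rpower (- (p * A) / (q * B)) q < Rpower (- p / (B * (q - p))) (q - p).

(** For [p * A < 0] the critical point satisfies [y0^(q - p) = om], and the critical value is
    negative exactly if [y0^q < r] for a certain [r]. Raised to the power [q - p], this compares
    integer powers of [om] and [r], which are rational functions of the coefficients. *)
Lemma two_crit : exists y0, convex_class A p B q y0 /\
  (forall y, 0 < y -> (0 < dtwo y <-> y0 < y)) /\ (forall y, 0 < y -> (0 <= dtwo y <-> y0 <= y)) /\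
  ((0 <= p * A /\ y0 = 0) \/ (p * A < 0 /\ 0 < y0 /\ (two_cond <-> two y0 < 0))).
Proof.
  destruct (Rle_lt_dec 0 (p * A)) as [HpA|HpA].
  - exists 0. split; [|split; [|split; [|left; split; [exact HpA|reflexivity]]]].
    + split; [exact HB|]. split; [exact Hq|]. left. split; [exact HpA|]. split; [reflexivity|].
      destruct HA as [HA'|HA']; [right|now left]. split; [exact HA'|].
      destruct Hp as [|[|]]; [lra|assumption|nra].
    + intros y Hy. unfold dtwo. pose proof (Rpower_pos y p). pose proof (Rpower_pos y q).
      split; [intros _; exact Hy|intros _]. assert (0 < q * (B * Rpower y q)) by (apply Rmult_lt_0_compat; nra).
      assert (0 <= p * A * Rpower y p) by nra. lra.
    + intros y Hy. unfold dtwo. pose proof (Rpower_pos y p). pose proof (Rpower_pos y q).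
      split; [intros _; lra|intros _]. assert (0 < q * (B * Rpower y q)) by (apply Rmult_lt_0_compat; nra).
      assert (0 <= p * A * Rpower y p) by nra. lra.
  - assert (Hp1 : p <= -1) by nra.
    set (om := - (p * A) / (q * B)).
    assert (Pqb : 0 < q * B) by nra.
    assert (Pom : 0 < om) by (apply Rdiv_lt_0_compat; lra).
    set (y0 := Rpower om (/ (q - p))).
    assert (Py0 : 0 < y0) by apply Rpower_pos.
    assert (Eom : Rpower y0 (q - p) = om).
    { unfold y0. rewrite Rpower_mult, Rinv_l, Rpower_1 by lra. reflexivity. }
    assert (ED : forall y, dtwo y = q * B * Rpower y p * (Rpower y (q - p) - om)).
    { intros y. unfold dtwo, om. replace (Rpower y q) with (Rpower y p * Rpower y (q - p)).
      - field. split; lra.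
      - rewrite <- Rpower_plus. f_equal. ring. }
    assert (LT : forall u v, 0 < u -> u < v -> Rpower u (q - p) < Rpower v (q - p)).
    { intros u v Hu Huv. apply Rlt_Rpower_l; lra. }
    exists y0. split; [|split; [|split]].
    + split; [exact HB|]. split; [exact Hq|]. right. split; [exact HpA|]. split; [lra|]. split; [lra|].
      split; [exact Py0|]. pose proof (ED y0) as X. rewrite Eom in X. unfold dtwo in X. lra.
    + intros y Hy. rewrite ED. pose proof (Rpower_pos y p) as Py.
      assert (Pc : 0 < q * B * Rpower y p) by nra. split; intros H.
      * destruct (Rle_lt_dec y y0) as [[Z|Z]|]; [..|assumption]; exfalso.
        -- pose proof (LT _ _ Hy Z). nra.
        -- rewrite Z, Eom in H. lra.
      * pose proof (LT _ _ Py0 H). apply Rmult_lt_0_compat; lra.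
    + intros y Hy. rewrite ED. pose proof (Rpower_pos y p) as Py.
      assert (Pc : 0 < q * B * Rpower y p) by nra. split; intros H.
      * destruct (Rlt_le_dec y y0) as [Z|]; [|assumption]. exfalso. pose proof (LT _ _ Hy Z). nra.
      * destruct H as [H|<-]; [|rewrite Eom; lra]. pose proof (LT _ _ Py0 H). apply Rmult_le_pos; lra.
    + right. split; [exact HpA|]. split; [exact Py0|].
      set (m := - p). assert (Hm : 1 <= m) by (unfold m; lra).
      assert (Pk : 0 < B * (q - p)) by nra.
      set (r := m / (B * (q - p))). assert (Pr : 0 < r) by (apply Rdiv_lt_0_compat; lra).
      assert (ET : two y0 = B * (q - p) / m * (Rpower y0 q - r)).
      { pose proof (ED y0) as X. rewrite Eom in X. unfold dtwo in X. unfold two, r.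
        assert (EA : A * Rpower y0 p = q * (B * Rpower y0 q) / m) by (apply Rmult_eq_reg_l with m; [unfold m in *; field_simplify; lra|lra]).
        rewrite EA. unfold m in *. field. repeat split; lra. }
      assert (C : two_cond <-> Rpower om q < Rpower r (q - p)).
      { split; [intros [|]; [lra|assumption]|now right]. }
      rewrite C, ET. rewrite <- Eom.
      assert (S : Rpower (Rpower y0 (q - p)) q = Rpower (Rpower y0 q) (q - p))
        by (rewrite !Rpower_mult; f_equal; ring).
      rewrite S. pose proof (Rpower_pos y0 q) as Pq.
      assert (Pc : 0 < B * (q - p) / m) by (apply Rdiv_lt_0_compat; lra).
      split; intros H.
      * destruct (Rlt_le_dec (Rpower y0 q) r) as [Z|Z]; [nra|]. exfalso.
        destruct Z as [Z|Z]; [pose proof (LT _ _ Pr Z); lra|rewrite Z in H; lra].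
      * apply LT; [exact Pq|]. destruct (Rlt_le_dec (Rpower y0 q) r); [assumption|nra].
Qed.

Lemma two_deriv y : 0 < y -> derivable_pt_lim two y (dtwo y / y).
Proof.
  intros Hy. pose proof (Phi_deriv A p B q (-1) y Hy) as H.
  replace (dtwo y / y) with (Phi1 A p B q y).
  - exact H.
  - unfold Phi1, dtwo. rewrite !Rpower_m1 by lra. field. lra.
Qed.

Lemma two_mono y0 : (forall y, 0 < y -> (0 < dtwo y <-> y0 < y)) ->
  forall a b, 0 < a -> y0 <= a -> a < b -> two a < two b.
Proof.
  intros HD a b Ha Ha0 Hab.
  destruct (MVT_cor2 two (fun y => dtwo y / y) a b Hab) as (z & Ez & Hz).
  - intros y Hy. apply two_deriv. lra.
  - assert (0 < dtwo z / z) by (apply Rdiv_lt_0_compat; [apply HD; lra|lra]). nra.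
Qed.

Lemma two_cond_of_root y : 0 < y -> two y = 0 -> 0 < dtwo y -> two_cond.
Proof.
  intros Hy H0 H1. destruct two_crit as (y0 & HC & D1 & D2 & [[X _]|(X & P0 & Y)]); [now left|].
  apply Y. rewrite <- H0. apply (two_mono y0 D1); [exact P0|lra|]. now apply D1.
Qed.

Lemma two_root : two_cond -> exists y0 rho, convex_class A p B q y0 /\
  is_root two y0 rho /\ 0 < rho /\ two rho = 0 /\ 0 < dtwo rho /\
  (forall y, 0 < y -> (rho <= y <-> 0 <= two y /\ 0 <= dtwo y)) /\
  (forall y, 0 < y -> (rho < y <-> 0 < two y /\ 0 < dtwo y)).
Proof.
  intros Hc. destruct two_crit as (y0 & HC & D1 & D2 & HY).
  pose proof (convex_class_nonneg _ _ _ _ _ HC) as Hy0.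
  pose proof (two_mono y0 D1) as MN.
  assert (X1 : exists x1, 0 < x1 /\ y0 <= x1 /\ two x1 < 0).
  { destruct HY as [[X ->]|(X & P0 & Y)]; [|exists y0; split; [exact P0|]; split; [lra|now apply Y]].
    (* Since [x < 1] and the exponents of nonzero terms are at least 1, the two terms add up to at
       most [(A + B) * x < 1]. *)
    set (x := 1 / (1 + A + B)). assert (Px : 0 < x) by (apply Rdiv_lt_0_compat; lra).
    assert (Ex : x * (1 + A + B) = 1) by (unfold x; field; lra).
    exists x. split; [exact Px|]. split; [lra|]. unfold two.
    assert (LE : forall s, 1 <= s -> Rpower x s <= x).
    { intros s Hs. rewrite <- (exp_ln x) at 2 by exact Px. apply exp_mono.
      assert (ln x < 0) by (rewrite <- ln_1; apply ln_increasing; [exact Px|nra]). nra. }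
    pose proof (LE q Hq).
    assert (A * Rpower x p <= A * x).
    { destruct HA as [HA'|<-]; [|lra]. apply Rmult_le_compat_l; [lra|]. apply LE.
      destruct Hp as [|[|]]; [lra|assumption|nra]. }
    assert (B * Rpower x q <= B * x) by nra. lra. }
  destruct X1 as (x1 & Px1 & Hx1 & F1).
  set (x2 := x1 + 1 + 1 / B).
  assert (PiB : 0 < 1 / B) by (apply Rdiv_lt_0_compat; lra).
  assert (F2 : 0 < two x2).
  { unfold two. pose proof (Rpower_pos x2 p).
    assert (x2 <= Rpower x2 q).
    { rewrite <- (Rpower_1 x2) at 1 by (unfold x2; lra). apply Rle_Rpower; [unfold x2; lra|exact Hq]. }
    assert (1 < B * x2).
    { unfold x2. replace (B * (x1 + 1 + 1 / B)) with (B * (x1 + 1) + 1) by (field; lra). nra. }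
    nra. }
  destruct (IVT_interv two x1 x2) as (rho & Hr & Er); trivial.
  - intros a Ha. apply derivable_continuous_pt. exists (dtwo a / a). apply two_deriv. lra.
  - unfold x2. lra.
  - assert (Hr0 : y0 < rho).
    { destruct (proj1 Hr) as [Z|Z]; [lra|]. exfalso. rewrite Z, Er in F1. lra. }
    assert (Pr : 0 < rho) by lra.
    assert (CMP : forall y, 0 < y -> y0 <= y -> (rho <= y <-> 0 <= two y) /\ (rho < y <-> 0 < two y)).
    { intros y Hy Hyy. destruct (Rtotal_order y rho) as [Z|[Z|Z]].
      - pose proof (MN y rho Hy Hyy Z). split; split; intros; lra.
      - subst y. split; split; intros; lra.
      - pose proof (MN rho y Pr ltac:(lra) Z). split; split; intros; lra. }
    exists y0, rho. split; [exact HC|]. split; [|split; [exact Pr|split; [exact Er|split; [|split]]]].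
    + split; [lra|]. split; [|now intros _]. intros y Hy.
      destruct (CMP y ltac:(lra) ltac:(lra)) as [W _]. tauto.
    + apply D1; lra.
    + intros y Hy. rewrite D2 by exact Hy. split.
      * intros H. split; [|lra]. apply CMP; lra.
      * intros [H1 H2]. now apply CMP.
    + intros y Hy. rewrite D1 by exact Hy. split.
      * intros H. split; [|lra]. apply CMP; lra.
      * intros [H1 H2]. apply CMP; lra.
Qed.

End TwoTerm.

(** The solver expects the second term to be increasing, so the terms are exchanged if necessary. If
    neither increases, there is no root with positive derivative. *)
Definition nrm {V} (A p B q : V) : prog V :=
  Bind (fprog (FAnd (FLt 0 #B) (FLt 0 #q))) (fun f _ _ _ _ =>
  If 1 #f (Ret #A #p #B #q 1)
  (Bind (fprog (FAnd (FLt 0 #A) (FLt 0 #p))) (fun f _ _ _ _ =>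
  If 1 #f (Ret #B #q #A #p 1) (Ret1 0%A)))).

Definition two_test {V} (E : env V) (A p B q : V) : prog V :=
  If 0 (#p * #A) (Ret1 1%A)
  (Let (0 - #p * #A / (#q * #B)) (fun om => Let (#q - #p) (fun k =>
   Let ((0 - #p) / (#B * #k)) (fun r =>
   Bind (zpow (ng E) om q) (fun u _ _ _ _ => Bind (zpow (ng E) r k) (fun v _ _ _ _ =>
   fprog (FLt #u #v))))))).

(** The root on the increasing branch is computed directly. With [flip] the exponents come negated
    and the root is the inverse [v] of the coordinate, which gives access to the decreasing branch;
    the box is then tested at [1 / Rb]. If [v] exceeds [1 / e], the coordinate is below [e] and
    [e / 2] approximates it. Otherwise inverting costs a factor of at most [Rb^2] in accuracy,
    whence the tolerance [e / (2 Rb^2)]. *)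
Definition two_blk {V} (E : env V) (flip : bool) (A p B q : V) : prog V :=
  Bind (nrm A p B q) (fun A p B q ok => If 1 #ok
  (Bind (two_test E A p B q) (fun f _ _ _ _ => If 1 #f
   (Let (0 - 1) (fun m1 => let F := Poly3 A p B q m1 in
    if flip then
      Let (1 / #(nR E)) (fun u => Bind (ev (ng E) F u) (fun v v1 _ _ _ =>
      Bind (fprog (FNot (FAnd (FLt 0 #v) (FLt 0 #v1)))) (fun fb _ _ _ _ =>
      Let (1 / #(ne E)) (fun u' => Bind (ev (ng E) F u') (fun w w1 _ _ _ =>
      Bind (fprog (FAnd (FLe 0 #w) (FLe 0 #w1))) (fun fs _ _ _ _ =>
      If 1 #fs
        (Let (#(ne E) / ((1 + 1) * #(nR E) * #(nR E))) (fun ep =>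
         Bind (lr (ng E) F ep) (fun v _ _ _ _ => Ret #fb (1 / #v) 0 0 0)))
        (Ret #fb (#(ne E) / (1 + 1)) 0 0 0)))))))
    else
      Let #(nR E) (fun u => Bind (ev (ng E) F u) (fun v v1 _ _ _ =>
      Bind (fprog (FAnd (FLe 0 #v) (FLe 0 #v1))) (fun fb _ _ _ _ =>
      Let (#(ne E) / (1 + 1)) (fun ep => Bind (lr (ng E) F ep) (fun y _ _ _ _ =>
      Ret #fb #y 0 0 0)))))))
   (Ret1 0%A))) (Ret1 0%A)).

Lemma two_swap A p B q y : two A p B q y = two B q A p y.
Proof. unfold two. ring. Qed.

Lemma dtwo_swap A p B q y : dtwo A p B q y = dtwo B q A p y.
Proof. unfold dtwo. ring. Qed.

Lemma int_neq_cases p : is_int p -> p <> 0 -> 1 <= p \/ p <= -1.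
Proof.
  intros H N. pose proof (int_abs_ge1 p H N) as X. destruct (Rle_lt_dec 0 p).
  - rewrite Rabs_right in X by lra. now left.
  - rewrite Rabs_left in X by lra. right. lra.
Qed.

(** The inverted equation asks for roots up to [1 / e] with tolerance [e / (2 Rb^2)], a ratio of
    order [(Rb / e)^2]. This is why the range of the search contains a square. *)
Lemma reach_G : Rb <= e / 2 / 4 * 2 ^ fib (S n) /\ 1 / e <= e / (2 * Rb * Rb) / 4 * 2 ^ fib (S n).
Proof.
  pose proof (big_G) as HG.
  assert (H64 : 8 <= T ^ 64).
  { apply Rle_trans with (2 ^ 64); [|apply (T_pow)].
    replace 8 with (2 ^ 3) by lra. apply Rle_pow; [lra|lia]. }
  set (g := 2 ^ fib (S n)) in *. set (u := Rb / e) in *. assert (Hu : 0 < u) by now apply Rdiv_lt_0_compat.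
  assert (ER : Rb = u * e) by (unfold u; field; lra).
  assert (X1 : 8 * ((1 + u) * (1 + u)) <= g).
  { nra. }
  split.
  - nra.
  - apply Rmult_le_reg_r with (8 * Rb * Rb); [nra|].
    replace (e / (2 * Rb * Rb) / 4 * g * (8 * Rb * Rb)) with (e * g) by (field; lra).
    replace (1 / e * (8 * Rb * Rb)) with (e * (8 * (u * u))) by (rewrite ER; field; lra).
    apply Rmult_le_compat_l; lra.
Qed.

Lemma den_nrm A p B q : exists A' p' B' q' ok, den (nrm A p B q) = (A', p', B', q', ok) /\
  ((ok = 1 /\ 0 < B' /\ 0 < q' /\ ((A', p', B', q') = (A, p, B, q) \/ (A', p', B', q') = (B, q, A, p))) \/
   (ok = 0 /\ ~ (0 < B /\ 0 < q) /\ ~ (0 < A /\ 0 < p))).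
Proof.
  unfold nrm. cbn [den]. rewrite den_fprog. unfold one_of at 1. aden_simpl.
  set (s1 := fsem (FAnd (FLt 0 #B) (FLt 0 #q))).
  assert (E1 : s1 <-> 0 < B /\ 0 < q) by (unfold s1; cbn [fsem]; rewrite !fsem_Lt; reflexivity).
  destruct (Rle_dec 1 (fl s1)) as [H|H]; rewrite fl_ge1, E1 in H.
  - do 5 eexists. split; [reflexivity|]. left. tauto.
  - rewrite den_fprog. unfold one_of at 1. set (s2 := fsem (FAnd (FLt 0 #A) (FLt 0 #p))).
    assert (E2 : s2 <-> 0 < A /\ 0 < p) by (unfold s2; cbn [fsem]; rewrite !fsem_Lt; reflexivity).
    destruct (Rle_dec 1 (fl s2)) as [H'|H']; rewrite fl_ge1, E2 in H'.
    + do 5 eexists. split; [reflexivity|]. left. tauto.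
    + do 5 eexists. split; [reflexivity|]. right. tauto.
Qed.

Lemma den_two_test A p B q : 0 <= A -> 0 < B -> 1 <= q -> int_le T p -> int_le T q ->
  den (two_test E A p B q) = one_of (fl (two_cond A p B q)).
Proof.
  intros HA HB Hq Ip Iq. unfold two_test. cbn [den]. aden_simpl.
  destruct (Rle_dec 0 (p * A)) as [H|H].
  - rewrite fl_true; [reflexivity|now left].
  - assert (Hp : p < 0) by nra.
    assert (Pom : 0 < 0 - p * A / (q * B)).
    { replace (0 - p * A / (q * B)) with (- (p * A) / (q * B)) by lra.
      apply Rdiv_lt_0_compat; nra. }
    assert (Pr : 0 < (0 - p) / (B * (q - p))) by (apply Rdiv_lt_0_compat; nra).
    assert (Ik : int_le (2 * T ^ 2) (q - p)).
    { apply int_le_weaken with (T + T); [now apply int_le_minus|].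
      pose proof (T_ge2). nra. }
    pose proof (glob_E) as Hg.
    rewrite (den_zpow _ _ _ _ _ Hg Pom (int_small1 q Iq)). unfold one_of at 1.
    rewrite (den_zpow _ _ _ _ _ Hg Pr (proj1 (int_small _ Ik))). unfold one_of at 1.
    rewrite den_fprog. f_equal. apply fl_iff. rewrite fsem_Lt. replace (0 - p * A / (q * B)) with (- (p * A) / (q * B)) by lra.
    replace (0 - p) with (- p) by ring. split; [now right|]. intros [|]; [lra|assumption].
Qed.

Definition two_sol (A p B q v : R) : Prop := 0 < v /\ two A p B q v = 0 /\ 0 < dtwo A p B q v.

Lemma den_two_blk (flip : bool) A p B q : 0 <= A -> 0 <= B -> int_le T p -> int_le T q ->
  (A = 0 \/ p <> 0) -> (B = 0 \/ q <> 0) ->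
  let Y v := if flip then 1 / v else v in
  exists f y, den (two_blk E flip A p B q) = (f, y, 0, 0, 0) /\ (f = 0 \/ f = 1) /\
    (f = 1 -> exists v, two_sol A p B q v /\ Y v <= Rb /\ Rabs (y - Y v) < e) /\
    (forall v, two_sol A p B q v -> Y v <= Rb -> f = 1 /\ Rabs (y - Y v) < e).
Proof.
  intros HA HB Ip Iq Np Nq Y. unfold two_blk. cbn [den].
  destruct (den_nrm A p B q) as (A' & p' & B' & q' & ok & -> & HN). aden_simpl.
  assert (SW : forall v, (A', p', B', q') = (A, p, B, q) \/ (A', p', B', q') = (B, q, A, p) ->
    (two_sol A' p' B' q' v <-> two_sol A p B q v)).
  { intros v [W|W]; injection W as -> -> -> ->; [reflexivity|]. unfold two_sol.
    rewrite (two_swap B q), (dtwo_swap B q). reflexivity. }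
  destruct HN as [(-> & PB & Pq & HW)|(-> & N1 & N2)].
  2: { destruct (Rle_dec 1 0) as [X|_]; [lra|]. exists 0, 0. split; [reflexivity|]. split; [now left|].
    split; [lra|]. intros v (Hv & _ & HD) _. exfalso. unfold dtwo in HD.
    pose proof (Rpower_pos v p) as P1. pose proof (Rpower_pos v q) as P2.
    assert (p * (A * Rpower v p) <= 0).
    { destruct HA as [HA|<-]; [|lra]. assert (0 < A * Rpower v p) by nra. nra. }
    assert (q * (B * Rpower v q) <= 0).
    { destruct HB as [HB|<-]; [|lra]. assert (0 < B * Rpower v q) by nra. nra. }
    lra. }
  destruct (Rle_dec 1 1) as [_|X]; [|lra].
  assert (HA' : 0 <= A' /\ int_le T p' /\ int_le T q' /\ (A' = 0 \/ p' <> 0)).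
  { destruct HW as [W|W]; injection W as -> -> -> ->; tauto. }
  destruct HA' as (HA' & Ip' & Iq' & Np').
  assert (Hq1 : 1 <= q') by (destruct (int_neq_cases q' (proj1 Iq') (Rgt_not_eq _ _ Pq)); lra).
  assert (Hp1 : A' = 0 \/ 1 <= p' \/ p' <= -1).
  { destruct Np' as [|N]; [now left|right; apply (int_neq_cases p' (proj1 Ip') N)]. }
  rewrite den_two_test by tauto. unfold one_of at 1.
  destruct (Rle_dec 1 (fl (two_cond A' p' B' q'))) as [C|C]; rewrite fl_ge1 in C.
  2: { exists 0, 0. split; [reflexivity|]. split; [now left|]. split; [lra|].
    intros v Hv _. exfalso. apply SW in Hv; [|exact HW]. destruct Hv as (Hv & H0 & H1).
    now apply C, (two_cond_of_root A' p' B' q' HA' PB Hq1 Hp1 v). }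
  destruct (two_root A' p' B' q' HA' PB Hq1 Hp1 C) as (y0 & rho & HC & IR & Pr & R0 & R1 & LE & LT).
  assert (Srho : two_sol A p B q rho) by (apply SW; [exact HW|repeat split; assumption]).
  assert (UNI : forall v, two_sol A p B q v -> v = rho).
  { intros v Hv. apply SW in Hv; [|exact HW]. destruct Hv as (Hv & V0 & V1).
    assert (rho <= v) by (apply LE; lra). assert (~ rho < v) by (rewrite LT by exact Hv; lra). lra. }
  set (F := Poly3 A' p' B' q' (0 - 1)).
  pose proof (glob_E) as Hg.
  assert (Sp := int_small1 p' Ip'). assert (Sq := int_small1 q' Iq').
  assert (EF : forall y, PhiR F y = two A' p' B' q' y) by (intros y; unfold PhiR, Phi, two, F; cbn; ring).
  assert (PO : poly_ok (32 * L) F y0).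
  { split; [exact HC|]. split; [exact Sp|]. split; [exact Sq|]. assert (Ik : int_le (2 * T ^ 2) (Rabs p' + q')).
    { apply int_le_weaken with (T + T).
      - apply int_le_plus; [|exact Iq']. destruct Ip' as [[z ->] B1]. split; [|now rewrite Rabs_Rabsolu].
        rewrite <- abs_IZR. now exists (Z.abs z).
      - pose proof (T_ge2). nra. }
    pose proof (proj2 (int_small _ Ik)) as X.
    pose proof (Rabs_pos p'). rewrite (Rabs_right (Rabs p' + q')) in X by lra. exact X. }
  assert (IR' : is_root (PhiR F) y0 rho).
  { destruct IR as (I1 & I2 & I3). split; [exact I1|]. split; [|now rewrite EF].
    intros y Hy. rewrite EF. now apply I2. }
  assert (EV : forall u, 0 < u -> den (ev (ng E) F u) = (two A' p' B' q' u, dtwo A' p' B' q' u, 0, 0, 0)).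
  { intros u Hu. rewrite (den_ev _ _ _ F u Hg Hu Sp Sq). rewrite EF.
    replace (u * Phi1R F u) with (dtwo A' p' B' q' u); [reflexivity|].
    unfold Phi1R, Phi1, dtwo, F. cbn [cA cp cB ck]. rewrite !Rpower_m1 by exact Hu. field. lra. }
  destruct HE as (_ & ER & Ee & _). rewrite ER, Ee.
  destruct reach_G as [RG1 RG2]. assert (FIN : forall fb P y, fb = fl P -> (P <-> Y rho <= Rb) -> (P -> Rabs (y - Y rho) < e) ->
    (fb = 0 \/ fb = 1) /\ (fb = 1 -> exists v, two_sol A p B q v /\ Y v <= Rb /\ Rabs (y - Y v) < e) /\
    (forall v, two_sol A p B q v -> Y v <= Rb -> fb = 1 /\ Rabs (y - Y v) < e)).
  { intros fb P y -> HP HY. destruct (classic P) as [H|H].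
    - rewrite (fl_true _ H). split; [now right|]. split.
      + intros _. exists rho. split; [exact Srho|]. split; [now apply HP|now apply HY].
      + intros v Hv Hb. rewrite (UNI v Hv). split; [reflexivity|now apply HY].
    - rewrite (fl_false _ H). split; [now left|]. split; [lra|].
      intros v Hv Hb. exfalso. rewrite (UNI v Hv) in Hb. now apply H, HP. }
  destruct flip; unfold Y in *.
  - cbn [den]. aden_simpl. assert (PiR : 0 < 1 / Rb) by (apply Rdiv_lt_0_compat; lra).
    assert (Pie : 0 < 1 / e) by (apply Rdiv_lt_0_compat; lra).
    rewrite EV by exact PiR. rewrite den_fprog. unfold one_of at 1. rewrite EV by exact Pie.
    rewrite den_fprog. unfold one_of at 1. set (s1 := fsem (FNot (FAnd (FLt 0 #(two A' p' B' q' (1 / Rb))) (FLt 0 #(dtwo A' p' B' q' (1 / Rb)))))).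
    assert (E1 : s1 <-> 1 / rho <= Rb).
    { unfold s1. cbn [fsem]. rewrite !fsem_Lt. cbn [aden]. rewrite <- LT by exact PiR. split; intros H.
      - assert (H' : 1 / Rb <= rho) by lra.
        apply Rmult_le_reg_r with rho; [exact Pr|]. replace (1 / rho * rho) with 1 by (field; lra).
        apply Rmult_le_compat_l with (r := Rb) in H'; [|lra].
        replace (Rb * (1 / Rb)) with 1 in H' by (field; lra). exact H'.
      - intros H'. apply Rmult_le_compat_r with (r := rho) in H; [|lra].
        replace (1 / rho * rho) with 1 in H by (field; lra).
        apply Rmult_lt_compat_l with (r := Rb) in H'; [|exact HRb].
        replace (Rb * (1 / Rb)) with 1 in H' by (field; lra). lra. }
    set (s2 := fsem (FAnd (FLe 0 #(two A' p' B' q' (1 / e))) (FLe 0 #(dtwo A' p' B' q' (1 / e))))).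
    assert (E2 : s2 <-> rho <= 1 / e) by (unfold s2; cbn [fsem aden]; rewrite <- LE by exact Pie; reflexivity).
    destruct (Rle_dec 1 (fl s2)) as [S2|S2]; rewrite fl_ge1, E2 in S2.
    + replace (1 + 1) with 2 by ring. set (ep := e / (2 * Rb * Rb)) in *. assert (Pep : 0 < ep) by (apply Rdiv_lt_0_compat; nra).
      destruct (den_lr (ng E) (32 * L) n F y0 rho ep Hg PO IR' Pep ltac:(lra)) as (v & Ev & Hv).
      rewrite Ev. unfold one_of at 1.
      pose proof (eval_div 1 v) as W. unfold eval_rop in W. rewrite W. exists (fl s1), (1 / v). split; [reflexivity|].
      apply (FIN _ s1); [reflexivity|exact E1|]. intros H. apply E1 in H.
      replace (1 / v - 1 / rho) with (- ((v - rho) * (1 / rho) * (1 / v))) by (field; lra).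
      rewrite Rabs_Ropp.
      assert (P2 : 0 < 1 / v) by (apply Rdiv_lt_0_compat; lra).
      assert (P3 : 1 / v <= 1 / rho).
      { apply Rmult_le_compat_l; [lra|]. apply Rinv_le_contravar; lra. }
      rewrite Rabs_right by (apply Rle_ge; repeat apply Rmult_le_pos; lra).
      apply Rle_lt_trans with (ep * Rb * Rb).
      * apply Rmult_le_compat; try lra; [apply Rmult_le_pos; lra|]. apply Rmult_le_compat; lra.
      * unfold ep. replace (e / (2 * Rb * Rb) * Rb * Rb) with (e / 2) by (field; lra). lra.
    + exists (fl s1), (e / 2). split; [reflexivity|]. apply (FIN _ s1); [reflexivity|exact E1|].
      intros _. assert (Hr : 1 / e < rho) by lra.
      assert (P1 : 0 < 1 / rho) by (apply Rdiv_lt_0_compat; lra).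
      assert (1 / rho < e).
      { apply Rmult_lt_reg_r with rho; [exact Pr|]. replace (1 / rho * rho) with 1 by (field; lra).
        apply Rmult_lt_compat_l with (r := e) in Hr; [|exact He].
        replace (e * (1 / e)) with 1 in Hr by (field; lra). exact Hr. }
      apply Rabs_def1; lra.
  - cbn [den]. aden_simpl. rewrite EV by exact HRb. rewrite den_fprog. replace (1 + 1) with 2 by ring. set (s1 := fsem (FAnd (FLe 0 #(two A' p' B' q' Rb)) (FLe 0 #(dtwo A' p' B' q' Rb)))).
    assert (E1 : s1 <-> rho <= Rb) by (unfold s1; cbn [fsem aden]; rewrite <- LE by exact HRb; reflexivity).
    destruct (den (lr (ng E) F (e / 2))) as [[[[y y2] y3] y4] y5] eqn:EL. exists (fl s1), y. split; [reflexivity|]. apply (FIN _ s1); [reflexivity|exact E1|].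
    intros H. apply E1 in H.
    destruct (den_lr (ng E) (32 * L) n F y0 rho (e / 2) Hg PO IR' ltac:(lra) ltac:(lra)) as (y' & Ey & Hy).
    rewrite Ey in EL. injection EL as <- _ _ _ _. apply Rabs_def1; lra.
Qed.

Definition min_exp {V} (E : env V) : prog V :=
  Let #(na E 0%nat) (fun x => Let #(na E 1%nat) (fun y => Let #(na E 2%nat) (fun z =>
  If #x #y (If #x #z (Ret1 #x%A) (Ret1 #z%A)) (If #y #z (Ret1 #y%A) (Ret1 #z%A))))).

Definition line_test {V} (E : env V) : prog V :=
  Bind (dif E) (fun a1 b1 a2 b2 D => Bind (ecoef a1 b1 a2 b2 D) (fun e3 e2 e1 e0 _ =>
  fprog (FAnd (FNot (FEq #D 0)) (FAnd (FEq #e3 0) (FAnd (FEq #e2 0) (FAnd (FEq #e1 0) (FEq #e0 0))))))).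

(** [thr2] admits isolated vertical tangents, which off the origin occur on the axis [y = 0] but not
    on the axis [x = 0]. *)
Definition want_test {V} (E : env V) (thr2 : bool) (k : V) : prog V :=
  Bind (line_test E) (fun ln _ _ _ _ =>
  Let (#(na E 0%nat) + #(na E 1%nat) + #(na E 2%nat)) (fun sa =>
  Let (#(nb E 0%nat) + #(nb E 1%nat) + #(nb E 2%nat)) (fun sb =>
  Let (#(na E 0%nat) * #(nb E 0%nat) + #(na E 1%nat) * #(nb E 1%nat) + #(na E 2%nat) * #(nb E 2%nat)) (fun sab =>
  let infl := FAnd (FLt #ln 1)
    (FOr (FLe (1 + 1 + 1) #sa) (FAnd (FEq #sa 1) (FEq #sb ((1 + 1 + 1) * #sab + 1)))) in
  fprog (FOr (FEq #k 1) (FAnd (FEq #k 0)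
    (if thr2 then FOr (FLe (1 + 1) #sa) infl else infl))))))).

Definition coef_at {V} (E : env V) (k : V) (t : nat) : prog V :=
  Bind (fprog (FEq #(na E t) #k)) (fun f _ _ _ _ => Ret1 (#f * #(nc E t))%A).

(** Term [i] is the one with sign opposite to the others. Dividing by it leaves [A y^p + B y^q = 1]
    with nonnegative coefficients, where terms with a higher power of [x] count as 0. Such an
    equation has at most one simple root on each monotone branch, and [flip] selects the decreasing
    branch by passing to [1 / y]. *)
Definition axis_blk {V} (E : env V) (thr2 flip : bool) (i j l : nat) : prog V :=
  Bind (min_exp E) (fun k _ _ _ _ => Bind (want_test E thr2 k) (fun w _ _ _ _ =>
  Bind (coef_at E k i) (fun gi _ _ _ _ => Bind (coef_at E k j) (fun gj _ _ _ _ =>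
  Bind (coef_at E k l) (fun gl _ _ _ _ =>
  Bind (fprog (FAnd (FLe 1 #w) (FAnd (FNot (FEq #gi 0)) (FAnd (FLe (#gi * #gj) 0) (FAnd (FLe (#gi * #gl) 0)
    (FNot (FAnd (FEq #gj 0) (FEq #gl 0)))))))) (fun f _ _ _ _ =>
  If 1 #f
    (Let (0 - #gj / #gi) (fun A => Let (0 - #gl / #gi) (fun B =>
     Let (if flip then (#(nb E i) - #(nb E j))%A else (#(nb E j) - #(nb E i))%A) (fun p =>
     Let (if flip then (#(nb E i) - #(nb E l))%A else (#(nb E l) - #(nb E i))%A) (fun q =>
     two_blk E flip A p B q)))))
    (Ret1 0%A))))))).

(** A vanishing sum with positive weights has terms of both signs, so among three terms one stands
    alone against the others, up to zeros. *)
Lemma sign_role x y z u v w : 0 < u -> 0 < v -> 0 < w -> x * u + y * v + z * w = 0 ->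
  ~ (x = 0 /\ y = 0 /\ z = 0) ->
  (x <> 0 /\ x * y <= 0 /\ x * z <= 0 /\ ~ (y = 0 /\ z = 0)) \/
  (y <> 0 /\ y * x <= 0 /\ y * z <= 0 /\ ~ (x = 0 /\ z = 0)) \/
  (z <> 0 /\ z * x <= 0 /\ z * y <= 0 /\ ~ (x = 0 /\ y = 0)).
Proof.
  intros P0 P1 P2 HS NN.
  assert (SG : forall s r, 0 < r -> (0 < s -> 0 < s * r) /\ (s < 0 -> s * r < 0) /\ (s = 0 -> s * r = 0)).
  { intros s r Hr. split; [|split]; intros; nra. }
  destruct (SG x u P0) as (X1 & X2 & X3). destruct (SG y v P1) as (Y1 & Y2 & Y3).
  destruct (SG z w P2) as (Z1 & Z2 & Z3). assert (R : forall a b d, (a < 0 /\ 0 <= b /\ 0 <= d /\ 0 < b + d) \/ (0 < a /\ b <= 0 /\ d <= 0 /\ b + d < 0) ->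
    a <> 0 /\ a * b <= 0 /\ a * d <= 0 /\ ~ (b = 0 /\ d = 0)).
  { intros a b d [(A1 & A2 & A3 & A4)|(A1 & A2 & A3 & A4)];
      (split; [intros ->; lra|split; [nra|split; [nra|intros [-> ->]; lra]]]). }
  generalize (x * u), (y * v), (z * w), HS, X1, X2, X3, Y1, Y2, Y3, Z1, Z2, Z3. clear - NN R.
  intros p q r HS X1 X2 X3 Y1 Y2 Y3 Z1 Z2 Z3.
  destruct (Rtotal_order x 0) as [Hx|[Hx|Hx]]; [specialize (X2 Hx)|specialize (X3 Hx)|specialize (X1 Hx)];
  (destruct (Rtotal_order y 0) as [Hy|[Hy|Hy]]; [specialize (Y2 Hy)|specialize (Y3 Hy)|specialize (Y1 Hy)]);
  (destruct (Rtotal_order z 0) as [Hz|[Hz|Hz]]; [specialize (Z2 Hz)|specialize (Z3 Hz)|specialize (Z1 Hz)]);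
  first [exfalso; lra | exfalso; apply NN; repeat split; lra | left; apply R; lra | right; left; apply R; lra | right; right; apply R; lra].
Qed.

Lemma env_t t : (t < 3)%nat -> nc E t = c t /\ na E t = INR (ea t) /\ nb E t = INR (eb t).
Proof. intros Ht. destruct HE as (H & _). destruct (H t Ht) as (A1 & A2 & A3 & _). auto. Qed.

Lemma den_min_exp : den (min_exp E) = one_of (INR (kmin ea)).
Proof.
  unfold min_exp. cbn [den aden].
  destruct (env_t 0) as (_ & -> & _); [lia|]. destruct (env_t 1) as (_ & -> & _); [lia|].
  destruct (env_t 2) as (_ & -> & _); [lia|]. unfold kmin, Ret1, one_of. assert (X : forall a b, (INR a <= INR b <-> (a <= b)%nat)) by (split; [apply INR_le|apply le_INR]).
  destruct (Rle_dec (INR (ea 0)) (INR (ea 1))) as [H|H]; rewrite X in H;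
    [destruct (Rle_dec (INR (ea 0)) (INR (ea 2))) as [H'|H']|destruct (Rle_dec (INR (ea 1)) (INR (ea 2))) as [H'|H']];
    rewrite X in H'; apply (f_equal (fun x => (INR x, 0, 0, 0, 0))); lia.
Qed.

Lemma den_line_test : den (line_test E) = one_of (fl (line_case ea eb)).
Proof.
  unfold line_test. cbn [den]. rewrite (den_dif _ _ _ _ _ _ _ _ HE).
  destruct (den_ecoef ea eb) as (x & ->). rewrite den_fprog. f_equal. apply fl_iff.
  cbn [fsem]. rewrite !fsem_Eq. unfold line_case. tauto.
Qed.

Definition wanted (thr2 : bool) : Prop :=
  kmin ea = 1%nat \/ (kmin ea = 0%nat /\
    ((thr2 = true /\ (2 <= ea 0 + ea 1 + ea 2)%nat) \/ (~ line_case ea eb /\ infl_cond ea eb 3))).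

(** If the exponents [ea] sum to 1, exactly one of them is 1, and the sum of products picks the
    matching [eb] by arithmetic alone. *)
Lemma infl_cond_sum : infl_cond ea eb 3 <-> (3 <= ea 0 + ea 1 + ea 2)%nat \/
  (ea 0 + ea 1 + ea 2 = 1 /\ eb 0 + eb 1 + eb 2 = 3 * (ea 0 * eb 0 + ea 1 * eb 1 + ea 2 * eb 2) + 1)%nat.
Proof.
  unfold infl_cond.
  destruct (Nat.eq_dec (ea 0 + ea 1 + ea 2) 1) as [H|H]; [|lia].
  assert (X : forall t, (ea t <= 1)%nat -> ((if Nat.eq_dec (ea t) 0 then 0 else eb t) = ea t * eb t)%nat).
  { intros t Ht. destruct (Nat.eq_dec (ea t) 0) as [Z|Z]; [rewrite Z; reflexivity|].
    replace (ea t) with 1%nat by lia. lia. }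
  rewrite !X by lia. reflexivity.
Qed.

Lemma den_want_test thr2 : den (want_test E thr2 (INR (kmin ea))) = one_of (fl (wanted thr2)).
Proof.
  unfold want_test. cbn [den]. rewrite den_line_test. unfold one_of at 1. rewrite den_fprog. f_equal.
  apply fl_iff. aden_simpl.
  destruct (env_t 0) as (_ & -> & ->); [lia|]. destruct (env_t 1) as (_ & -> & ->); [lia|].
  destruct (env_t 2) as (_ & -> & ->); [lia|].
  rewrite <- !mult_INR, <- !plus_INR.
  set (sa := (ea 0 + ea 1 + ea 2)%nat). set (sb := (eb 0 + eb 1 + eb 2)%nat).
  set (sab := (ea 0 * eb 0 + ea 1 * eb 1 + ea 2 * eb 2)%nat).
  assert (XE : forall a b, (INR a = INR b <-> a = b)) by (split; [apply INR_eq|now intros ->]).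
  assert (XL : forall a b, (INR a <= INR b <-> (a <= b)%nat)) by (split; [apply INR_le|apply le_INR]).
  set (infl := FAnd (FLt #(fl (line_case ea eb)) 1)
    (FOr (FLe (1 + 1 + 1) #(INR sa)) (FAnd (FEq #(INR sa) 1) (FEq #(INR sb) ((1 + 1 + 1) * #(INR sab) + 1))))).
  assert (EI : fsem infl <-> ~ line_case ea eb /\ infl_cond ea eb 3).
  { unfold infl. cbn [fsem]. rewrite !fsem_Eq, fsem_Lt. aden_simpl.
    replace (1 + 1 + 1) with (INR 3) by tauto.
    replace (INR 3 * INR sab + 1) with (INR (3 * sab + 1)) by (rewrite plus_INR, mult_INR; simpl; lra).
    replace 1 with (INR 1) at 2 by tauto. rewrite !XE, XL, infl_cond_sum. assert (fl (line_case ea eb) < 1 <-> ~ line_case ea eb); [|tauto].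
    pose proof (fl_ge1 (line_case ea eb)) as FG.
    split; [intros X Y; apply FG in Y; lra|intros X; apply Rnot_le_lt; intros Y; now apply X, FG]. }
  unfold wanted. assert (K1 : fsem (FEq #(INR (kmin ea)) 1) <-> kmin ea = 1%nat)
    by (rewrite fsem_Eq; cbn [aden]; replace 1 with (INR 1) by reflexivity; apply XE).
  assert (K0 : fsem (FEq #(INR (kmin ea)) 0) <-> kmin ea = 0%nat)
    by (rewrite fsem_Eq; cbn [aden]; replace 0 with (INR 0) by reflexivity; apply XE).
  assert (S2 : fsem (FLe (1 + 1) #(INR sa)) <-> (2 <= sa)%nat).
  { cbn [fsem]. aden_simpl. replace (1 + 1) with (INR 2) by tauto. apply XL. }
  destruct thr2; cbn [fsem]; cbn [fsem] in S2; rewrite EI.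
  - tauto.
  - assert (~ (false = true)) by lra. tauto.
Qed.

Lemma den_coef_at k t : (t < 3)%nat -> den (coef_at E (INR k) t) = one_of (indic (ea t) k * c t).
Proof.
  intros Ht. destruct (env_t t Ht) as (Ec & Ea & _). unfold coef_at. cbn [den]. rewrite den_fprog.
  cbn [den Ret1]. aden_simpl. rewrite Ec, Ea. apply (f_equal (fun x => (x, 0, 0, 0, 0))). f_equal. unfold indic.
  assert (X : fsem (FEq #(INR (ea t)) #(INR k)) <-> ea t = k).
  { rewrite fsem_Eq. split; [apply INR_eq|now intros ->]. }
  destruct (Nat.eq_dec (ea t) k); [apply fl_true|apply fl_false]; tauto.
Qed.

Lemma two_of_G k i j l y : perm3 i j l -> 0 < y ->
  let g t := indic (ea t) k * c t in let d t := INR (eb t) - INR (eb i) in g i <> 0 ->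
  G c ea eb k y = - (g i * y ^ eb i) * two (0 - g j / g i) (d j) (0 - g l / g i) (d l) y /\
  G1 c ea eb k y = INR (eb i) * G c ea eb k y - g i * y ^ eb i * dtwo (0 - g j / g i) (d j) (0 - g l / g i) (d l) y.
Proof.
  intros P Hy g d Hg. destruct (G_sum c ea eb k i j l y P) as (E0 & E1 & _). rewrite E1, E0.
  assert (W : forall t, y ^ eb t = y ^ eb i * Rpower y (d t)).
  { intros t. unfold d. rewrite <- !Rpower_pow by exact Hy. rewrite <- Rpower_plus. f_equal. ring. }
  rewrite (W j), (W l). unfold two, dtwo.
  assert (Z : forall t m, indic (ea t) k * (c t * m) = g t * m) by (intros; unfold g; ring).
  assert (Z1 : forall t m, indic (ea t) k * (INR (eb t) * (c t * m)) = INR (eb t) * (g t * m)) by (intros; unfold g; ring).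
  rewrite !Z, !Z1. replace (INR (eb j)) with (d j + INR (eb i)) by (unfold d; ring).
  replace (INR (eb l)) with (d l + INR (eb i)) by (unfold d; ring).
  assert (Hg' : g i <> 0) by exact Hg. generalize (g i), (g j), (g l), (d j), (d l), Hg'.
  intros x1 x2 x3 d2 d3 Hx. split; field; exact Hx.
Qed.

Lemma two_inv A p B q v : 0 < v -> two A (- p) B (- q) (1 / v) = two A p B q v /\
  dtwo A (- p) B (- q) (1 / v) = - dtwo A p B q v.
Proof.
  intros Hv. assert (X : forall s, Rpower (1 / v) (- s) = Rpower v s).
  { intros s. unfold Rpower. f_equal. unfold Rdiv. rewrite Rmult_1_l, ln_Rinv by exact Hv. ring. }
  unfold two, dtwo. rewrite !X. split; ring.
Qed.

Definition axis_point (thr2 : bool) (y : R) : Prop := 0 < y /\ y <= Rb /\ wanted thr2 /\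
  G c ea eb (kmin ea) y = 0 /\ G1 c ea eb (kmin ea) y <> 0.

Lemma den_axis_blk (thr2 flip : bool) i j l : perm3 i j l ->
  let g t := indic (ea t) (kmin ea) * c t in
  let ok := wanted thr2 /\ g i <> 0 /\ g i * g j <= 0 /\ g i * g l <= 0 /\ ~ (g j = 0 /\ g l = 0) in
  let good y := G c ea eb (kmin ea) y = 0 /\
    if flip then 0 < g i * G1 c ea eb (kmin ea) y else g i * G1 c ea eb (kmin ea) y < 0 in
  exists f y, den (axis_blk E thr2 flip i j l) = (f, y, 0, 0, 0) /\ (f = 0 \/ f = 1) /\
    (f = 1 -> exists y0, axis_point thr2 y0 /\ Rabs (y - y0) < e) /\
    (ok -> forall y0, axis_point thr2 y0 -> good y0 -> f = 1 /\ Rabs (y - y0) < e).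
Proof.
  intros P g ok good. assert (P' := P). destruct P' as (Hi & Hj & Hl & Hij & Hil & Hjl).
  unfold axis_blk. cbn [den]. rewrite den_min_exp. unfold one_of at 1. rewrite den_want_test. unfold one_of at 1.
  rewrite !den_coef_at by lia. unfold one_of at 1. unfold one_of at 1. unfold one_of at 1.
  rewrite den_fprog. unfold one_of at 1. aden_simpl.
  match goal with |- context [fl (fsem ?X)] => set (s := fsem X) end.
  assert (Es : s <-> ok).
  { unfold s, ok. cbn [fsem]. rewrite !fsem_Eq. aden_simpl. rewrite fl_ge1. tauto. }
  destruct (Rle_dec 1 (fl s)) as [H|H]; rewrite fl_ge1, Es in H.
  2: { exists 0, 0. split; [reflexivity|]. split; [now left|]. split; [lra|]. tauto. }
  destruct H as (Hw & Hg & Hgj & Hgl & Hn).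
  destruct (env_t i Hi) as (_ & _ & Ebi). destruct (env_t j Hj) as (_ & _ & Ebj).
  destruct (env_t l Hl) as (_ & _ & Ebl).
  set (d := fun t => INR (eb t) - INR (eb i)).
  assert (Ep : aden (if flip then (#(nb E i) - #(nb E j))%A else (#(nb E j) - #(nb E i))%A) =
    if flip then - d j else d j) by (unfold d; destruct flip; cbn [aden eval_rop]; rewrite Ebi, Ebj; ring).
  assert (Eq : aden (if flip then (#(nb E i) - #(nb E l))%A else (#(nb E l) - #(nb E i))%A) =
    if flip then - d l else d l) by (unfold d; destruct flip; cbn [aden eval_rop]; rewrite Ebi, Ebl; ring).
  rewrite Ep, Eq. clear Ep Eq.
  assert (SGN : forall t, g i * g t <= 0 -> 0 <= 0 - g t / g i).
  { intros t Ht. replace (0 - g t / g i) with (- (g i * g t) / (g i * g i)) by (field; exact Hg).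
    apply Rmult_le_pos; [lra|]. left. apply Rinv_0_lt_compat. nra. }
  assert (NZ : forall t, (t < 3)%nat -> t <> i -> 0 - g t / g i = 0 \/ d t <> 0).
  { intros t Ht Hti. destruct (Req_dec (g t) 0) as [Z|Z]; [left; rewrite Z; unfold Rdiv; ring|right].
    assert (ea t = kmin ea) by (destruct (Nat.eq_dec (ea t) (kmin ea)) as [|N]; [assumption|exfalso; apply Z; unfold g; rewrite indic_neq by exact N; ring]).
    assert (ea i = kmin ea) by (destruct (Nat.eq_dec (ea i) (kmin ea)) as [|N]; [assumption|exfalso; apply Hg; unfold g; rewrite indic_neq by exact N; ring]).
    destruct (exps_neq c ea eb Htri t i Ht Hi Hti) as [N|N]; [lia|]. unfold d. intros W. apply N, INR_eq. lra. }
  assert (IL : forall t, (t < 3)%nat -> int_le (2 ^ L) (if flip then - d t else d t)).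
  { intros t Ht. pose proof (proj2 (exp_dif t i Ht Hi)). destruct flip; [now apply int_le_opp|assumption]. }
  set (A := 0 - g j / g i). set (B := 0 - g l / g i).
  set (p := if flip then - d j else d j). set (q := if flip then - d l else d l).
  destruct (den_two_blk flip A p B q) as (f & y & E1 & E2 & E3 & E4).
  { now apply SGN. } { now apply SGN. } { now apply IL. } { now apply IL. }
  { destruct (NZ j Hj ltac:(lia)); [now left|right]. unfold p. destruct flip; [lra|assumption]. }
  { destruct (NZ l Hl ltac:(lia)); [now left|right]. unfold q. destruct flip; [lra|assumption]. }
  (* The division by term [i] reverses the sign of the derivative relative to that term, and
     inversion reverses it once more; hence the two sign conditions in [good]. *)
  assert (KEY : forall v, 0 < v -> let Y := if flip then 1 / v else v in
    0 < Y /\ (two_sol A p B q v <-> good Y)).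
  { intros v Hv Y. assert (HY : 0 < Y) by (unfold Y; destruct flip; [apply Rdiv_lt_0_compat; lra|exact Hv]).
    split; [exact HY|].
    destruct (two_of_G (kmin ea) i j l Y P HY Hg) as [G0 G1']. fold (g i) (g j) (g l) A B in G0, G1'.
    fold (d j) (d l) in G0, G1'.
    assert (Py : 0 < Y ^ eb i) by now apply pow_lt.
    assert (TV : two A p B q v = two A (d j) B (d l) Y /\
      dtwo A p B q v = (if flip then - dtwo A (d j) B (d l) Y else dtwo A (d j) B (d l) Y)).
    { unfold p, q, Y. destruct flip; [|tauto]. destruct (two_inv A (- d j) B (- d l) v Hv) as [I1 I2].
      rewrite !Ropp_involutive in I1, I2. rewrite I1, I2. split; [reflexivity|ring]. }
    destruct TV as [TV DV]. unfold two_sol, good. rewrite TV, DV.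
    set (W := two A (d j) B (d l) Y) in *. set (DW := dtwo A (d j) B (d l) Y) in *.
    assert (Z0 : G c ea eb (kmin ea) Y = 0 <-> W = 0).
    { rewrite G0. split; intros H; [|rewrite H; ring]. apply Rmult_integral in H.
      destruct H as [H|H]; [|exact H]. exfalso.
      assert (g i * Y ^ eb i = 0) as H' by lra. apply Rmult_integral in H'. lra. }
    rewrite Z0.
    assert (Z1 : W = 0 -> g i * G1 c ea eb (kmin ea) Y = - (g i * g i * Y ^ eb i) * DW).
    { intros HW. rewrite G1', (proj2 Z0 HW). ring. }
    assert (PP : 0 < g i * g i * Y ^ eb i) by (apply Rmult_lt_0_compat; [nra|exact Py]).
    split.
    - intros (_ & HW & HD). split; [exact HW|]. rewrite (Z1 HW). destruct flip; nra.
    - intros [HW HD]. split; [exact Hv|]. split; [exact HW|]. rewrite (Z1 HW) in HD. destruct flip; nra. }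
  exists f, y. split; [exact E1|]. split; [exact E2|]. split.
  - intros Hf. destruct (E3 Hf) as (v & Hv & Hb & Hc). destruct (KEY v (proj1 Hv)) as [K1 K2].
    apply K2 in Hv. exists (if flip then 1 / v else v). split; [|exact Hc].
    destruct Hv as [V0 V1]. split; [exact K1|]. split; [exact Hb|]. split; [exact Hw|]. split; [exact V0|].
    intros Z. rewrite Z in V1. destruct flip; lra.
  - intros _ y0 (Hy & Hyb & _ & _ & _) Hgood.
    assert (W : exists v, 0 < v /\ (if flip then 1 / v else v) = y0).
    { destruct flip; [exists (1 / y0)|exists y0]; (split; [try exact Hy; apply Rdiv_lt_0_compat; lra|]); [field; lra|reflexivity]. }
    destruct W as (v & Hv & Ev). destruct (KEY v Hv) as [K1 K2]. rewrite Ev in *.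
    destruct (E4 v) as [F1 F2]; [now apply K2|rewrite Ev; exact Hyb|]. rewrite Ev in F2. tauto.
Qed.

Definition others (i : nat) : nat * nat := match i with 0 => (1, 2) | 1 => (0, 2) | _ => (0, 1) end%nat.

(** The root is simple, so the derivative has a sign there, and this sign determines the branch. *)
Lemma axis_complete thr2 y0 : axis_point thr2 y0 -> exists flip i f y, (i < 3)%nat /\
  den (axis_blk E thr2 flip i (fst (others i)) (snd (others i))) = (f, y, 0, 0, 0) /\ f = 1 /\ Rabs (y - y0) < e.
Proof.
  intros HY. assert (HY' := HY). destruct HY' as (Hy & Hyb & Hw & H0 & H1).
  set (g := fun t => indic (ea t) (kmin ea) * c t).
  assert (P3 : forall i, (i < 3)%nat -> perm3 i (fst (others i)) (snd (others i))).
  { intros i Hi. destruct i as [|[|[|i]]]; simpl; unfold perm3; lia. }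
  assert (HS : g 0%nat * y0 ^ eb 0 + g 1%nat * y0 ^ eb 1 + g 2%nat * y0 ^ eb 2 = 0).
  { rewrite <- H0. unfold G, sum3, g. ring. }
  assert (HS1 : INR (eb 0) * (g 0%nat * y0 ^ eb 0) + INR (eb 1) * (g 1%nat * y0 ^ eb 1) + INR (eb 2) * (g 2%nat * y0 ^ eb 2) <> 0).
  { intros Z. apply H1. rewrite <- Z. unfold G1, sum3, g. ring. }
  assert (W : exists i, (i < 3)%nat /\ g i <> 0 /\ g i * g (fst (others i)) <= 0 /\ g i * g (snd (others i)) <= 0 /\
    ~ (g (fst (others i)) = 0 /\ g (snd (others i)) = 0)).
  { destruct (sign_role (g 0%nat) (g 1%nat) (g 2%nat) _ _ _ (pow_lt y0 (eb 0) Hy) (pow_lt y0 (eb 1) Hy)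
      (pow_lt y0 (eb 2) Hy) HS) as [W|[W|W]].
    - nra.
    - exists 0%nat. split; [lia|exact W].
    - exists 1%nat. split; [lia|exact W].
    - exists 2%nat. split; [lia|exact W]. }
  destruct W as (i & Hi & Gi & Gj & Gl & GN).
  assert (FL : exists flip : bool, if flip then 0 < g i * G1 c ea eb (kmin ea) y0 else g i * G1 c ea eb (kmin ea) y0 < 0).
  { destruct (Rtotal_order (g i * G1 c ea eb (kmin ea) y0) 0) as [Z|[Z|Z]]; [now exists false| |now exists true].
    apply Rmult_integral in Z. tauto. }
  destruct FL as (flip & Hflip).
  destruct (den_axis_blk thr2 flip _ _ _ (P3 i Hi)) as (f & y & E1 & _ & _ & E4).
  exists flip, i, f, y. split; [exact Hi|]. split; [exact E1|]. apply E4; [|exact HY|split; assumption].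
  split; [exact Hw|]. split; [exact Gi|]. tauto.
Qed.

(** * Programs for all kinds of special points *)

Definition swap_env {V} (E : env V) : env V := Env (nc E) (nb E) (na E) (nR E) (ne E) (ng E).

Definition infl_blk {V} (E : env V) (mid neg : bool) : prog V :=
  Bind (dif E) (fun a1 b1 a2 b2 D => Bind (ecoef a1 b1 a2 b2 D) (fun e3 e2 e1 e0 _ =>
  Bind (fprog (FAnd (FNot (FEq #D 0)) (FNot (FAnd (FEq #e3 0) (FAnd (FEq #e2 0) (FAnd (FEq #e1 0) (FEq #e0 0)))))))
    (fun f _ _ _ _ => If 1 #f (cubic_blk E mid neg e3 e2 e1 e0 a1 b1 a2 b2 D) (Ret1 0%A)))).

Definition vtan_blk {V} (E : env V) (mid neg : bool) : prog V :=
  Bind (dif E) (fun a1 b1 a2 b2 D => Let 0 (fun z => Let (#b1 - #b2) (fun k1 => Let (0 - #b2) (fun k0 =>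
  Bind (fprog (FNot (FEq #D 0)))
    (fun f _ _ _ _ => If 1 #f (cubic_blk E mid neg z z k1 k0 a1 b1 a2 b2 D) (Ret1 0%A)))))).

Definition mono_at {V} (E : env V) (t : nat) : prog V :=
  Let #(nR E) (fun x => Let #(na E t) (fun a => Let #(nb E t) (fun b =>
  Bind (pow_m (ng E) x a) (fun u _ _ _ _ => Bind (pow_m (ng E) x b) (fun v _ _ _ _ =>
  Ret1 (#(nc E t) * #u * #v)%A))))).

(** The corner [(Rb, Rb)] can be isolated as the only point in the box of a line of inflections or
    of an orbit of singular points. *)
Definition corner_blk {V} (E : env V) : prog V :=
  Bind (line_test E) (fun ln _ _ _ _ => Bind (dif E) (fun a1 b1 a2 b2 D =>
  Bind (mono_at E 0) (fun m0 _ _ _ _ => Bind (mono_at E 1) (fun m1 _ _ _ _ => Bind (mono_at E 2) (fun m2 _ _ _ _ =>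
  Let (#m0 + #m1 + #m2) (fun S0 =>
  Let (#(na E 0%nat) * #m0 + #(na E 1%nat) * #m1 + #(na E 2%nat) * #m2) (fun Sa =>
  Let (#(nb E 0%nat) * #m0 + #(nb E 1%nat) * #m1 + #(nb E 2%nat) * #m2) (fun Sb =>
  fprog (FAnd (FEq #S0 0) (FOr (FAnd (FLe 1 #ln) (FLt 0 (#Sa * #Sb)))
    (FAnd (FEq #D 0) (FAnd (FEq #Sa 0) (FAnd (FEq #Sb 0) (FLt 0 (#a1 * #b1))))))))))))))).

Definition edge_at {V} (E : env V) (k : V) : prog V :=
  Let #(nR E) (fun x =>
  Bind (coef_at E k 0) (fun g0 _ _ _ _ => Bind (coef_at E k 1) (fun g1 _ _ _ _ => Bind (coef_at E k 2) (fun g2 _ _ _ _ =>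
  Bind (pow_m (ng E) x (nb E 0%nat)) (fun u0 _ _ _ _ => Bind (pow_m (ng E) x (nb E 1%nat)) (fun u1 _ _ _ _ =>
  Bind (pow_m (ng E) x (nb E 2%nat)) (fun u2 _ _ _ _ =>
  Ret (#g0 * #u0 + #g1 * #u1 + #g2 * #u2)
      (#(nb E 0%nat) * (#g0 * #u0) + #(nb E 1%nat) * (#g1 * #u1) + #(nb E 2%nat) * (#g2 * #u2)) 0 0 0))))))).

Definition edge_corner_blk {V} (E : env V) : prog V :=
  Bind (line_test E) (fun ln _ _ _ _ => Let 0 (fun z => Let 1 (fun o =>
  Bind (edge_at E z) (fun g dg _ _ _ => Bind (edge_at E o) (fun h _ _ _ _ =>
  fprog (FAnd (FLe 1 #ln) (FAnd (FEq #g 0) (FLt (#h * #dg) 0)))))))).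

Definition cf_at {V} (E : env V) (p q : V) : prog V :=
  Bind (fprog (FAnd (FEq #(na E 0%nat) #p) (FEq #(nb E 0%nat) #q))) (fun f0 _ _ _ _ =>
  Bind (fprog (FAnd (FEq #(na E 1%nat) #p) (FEq #(nb E 1%nat) #q))) (fun f1 _ _ _ _ =>
  Bind (fprog (FAnd (FEq #(na E 2%nat) #p) (FEq #(nb E 2%nat) #q))) (fun f2 _ _ _ _ =>
  Ret1 (#f0 * #(nc E 0%nat) + #f1 * #(nc E 1%nat) + #f2 * #(nc E 2%nat))%A))).

(** The discriminant of three collinear terms: for the vector [d = (a1 - a2, a2, - a1)] orthogonal
    to 1 and to the exponents, the numbers [s * d t / c t] are positive and the product of their
    powers with exponents [d t] is 1. *)
Definition double_test {V} (E : env V) : prog V :=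
  Bind (dif E) (fun a1 b1 a2 b2 D => Let (#a1 - #a2) (fun d0 => Let (0 - #a1) (fun d2 =>
  Bind (If 0 (#d0 / #(nc E 0%nat)) (Ret1 1%A) (Ret1 (0 - 1)%A)) (fun s _ _ _ _ =>
  Let (#s * (#d0 / #(nc E 0%nat))) (fun r0 => Let (#s * (#a2 / #(nc E 1%nat))) (fun r1 =>
  Let (#s * (#d2 / #(nc E 2%nat))) (fun r2 =>
  Bind (fprog (FAnd (FEq #D 0) (FAnd (FLt (#a1 * #b1) 0) (FAnd (FLt 0 #r0) (FAnd (FLt 0 #r1) (FLt 0 #r2))))))
    (fun f _ _ _ _ => If 1 #f
  (Bind (zpow (ng E) r0 d0) (fun u0 _ _ _ _ => Bind (zpow (ng E) r1 a2) (fun u1 _ _ _ _ =>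
   Bind (zpow (ng E) r2 d2) (fun u2 _ _ _ _ => fprog (FEq (#u0 * #u1 * #u2) 1)))))
  (Ret1 0%A))))))))).

Definition origin_blk {V} (E : env V) : prog V :=
  Let 0 (fun z => Let 1 (fun o => Let (1 + 1) (fun w =>
  Bind (cf_at E z z) (fun c00 _ _ _ _ => Bind (cf_at E o z) (fun c10 _ _ _ _ =>
  Bind (cf_at E z o) (fun c01 _ _ _ _ => Bind (cf_at E w z) (fun c20 _ _ _ _ =>
  Bind (cf_at E o o) (fun c11 _ _ _ _ => Bind (cf_at E z w) (fun c02 _ _ _ _ =>
  Bind (min_exp E) (fun ka _ _ _ _ => Bind (min_exp (swap_env E)) (fun kb _ _ _ _ =>
  Bind (double_test E) (fun db _ _ _ _ =>
  Let (#c20 * (#c01 * #c01) - #c11 * #c10 * #c01 + #c02 * (#c10 * #c10)) (fun hs =>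
  fprog (FAnd (FEq #c00 0)
   (FOr (FAnd (FNot (FEq #c10 0)) (FAnd (FEq #c01 0) (FEq #ka 0)))
   (FOr (FAnd (FOr (FNot (FEq #c10 0)) (FNot (FEq #c01 0))) (FAnd (FEq #ka 0) (FAnd (FEq #kb 0) (FEq #hs 0))))
        (FAnd (FEq #c10 0) (FAnd (FEq #c01 0) (FAnd (FLe #ka 1) (FAnd (FLe #kb 1) (FNot (FLe 1 #db)))))))))))))))))))))).

Lemma env_swap : env_ok (swap_env E) c eb ea Rb e L n.
Proof.
  destruct HE as (H & H'). split; [|exact H']. intros t Ht.
  destruct (H t Ht) as (A1 & A2 & A3 & A4 & A5). repeat split; assumption.
Qed.

Lemma int_ecoef : int_le (T ^ 7) (e3 ea eb) /\ int_le (T ^ 7) (e2 ea eb) /\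
  int_le (T ^ 7) (e1 ea eb) /\ int_le (T ^ 7) (e0 ea eb).
Proof.
  assert (HT : 2 <= T) by exact (T_ge2).
  pose proof (int_a2) as Ia2.
  pose proof (int_b2) as Ib2.
  pose proof (int_a12) as Ia. pose proof (int_b12) as Ib.
  pose proof (int_Dt) as ID.
  set (t := T) in *. assert (H4 : 8 <= t ^ 3) by nra.
  assert (H16 : 16 <= t ^ 4) by nra.
  (* The coefficients have degree 4 in [T]; as [T] is at least 2, the power 7 absorbs the
     constants. *)
  assert (B4 : 4 * (t * t * t * t) + 6 * (t * t * t) <= t ^ 7).
  { nra. }
  assert (Is : int_le (2 * t) (a1 ea - a2 ea + (b1 eb - b2 eb)))
    by (eapply int_le_weaken; [apply int_le_plus; eassumption|lra]).
  assert (Is' : int_le (2 * t) (- a2 ea - b2 eb))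
    by (eapply int_le_weaken; [apply int_le_minus; [apply int_le_opp|]; eassumption|lra]).
  assert (Iab : int_le (t * t) ((a1 ea - a2 ea) * (b1 eb - b2 eb))) by now apply int_le_mult.
  assert (Iab' : int_le (t * t) (a2 ea * b2 eb)) by now apply int_le_mult.
  assert (Im : int_le (2 * (t * t)) ((a1 ea - a2 ea) * - b2 eb + - a2 ea * (b1 eb - b2 eb))).
  { eapply int_le_weaken; [apply int_le_plus; apply int_le_mult; try apply int_le_opp; eassumption|lra]. }
  assert (ID2 : int_le (4 * (t * t * t * t)) (Dt ea eb * Dt ea eb)).
  { eapply int_le_weaken; [apply int_le_mult; exact ID|simpl; lra]. }
  split; [|split; [|split]].
  - apply int_le_opp. eapply int_le_weaken; [apply int_le_mult; [exact Iab|exact Is]|lra].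
  - eapply int_le_weaken; [apply int_le_minus; [exact ID2|apply int_le_plus; apply int_le_mult; eassumption]|lra].
  - eapply int_le_weaken; [apply int_le_minus; [exact ID2|apply int_le_plus; apply int_le_mult; eassumption]|lra].
  - apply int_le_opp. eapply int_le_weaken; [apply int_le_mult; [exact Iab'|exact Is']|lra].
Qed.

Definition sound (S : R * R -> Prop) (r : tup) : Prop :=
  let '(f, x, y, _, _) := r in 1 <= f -> exists p, S p /\ close e (x, y) p.
Definition hits (p : R * R) (r : tup) : Prop :=
  let '(f, x, y, _, _) := r in 1 <= f /\ close e (x, y) p.

Definition infl_set (p : R * R) : Prop := Dt ea eb <> 0 /\ ~ line_case ea eb /\
  exists t, Ecub ea eb t = 0 /\ 0 < T1 c t /\ 0 < T2 c t /\ p = (Xt c ea eb t, Yt c ea eb t) /\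
    box Rb (Xt c ea eb t) (Yt c ea eb t).

Definition vtan_set (p : R * R) : Prop := Dt ea eb <> 0 /\
  exists t, be eb t = 0 /\ 0 < T1 c t /\ 0 < T2 c t /\ p = (Xt c ea eb t, Yt c ea eb t) /\
    box Rb (Xt c ea eb t) (Yt c ea eb t).

Lemma line_case_iff : Dt ea eb <> 0 -> (~ line_case ea eb <->
  e3 ea eb <> 0 \/ e2 ea eb <> 0 \/ e1 ea eb <> 0 \/ e0 ea eb <> 0).
Proof. intros HD. unfold line_case. split; [intros H; apply NNPP; intros H'|]; tauto. Qed.

Lemma infl_blk_den mid neg : den (infl_blk E mid neg) =
  if excluded_middle_informative (Dt ea eb <> 0 /\ ~ line_case ea eb) then
    den (cubic_blk E mid neg (e3 ea eb) (e2 ea eb) (e1 ea eb) (e0 ea eb) (a1 ea) (b1 eb) (a2 ea) (b2 eb) (Dt ea eb))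
  else one_of 0.
Proof.
  unfold infl_blk. cbn [den]. rewrite (den_dif _ _ _ _ _ _ _ _ HE).
  destruct (den_ecoef ea eb) as (x & ->). rewrite den_fprog. unfold one_of at 1. cbn [aden].
  match goal with |- context [fl (fsem ?X)] => set (s := fsem X) end.
  assert (Es : s <-> Dt ea eb <> 0 /\ ~ line_case ea eb).
  { unfold s. cbn [fsem]. rewrite !fsem_Eq. unfold line_case. tauto. }
  destruct (excluded_middle_informative _) as [H|H]; rewrite <- Es in H;
    destruct (Rle_dec 1 (fl s)) as [H'|H']; rewrite fl_ge1 in H'; try tauto; reflexivity.
Qed.

Lemma vtan_blk_den mid neg : den (vtan_blk E mid neg) =
  if excluded_middle_informative (Dt ea eb <> 0) then
    den (cubic_blk E mid neg 0 0 (b1 eb - b2 eb) (0 - b2 eb) (a1 ea) (b1 eb) (a2 ea) (b2 eb) (Dt ea eb))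
  else one_of 0.
Proof.
  unfold vtan_blk. cbn [den]. rewrite (den_dif _ _ _ _ _ _ _ _ HE).
  rewrite den_fprog. unfold one_of at 1. aden_simpl.
  match goal with |- context [fl (fsem ?X)] => set (s := fsem X) end.
  assert (Es : s <-> Dt ea eb <> 0).
  { unfold s. cbn [fsem]. rewrite !fsem_Eq. tauto. }
  destruct (excluded_middle_informative _) as [H|H]; rewrite <- Es in H;
    destruct (Rle_dec 1 (fl s)) as [H'|H']; rewrite fl_ge1 in H'; try tauto; reflexivity.
Qed.

Lemma infl_blk_sound mid neg : (mid = true -> neg = false) -> sound infl_set (den (infl_blk E mid neg)).
Proof.
  intros Hmn. rewrite infl_blk_den. destruct (excluded_middle_informative _) as [[HD HL]|H].
  - destruct int_ecoef as (I3 & I2 & I1 & I0).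
    destruct (cubic_blk_sound _ _ _ _ I3 I2 I1 I0
      (proj1 (line_case_iff HD) HL) HD mid neg Hmn) as (f & x & y & -> & Hf & H).
    intros Hf1. destruct H as (t & p & (Ht & A1 & A2 & A3 & A4) & HC); [destruct Hf; [lra|assumption]|].
    exists p. split; [|exact HC]. split; [exact HD|]. split; [exact HL|]. exists t.
    rewrite Ecub_eq. tauto.
  - unfold sound, one_of. lra.
Qed.

Lemma infl_blk_complete p : infl_set p -> exists mid neg, (mid = true -> neg = false) /\
  hits p (den (infl_blk E mid neg)).
Proof.
  intros (HD & HL & t & Ht & HX). destruct int_ecoef as (I3 & I2 & I1 & I0).
  rewrite Ecub_eq in Ht.
  destruct (cubic_blk_complete _ _ _ _ I3 I2 I1 I0
      (proj1 (line_case_iff HD) HL) HD t p) as (mid & neg & f & x & y & Hmn & Hd & Hf & HC).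
  { split; [exact Ht|tauto]. }
  exists mid, neg. split; [exact Hmn|]. rewrite infl_blk_den.
  destruct (excluded_middle_informative _) as [_|H]; [|tauto]. rewrite Hd. split; [lra|exact HC].
Qed.

Lemma vtan_coefs : Dt ea eb <> 0 -> int_le (T ^ 7) 0 /\ int_le (T ^ 7) (b1 eb - b2 eb) /\
  int_le (T ^ 7) (0 - b2 eb) /\ (0 <> 0 \/ 0 <> 0 \/ b1 eb - b2 eb <> 0 \/ 0 - b2 eb <> 0) /\
  forall t, cubic 0 0 (b1 eb - b2 eb) (0 - b2 eb) t = be eb t.
Proof.
  intros HD. assert (HT : 2 <= T) by exact (T_ge2).
  assert (HT7 : T <= T ^ 7) by (rewrite <- (pow_1 T) at 1; apply Rle_pow; [lra|lia]).
  split; [apply int_le_0; lra|]. split; [apply int_le_weaken with T; [apply (int_b12)|exact HT7]|].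
  split.
  { replace (0 - b2 eb) with (- b2 eb) by ring. apply int_le_opp.
    apply int_le_weaken with T; [apply (int_b2)|exact HT7]. }
  split.
  - destruct (Req_dec (b2 eb) 0) as [Z2|N2]; [|right; right; right; lra].
    destruct (Req_dec (b1 eb) 0) as [Z1|N1]; [|right; right; left; lra].
    exfalso. apply HD. unfold Dt. rewrite Z1, Z2. ring.
  - intros t. unfold cubic, be. ring.
Qed.

Lemma vtan_blk_sound mid neg : (mid = true -> neg = false) -> sound vtan_set (den (vtan_blk E mid neg)).
Proof.
  intros Hmn. rewrite vtan_blk_den. destruct (excluded_middle_informative _) as [HD|H].
  - destruct (vtan_coefs HD) as (I0 & I1 & I2 & HN & HR).
    destruct (cubic_blk_sound _ _ _ _ I0 I0 I1 I2 HN HD mid neg Hmn)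
      as (f & x & y & -> & Hf & H).
    intros Hf1. destruct H as (t & p & (Ht & A1 & A2 & A3 & A4) & HC); [destruct Hf; [lra|assumption]|].
    exists p. split; [|exact HC]. split; [exact HD|]. exists t. rewrite HR in Ht. tauto.
  - unfold sound, one_of. lra.
Qed.

Lemma vtan_blk_complete p : vtan_set p -> exists mid neg, (mid = true -> neg = false) /\
  hits p (den (vtan_blk E mid neg)).
Proof.
  intros (HD & t & Ht & HX). destruct (vtan_coefs HD) as (I0 & I1 & I2 & HN & HR).
  rewrite <- HR in Ht.
  destruct (cubic_blk_complete _ _ _ _ I0 I0 I1 I2 HN HD t p)
    as (mid & neg & f & x & y & Hmn & Hd & Hf & HC).
  { split; [exact Ht|tauto]. }
  exists mid, neg. split; [exact Hmn|]. rewrite vtan_blk_den.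
  destruct (excluded_middle_informative _) as [_|H]; [|tauto]. rewrite Hd. split; [lra|exact HC].
Qed.

Lemma exps_w t : (t < 3)%nat -> (ea t < 2 ^ (32 * L))%nat /\ (eb t < 2 ^ (32 * L))%nat.
Proof.
  intros Ht. destruct HE as (H & _). destruct (H t Ht) as (_ & _ & _ & A1 & A2).
  assert (X : forall m, INR m < T -> (m < 2 ^ (32 * L))%nat).
  { intros m Hm. apply INR_lt. rewrite pow_INR. replace (INR 2) with 2 by tauto.
    apply Rlt_le_trans with (1 := Hm). apply Rle_pow; [lra|lia]. }
  split; apply X; assumption.
Qed.

Lemma den_mono_at t : (t < 3)%nat -> den (mono_at E t) = one_of (mono c ea eb t Rb Rb).
Proof.
  intros Ht. destruct (env_t t Ht) as (Ec & Ea & Eb).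
  destruct (exps_w t Ht) as [W1 W2]. pose proof (glob_E) as Hg.
  destruct HE as (_ & ER & _). unfold mono_at. cbn [den aden]. rewrite Ec, Ea, Eb, ER.
  rewrite (den_pow _ _ _ _ _ Hg W1). rewrite (den_pow _ _ _ _ _ Hg W2). reflexivity.
Qed.

Lemma den_corner_blk : den (corner_blk E) = one_of (fl (M0 c ea eb Rb Rb = 0 /\
  ((line_case ea eb /\ 0 < Ma c ea eb Rb Rb * Mb c ea eb Rb Rb) \/
   (Dt ea eb = 0 /\ Ma c ea eb Rb Rb = 0 /\ Mb c ea eb Rb Rb = 0 /\ 0 < a1 ea * b1 eb)))).
Proof.
  unfold corner_blk. cbn [den]. rewrite (den_line_test). unfold one_of at 1.
  rewrite (den_dif _ _ _ _ _ _ _ _ HE). rewrite !den_mono_at by lia. unfold one_of at 1.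
  unfold one_of at 1. unfold one_of at 1. rewrite den_fprog. f_equal. apply fl_iff. destruct (env_t 0) as (_ & -> & ->); [lia|].
  destruct (env_t 1) as (_ & -> & ->); [lia|].
  destruct (env_t 2) as (_ & -> & ->); [lia|].
  cbn [fsem]. rewrite !fsem_Eq, !fsem_Lt. aden_simpl. rewrite fl_ge1. tauto.
Qed.

Lemma den_edge_at k : exists x y, den (edge_at E (INR k)) = (G c ea eb k Rb, G1 c ea eb k Rb, x, y, 0).
Proof.
  exists 0, 0. unfold edge_at. cbn [den]. rewrite !(den_coef_at) by lia.
  destruct (env_t 0) as (_ & _ & ->); [lia|].
  destruct (env_t 1) as (_ & _ & ->); [lia|].
  destruct (env_t 2) as (_ & _ & ->); [lia|].
  pose proof (glob_E) as Hg.
  rewrite !(den_pow _ _ _ _ _ Hg) by (apply exps_w; lia). aden_simpl. destruct HE as (_ & -> & _). unfold G, G1, sum3.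
  apply (f_equal2 (fun x y => (x, y, 0, 0, 0))); ring.
Qed.

Lemma den_edge_corner_blk : den (edge_corner_blk E) = one_of (fl (corner_axis c ea eb Rb)).
Proof.
  unfold edge_corner_blk. cbn [den]. rewrite (den_line_test). unfold one_of at 1.
  cbn [aden]. change 0 with (INR 0) at 1. change 1 with (INR 1) at 1.
  destruct (den_edge_at 0) as (x & y & ->). destruct (den_edge_at 1) as (x' & y' & ->).
  rewrite den_fprog. f_equal. apply fl_iff. cbn [fsem]. rewrite fsem_Eq, fsem_Lt. aden_simpl.
  rewrite fl_ge1. unfold corner_axis. tauto.
Qed.

Lemma den_cf_at p q : den (cf_at E (INR p) (INR q)) = one_of (cf c ea eb p q).
Proof.
  unfold cf_at. cbn [den]. rewrite den_fprog. unfold one_of at 1. rewrite den_fprog. unfold one_of at 1.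
  rewrite den_fprog. unfold one_of at 1. unfold Ret1. cbn [den]. aden_simpl. cbn [fsem].
  assert (X : forall t, (t < 3)%nat ->
    fl (fsem (FEq #(na E t) #(INR p)) /\ fsem (FEq #(nb E t) #(INR q))) * nc E t =
    indic (ea t) p * (indic (eb t) q * c t)).
  { intros t Ht. destruct (env_t t Ht) as (-> & Ea & Eb).
    rewrite (fl_iff _ (ea t = p /\ eb t = q)).
    2: { rewrite !fsem_Eq. rewrite Ea, Eb. split; intros [X1 X2].
      - split; now apply INR_eq.
      - now rewrite X1, X2. }
    unfold indic. destruct (Nat.eq_dec (ea t) p) as [Z|Z]; [destruct (Nat.eq_dec (eb t) q) as [Z'|Z']|].
    - rewrite fl_true by tauto. ring.
    - rewrite fl_false by tauto. ring.
    - rewrite fl_false by tauto. ring. }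
  rewrite !X by lia. reflexivity.
Qed.

End Blocks.

(** * Double roots with collinear exponents, and the origin *)

Section Double.

Variables (E : env R) (c : nat -> R) (ea eb : nat -> nat) (Rb e : R) (L n : nat).
Hypothesis Htri : is_trinomial c ea eb.
Hypothesis HRb : 0 < Rb.
Hypothesis He : 0 < e.
Hypothesis HE : env_ok E c ea eb Rb e L n.

Let d0 := a1 ea - a2 ea.
Let d1 := a2 ea.
Let d2 := 0 - a1 ea.

(** Write the monomials as [c t * X t]. Vanishing of [M0] and [Ma] makes them proportional to
    [(d0, d1, d2)], so [X t] is [d t / c t] up to a common factor, whose sign [s] is fixed by
    positivity. The [d t] annihilate the exponents, so the logarithms of the [X t] weighted by [d t]
    sum to 0, and the common factor drops out because the [d t] sum to 0. *)
Lemma double_root_iff : Dt ea eb = 0 -> a1 ea * b1 eb < 0 ->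
  forall s, s = (if Rle_dec 0 (d0 / c 0%nat) then 1 else -1) ->
  ((exists x y, 0 < x /\ 0 < y /\ M0 c ea eb x y = 0 /\ Ma c ea eb x y = 0 /\ Mb c ea eb x y = 0) <->
   0 < s * (d0 / c 0%nat) /\ 0 < s * (d1 / c 1%nat) /\ 0 < s * (d2 / c 2%nat) /\
   d0 * ln (s * (d0 / c 0%nat)) + d1 * ln (s * (d1 / c 1%nat)) + d2 * ln (s * (d2 / c 2%nat)) = 0).
Proof.
  intros HD Hab s Es.
  assert (Na1 : a1 ea <> 0) by nra.
  assert (C0 := c_neq c ea eb Htri 0 ltac:(lia)). assert (C1 := c_neq c ea eb Htri 1 ltac:(lia)).
  assert (C2 := c_neq c ea eb Htri 2 ltac:(lia)).
  assert (A1 : INR (ea 1%nat) = INR (ea 0%nat) + a1 ea) by (unfold a1; ring).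
  assert (A2 : INR (ea 2%nat) = INR (ea 0%nat) + a2 ea) by (unfold a2; ring).
  assert (B1 : INR (eb 1%nat) = INR (eb 0%nat) + b1 eb) by (unfold b1; ring).
  assert (B2 : INR (eb 2%nat) = INR (eb 0%nat) + b2 eb) by (unfold b2; ring).
  assert (Hs : s = 1 \/ s = -1) by (rewrite Es; destruct (Rle_dec _ _); tauto).
  split.
  - intros (x & y & Hx & Hy & H0 & Ha & _).
    unfold M0, Ma, sum3 in H0, Ha. rewrite A1, A2 in Ha.
    assert (LT : forall t, (t < 3)%nat -> exists X, 0 < X /\ mono c ea eb t x y = c t * X /\
      ln X = INR (ea t) * ln x + INR (eb t) * ln y).
    { intros t Ht. exists (x ^ ea t * y ^ eb t).
      assert (P1 : 0 < x ^ ea t) by now apply pow_lt. assert (P2 : 0 < y ^ eb t) by now apply pow_lt.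
      split; [now apply Rmult_lt_0_compat|]. split; [unfold mono; ring|].
      rewrite ln_mult by lra. rewrite !pow_exp_ln, !ln_exp by lra. reflexivity. }
    destruct (LT 0%nat ltac:(lia)) as (X0 & P0 & M0' & L0). destruct (LT 1%nat ltac:(lia)) as (X1 & P1 & M1' & L1).
    destruct (LT 2%nat ltac:(lia)) as (X2 & P2 & M2' & L2). rewrite M0', M1', M2' in *. clear LT M0' M1' M2'.
    set (m0 := c 0%nat * X0) in *. set (m1 := c 1%nat * X1) in *. set (m2 := c 2%nat * X2) in *.
    assert (Hm : a1 ea * m1 + a2 ea * m2 = 0).
    { replace (a1 ea * m1 + a2 ea * m2) with (INR (ea 0%nat) * m0 + (INR (ea 0%nat) + a1 ea) * m1 +
        (INR (ea 0%nat) + a2 ea) * m2 - INR (ea 0%nat) * (m0 + m1 + m2)) by ring. rewrite Ha, H0. ring. }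
    assert (N2 : m2 <> 0) by (unfold m2; apply Rmult_integral_contrapositive_currified; lra).
    (* The factor of proportionality between the monomials and the vector [d]. *)
    set (la := - m2 / a1 ea).
    assert (Nla : la <> 0).
    { unfold la. intros Z. apply N2. apply Rmult_eq_reg_r with (/ a1 ea); [|now apply Rinv_neq_0_compat].
      lra. }
    assert (E2 : c 2%nat * X2 = la * d2) by (unfold la, d2; fold m2; field; exact Na1).
    assert (E1 : c 1%nat * X1 = la * d1).
    { unfold la, d1. fold m1. apply Rmult_eq_reg_l with (a1 ea); [|exact Na1]. field_simplify; [lra|exact Na1]. }
    assert (E0 : c 0%nat * X0 = la * d0).
    { assert (la * (d0 + d1 + d2) = 0) by (unfold d0, d1, d2; ring). fold m0. fold m1 in E1. fold m2 in E2. lra. }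
    clear Ha H0 Hm. assert (Q : forall d t X, c t <> 0 -> c t * X = la * d -> d / c t = X * / la).
    { intros d t X Hc HX. apply Rmult_eq_reg_r with (la * c t); [|now apply Rmult_integral_contrapositive_currified].
      replace (d / c t * (la * c t)) with (la * d) by (field; exact Hc). rewrite <- HX. field. exact Nla. }
    rewrite (Q d0 0%nat X0), (Q d1 1%nat X1), (Q d2 2%nat X2) by lra.
    rewrite (Q d0 0%nat X0) in Es by lra.
    assert (Hsl : 0 < s * / la).
    { rewrite Es. destruct (Rle_dec 0 (X0 * / la)) as [Z|Z].
      - assert (/ la <> 0) by now apply Rinv_neq_0_compat. assert (0 <= / la) by nra. lra.
      - nra. }
    set (u := s * / la) in *. 
    replace (s * (X0 * / la)) with (X0 * u) by (unfold u; ring).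
    replace (s * (X1 * / la)) with (X1 * u) by (unfold u; ring).
    replace (s * (X2 * / la)) with (X2 * u) by (unfold u; ring).
    split; [now apply Rmult_lt_0_compat|]. split; [now apply Rmult_lt_0_compat|]. split; [now apply Rmult_lt_0_compat|].
    rewrite !ln_mult by lra. rewrite L0, L1, L2, A1, A2, B1, B2. unfold d0, d1, d2.
    unfold Dt in HD. transitivity (- (a1 ea * b2 eb - a2 ea * b1 eb) * ln y); [ring|rewrite HD; ring].
  - intros (P0 & P1 & P2 & HL).
    set (r0 := s * (d0 / c 0%nat)) in *. set (r1 := s * (d1 / c 1%nat)) in *. set (r2 := s * (d2 / c 2%nat)) in *.
    set (X := (ln r1 - ln r0) / a1 ea).
    (* Singular points form an orbit of the flow, and since [a1] is nonzero it contains a point with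
       [y = 1]. *)
    exists (exp X), 1. split; [apply exp_pos|]. split; [lra|].
    set (ka := exp (INR (ea 0%nat) * X - ln r0)).
    assert (EX : forall r t, 0 < r -> INR (ea t) * X = INR (ea 0%nat) * X - ln r0 + ln r ->
      mono c ea eb t (exp X) 1 = c t * (ka * r)).
    { intros r t Hr H. unfold mono, ka. rewrite pow1, pow_exp_ln, ln_exp, H, exp_plus, exp_ln by (assumption || apply exp_pos). ring. }
    assert (XA : a1 ea * X = ln r1 - ln r0) by (unfold X; field; exact Na1).
    assert (XB : a2 ea * X = ln r2 - ln r0).
    { apply Rmult_eq_reg_l with (a1 ea); [|exact Na1]. replace (a1 ea * (a2 ea * X)) with (a2 ea * (a1 ea * X)) by ring.
      rewrite XA. unfold d0, d1, d2 in HL. lra. }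
    assert (F0 : mono c ea eb 0 (exp X) 1 = ka * s * d0).
    { rewrite (EX r0) by lra. unfold r0. field. exact C0. }
    assert (F1 : mono c ea eb 1 (exp X) 1 = ka * s * d1).
    { rewrite (EX r1) by (trivial; rewrite A1; lra). unfold r1. field. exact C1. }
    assert (F2 : mono c ea eb 2 (exp X) 1 = ka * s * d2).
    { rewrite (EX r2) by (trivial; rewrite A2; lra). unfold r2. field. exact C2. }
    unfold M0, Ma, Mb, sum3. rewrite F0, F1, F2, A1, A2, B1, B2. unfold d0, d1, d2.
    split; [ring|]. split; [ring|].
    unfold Dt in HD. transitivity (- (ka * s) * (a1 ea * b2 eb - a2 ea * b1 eb)); [ring|rewrite HD; ring].
Qed.

Lemma den_double_test : den (double_test E) = one_of (fl (double_root c ea eb)).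
Proof.
  unfold double_test. cbn [den]. rewrite (den_dif E c ea eb Rb e L n HE). aden_simpl.
  destruct (env_t E c ea eb Rb e L n HE 0) as (-> & _); [lia|].
  destruct (env_t E c ea eb Rb e L n HE 1) as (-> & _); [lia|].
  destruct (env_t E c ea eb Rb e L n HE 2) as (-> & _); [lia|].
  fold d0 d2. set (s := if Rle_dec 0 (d0 / c 0%nat) then 1 else -1).
  assert (Es : (if Rle_dec 0 (d0 / c 0%nat) then den (Ret1 1%A) else den (Ret1 (0 - 1)%A)) = one_of s).
  { unfold s. destruct (Rle_dec _ _); [reflexivity|]. unfold Ret1, one_of. cbn [den]. aden_simpl.
    apply (f_equal (fun x => (x, 0, 0, 0, 0))). ring. }
  rewrite Es. unfold one_of at 1. rewrite den_fprog. unfold one_of at 1. cbn [fsem]. match goal with |- context [fl ?X] => set (P := X) end.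
  assert (EP : P <-> Dt ea eb = 0 /\ a1 ea * b1 eb < 0 /\ 0 < s * (d0 / c 0%nat) /\
    0 < s * (d1 / c 1%nat) /\ 0 < s * (d2 / c 2%nat)).
  { unfold P. rewrite fsem_Eq, !fsem_Lt. reflexivity. }
  destruct (Rle_dec 1 (fl P)) as [H|H]; rewrite fl_ge1, EP in H.
  2: { rewrite (fl_false (double_root c ea eb)); [reflexivity|].
    intros (HD & Hab & HX). apply H. apply (double_root_iff HD Hab s eq_refl) in HX. tauto. }
  destruct H as (HD & Hab & P0 & P1 & P2).
  pose proof (glob_E _ _ _ _ _ _ _ _ HE) as Hg.
  assert (I0 : int_le (2 ^ L) d0) by exact (int_a12 _ _ _ _ _ _ _ _ HE).
  assert (I1 : int_le (2 ^ L) d1) by exact (int_a2 _ _ _ _ _ _ _ _ HE).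
  assert (I2 : int_le (2 ^ L) d2).
  { unfold d2. replace (0 - a1 ea) with (- a1 ea) by ring. apply int_le_opp. exact (int_a1 _ _ _ _ _ _ _ _ HE). }
  fold d1.
  rewrite (den_zpow _ _ _ _ _ Hg P0 (int_small1 _ _ _ _ _ _ _ _ HE _ I0)). unfold one_of at 1.
  rewrite (den_zpow _ _ _ _ _ Hg P1 (int_small1 _ _ _ _ _ _ _ _ HE _ I1)). unfold one_of at 1.
  rewrite (den_zpow _ _ _ _ _ Hg P2 (int_small1 _ _ _ _ _ _ _ _ HE _ I2)). unfold one_of at 1.
  rewrite den_fprog. f_equal. apply fl_iff. rewrite fsem_Eq. aden_simpl.
  unfold double_root. rewrite (double_root_iff HD Hab s eq_refl).
  unfold Rpower. rewrite <- !exp_plus, <- exp_0.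
  split; [intros H; apply exp_inv in H; tauto|]. intros (_ & _ & _ & _ & _ & H). now rewrite H.
Qed.

Lemma den_origin_blk : den (origin_blk E) = one_of (fl (special_pt c ea eb Rb (0, 0))).
Proof.
  unfold origin_blk. cbn [den]. aden_simpl. replace (1 + 1) with (INR 2) by tauto.
  pose proof (den_cf_at E c ea eb Rb e L n HE) as CF.
  change (den (cf_at E 0 0)) with (den (cf_at E (INR 0) (INR 0))). rewrite CF. unfold one_of at 1.
  change (den (cf_at E 1 0)) with (den (cf_at E (INR 1) (INR 0))). rewrite CF. unfold one_of at 1.
  change (den (cf_at E 0 1)) with (den (cf_at E (INR 0) (INR 1))). rewrite CF. unfold one_of at 1.
  change (den (cf_at E (INR 2) 0)) with (den (cf_at E (INR 2) (INR 0))). rewrite CF. unfold one_of at 1.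
  change (den (cf_at E 1 1)) with (den (cf_at E (INR 1) (INR 1))). rewrite CF. unfold one_of at 1.
  change (den (cf_at E 0 (INR 2))) with (den (cf_at E (INR 0) (INR 2))). rewrite CF. unfold one_of at 1.
  rewrite (den_min_exp E c ea eb Rb e L n HE). unfold one_of at 1.
  rewrite (den_min_exp (swap_env E) c eb ea Rb e L n (env_swap _ _ _ _ _ _ _ _ HE)). unfold one_of at 1.
  rewrite den_double_test. unfold one_of at 1. rewrite den_fprog. f_equal. apply fl_iff.
  rewrite (special_origin c ea eb Rb Htri HRb).
  assert (K0 : forall k, INR k = 0 <-> k = 0%nat).
  { intros k. change 0 with (INR 0). split; [apply INR_eq|now intros ->]. }
  assert (K1 : forall k, INR k <= 1 <-> (k <= 1)%nat).
  { intros k. change 1 with (INR 1). split; [apply INR_le|apply le_INR]. }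
  cbn [fsem]. rewrite !fsem_Eq. aden_simpl. rewrite fl_ge1, !K0, !K1. tauto.
Qed.

End Double.

(** * Cost of the blocks *)

(** The first factor is the cost of an evaluation with exponents of [w] bits, the second the number
    of evaluations in a root search. *)
Definition unit_cost (w n : nat) : nat := ((w + 1) * (w + n + 1))%nat.

Section Cost.

Variables (E : env R) (w n : nat).
Hypothesis HW : gW (ng E) = INR w.
Hypothesis HK : gK (ng E) = INR n.

Notation U := (unit_cost w n).

Lemma unit_ge : (w + 1 <= U)%nat.
Proof. unfold unit_cost. nia. Qed.

Lemma cbu_pow x m : cb (pow_m (ng E) x m) (100 * U).
Proof. eapply cb_le; [now apply cb_pow with (w := w)|]. pose proof unit_ge. lia. Qed.
Lemma cbu_zpow x m : cb (zpow (ng E) x m) (300 * U).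
Proof. eapply cb_le; [now apply cb_zpow with (w := w)|]. pose proof unit_ge. lia. Qed.
Lemma cbu_ev f x : cb (ev (ng E) f x) (700 * U).
Proof. eapply cb_le; [now apply cb_ev with (w := w)|]. pose proof unit_ge. lia. Qed.
Lemma cbu_lr f ep : cb (lr (ng E) f ep) (100 * 200 * U).
Proof. eapply cb_le; [eapply cb_lr; eassumption|]. apply Nat.le_refl. Qed.
Lemma cbu_box mid P Q b0 b1 d0 d1 q1 q2 M : cb (box_test (ng E) mid P Q b0 b1 d0 d1 q1 q2 M) (100 * 400 * U).
Proof. eapply cb_le; [now apply cb_box_test with (w := w)|]. pose proof unit_ge. lia. Qed.
Lemma cbu_root_val t1 t2 q1 q2 k ep : cb (root_val (ng E) t1 t2 q1 q2 k ep) (100 * 50 * U).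
Proof. eapply cb_le; [eapply cb_root_val; eassumption|]. unfold unit_cost. lia. Qed.

Ltac cbu_step := first [cb_step | apply cbu_pow | apply cbu_zpow | apply cbu_ev | apply cbu_lr
  | apply cbu_box | apply cbu_root_val | apply cb_lin_np].
Ltac cbu_go := eapply cb_le; [repeat cbu_step|pose proof unit_ge; lia].

Lemma cbu_zapp mid P Q ep : cb (zapp (ng E) mid P Q ep) (100 * 500 * U).
Proof. unfold zapp. destruct mid; cbu_go. Qed.

Lemma cbu_pt mid P Q s h a b a' b' D : cb (pt_blk E mid P Q s h a b a' b' D) (1000 * 200 * U).
Proof.
  unfold pt_blk, fine. eapply cb_le; [repeat first [cbu_step | apply cbu_zapp]|pose proof unit_ge; lia].
Qed.

Lemma cbu_cubic mid neg k3 k2 k1 k0 a b a' b' D :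
  cb (cubic_blk E mid neg k3 k2 k1 k0 a b a' b' D) (1000 * 201 * U).
Proof.
  unfold cubic_blk, pad3, pad, depress.
  destruct mid, neg; (eapply cb_le; [repeat first [cbu_step | apply cbu_pt]|pose proof unit_ge; lia]).
Qed.

Lemma cbu_infl mid neg : cb (infl_blk E mid neg) (1000 * 202 * U).
Proof.
  unfold infl_blk, dif, ecoef. eapply cb_le; [repeat first [cbu_step | apply cbu_cubic]|pose proof unit_ge; lia].
Qed.

Lemma cbu_vtan mid neg : cb (vtan_blk E mid neg) (1000 * 202 * U).
Proof.
  unfold vtan_blk, dif. eapply cb_le; [repeat first [cbu_step | apply cbu_cubic]|pose proof unit_ge; lia].
Qed.

Lemma cbu_line : cb (line_test E) (1000 * U).
Proof. unfold line_test, dif, ecoef. cbu_go. Qed.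

Lemma cbu_two flip A p B q : cb (two_blk E flip A p B q) (1000 * 100 * U).
Proof.
  unfold two_blk, nrm, two_test. destruct flip; cbu_go.
Qed.

Lemma cbu_axis thr2 flip i j l : cb (axis_blk E thr2 flip i j l) (1000 * 110 * U).
Proof.
  unfold axis_blk, min_exp, want_test, coef_at.
  destruct thr2, flip; (eapply cb_le; [repeat first [cbu_step | apply cbu_line | apply cbu_two]|pose proof unit_ge; lia]).
Qed.

Lemma cbu_corner : cb (corner_blk E) (1000 * 10 * U).
Proof.
  unfold corner_blk, mono_at, dif. eapply cb_le; [repeat first [cbu_step | apply cbu_line]|pose proof unit_ge; lia].
Qed.

Lemma cbu_edge : cb (edge_corner_blk E) (1000 * 10 * U).
Proof.
  unfold edge_corner_blk, edge_at, coef_at. eapply cb_le; [repeat first [cbu_step | apply cbu_line]|pose proof unit_ge; lia].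
Qed.

Lemma cbu_origin : cb (origin_blk E) (1000 * 20 * U).
Proof.
  unfold origin_blk, cf_at, double_test, min_exp, dif, swap_env. cbu_go.
Qed.

End Cost.

(** * Parametricity of the programs for single points *)

Definition enveq (G : ctx) (E : env nat) (E' : env R) : Prop :=
  (forall t, In (nc E t, nc E' t) G) /\ (forall t, In (na E t, na E' t) G) /\
  (forall t, In (nb E t, nb E' t) G) /\ In (nR E, nR E') G /\ In (ne E, ne E') G /\ geq G (ng E) (ng E').

Lemma enveq_cons x G E E' : enveq G E E' -> enveq (x :: G) E E'.
Proof.
  intros (H1 & H2 & H3 & H4 & H5 & H6).
  repeat split; try (intros; right; auto); apply H6.
Qed.

Lemma enveq_swap G E E' : enveq G E E' -> enveq G (swap_env E) (swap_env E').
Proof. intros (H1 & H2 & H3 & H). repeat split; try assumption; apply H. Qed.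

Lemma enveq_c G E E' t : enveq G E E' -> In (nc E t, nc E' t) G. Proof. intros H. apply H. Qed.
Lemma enveq_a G E E' t : enveq G E E' -> In (na E t, na E' t) G. Proof. intros H. apply H. Qed.
Lemma enveq_b G E E' t : enveq G E E' -> In (nb E t, nb E' t) G. Proof. intros H. apply H. Qed.
Lemma enveq_R G E E' : enveq G E E' -> In (nR E, nR E') G. Proof. intros H. apply H. Qed.
Lemma enveq_e G E E' : enveq G E E' -> In (ne E, ne E') G. Proof. intros H. apply H. Qed.
Lemma enveq_g G E E' : enveq G E E' -> geq G (ng E) (ng E'). Proof. intros H. apply H. Qed.

Ltac env_ctx := first [eassumption | apply enveq_swap; env_ctx | apply enveq_cons; env_ctx].

Ltac env_base :=
  match goal with
  | |- enveq _ _ _ => env_ctx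
  | |- In (nc _ _, _) _ => apply enveq_c
  | |- In (na _ _, _) _ => apply enveq_a
  | |- In (nb _ _, _) _ => apply enveq_b
  | |- In (nR _, _) _ => apply enveq_R
  | |- In (ne _, _) _ => apply enveq_e
  | |- In (gT (ng _), _) _ => eapply geq_In, enveq_g
  | |- geq _ (ng _) _ => apply enveq_g
  | |- peq _ (fprog _) _ => apply peq_fprog
  | |- peq _ (pow_m _ _ _) _ => apply peq_pow
  | |- peq _ (zpow _ _ _) _ => apply peq_zpow
  | |- peq _ (ev _ _ _) _ => apply peq_ev
  | |- peq _ (lr _ _ _) _ => apply peq_lr
  | |- peq _ (lin_np _ _ _ _ _) _ => apply peq_lin_np
  | |- peq _ (box_test _ _ _ _ _ _ _ _ _ _ _) _ => apply peq_box_test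
  | |- peq _ (root_val _ _ _ _ _ _ _) _ => apply peq_root_val
  end.
Ltac env_go := repeat first [env_base | pq_base].

Lemma peq_zapp G g g' mid P P' Q Q' ep ep' : geq G g g' -> In (P, P') G -> In (Q, Q') G -> In (ep, ep') G ->
  peq G (zapp g mid P Q ep) (zapp g' mid P' Q' ep').
Proof. intros. unfold zapp. destruct mid; pq_unfold; env_go. Qed.

Lemma peq_fine G E E' : enveq G E E' -> peq G (fine E) (fine E').
Proof. intros. unfold fine. pq_unfold. env_go. Qed.

Lemma peq_dif G E E' : enveq G E E' -> peq G (dif E) (dif E').
Proof. intros. unfold dif. pq_unfold. env_go. Qed.

Lemma peq_ecoef G a a' b b' p p' q q' D D' : In (a, a') G -> In (b, b') G -> In (p, p') G -> In (q, q') G ->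
  In (D, D') G -> peq G (ecoef a b p q D) (ecoef a' b' p' q' D').
Proof. intros. unfold ecoef. pq_unfold. env_go. Qed.

Lemma peq_pt G E E' mid P P' Q Q' s s' h h' a a' b b' p p' q q' D D' : enveq G E E' ->
  In (P, P') G -> In (Q, Q') G -> In (s, s') G -> In (h, h') G ->
  In (a, a') G -> In (b, b') G -> In (p, p') G -> In (q, q') G -> In (D, D') G ->
  peq G (pt_blk E mid P Q s h a b p q D) (pt_blk E' mid P' Q' s' h' a' b' p' q' D').
Proof.
  intros. unfold pt_blk. pq_unfold. repeat first [apply peq_zapp | apply peq_fine | env_base | pq_base].
Qed.

Lemma peq_cubic G E E' mid neg x3 y3 x2 y2 x1 y1 x0 y0 a a' b b' p p' q q' D D' : enveq G E E' ->
  In (x3, y3) G -> In (x2, y2) G -> In (x1, y1) G -> In (x0, y0) G ->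
  In (a, a') G -> In (b, b') G -> In (p, p') G -> In (q, q') G -> In (D, D') G ->
  peq G (cubic_blk E mid neg x3 x2 x1 x0 a b p q D) (cubic_blk E' mid neg y3 y2 y1 y0 a' b' p' q' D').
Proof.
  intros. unfold cubic_blk, pad3, pad, depress. pq_unfold.
  destruct mid, neg; repeat first [apply peq_pt | env_base | pq_base].
Qed.

Lemma peq_infl G E E' mid neg : enveq G E E' -> peq G (infl_blk E mid neg) (infl_blk E' mid neg).
Proof.
  intros. unfold infl_blk. pq_unfold. repeat first [apply peq_cubic | apply peq_dif | apply peq_ecoef | env_base | pq_base].
Qed.

Lemma peq_vtan G E E' mid neg : enveq G E E' -> peq G (vtan_blk E mid neg) (vtan_blk E' mid neg).
Proof.
  intros. unfold vtan_blk. pq_unfold. repeat first [apply peq_cubic | apply peq_dif | env_base | pq_base].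
Qed.

Lemma peq_line G E E' : enveq G E E' -> peq G (line_test E) (line_test E').
Proof. intros. unfold line_test. pq_unfold. repeat first [apply peq_dif | apply peq_ecoef | env_base | pq_base]. Qed.

Lemma peq_min_exp G E E' : enveq G E E' -> peq G (min_exp E) (min_exp E').
Proof. intros. unfold min_exp. pq_unfold. env_go. Qed.

Lemma peq_coef_at G E E' k k' t : enveq G E E' -> In (k, k') G -> peq G (coef_at E k t) (coef_at E' k' t).
Proof. intros. unfold coef_at. pq_unfold. env_go. Qed.

Lemma peq_want G E E' thr2 k k' : enveq G E E' -> In (k, k') G -> peq G (want_test E thr2 k) (want_test E' thr2 k').
Proof.
  intros. unfold want_test. pq_unfold. destruct thr2; repeat first [apply peq_line | env_base | pq_base].
Qed.

Lemma peq_two G E E' flip A A' p p' B B' q q' : enveq G E E' -> In (A, A') G -> In (p, p') G ->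
  In (B, B') G -> In (q, q') G -> peq G (two_blk E flip A p B q) (two_blk E' flip A' p' B' q').
Proof. intros. unfold two_blk, nrm, two_test. pq_unfold. destruct flip; env_go. Qed.

Lemma peq_axis G E E' thr2 flip i j l : enveq G E E' ->
  peq G (axis_blk E thr2 flip i j l) (axis_blk E' thr2 flip i j l).
Proof.
  intros. unfold axis_blk. pq_unfold.
  destruct flip; repeat first [apply peq_min_exp | apply peq_want | apply peq_coef_at | apply peq_two | env_base | pq_base].
Qed.

Lemma peq_corner G E E' : enveq G E E' -> peq G (corner_blk E) (corner_blk E').
Proof.
  intros. unfold corner_blk, mono_at. pq_unfold. repeat first [apply peq_line | apply peq_dif | env_base | pq_base].
Qed.

Lemma peq_edge G E E' : enveq G E E' -> peq G (edge_corner_blk E) (edge_corner_blk E').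
Proof.
  intros. unfold edge_corner_blk, edge_at. pq_unfold.
  repeat first [apply peq_line | apply peq_coef_at | env_base | pq_base].
Qed.

Lemma peq_origin G E E' : enveq G E E' -> peq G (origin_blk E) (origin_blk E').
Proof.
  intros. unfold origin_blk, cf_at, double_test. pq_unfold.
  repeat first [apply peq_dif | apply peq_min_exp | env_base | pq_base].
Qed.

(** * The program *)

(** Five doublings turn [L] into [32 * L], five squarings turn [2 ^ L] into [2 ^ (32 * L)], and [x]
    is the search range demanded by [env_ok]. *)
Definition init_blk {V} (Lb T Rb e : V) : prog V :=
  Let (#Lb + #Lb) (fun l => Let (#l + #l) (fun l => Let (#l + #l) (fun l => Let (#l + #l) (fun l => Let (#l + #l) (fun l =>
  Let (#T * #T) (fun t => Let (#t * #t) (fun t => Let (#t * #t) (fun t => Let (#t * #t) (fun t => Let (#t * #t) (fun t =>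
  Let (1 + #Rb / #e) (fun u => Let (#t * #t * (#u * #u)) (fun x =>
  Bind (fiblog x) (fun n G H _ _ => Ret #l #t #n #G #H))))))))))))).

Lemma den_init L Rb e : (1 <= L)%nat -> 0 < Rb -> 0 < e ->
  exists n, den (init_blk (INR L) (2 ^ L)%R Rb e) = (INR (32 * L), 2 ^ (32 * L), INR n, 2 ^ fib (S n), 2 ^ fib n) /\
    2 ^ (64 * L) * ((1 + Rb / e) * (1 + Rb / e)) <= 2 ^ fib (S n) /\
    2 ^ fib n <= 2 ^ (64 * L) * ((1 + Rb / e) * (1 + Rb / e)) /\
    (cost (init_blk (INR L) (2 ^ L)%R Rb e) <= 30 * (n + 1) + 200)%nat.
Proof.
  intros HL HRb He.
  assert (EL : INR L + INR L + (INR L + INR L) + (INR L + INR L + (INR L + INR L)) +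
    (INR L + INR L + (INR L + INR L) + (INR L + INR L + (INR L + INR L))) +
    (INR L + INR L + (INR L + INR L) + (INR L + INR L + (INR L + INR L)) +
    (INR L + INR L + (INR L + INR L) + (INR L + INR L + (INR L + INR L)))) = INR (32 * L)).
  { rewrite mult_INR. simpl (INR 32). ring. }
  assert (ET : forall k, 2 ^ (k * L) * 2 ^ (k * L) = 2 ^ ((2 * k) * L)).
  { intros k. rewrite <- pow_add. f_equal. lia. }
  assert (T1 : 2 ^ L = 2 ^ (1 * L)) by (f_equal; lia).
  assert (Q : 0 < Rb / e) by now apply Rdiv_lt_0_compat.
  set (X := 2 ^ (64 * L) * ((1 + Rb / e) * (1 + Rb / e))).
  assert (HX : 2 <= X).
  { unfold X. assert (2 <= 2 ^ (64 * L)) by (rewrite <- (pow_1 2) at 1; apply Rle_pow; [lra|lia]).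
    assert (1 <= (1 + Rb / e) * (1 + Rb / e)) by nra. nra. }
  destruct (den_fiblog X HX) as (n & En & H1 & H2). exists n.
  assert (ED : den (init_blk (INR L) (2 ^ L)%R Rb e) = (INR (32 * L), 2 ^ (32 * L), INR n, 2 ^ fib (S n), 2 ^ fib n) /\
    (cost (init_blk (INR L) (2 ^ L)%R Rb e) <= cost (fiblog X) + 160)%nat).
  { unfold init_blk. cbn [den cost]. aden_simpl. rewrite EL, T1, !ET. simpl (2 * _)%nat. fold X. rewrite En.
    split; [reflexivity|]. cbn [asz]. lia. }
  destruct ED as [-> HC]. split; [reflexivity|]. split; [exact H1|]. split; [exact H2|].
  pose proof (cb_fiblog X n En) as CF. unfold cb in CF. lia.
Qed.

Definition corner_out {V} (E : env V) : prog V :=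
  Bind (corner_blk E) (fun f _ _ _ _ => Ret #f #(nR E) #(nR E) 0 0).
Definition edge_out_x0 {V} (E : env V) : prog V :=
  Bind (edge_corner_blk E) (fun f _ _ _ _ => Ret #f 0 #(nR E) 0 0).
Definition edge_out_y0 {V} (E : env V) : prog V :=
  Bind (edge_corner_blk (swap_env E)) (fun f _ _ _ _ => Ret #f #(nR E) 0 0 0).
Definition axis_out_x0 {V} (E : env V) (fi : bool * nat) : prog V :=
  Bind (axis_blk E false (fst fi) (snd fi) (fst (others (snd fi))) (snd (others (snd fi))))
    (fun f y _ _ _ => Ret #f 0 #y 0 0).
Definition axis_out_y0 {V} (E : env V) (fi : bool * nat) : prog V :=
  Bind (axis_blk (swap_env E) true (fst fi) (snd fi) (fst (others (snd fi))) (snd (others (snd fi))))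
    (fun f y _ _ _ => Ret #f #y 0 0 0).
Definition origin_out {V} (E : env V) : prog V :=
  Bind (origin_blk E) (fun f _ _ _ _ => Ret #f 0 0 0 0).

(** The reflection of a middle root is again a middle root, so [mid] and [neg] are not combined. *)
Definition kinds : list (bool * bool) := [(false, false); (false, true); (true, false)].
Definition branches : list (bool * nat) :=
  [(false, 0); (false, 1); (false, 2); (true, 0); (true, 1); (true, 2)]%nat.

(** These are 22 candidates, whose coordinates fit into the output area below [RB]. *)
Definition blocks {V} (E : env V) : list (prog V) :=
  map (fun k => infl_blk E (fst k) (snd k)) kinds ++ map (fun k => vtan_blk E (fst k) (snd k)) kinds ++
  [corner_out E; edge_out_x0 E; edge_out_y0 E; origin_out E] ++
  map (axis_out_x0 E) branches ++ map (axis_out_y0 E) branches.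

Definition inputs {V} (c0 c1 c2 Rb e x0 y0 x1 y1 x2 y2 W T K G H : V) : env V :=
  Env (fun t => match t with 0%nat => c0 | 1%nat => c1 | _ => c2 end)
    (fun t => match t with 0%nat => x0 | 1%nat => x1 | _ => x2 end)
    (fun t => match t with 0%nat => y0 | 1%nat => y1 | _ => y2 end) Rb e (Glob W T K G H).

(** * Soundness and completeness of the output *)

Section Correct.

Variables (E : env R) (c : nat -> R) (ea eb : nat -> nat) (Rb e : R) (L n : nat).
Hypothesis Htri : is_trinomial c ea eb.
Hypothesis HRb : 0 < Rb.
Hypothesis He : 0 < e.
Hypothesis HE : env_ok E c ea eb Rb e L n.

Let Htri' : is_trinomial c eb ea := trinomial_swap _ _ _ Htri.
Let HE' : env_ok (swap_env E) c eb ea Rb e L n := env_swap _ _ _ _ _ _ _ _ HE.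

Notation S := (special_pt c ea eb Rb).

Lemma close_refl p : close e p p.
Proof. split; rewrite Rminus_diag, Rabs_R0; exact He. Qed.

Lemma sound_weaken (S1 S2 : R * R -> Prop) e' r : (forall p, S1 p -> S2 p) -> sound e' S1 r -> sound e' S2 r.
Proof.
  destruct r as [[[[f x] y] a] b]. intros H Hs Hf. destruct (Hs Hf) as (p & Hp & HC).
  exists p. split; [now apply H|exact HC].
Qed.

Lemma infl_special p : infl_set c ea eb Rb p -> S p.
Proof.
  intros (HD & HL & t & Ht & A1 & A2 & -> & HB).
  apply (special_quadrant c ea eb Rb Htri HRb); [apply exp_pos|apply exp_pos|exact HD|].
  split; [exact HB|]. left. split; [exact HL|]. exists t. tauto.
Qed.

Lemma vtan_special p : vtan_set c ea eb Rb p -> S p.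
Proof.
  intros (HD & t & Ht & A1 & A2 & -> & HB).
  apply (special_quadrant c ea eb Rb Htri HRb); [apply exp_pos|apply exp_pos|exact HD|].
  split; [exact HB|]. right; left. exists t. tauto.
Qed.

Definition corner_cond : Prop := M0 c ea eb Rb Rb = 0 /\
  ((line_case ea eb /\ 0 < Ma c ea eb Rb Rb * Mb c ea eb Rb Rb) \/
   (Dt ea eb = 0 /\ Ma c ea eb Rb Rb = 0 /\ Mb c ea eb Rb Rb = 0 /\ 0 < a1 ea * b1 eb)).

Lemma corner_special : corner_cond -> S (Rb, Rb).
Proof.
  intros [H0 [[HL H1]|(HD & H1 & H2 & H3)]].
  - apply (special_quadrant c ea eb Rb Htri HRb); trivial; [apply HL|].
    split; [unfold box; lra|]. right; right. tauto.
  - apply (special_collinear c ea eb Rb Htri HRb); trivial. tauto.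
Qed.

Lemma axis_x0_special y : axis_point c ea eb Rb false y -> S (0, y).
Proof.
  intros (Hy & Hb & [K|[K [[W _]|[HL HI]]]] & H0 & H1); try discriminate;
    apply (special_xaxis0 c ea eb Rb Htri HRb y Hy); (split; [exact Hb|]); rewrite K in *.
  - left. tauto.
  - right; left. tauto.
Qed.

Lemma axis_y0_special x : axis_point c eb ea Rb true x -> S (x, 0).
Proof.
  intros (Hx & Hb & [K|[K [[_ W]|[HL HI]]]] & H0 & H1);
    apply (special_yaxis0 c ea eb Rb Htri HRb x Hx); (split; [exact Hb|]); rewrite K in *.
  - left. tauto.
  - tauto.
  - right; left. rewrite <- line_case_swap. tauto.
Qed.

Lemma special_in_box p : S p -> in_box Rb p.
Proof. intros [[H _]|[[H _]|[H _]]]; apply H. Qed.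

Lemma branches_lt fi : In fi branches -> (snd fi < 3)%nat.
Proof. simpl. intuition (subst; simpl; lia). Qed.

Lemma others_perm i : (i < 3)%nat -> perm3 i (fst (others i)) (snd (others i)).
Proof. intros Hi. destruct i as [|[|[|i]]]; simpl; unfold perm3; lia. Qed.

Lemma kinds_ok k : In k kinds -> fst k = true -> snd k = false.
Proof. simpl. intuition (subst; simpl in *; congruence). Qed.

Lemma branches_all flip i : (i < 3)%nat -> In (flip, i) branches.
Proof. intros Hi. destruct flip, i as [|[|[|i]]]; simpl; try lia; tauto. Qed.

Lemma kinds_all mid neg : (mid = true -> neg = false) -> In (mid, neg) kinds.
Proof. intros H. destruct mid, neg; simpl; try tauto. discriminate (H eq_refl). Qed.

Lemma blocks_sound p : In p (blocks E) -> sound e S (den p).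
Proof.
  assert (ER : nR E = Rb) by apply HE.
  unfold blocks. rewrite !in_app_iff, !in_map_iff.
  intros [(k & <- & Hk)|[(k & <- & Hk)|[H|[(fi & <- & Hf)|(fi & <- & Hf)]]]].
  - apply (sound_weaken (infl_set c ea eb Rb)); [exact infl_special|].
    apply (infl_blk_sound E c ea eb Rb e L n HRb He HE). now apply kinds_ok.
  - apply (sound_weaken (vtan_set c ea eb Rb)); [exact vtan_special|].
    apply (vtan_blk_sound E c ea eb Rb e L n HRb He HE). now apply kinds_ok.
  - destruct H as [<-|[<-|[<-|[<-|[]]]]].
    + unfold corner_out. cbn [den]. rewrite (den_corner_blk E c ea eb Rb e L n HE). cbn [aden].
      intros H. rewrite fl_ge1 in H. exists (Rb, Rb). split; [now apply corner_special|rewrite ER; apply close_refl].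
    + unfold edge_out_x0. cbn [den]. rewrite (den_edge_corner_blk E c ea eb Rb e L n HE). cbn [aden].
      intros H. rewrite fl_ge1 in H. exists (0, Rb). split; [|rewrite ER; apply close_refl].
      apply (special_xaxis0 c ea eb Rb Htri HRb Rb HRb). split; [lra|tauto].
    + unfold edge_out_y0. cbn [den]. rewrite (den_edge_corner_blk (swap_env E) c eb ea Rb e L n HE'). cbn [aden].
      intros H. rewrite fl_ge1 in H. exists (Rb, 0). split; [|rewrite ER; apply close_refl].
      apply (special_yaxis0 c ea eb Rb Htri HRb Rb HRb). split; [lra|tauto].
    + unfold origin_out. cbn [den]. rewrite (den_origin_blk E c ea eb Rb e L n Htri HRb HE). cbn [aden].
      intros H. rewrite fl_ge1 in H. exists (0, 0). split; [exact H|apply close_refl].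
  - unfold axis_out_x0. cbn [den].
    destruct (den_axis_blk E c ea eb Rb e L n Htri HRb He HE false (fst fi) _ _ _ (others_perm _ (branches_lt _ Hf)))
      as (f & y & -> & Hf01 & H & _). cbn [aden].
    intros Hf1. destruct H as (y0 & Hy & Hc); [destruct Hf01; [lra|assumption]|].
    exists (0, y0). split; [now apply axis_x0_special|]. split; simpl; [rewrite Rminus_diag, Rabs_R0; exact He|exact Hc].
  - unfold axis_out_y0. cbn [den].
    destruct (den_axis_blk (swap_env E) c eb ea Rb e L n Htri' HRb He HE' true (fst fi) _ _ _ (others_perm _ (branches_lt _ Hf)))
      as (f & y & -> & Hf01 & H & _). cbn [aden].
    intros Hf1. destruct H as (y0 & Hy & Hc); [destruct Hf01; [lra|assumption]|].
    exists (y0, 0). split; [now apply axis_y0_special|]. split; simpl; [exact Hc|rewrite Rminus_diag, Rabs_R0; exact He].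
Qed.

Definition hit (p : R * R) : Prop := exists q, In q (blocks E) /\ hits e p (den q).

Ltac in_blocks := unfold blocks; rewrite !in_app_iff, !in_map_iff.

Lemma corner_hit : corner_cond -> hit (Rb, Rb).
Proof.
  intros H. exists (corner_out E). split; [in_blocks; simpl; tauto|].
  assert (ER : nR E = Rb) by apply HE.
  unfold corner_out. cbn [den]. rewrite (den_corner_blk E c ea eb Rb e L n HE). cbn [aden].
  rewrite fl_true by exact H. rewrite ER. split; [lra|apply close_refl].
Qed.

Lemma edge_x0_hit : corner_axis c ea eb Rb -> hit (0, Rb).
Proof.
  intros H. exists (edge_out_x0 E). split; [in_blocks; simpl; tauto|].
  assert (ER : nR E = Rb) by apply HE.
  unfold edge_out_x0. cbn [den]. rewrite (den_edge_corner_blk E c ea eb Rb e L n HE). cbn [aden].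
  rewrite fl_true by exact H. rewrite ER. split; [lra|apply close_refl].
Qed.

Lemma edge_y0_hit : corner_axis c eb ea Rb -> hit (Rb, 0).
Proof.
  intros H. exists (edge_out_y0 E). split; [in_blocks; simpl; tauto|].
  assert (ER : nR E = Rb) by apply HE.
  unfold edge_out_y0. cbn [den]. rewrite (den_edge_corner_blk (swap_env E) c eb ea Rb e L n HE'). cbn [aden].
  rewrite fl_true by exact H. rewrite ER. split; [lra|apply close_refl].
Qed.

Lemma axis_x0_hit y : axis_point c ea eb Rb false y -> hit (0, y).
Proof.
  intros H. destruct (axis_complete E c ea eb Rb e L n Htri HRb He HE false y H) as (flip & i & f & y' & Hi & Ed & -> & Hc).
  exists (axis_out_x0 E (flip, i)). split.
  - in_blocks. right; right; right; left. exists (flip, i). split; [reflexivity|now apply branches_all].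
  - unfold axis_out_x0. cbn [den fst snd]. rewrite Ed. cbn [aden]. split; [lra|].
    split; simpl; [rewrite Rminus_diag, Rabs_R0; exact He|exact Hc].
Qed.

Lemma axis_y0_hit x : axis_point c eb ea Rb true x -> hit (x, 0).
Proof.
  intros H. destruct (axis_complete (swap_env E) c eb ea Rb e L n Htri' HRb He HE' true x H) as (flip & i & f & y' & Hi & Ed & -> & Hc).
  exists (axis_out_y0 E (flip, i)). split.
  - in_blocks. right; right; right; right. exists (flip, i). split; [reflexivity|now apply branches_all].
  - unfold axis_out_y0. cbn [den fst snd]. rewrite Ed. cbn [aden]. split; [lra|].
    split; simpl; [exact Hc|rewrite Rminus_diag, Rabs_R0; exact He].
Qed.

Lemma blocks_complete p : S p -> hit p.
Proof.
  intros HS. destruct p as [x y]. destruct (special_in_box _ HS) as [[Bx1 Bx2] [By1 By2]]. simpl in *.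
  destruct Bx1 as [Hx|<-], By1 as [Hy|<-].
  - destruct (Req_dec (Dt ea eb) 0) as [HD|HD].
    + apply (special_collinear c ea eb Rb Htri HRb x y HD Hx Hy) in HS. destruct HS as (-> & -> & HS).
      apply corner_hit. unfold corner_cond. tauto.
    + apply (special_quadrant c ea eb Rb Htri HRb x y Hx Hy HD) in HS.
      destruct HS as [HB [[HL (t & H1 & H2 & H3 & -> & ->)]|[(t & H1 & H2 & H3 & -> & ->)|(HL & -> & -> & H0 & H1)]]].
      * destruct (infl_blk_complete E c ea eb Rb e L n HRb He HE (Xt c ea eb t, Yt c ea eb t)) as (mid & neg & Hk & HH).
        { split; [exact HD|]. split; [exact HL|]. exists t. tauto. }
        exists (infl_blk E mid neg). split; [|exact HH].
        in_blocks. left. exists (mid, neg). split; [reflexivity|now apply kinds_all].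
      * destruct (vtan_blk_complete E c ea eb Rb e L n HRb He HE (Xt c ea eb t, Yt c ea eb t)) as (mid & neg & Hk & HH).
        { split; [exact HD|]. exists t. tauto. }
        exists (vtan_blk E mid neg). split; [|exact HH].
        in_blocks. right; left. exists (mid, neg). split; [reflexivity|now apply kinds_all].
      * apply corner_hit. unfold corner_cond. tauto.
  - apply (special_yaxis0 c ea eb Rb Htri HRb x Hx) in HS.
    destruct HS as [HB [(K & H0 & H1)|[(HL & K & H0 & H1 & HI)|[(K & H0 & H1 & HI)|[-> HC]]]]].
    + apply axis_y0_hit. repeat split; trivial; try (rewrite K; assumption). now left.
    + apply axis_y0_hit. repeat split; trivial; try (rewrite K; assumption). right. split; [exact K|].
      right. rewrite line_case_swap. tauto.
    + apply axis_y0_hit. repeat split; trivial; try (rewrite K; assumption). right. split; [exact K|]. left. tauto.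
    + now apply edge_y0_hit.
  - apply (special_xaxis0 c ea eb Rb Htri HRb y Hy) in HS.
    destruct HS as [HB [(K & H0 & H1)|[(HL & K & H0 & H1 & HI)|[-> HC]]]].
    + apply axis_x0_hit. repeat split; trivial; try (rewrite K; assumption). now left.
    + apply axis_x0_hit. repeat split; trivial; try (rewrite K; assumption). right. split; [exact K|]. right. tauto.
    + now apply edge_x0_hit.
  - exists (origin_out E). split; [in_blocks; simpl; tauto|].
    unfold origin_out. cbn [den]. rewrite (den_origin_blk E c ea eb Rb e L n Htri HRb HE). cbn [aden].
    rewrite fl_true by exact HS. split; [lra|apply close_refl].
Qed.

End Correct.

Lemma blocks_approx (l : list (prog R)) (S : R * R -> Prop) e :
  (forall p, In p l -> sound e S (den p)) ->
  (forall p, S p -> exists q, In q l /\ hits e p (den q)) ->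
  eps_approx e (flat_map (fun q => emits (den q)) l) S.
Proof.
  intros H1 H2. split.
  - intros p Hp. destruct (H2 p Hp) as (q & Hq & HH).
    destruct (den q) as [[[[f x] y] a] b] eqn:E. destruct HH as [Hf HC]. exists (x, y). split; [|exact HC].
    apply in_flat_map. exists q. split; [exact Hq|]. rewrite E. unfold emits.
    destruct (Rle_dec 1 f); [now left|contradiction].
  - intros q Hq. apply in_flat_map in Hq. destruct Hq as (p & Hp & Hq). specialize (H1 p Hp).
    unfold emits in Hq. destruct (den p) as [[[[f x] y] a] b]. destruct (Rle_dec 1 f) as [Hf|]; [|destruct Hq].
    destruct Hq as [<-|[]]. exact (H1 Hf).
Qed.

Lemma list_sum_le {A} (f : A -> nat) l N : (forall p, In p l -> (f p <= N)%nat) ->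
  (list_sum (map f l) <= length l * N)%nat.
Proof.
  induction l as [|p l IH]; intros H; simpl; [lia|]. pose proof (H p (or_introl eq_refl)).
  specialize (IH (fun q Hq => H q (or_intror Hq))). lia.
Qed.

Lemma blocks_cb E w n p : gW (ng E) = INR w -> gK (ng E) = INR n -> In p (blocks E) ->
  cb p (1000 * 210 * unit_cost w n).
Proof.
  intros HW HK. pose proof (unit_ge w n) as HU. unfold blocks. rewrite !in_app_iff, !in_map_iff.
  intros [(k & <- & Hk)|[(k & <- & Hk)|[H|[(fi & <- & Hf)|(fi & <- & Hf)]]]].
  - eapply cb_le; [now apply cbu_infl with (w := w) (n := n)|lia].
  - eapply cb_le; [now apply cbu_vtan with (w := w) (n := n)|lia].
  - destruct H as [<-|[<-|[<-|[<-|[]]]]].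
    + eapply cb_le; [eapply cb_Bind; [now apply cbu_corner with (w := w) (n := n)|intros; cb_step]|lia].
    + eapply cb_le; [eapply cb_Bind; [now apply cbu_edge with (w := w) (n := n)|intros; cb_step]|lia].
    + eapply cb_le; [eapply cb_Bind; [now apply cbu_edge with (w := w) (n := n)|intros; cb_step]|lia].
    + eapply cb_le; [eapply cb_Bind; [now apply cbu_origin with (w := w) (n := n)|intros; cb_step]|lia].
  - eapply cb_le; [eapply cb_Bind; [now apply cbu_axis with (w := w) (n := n)|intros; cb_step]|lia].
  - eapply cb_le; [eapply cb_Bind; [now apply cbu_axis with (w := w) (n := n)|intros; cb_step]|lia].
Qed.

Lemma blocks_peq G E E' : enveq G E E' -> Forall2 (peq G) (blocks E) (blocks E').
Proof.
  intros H. repeat apply Forall2_cons; try apply Forall2_nil; cbn [fst snd];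
    first [now apply peq_infl | now apply peq_vtan | constructor; [|intros; unfold ext5; env_go]];
    first [now apply peq_corner | now apply peq_edge | now apply peq_edge, enveq_swap
      | now apply peq_origin | now apply peq_axis | now apply peq_axis, enveq_swap].
Qed.

(** The numerals are variable names in the order of [start_ctx]: 11 and 12 stand for [L] and
    [2 ^ L], 3 and 4 for [Rb] and [e]; the names 13 to 17 below are the results of this program. *)
Definition init_prog : prog nat := (init_blk 11 12 3 4)%nat.
Definition block_progs : list (prog nat) :=
  blocks (inputs 0 1 2 3 4 5 6 7 8 9 10 13 14 15 16 17)%nat.
Definition main_program : program := program_of init_prog block_progs.
Definition registers : nat := Nat.max 18 (Nat.max (mr init_prog 13) (lmr block_progs 18)).

Definition bit_size (ea eb : nat -> nat) : nat := S (Nat.log2 (tdeg ea eb)).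

Lemma main_run c ea eb Rb e : is_trinomial c ea eb -> 0 < Rb -> 0 < e ->
  let L := bit_size ea eb in
  exists n k, 2 ^ fib n <= 2 ^ (64 * L) * ((1 + Rb / e) * (1 + Rb / e)) /\
    let s := run main_program k (init_state c ea eb Rb e) in
    halted main_program s /\ eps_approx e (output s) (special_pt c ea eb Rb) /\
    (arith_ops s <= 1000 * 5000 * unit_cost (32 * L) n)%nat /\
    (bit_ops s <= 21 * L + 2 * registers + 150)%nat.
Proof.
  intros Htri HRb He L.
  assert (HL : (1 <= L)%nat) by (unfold L, bit_size; lia).
  destruct (den_init L Rb e HL HRb He) as (n & EI & G1 & G2 & HC).
  set (E := inputs (c 0%nat) (c 1%nat) (c 2%nat) Rb e (INR (ea 0%nat)) (INR (eb 0%nat)) (INR (ea 1%nat))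
    (INR (eb 1%nat)) (INR (ea 2%nat)) (INR (eb 2%nat))
    (INR (32 * L)) (2 ^ (32 * L)) (INR n) (2 ^ fib (S n)) (2 ^ fib n)).
  assert (Hlen : length (blocks E) = 22%nat) by reflexivity.
  assert (HE : env_ok E c ea eb Rb e L n).
  { split; [|split; [reflexivity|split; [reflexivity|split; [repeat split|split; [exact HL|exact G1]]]]].
    intros t Ht.
    assert (Y : forall k, INR (exps ea eb k) < 2 ^ L).
    { intros k. apply Rlt_le_trans with (INR (2 ^ L)); [apply lt_INR, exps_small|].
      rewrite pow_INR. right. f_equal. }
    destruct t as [|[|[|t]]]; [| | |lia]; (split; [reflexivity|split; [reflexivity|split; [reflexivity|]]]).
    - split; [exact (Y 0%nat)|exact (Y 1%nat)].
    - split; [exact (Y 2%nat)|exact (Y 3%nat)].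
    - split; [exact (Y 4%nat)|exact (Y 5%nat)]. }
  destruct (program_of_ok init_prog (init_blk (INR L) (2 ^ L)%R Rb e) block_progs (blocks E)
    (INR (32 * L)) (2 ^ (32 * L)) (INR n) (2 ^ fib (S n)) (2 ^ fib n) c ea eb Rb e) as (k & Hk); [|exact EI|..].
  { unfold init_prog, init_blk, start_ctx. fold (bit_size ea eb). fold L. cbn [combine seq].
    pq_unfold. repeat first [apply peq_fiblog | pq_base]. }
  { apply blocks_peq. unfold ext5, start_ctx, E, inputs. cbn [combine seq].
    repeat split; cbn [nc na nb nR ne ng gW gT gK gG gH];
      try (intros [|[|t]]; cbv beta iota); in_ctx. }
  { rewrite Hlen. unfold RB. lia. }
  exists n, k. split; [exact G2|]. fold main_program registers in Hk. cbv zeta in Hk |- *.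
  destruct Hk as (K1 & K2 & K3 & K4). split; [exact K1|]. split; [|split].
  - rewrite K2. apply blocks_approx.
    + intros p Hp. exact (blocks_sound E c ea eb Rb e L n Htri HRb He HE p Hp).
    + intros p Hp. exact (blocks_complete E c ea eb Rb e L n Htri HRb He HE p Hp).
  - pose proof (list_sum_le (fun q => (cost q + 4)%nat) (blocks E) (1000 * 210 * unit_cost (32 * L) n + 4)
      (fun p Hp => proj1 (Nat.add_le_mono_r _ _ _) (blocks_cb E (32 * L) n p eq_refl eq_refl Hp))) as TC.
    rewrite Hlen in TC. fold (bit_size ea eb) in K3. fold L in K3.
    pose proof (unit_ge (32 * L) n) as HU. assert (n <= unit_cost (32 * L) n)%nat by (unfold unit_cost; nia). lia.
  - fold (bit_size ea eb) in K4. fold L in K4. rewrite Hlen in K4. lia.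
Qed.

(** * Asymptotic bounds *)

Lemma tdeg_pos c ea eb : is_trinomial c ea eb -> (1 <= tdeg ea eb)%nat.
Proof.
  intros [_ H]. destruct (tdeg ea eb) eqn:E; [|lia]. exfalso. unfold tdeg in E.
  apply (H 0%nat 1%nat); try lia. f_equal; lia.
Qed.

Lemma bit_size_le ea eb : (1 <= tdeg ea eb)%nat ->
  INR (bit_size ea eb) <= INR (tdeg ea eb) /\ INR (bit_size ea eb) <= 4 * ln (2 + INR (tdeg ea eb)).
Proof.
  intros H. unfold bit_size. set (d := tdeg ea eb) in *. pose proof (Nat.log2_spec d H) as [H1 _].
  set (l := Nat.log2 d) in *.
  assert (X : (S l <= 2 ^ l)%nat).
  { induction l as [|l IH]; [simpl; lia|]. simpl in *. lia. }
  assert (D1 : 1 <= INR d) by (apply (le_INR 1); exact H).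
  pose proof ln_lt_2 as L2.
  split; [apply le_INR; lia|]. rewrite S_INR.
  assert (P : INR l * ln 2 <= ln (INR d)).
  { rewrite <- ln_pow by lra. apply le_INR in H1. rewrite pow_INR in H1.
    replace (INR 2) with 2 in H1 by tauto.
    destruct H1 as [H1|H1]; [left; apply ln_increasing; [apply pow_lt; lra|exact H1]|right; now rewrite H1]. }
  assert (ln (INR d) < ln (2 + INR d)) by (apply ln_increasing; lra).
  assert (ln 2 <= ln (2 + INR d)) by (left; apply ln_increasing; lra).
  nra.
Qed.

(* [n] steps of the search reach [2 ^ fib n], and [fib] grows exponentially. *)
Lemma steps_le L n (d r : R) : 1 <= d -> INR L <= d -> 0 < r ->
  2 ^ fib n <= 2 ^ (64 * L) * ((1 + r) * (1 + r)) -> INR n <= 44 * ln (2 + d * ln (2 + r)).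
Proof.
  intros Hd HL Hr H. pose proof ln_lt_2 as L2.
  set (V := ln (2 + r)). assert (HV : ln 2 < V) by (apply ln_increasing; lra).
  assert (HdV : / 2 < d * V) by nra.
  set (Wn := ln (2 + d * V)). assert (HW : ln 2 < Wn) by (apply ln_increasing; lra).
  (* Logarithms give [fib n <= 64 * d + 4 * V], and both summands are at most multiples of [d * V],
     because [V > 1 / 2] and [d >= 1]. *)
  assert (F : INR (fib n) <= 260 * (d * V)).
  { assert (Q : INR (fib n) * ln 2 <= INR (64 * L) * ln 2 + 2 * ln (1 + r)).
    { rewrite <- !ln_pow by lra. replace (2 * ln (1 + r)) with (ln ((1 + r) * (1 + r))) by (rewrite ln_mult by lra; ring).
      rewrite <- ln_mult by (try apply pow_lt; nra).
      destruct H as [H|H]; [left; apply ln_increasing; [apply pow_lt; lra|exact H]|right; now rewrite H]. }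
    assert (ln (1 + r) < V) by (apply ln_increasing; lra).
    assert (INR (64 * L) <= 64 * d) by (rewrite mult_INR; simpl (INR 64); lra).
    nra. }
  (* [m] is half the index, as [fib_double] gains one factor 2 in two steps. *)
  destruct n as [|n']; [simpl; lra|]. set (m := (n' / 2)%nat).
  assert (Hm : (2 * m <= n' < 2 * m + 2)%nat).
  { pose proof (Nat.div_mod_eq n' 2). pose proof (Nat.mod_upper_bound n' 2 ltac:(lia)). lia. }
  assert (Fm : (2 ^ m <= fib (S n'))%nat).
  { apply Nat.le_trans with (1 := proj1 (fib_double m)). destruct Hm as [Hm _]. clear - Hm.
    apply Nat.succ_le_mono in Hm. induction Hm as [|k _ IH]; [lia|]. pose proof (fib_mono k). lia. }
  assert (M1 : 2 ^ m <= 2 ^ 9 * (2 + d * V)).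
  { apply le_INR in Fm. rewrite pow_INR in Fm. replace (INR 2) with 2 in Fm by tauto. lra. }
  assert (M2 : INR m * ln 2 <= 9 * ln 2 + Wn).
  { replace 9 with (INR 9) by (simpl; lra). rewrite <- !ln_pow by lra. unfold Wn.
    rewrite <- ln_mult by lra.
    destruct M1 as [M1|M1]; [left; apply ln_increasing; [apply pow_lt; lra|exact M1]|right; now rewrite M1]. }
  assert (M3 : INR m <= 20 * Wn) by nra.
  assert (M4 : INR (S n') <= 2 * INR m + 2).
  { replace (2 * INR m + 2) with (INR (2 * m + 2)) by (rewrite plus_INR, mult_INR; simpl; ring). apply le_INR. lia. }
  lra.
Qed.

Lemma unit_cost_le L n (x y : R) : (1 <= L)%nat -> INR L <= 4 * x -> INR L <= 8 * y -> INR n <= 44 * y -> 0 <= y ->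
  INR (unit_cost (32 * L) n) <= 132 * 308 * x * y.
Proof.
  intros H1 Hx Hy Hn Hy0. unfold unit_cost. rewrite mult_INR.
  assert (A : INR (32 * L + 1) <= 132 * x).
  { rewrite plus_INR, mult_INR. simpl (INR 32). simpl (INR 1). apply le_INR in H1. simpl (INR 1) in H1. lra. }
  assert (B : INR (32 * L + n + 1) <= 308 * y).
  { rewrite !plus_INR, mult_INR. simpl (INR 32). simpl (INR 1). apply le_INR in H1. simpl (INR 1) in H1. lra. }
  pose proof (pos_INR (32 * L + 1)). pose proof (pos_INR (32 * L + n + 1)).
  replace (132 * 308 * x * y) with ((132 * x) * (308 * y)) by ring. apply Rmult_le_compat; assumption.
Qed.

Theorem theorem1p6 :
  exists Ca : R, 0 < Ca /\
  forall delta : R, 0 < delta ->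
  exists (P : program) (Cb : R), 0 < Cb /\
  forall (c : nat -> R) (ea eb : nat -> nat) (Rb e : R),
    is_trinomial c ea eb -> 0 < Rb -> 0 < e ->
    let D := INR (tdeg ea eb) in
    exists n : nat,
      let s := run P n (init_state c ea eb Rb e) in
      halted P s /\
      eps_approx e (output s) (special_pt c ea eb Rb) /\
      INR (arith_ops s) <= Ca * ln (2 + D) * ln (2 + D * ln (2 + Rb / e)) /\
      INR (bit_ops s) <= Cb * Rpower (ln (2 + D)) (2 + delta).
Proof.
  exists (INR (1000 * 5000) * (132 * 308)). split.
  { rewrite mult_INR. apply Rmult_lt_0_compat; [|lra]. apply Rmult_lt_0_compat; apply lt_0_INR; lia. }
  intros delta Hdelta.
  (* The bit operations spent on addresses, input and output; their number depends on the program
     alone. *)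
  set (K := (2 * registers + 150)%nat).
  exists main_program, (INR (84 + K)). split; [apply lt_0_INR; lia|].
  intros c ea eb Rb e Htri HRb He D.
  pose proof (tdeg_pos _ _ _ Htri) as Hd.
  assert (HD : 1 <= D) by (apply (le_INR 1); exact Hd).
  destruct (bit_size_le ea eb Hd) as [B1 B2]. fold D in B1, B2.
  destruct (main_run c ea eb Rb e Htri HRb He) as (n & k & Hn & K1 & K2 & K3 & K4).
  exists k. set (L := bit_size ea eb) in *.
  set (s := run main_program k (init_state c ea eb Rb e)) in *.
  split; [exact K1|]. split; [exact K2|].
  assert (HL : (1 <= L)%nat) by (unfold L, bit_size; lia).
  assert (Hr : 0 < Rb / e) by now apply Rdiv_lt_0_compat.
  pose proof (steps_le L n D (Rb / e) HD B1 Hr Hn) as B3.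
  set (V := ln (2 + Rb / e)) in *. set (x := ln (2 + D)) in *. set (y := ln (2 + D * V)) in *.
  pose proof ln_lt_2 as L2. assert (HV : ln 2 < V) by (apply ln_increasing; lra).
  (* [2 + D] is at least 3 and so at least [exp 1]; a logarithm below 1 would shrink when raised to
     the power [2 + delta]. *)
  assert (Hx1 : 1 <= x).
  { pose proof exp_le_3 as E3. apply Rnot_lt_le. intros Hx. apply exp_increasing in Hx.
    unfold x in Hx. rewrite exp_ln in Hx; lra. }
  assert (HDV : / 2 < D * V) by nra.
  assert (Hy0 : ln 2 < y) by (apply ln_increasing; lra).
  (* The second factor of the cost contains [L] besides [n], and both have to be bounded by the
     second logarithm alone. *)
  assert (Hxy : x <= 2 * y).
  { apply Rle_trans with (ln 2 + y); [|lra]. unfold y. rewrite <- ln_mult by lra. left. apply ln_increasing; [lra|]. nra. }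
  split.
  - apply le_INR in K3. rewrite (mult_INR (1000 * 5000)) in K3.
    apply Rle_trans with (1 := K3).
    pose proof (unit_cost_le L n x y HL B2 ltac:(lra) B3 ltac:(lra)) as U.
    replace (INR (1000 * 5000) * (132 * 308) * x * y) with (INR (1000 * 5000) * (132 * 308 * x * y)) by ring.
    apply Rmult_le_compat_l; [apply pos_INR|exact U].
  (* The bit operations are linear in [L], far below the claimed power. The constant 84 is 21
     operations per bit times the factor 4 between [L] and the logarithm. *)
  - assert (HP : x <= Rpower x (2 + delta)).
    { rewrite <- (Rpower_1 x) at 1 by lra. apply Rle_Rpower; lra. }
    apply Rle_trans with (INR (84 + K) * x); [|apply Rmult_le_compat_l; [apply pos_INR|exact HP]].
    assert (K4' : (bit_ops s <= 21 * L + K)%nat) by lia.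
    apply le_INR in K4'. rewrite plus_INR, mult_INR in K4'. rewrite plus_INR.
    replace (INR 21) with 21 in K4' by (simpl; lra). replace (INR 84) with 84 by (simpl; lra).
    pose proof (pos_INR K). nra.
Qed.
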